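(* Let $1<s<3$, let $m=(s-1)^{-1}$, let $\hat f\in\mathbb{C}_{(s)}[[z]]$, and let $\theta\in\mathbb{R}$. Then $g(u)=(\hat{\mathcal{B}}_m\hat f)(u)$ is holomorphic in a neighbourhood of the origin, and the following are equivalent: 1. There exist a sector $S=S(\theta,\alpha,\rho)$ with $\alpha>(s-1)\pi$ and a function $f\in\mathcal{O}_{(s)}(S)$ such that $f\approx_s\hat f$ in $S$. 2. There exists a sector $\tilde S=S(\theta,\epsilon)$ of infinite radius such that $g$ admits a holomorphic continuation to $\tilde S$, and this continuation has exponential growth of order $m$ in $\tilde S$. Moreover, if either of these holds, then $f=\mathcal{L}_m g$ (where both sides are defined), and hence $f$ is uniquely determined by $\hat f$.
   Context: For $\psi\in\mathbb{R}$, $0<\alpha\le 2\pi$, $0<r\le\infty$, $S(\psi,\alpha,r)=\{te^{i\varphi}:0<t<r,\ |\varphi-\psi|<\alpha/2\}$, and $S(\psi,\alpha)=S(\psi,\alpha,\infty)$ (infinite radius). $S'\subset\!\subset S$ means that $S'$ is a sector $\{0<|z|<r',\ \eta'<\arg z<\theta'\}$ and $S=\{0<|z|<r,\ \eta<\arg z<\theta\}$ with $0<r'<r$, $\eta<\eta'<\theta'<\theta$. $\mathbb{C}_{(s)}[[z]]$ is the set of formal series $\sum_{k\ge0}c_kz^k$ for which there are $M,C>0$ with $|c_k|\le MC^k\,k!^{\,s-1}$ for all $k\ge0$. $\mathcal{O}_{(s)}(S)$ is the set of holomorphic $f$ on $S$ such that for every $S'\subset\!\subset S$ there are $M,C>0$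 with $|f^{(k)}(z)|\le MC^k\,k!^{\,s}$ for all $k\ge0$, $z\in S'$. $f\approx_s\hat f$ in $S$, for $\hat f=\sum_k\frac{a_k}{k!}z^k$, means: for every $S'\subset\!\subset S$ there are $M,C>0$ with $|f(z)-\sum_{k=0}^{n-1}\frac{a_k}{k!}z^k|\le MC^n\,n!^{\,s-1}|z|^n$ for all $n\ge0$, $z\in S'$. Formal Borel transform of index $m$: $\hat{\mathcal{B}}_m\big(\sum_k c_kz^k\big)=\sum_k\frac{c_k}{\Gamma(1+k/m)}z^k$. A function $h$ holomorphic on an infinite-radius sector $\tilde S$ has exponential growth of order $m$ in $\tilde S$ if for every infinite-radius subsector $S'=\{\eta'<\arg z<\theta'\}$ whose angular interval $[\eta',\theta']$ is contained in the open angular interval of $\tilde S$ there are $r,b,B>0$ with $|h(z)|\le Be^{b|z|^m}$ for $z\in S'$, $|z|>r$. Laplace transform of index $m$: for such $h$ on $S(\theta,\epsilon)$, bounded near $0$, and $|\eta-\theta|<\epsilon/2$, $$(\mathcal{L}_mh)(z)=\frac{m}{z^m}\int_0^{\infty e^{i\eta}}h(u)e^{-(u/z)^m}u^{m-1}\,du,$$ integrated along the ray $\arg u=\eta$; it is holomorphic for $z$ with $m|\arg z-\eta|<\pi/2$ and $0<b|z|^m<\cos(m(\eta-\arg z))$ for a constant $b>0$ depending on $h,\eta$ (powers are taken with $\arg u=\eta$ and this determination of $\arg z$). Different $\eta$ give analytic continuations of one function $\mathcal{L}_mh$. Here $\mathcal{L}_m g$ is formed with the holomorphic continuation of $g$ to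 $\tilde S$. *)

(* Defs.v *)
From Stdlib Require Import Reals Factorial.
From Coquelicot Require Export Coquelicot.
Open Scope R_scope.

Definition polar (t phi : R) : C := (t * cos phi, t * sin phi).

(* The power z^a of z = t e^{i phi}, t > 0, for the determination arg z = phi. *)
Definition polar_pow (t phi a : R) : C := polar (Rpower t a) (a * phi).

Definition Cexp (z : C) : C := polar (exp (Re z)) (Im z).

Definition sector (psi alpha : R) (r : Rbar) (z : C) : Prop :=
  exists t phi : R,
    0 < t /\ Rbar_lt t r /\ Rabs (phi - psi) < alpha / 2 /\ z = polar t phi.

Definition arg_sector (eta theta : R) (r : Rbar) (z : C) : Prop :=
  exists t phi : R,
    0 < t /\ Rbar_lt t r /\ eta < phi < theta /\ z = polar t phi.

(* arg_sector eta' theta' r' is a proper subsector of sector psi alpha r, whose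
   bounding arguments are psi - alpha / 2 and psi + alpha / 2. *)
Definition proper_subsector (psi alpha : R) (r : Rbar) (eta' theta' r' : R) : Prop :=
  0 < r' /\ Rbar_lt r' r /\
  psi - alpha / 2 < eta' /\ eta' < theta' /\ theta' < psi + alpha / 2.

Definition holomorphic_on (S : C -> Prop) (f : C -> C) : Prop :=
  forall z : C, S z -> ex_derive (K := C_AbsRing) (V := C_NormedModule) f z.

(* Coquelicot's C_derive is total, and is the complex derivative where that exists. *)
Fixpoint C_derive_n (f : C -> C) (k : nat) : C -> C :=
  match k with
  | O => f
  | S k' => C_derive (C_derive_n f k')
  end.

(* A formal power series sum_k c_k z^k is represented by its coefficients c. *)
Definition formal_gevrey (s : R) (c : nat -> C) : Prop :=
  exists M K : R, 0 < M /\ 0 < K /\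
    forall k : nat, Cmod (c k) <= M * K ^ k * Rpower (INR (fact k)) (s - 1).

Definition gevrey_on (s psi alpha : R) (r : Rbar) (f : C -> C) : Prop :=
  holomorphic_on (sector psi alpha r) f /\
  forall eta' theta' r' : R,
    proper_subsector psi alpha r eta' theta' r' ->
    exists M K : R, 0 < M /\ 0 < K /\
      forall (k : nat) (z : C), arg_sector eta' theta' r' z ->
        Cmod (C_derive_n f k z) <= M * K ^ k * Rpower (INR (fact k)) s.

(* c_0 + ... + c_{n-1} z^{n-1}; Coquelicot's sum_n a n has n + 1 terms. *)
Definition partial_sum (c : nat -> C) (n : nat) (z : C) : C :=
  match n with
  | O => RtoC 0
  | S n' => sum_n (fun k : nat => (c k * z ^ k)%C) n'
  end.

(* Here c_k = a_k / k! in terms of the Taylor coefficients a_k. *)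
Definition gevrey_asymptotic (s psi alpha : R) (r : Rbar)
    (f : C -> C) (c : nat -> C) : Prop :=
  forall eta' theta' r' : R,
    proper_subsector psi alpha r eta' theta' r' ->
    exists M K : R, 0 < M /\ 0 < K /\
      forall (n : nat) (z : C), arg_sector eta' theta' r' z ->
        Cmod (f z - partial_sum c n z)%C
          <= M * K ^ n * Rpower (INR (fact n)) (s - 1) * Cmod z ^ n.

(* Euler's integral; meaningful for x > 0. *)
Definition Gamma (x : R) : R :=
  RInt_gen (fun t : R => Rpower t (x - 1) * exp (- t))
    (at_right 0) (Rbar_locally p_infty).

Definition formal_borel (m : R) (c : nat -> C) (k : nat) : C :=
  (c k / RtoC (Gamma (1 + INR k / m)))%C.

(* Meaningful where the power series converges. *)
Definition power_series_sum (c : nat -> C) (u : C) : C :=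
  iota (T := C_CompleteNormedModule)
    (is_pseries (K := C_AbsRing) (V := C_NormedModule) c u).

Definition exponential_growth (m theta eps : R) (h : C -> C) : Prop :=
  forall eta' theta' : R,
    theta - eps / 2 < eta' -> eta' < theta' -> theta' < theta + eps / 2 ->
    exists r b B : R, 0 < r /\ 0 < b /\ 0 < B /\
      forall z : C, arg_sector eta' theta' p_infty z -> r < Cmod z ->
        Cmod (h z) <= B * exp (b * Rpower (Cmod z) m).

(* The sector and a disc around 0 meet in a connected set, so agreement with g
   near 0 is what it means for h to continue the germ g to the sector. *)
Definition continuation_to_sector (g : C -> C) (theta eps : R) (h : C -> C) : Prop :=
  holomorphic_on (sector theta eps p_infty) h /\
  exists delta : R, 0 < delta /\
    forall u : C, sector theta eps p_infty u -> Cmod u < delta -> h u = g u.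

Definition ray_growth (m eta b : R) (h : C -> C) : Prop :=
  exists r B : R, 0 < r /\ 0 < B /\
    forall x : R, r < x -> Cmod (h (polar x eta)) <= B * exp (b * Rpower x m).

(* The integral along u = x e^{i eta}, du = e^{i eta} dx, converges and defines
   w = (L_m h)(z) at z = t e^{i phi}; powers use arg u = eta and arg z = phi. *)
Definition is_laplace (m : R) (h : C -> C) (eta t phi : R) (w : C) : Prop :=
  exists I : C,
    is_RInt_gen (V := C_R_NormedModule)
      (fun x : R =>
         (h (polar x eta) * Cexp (- polar_pow (x / t) (eta - phi) m)
            * polar_pow x eta (m - 1) * polar 1 eta)%C)
      (at_right 0) (Rbar_locally p_infty) I /\
    w = (RtoC m / polar_pow t phi m * I)%C.

(* Points z = t e^{i phi} at which the transform along arg u = eta is defined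
   when h grows along that ray at most like exp (b |u|^m). *)
Definition laplace_domain (m eta b t phi : R) : Prop :=
  0 < t /\ m * Rabs (phi - eta) < PI / 2 /\
  b * Rpower t m < cos (m * (eta - phi)).

Definition wide_realization (s theta : R) (c : nat -> C)
    (alpha : R) (rho : Rbar) (f : C -> C) : Prop :=
  (s - 1) * PI < alpha <= 2 * PI /\ Rbar_lt 0 rho /\
  gevrey_on s theta alpha rho f /\ gevrey_asymptotic s theta alpha rho f c.

Definition growing_continuation (m theta : R) (g : C -> C)
    (eps : R) (h : C -> C) : Prop :=
  0 < eps <= 2 * PI /\
  continuation_to_sector g theta eps h /\ exponential_growth m theta eps h.

(* Main.v *)
(* In the coordinates z = exp(p zeta + i theta), u = exp(p w + i theta) with p = s - 1 = 1/m,
   the transform of index m becomes the integral of h(u) kap(w - zeta), kap(w) = exp(w - e^w), over a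
   horizontal line of the w-plane.
   From 1 to 2: for F(zeta) = f(z), the Borel transform is
     (1 / 2 pi i) times the integral of F(s) exp(exp(w - s)) ds
   over the boundary of a half strip Re s <= r, |Im s| <= pi/2 + delta, available because the
   opening of S exceeds (s - 1) pi.  It is holomorphic of the required growth for |Im w| < delta; its
   Laplace transform is F, by exchanging the integrals and evaluating a simple pole; and its values
   near Re w = -oo are those of g, because the transform sends e^{x s} to e^{x w} / Gamma(1 + x)
   and, with the contour moved to Re s = Re w - ln(n + 1), the n-th remainder tends to 0.
   From 2 to 1: Laplace transforms along the directions theta +- p e0 are glued; the Gevrey bounds come
   from integrating the Taylor remainders of g, those on derivatives from Cauchy's estimates.
   By the identity theorem, f is the Laplace transform of any continuation of g: both agree
   near the ray arg z = theta, and one continues along small simultaneous changes of arg z and of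
   the direction of integration. *)
Require Import Defs.
From Stdlib Require Import Reals Factorial Lra Lia.
From Coquelicot Require Import Coquelicot.
Open Scope R_scope.

(** * Complex derivatives *)

(** In logarithmic coordinates a sector is a left half strip, powers are exponentials without a
    choice of branch, and the Laplace kernel depends on [w - zeta] only, so turning the ray of
    integration is a vertical translation. The contour of the Borel transform has half height
    [PI / 2 + dl] because [exp (exp (w - s))] must be small on both horizontal sides for every [w]
    with [|Im w| < dl]; in the other direction [s < 3] leaves room for an opening above
    [(s - 1) * PI] and at most [2 * PI]. The exchange of integrals is not a Fubini argument.
    Integrating the kernel in [w] first gives a contour integral that is a primitive, in [w], of the
    Laplace integrand; only its limits at both ends are then needed. The constants [1 / Gamma] come
    out of this inversion formula, without Hankel's integral. Function theory is done on rectangles.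
    Against circles the estimates lose constants, but each loss is at most geometric in the order of
    the expansion and is absorbed by [K ^ n]. Differentiation under integrals and sums rests on
    Cauchy's bound for the second order remainder, which is linear in a bound of the function and
    hence can be integrated and summed. *)

Local Notation CD := (is_derive (K := C_AbsRing) (V := C_NormedModule)).
Local Notation CE := (ex_derive (K := C_AbsRing) (V := C_NormedModule)).

Lemma Cmod_minus_sym (z w : C) : Cmod (z - w) = Cmod (w - z).
Proof. rewrite <- Cmod_opp. f_equal. ring. Qed.

Lemma Cmod_triangle_minus (z w : C) : Cmod (z - w) <= Cmod z + Cmod w.
Proof. unfold Cminus. rewrite <- (Cmod_opp w). apply Cmod_triangle. Qed.

Lemma Cmod_reverse (z w : C) : Cmod z - Cmod w <= Cmod (z - w).
Proof.
  assert (H := Cmod_triangle (z - w) w).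
  replace (z - w + w)%C with z in H by ring. lra.
Qed.

Lemma im_le_Cmod (z : C) : Rabs (Im z) <= Cmod z.
Proof. assert (H := Rmax_Cmod z). assert (H' := Rmax_r (Rabs (fst z)) (Rabs (snd z))). unfold Im. lra. Qed.

Lemma Cmod_le_sum (z : C) : Cmod z <= Rabs (Re z) + Rabs (Im z).
Proof.
  replace z with (RtoC (Re z) + Ci * RtoC (Im z))%C.
  2:{ destruct z; unfold RtoC, Ci, Cplus, Cmult, Re, Im; simpl. f_equal; ring. }
  eapply Rle_trans; [apply Cmod_triangle|].
  rewrite Cmod_mult, Cmod_Ci, !Cmod_R.
  apply Req_le. destruct z; unfold RtoC, Ci, Cplus, Cmult, Re, Im; simpl.
  rewrite Rmult_1_l. f_equal; f_equal; ring.
Qed.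

Lemma is_C_derive_eps (f : C -> C) (z l : C) :
  CD f z l <->
  forall eps : R, 0 < eps -> exists d : R, 0 < d /\ forall w : C,
    Cmod (w - z) < d -> Cmod (f w - f z - l * (w - z)) <= eps * Cmod (w - z).
Proof.
  split.
  - intros [_ H] eps Heps.
    destruct (H z (fun P HP => HP) (mkposreal eps Heps)) as [d Hd].
    exists d. split; [apply cond_pos|].
    intros w Hw. specialize (Hd w Hw).
    replace (f w - f z - l * (w - z))%C with (f w - f z - (w - z) * l)%C by ring.
    exact Hd.
  - intros H. split; [apply is_linear_scal_l|].
    intros x Hx. assert (x = z).
    { symmetry. apply (is_filter_lim_locally_unique (K:=C_AbsRing) (V:=AbsRing_NormedModule C_AbsRing) z x Hx). }
    subst x. intros [eps Heps]. destruct (H eps Heps) as [d [Hd Hw]].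
    exists (mkposreal d Hd).
    intros w Hw'. specialize (Hw w Hw').
    replace (f w - f z - l * (w - z))%C with (f w - f z - (w - z) * l)%C in Hw by ring.
    exact Hw.
Qed.

(** An explicit quadratic remainder survives integration and summation over a parameter, while a
    mere modulus of differentiability does not. Derivatives of integrals and of series are therefore
    all obtained in this form. *)
Lemma CD_quadratic (f : C -> C) (z l : C) (K d : R) :
  0 < d -> 
  (forall w, Cmod (w - z) < d -> Cmod (f w - f z - l * (w - z)) <= K * Cmod (w - z) ^ 2) ->
  CD f z l.
Proof.
  intros Hd H. apply is_C_derive_eps. intros eps Heps.
  exists (Rmin d (eps / (Rabs K + 1))).
  assert (HK : 0 < Rabs K + 1) by (assert (T := Rabs_pos K); lra).
  split. { apply Rmin_glb_lt; auto. apply Rdiv_lt_0_compat; auto. }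
  intros w Hw.
  assert (H1 : Cmod (w - z) < d) by (eapply Rlt_le_trans; [exact Hw|apply Rmin_l]).
  assert (H2 : Cmod (w - z) < eps / (Rabs K + 1)) by (eapply Rlt_le_trans; [exact Hw|apply Rmin_r]).
  eapply Rle_trans; [apply H, H1|].
  assert (H3 := Cmod_ge_0 (w - z)). 
  simpl. rewrite Rmult_1_r, <- Rmult_assoc. apply Rmult_le_compat_r; auto.
  apply Rle_trans with ((Rabs K + 1) * Cmod (w - z)).
  - apply Rmult_le_compat_r; auto. assert (T := Rle_abs K); lra.
  - apply Rmult_lt_compat_l with (r := Rabs K + 1) in H2; auto.
    replace eps with ((Rabs K + 1) * (eps / (Rabs K + 1))) by (field; lra). lra.
Qed.

Lemma CD_lipschitz (f : C -> C) (z l : C) : CD f z l ->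
  exists d, 0 < d /\ forall w, Cmod (w - z) < d -> Cmod (f w - f z) <= (Cmod l + 1) * Cmod (w - z).
Proof.
  intros H. apply is_C_derive_eps with (eps := 1) in H; [|lra].
  destruct H as [d [Hd H]]. exists d. split; auto. intros w Hw. specialize (H w Hw).
  replace (f w - f z)%C with ((f w - f z - l * (w - z)) + l * (w - z))%C by ring.
  eapply Rle_trans; [apply Cmod_triangle|]. rewrite Cmod_mult. lra.
Qed.

Lemma CD_cont (f : C -> C) (z l : C) : CD f z l ->
  forall eps, 0 < eps -> exists d, 0 < d /\ forall w, Cmod (w - z) < d -> Cmod (f w - f z) < eps.
Proof.
  intros H eps Heps. destruct (CD_lipschitz f z l H) as [d [Hd Hw]].
  assert (Hl := Cmod_ge_0 l).
  exists (Rmin d (eps / (Cmod l + 1))). split.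
  { apply Rmin_glb_lt; auto. apply Rdiv_lt_0_compat; lra. }
  intros w H1.
  assert (H2 : Cmod (w - z) < d) by (eapply Rlt_le_trans; [exact H1|apply Rmin_l]).
  assert (H3 : Cmod (w - z) < eps / (Cmod l + 1)) by (eapply Rlt_le_trans; [exact H1|apply Rmin_r]).
  eapply Rle_lt_trans; [apply Hw, H2|].
  apply Rmult_lt_compat_l with (r := Cmod l + 1) in H3; [|lra].
  replace ((Cmod l + 1) * (eps / (Cmod l + 1))) with eps in H3 by (field; lra). lra.
Qed.

Lemma CE_cont (f : C -> C) (z : C) : CE f z ->
  forall eps, 0 < eps -> exists d, 0 < d /\ forall w, Cmod (w - z) < d -> Cmod (f w - f z) < eps.
Proof. intros [l H]. apply CD_cont with l; auto. Qed.

Lemma CD_const (a z : C) : CD (fun _ => a) z (RtoC 0).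
Proof.
  apply CD_quadratic with 0 1; [lra|]. intros w _.
  replace (a - a - 0 * (w - z))%C with (RtoC 0) by ring. rewrite Cmod_0. lra.
Qed.

Lemma CD_id (z : C) : CD (fun w => w) z (RtoC 1).
Proof.
  apply CD_quadratic with 0 1; [lra|]. intros w _.
  replace (w - z - 1 * (w - z))%C with (RtoC 0) by ring. rewrite Cmod_0. lra.
Qed.

Lemma CD_ext_loc (f g : C -> C) (z l : C) (d : R) : 0 < d ->
  (forall w, Cmod (w - z) < d -> f w = g w) -> CD f z l -> CD g z l.
Proof.
  intros Hd E H. apply is_C_derive_eps. intros eps Heps.
  destruct (proj1 (is_C_derive_eps f z l) H eps Heps) as [d' [Hd' Hw]].
  exists (Rmin d d'). split; [apply Rmin_glb_lt; auto|]. intros w H1.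
  rewrite <- E, <- E.
  - apply Hw. eapply Rlt_le_trans; [exact H1|apply Rmin_r].
  - replace (z - z)%C with (RtoC 0) by ring. rewrite Cmod_0; auto.
  - eapply Rlt_le_trans; [exact H1|apply Rmin_l].
Qed.

Lemma CD_eq (f : C -> C) (z l l' : C) : l = l' -> CD f z l -> CD f z l'.
Proof. intros ->; auto. Qed.

Lemma CD_ext (f g : C -> C) (z l : C) :
  (forall w, f w = g w) -> CD f z l -> CD g z l.
Proof. intros E. apply CD_ext_loc with 1; [lra|auto]. Qed.

Lemma CD_plus (f g : C -> C) (z l l' : C) : CD f z l -> CD g z l' ->
  CD (fun w => f w + g w)%C z (l + l')%C.
Proof. intros H H'. apply (is_derive_plus (K:=C_AbsRing) (V:=C_NormedModule) f g z l l' H H'). Qed.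

Lemma CD_mult (f g : C -> C) (z l l' : C) : CD f z l -> CD g z l' ->
  CD (fun w => f w * g w)%C z (l * g z + f z * l')%C.
Proof.
  intros Hf Hg. apply is_C_derive_eps. intros eps Heps.
  assert (P1 := Cmod_ge_0 (g z)). assert (P2 := Cmod_ge_0 (f z)). assert (P3 := Cmod_ge_0 l).
  set (e := eps / (3 * (Cmod (g z) + 1 + Cmod (f z) + Cmod l))).
  assert (He : 0 < e). { unfold e. apply Rdiv_lt_0_compat; lra. }
  assert (Ee : e * (Cmod (g z) + 1 + Cmod (f z) + Cmod l) = eps / 3) by (unfold e; field; lra).
  destruct (proj1 (is_C_derive_eps f z l) Hf e He) as [d1 [Hd1 H1]].
  destruct (proj1 (is_C_derive_eps g z l') Hg e He) as [d2 [Hd2 H2]].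
  destruct (CD_cont g z l' Hg (Rmin e 1)) as [d3 [Hd3 H3]]; [apply Rmin_glb_lt; lra|].
  exists (Rmin d1 (Rmin d2 d3)). split; [repeat apply Rmin_glb_lt; auto|].
  intros w Hw.
  assert (T1 := Rmin_l d1 (Rmin d2 d3)). assert (T2 := Rmin_r d1 (Rmin d2 d3)).
  assert (T3 := Rmin_l d2 d3). assert (T4 := Rmin_r d2 d3).
  specialize (H1 w ltac:(lra)). specialize (H2 w ltac:(lra)). specialize (H3 w ltac:(lra)).
  assert (T5 := Rmin_l e 1). assert (T6 := Rmin_r e 1).
  set (D := Cmod (w - z)) in *. assert (HD : 0 <= D) by apply Cmod_ge_0.
  assert (Hg1 : Cmod (g w) <= Cmod (g z) + 1).
  { replace (g w) with ((g w - g z) + g z)%C by ring.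
    eapply Rle_trans; [apply Cmod_triangle|]. lra. }
  replace (f w * g w - f z * g z - (l * g z + f z * l') * (w - z))%C with
    ((f w - f z - l * (w - z)) * g w + (l * (w - z) * (g w - g z) + f z * (g w - g z - l' * (w - z))))%C by ring.
  eapply Rle_trans; [apply Cmod_triangle|].
  eapply Rle_trans; [apply Rplus_le_compat_l, Cmod_triangle|].
  rewrite !Cmod_mult. fold D.
  apply Rle_trans with (e * D * (Cmod (g z) + 1) + (Cmod l * D * e + Cmod (f z) * (e * D))).
  - apply Rplus_le_compat; [|apply Rplus_le_compat].
    + apply Rmult_le_compat; auto using Cmod_ge_0.
    + apply Rmult_le_compat_l; [|lra]. apply Rmult_le_pos; auto.
    + apply Rmult_le_compat_l; auto.
  - replace (e * D * (Cmod (g z) + 1) + (Cmod l * D * e + Cmod (f z) * (e * D)))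
      with (e * (Cmod (g z) + 1 + Cmod (f z) + Cmod l) * D) by ring.
    rewrite Ee. apply Rmult_le_compat_r; lra.
Qed.

Lemma CD_scal (a : C) (f : C -> C) (z l : C) : CD f z l -> CD (fun w => a * f w)%C z (a * l)%C.
Proof.
  intros H. eapply CD_eq; [|apply (CD_mult _ _ z _ _ (CD_const a z) H)]. ring.
Qed.

Lemma CD_opp (f : C -> C) (z l : C) : CD f z l -> CD (fun w => - f w)%C z (- l)%C.
Proof.
  intros H. exact (is_derive_opp (K:=C_AbsRing) (V:=C_NormedModule) f z l H).
Qed.

Lemma CD_minus (f g : C -> C) (z l l' : C) : CD f z l -> CD g z l' ->
  CD (fun w => f w - g w)%C z (l - l')%C.
Proof. intros H H'. apply CD_plus; [|apply CD_opp]; auto. Qed.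

Lemma CD_comp (g f : C -> C) (z l l' : C) : CD f z l -> CD g (f z) l' ->
  CD (fun w => g (f w)) z (l' * l)%C.
Proof.
  intros Hf Hg. apply is_C_derive_eps. intros eps Heps.
  assert (P1 := Cmod_ge_0 l). assert (P2 := Cmod_ge_0 l').
  set (e1 := eps / 2 / (Cmod l + 1)). set (e2 := eps / 2 / (Cmod l' + 1)).
  assert (He1 : 0 < e1). { unfold e1. repeat apply Rdiv_lt_0_compat; lra. }
  assert (He2 : 0 < e2). { unfold e2. repeat apply Rdiv_lt_0_compat; lra. }
  assert (E1 : e1 * (Cmod l + 1) = eps / 2) by (unfold e1; field; lra).
  assert (E2 : (Cmod l' + 1) * e2 = eps / 2) by (unfold e2; field; lra).
  destruct (proj1 (is_C_derive_eps g _ l') Hg e1 He1) as [d1 [Hd1 H1]].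
  destruct (proj1 (is_C_derive_eps f z l) Hf e2 He2) as [d2 [Hd2 H2]].
  destruct (CD_cont f z l Hf d1 Hd1) as [d3 [Hd3 H3]].
  destruct (CD_lipschitz f z l Hf) as [d4 [Hd4 H4]].
  exists (Rmin (Rmin d2 d4) d3). split; [repeat apply Rmin_glb_lt; auto|].
  intros w Hw.
  assert (T1 := Rmin_l (Rmin d2 d4) d3). assert (T2 := Rmin_r (Rmin d2 d4) d3).
  assert (T3 := Rmin_l d2 d4). assert (T4 := Rmin_r d2 d4).
  specialize (H3 w ltac:(lra)). specialize (H1 _ H3). specialize (H2 w ltac:(lra)). specialize (H4 w ltac:(lra)).
  set (D := Cmod (w - z)) in *. assert (HD : 0 <= D) by apply Cmod_ge_0.
  replace (g (f w) - g (f z) - l' * l * (w - z))%C with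
    ((g (f w) - g (f z) - l' * (f w - f z)) + l' * (f w - f z - l * (w - z)))%C by ring.
  eapply Rle_trans; [apply Cmod_triangle|]. rewrite Cmod_mult.
  apply Rle_trans with (e1 * ((Cmod l + 1) * D) + (Cmod l' + 1) * (e2 * D)).
  - apply Rplus_le_compat.
    + eapply Rle_trans; [exact H1|]. apply Rmult_le_compat_l; lra.
    + apply Rmult_le_compat; try lra. apply Cmod_ge_0.
  - rewrite <- !Rmult_assoc, E1, E2. lra.
Qed.

Lemma CD_inv (z : C) : z <> RtoC 0 -> CD (fun w => / w)%C z (- / (z * z))%C.
Proof.
  intros Hz. assert (P := proj1 (Cmod_gt_0 z) Hz).
  apply CD_quadratic with (2 / (Cmod z * Cmod z * Cmod z)) (Cmod z / 2); [lra|].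
  intros w Hw.
  assert (Hw2 : Cmod z / 2 <= Cmod w).
  { assert (T := Cmod_reverse z w). rewrite Cmod_minus_sym in T. lra. }
  assert (Hw0 : w <> RtoC 0). { apply Cmod_gt_0. lra. }
  replace (/ w - / z - - / (z * z) * (w - z))%C with ((w - z) * (w - z) * / (z * z * w))%C by (field; auto).
  rewrite !Cmod_mult, Cmod_inv, !Cmod_mult by (repeat apply Cmult_neq_0; auto).
  rewrite Rmult_comm. simpl. rewrite Rmult_1_r. apply Rmult_le_compat_r.
  { apply Rmult_le_pos; apply Cmod_ge_0. }
  replace (2 / (Cmod z * Cmod z * Cmod z)) with (/ (Cmod z * Cmod z * (Cmod z / 2))) by (field; lra).
  apply Rinv_le_contravar.
  - repeat apply Rmult_lt_0_compat; lra.
  - apply Rmult_le_compat_l; auto. apply Rmult_le_pos; lra.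
Qed.

Lemma CD_unique (f : C -> C) (z l l' : C) : CD f z l -> CD f z l' -> l = l'.
Proof. intros H H'. rewrite <- (is_C_derive_unique f z l H). apply is_C_derive_unique; auto. Qed.

Lemma CE_derive (f : C -> C) (z : C) : CE f z -> CD f z (C_derive f z).
Proof. apply C_derive_correct; exact (RtoC 0). Qed.

(** * The complex exponential and complex-valued integrals *)

Local Notation Ccont := (continuous (T := R_UniformSpace) (U := C_UniformSpace)).
Local Notation RD := (is_derive (K := R_AbsRing) (V := C_R_NormedModule)).
Local Notation is_CInt := (is_RInt (V := C_R_NormedModule)).
Local Notation CInt := (RInt (V := C_R_CompleteNormedModule)).
Local Notation ex_CInt := (ex_RInt (V := C_R_NormedModule)).
Local Notation is_CInt_gen := (is_RInt_gen (V := C_R_NormedModule)).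
Local Notation CInt_gen := (RInt_gen (V := C_R_CompleteNormedModule)).

Lemma pair_C (x y : R) : ((x, y) : C) = (RtoC x + Ci * RtoC y)%C.
Proof. unfold RtoC, Ci, Cplus, Cmult; simpl. f_equal; ring. Qed.

Lemma Re_Im_C (z : C) : z = (RtoC (Re z) + Ci * RtoC (Im z))%C.
Proof. rewrite <- pair_C. destruct z; reflexivity. Qed.

Lemma Cexp_plus (z w : C) : Cexp (z + w) = (Cexp z * Cexp w)%C.
Proof.
  unfold Cexp, polar. rewrite re_plus, im_plus, exp_plus, cos_plus, sin_plus.
  unfold Cmult; simpl. f_equal; ring.
Qed.

Lemma Cexp_0 : Cexp (RtoC 0) = RtoC 1.
Proof. unfold Cexp, polar, RtoC, Re, Im; simpl. rewrite exp_0, cos_0, sin_0. f_equal; ring. Qed.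

Lemma Cmod_polar (t phi : R) : 0 <= t -> Cmod (polar t phi) = t.
Proof.
  intros Ht. unfold Cmod, polar; simpl.
  replace (_ + _) with (t * t * (Rsqr (sin phi) + Rsqr (cos phi))) by (unfold Rsqr; ring).
  rewrite sin2_cos2, Rmult_1_r. apply sqrt_square; auto.
Qed.

Lemma Cmod_Cexp (z : C) : Cmod (Cexp z) = exp (Re z).
Proof. apply Cmod_polar, Rlt_le, exp_pos. Qed.

Lemma Cexp_neq_0 (z : C) : Cexp z <> RtoC 0.
Proof. apply Cmod_gt_0. rewrite Cmod_Cexp. apply exp_pos. Qed.

Lemma Cexp_opp (z : C) : Cexp (- z) = (/ Cexp z)%C.
Proof.
  assert (H := Cexp_neq_0 z).
  replace (/ Cexp z)%C with (Cexp (- z) * Cexp z * / Cexp z)%C.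
  - field; auto.
  - rewrite <- Cexp_plus. replace (- z + z)%C with (RtoC 0) by ring. rewrite Cexp_0. ring.
Qed.

Lemma Cexp_R (x : R) : Cexp (RtoC x) = RtoC (exp x).
Proof. unfold Cexp, polar, RtoC, Re, Im; simpl. rewrite cos_0, sin_0. f_equal; ring. Qed.

(** Both sides come from [1 + t <= exp t], taken at [x] and at [- x]. The second gives
    [exp x <= 1 / (1 - x)], which exceeds [1 + x] by [x ^ 2 / (1 - x)]. *)
Lemma exp_quadratic (x : R) : Rabs x <= 1 / 2 -> Rabs (exp x - 1 - x) <= 2 * x ^ 2.
Proof.
  intros H. apply Rabs_le_between in H.
  assert (H1 := exp_ineq1_le x). assert (H2 := exp_ineq1_le (- x)).
  assert (H3 : exp x * exp (- x) = 1) by (rewrite <- exp_plus, Rplus_opp_r; apply exp_0).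
  assert (H4 := exp_pos x).
  rewrite Rabs_pos_eq by lra.
  assert (exp x * (1 - x) <= 1) by nra. nra.
Qed.

Lemma sin_Rabs_le (y : R) : Rabs (sin y) <= Rabs y.
Proof.
  destruct (MVT_gen sin 0 y cos) as [c [_ Hc]].
  - intros x _. auto_derive; auto. ring.
  - intros x _. apply continuity_pt_filterlim, continuous_sin.
  - rewrite sin_0, !Rminus_0_r in Hc. rewrite Hc, Rabs_mult.
    rewrite <- (Rmult_1_l (Rabs y)) at 2. apply Rmult_le_compat_r; [apply Rabs_pos|].
    apply Rabs_le, COS_bound.
Qed.

Lemma cos_quadratic (y : R) : Rabs (cos y - 1) <= y ^ 2.
Proof.
  replace y with (2 * (y / 2)) at 1 by field. rewrite cos_2a_sin.
  replace (1 - 2 * sin (y / 2) * sin (y / 2) - 1) with (- (2 * (sin (y / 2) * sin (y / 2)))) by ring.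
  rewrite Rabs_Ropp, !Rabs_mult, (Rabs_pos_eq 2) by lra.
  assert (H := sin_Rabs_le (y / 2)). assert (H' := Rabs_pos (sin (y / 2))).
  assert (E : Rabs (y / 2) * Rabs (y / 2) = y ^ 2 / 4).
  { rewrite <- Rabs_mult, Rabs_pos_eq; [field|]. nra. }
  assert (0 <= y ^ 2) by nra. nra.
Qed.

Lemma sin_quadratic (y : R) : Rabs y <= 1 -> Rabs (sin y - y) <= y ^ 2.
Proof.
  intros Hy.
  destruct (MVT_gen (fun t => sin t - t) 0 y (fun t => cos t - 1)) as [c [Hc1 Hc]].
  - intros x _. auto_derive; auto. ring.
  - intros x _. apply continuity_pt_filterlim.
    apply (continuous_minus (V := R_NormedModule) sin (fun t => t)); [apply continuous_sin|apply continuous_id].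
  - rewrite sin_0, !Rminus_0_r in Hc. rewrite Hc, Rabs_mult.
    assert (H1 := cos_quadratic c).
    assert (H2 : c ^ 2 <= Rabs y).
    { assert (Rabs c <= Rabs y).
      { destruct (Rle_dec 0 y).
        - rewrite Rmin_left, Rmax_right in Hc1 by lra. rewrite !Rabs_pos_eq; lra.
        - rewrite Rmin_right, Rmax_left in Hc1 by lra. rewrite !Rabs_left1; lra. }
      rewrite <- (pow2_abs c). assert (T := Rabs_pos c). nra. }
    rewrite <- (pow2_abs y). assert (T := Rabs_pos y). nra.
Qed.

Lemma Cexp_quadratic (h : C) : Cmod h <= 1 / 2 -> Cmod (Cexp h - 1 - h) <= 12 * Cmod h ^ 2.
Proof.
  intros Hw. destruct h as [x y].
  assert (Hx := re_le_Cmod (x, y)). assert (Hy := im_le_Cmod (x, y)). simpl in Hx, Hy.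
  set (r := Cmod (x, y)) in *.
  eapply Rle_trans; [apply Cmod_le_sum|].
  unfold Cexp, polar, Re, Im, RtoC, Cminus, Cplus, Copp; simpl.
  assert (E1 := exp_quadratic x ltac:(lra)). assert (E2 := cos_quadratic y).
  assert (E3 := sin_quadratic y ltac:(lra)). assert (E4 := sin_Rabs_le y).
  assert (Qx : x ^ 2 <= r ^ 2). { rewrite <- (pow2_abs x). assert (T := Rabs_pos x). nra. }
  assert (Qy : y ^ 2 <= r ^ 2). { rewrite <- (pow2_abs y). assert (T := Rabs_pos y). nra. }
  assert (Qr : 0 <= r) by apply Cmod_ge_0.
  assert (E5 : Rabs (exp x - 1) <= 2 * r).
  { replace (exp x - 1) with ((exp x - 1 - x) + x) by ring.
    eapply Rle_trans; [apply Rabs_triang|]. nra. }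
  replace (exp x * cos y + - (1) + - x) with ((exp x - 1 - x) + ((exp x - 1) * (cos y - 1) + (cos y - 1))) by ring.
  replace (exp x * sin y + - 0 + - y) with ((exp x - 1) * sin y + (sin y - y)) by ring.
  assert (A1 : Rabs (exp x - 1 - x + ((exp x - 1) * (cos y - 1) + (cos y - 1))) <= 2 * r ^ 2 + (r ^ 2 + r ^ 2)).
  { eapply Rle_trans; [apply Rabs_triang|]. apply Rplus_le_compat; [lra|].
    eapply Rle_trans; [apply Rabs_triang|]. rewrite Rabs_mult.
    assert (T := Rabs_pos (cos y - 1)). assert (T' := Rabs_pos (exp x - 1)). nra. }
  assert (A2 : Rabs ((exp x - 1) * sin y + (sin y - y)) <= 2 * r ^ 2 + r ^ 2).
  { eapply Rle_trans; [apply Rabs_triang|]. rewrite Rabs_mult.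
    assert (T := Rabs_pos (sin y)). assert (T' := Rabs_pos (exp x - 1)). nra. }
  nra.
Qed.

Lemma CD_Cexp (z : C) : CD Cexp z (Cexp z).
Proof.
  apply CD_quadratic with (Cmod (Cexp z) * 12) (1 / 2); [lra|].
  intros w Hw. set (h := (w - z)%C) in *.
  replace w with (z + h)%C by (unfold h; ring).
  rewrite Cexp_plus.
  replace (Cexp z * Cexp h - Cexp z - Cexp z * h)%C with (Cexp z * (Cexp h - 1 - h))%C by ring.
  rewrite Cmod_mult, Rmult_assoc. apply Rmult_le_compat_l; [apply Cmod_ge_0|].
  apply Cexp_quadratic. lra.
Qed.

Lemma Ccont_eps (f : R -> C) (x : R) :
  Ccont f x <-> forall eps, 0 < eps -> exists d, 0 < d /\
    forall y, Rabs (y - x) < d -> Cmod (f y - f x) < eps.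
Proof.
  split.
  - intros H eps Heps.
    assert (H1 : locally (T := C_UniformSpace) (f x) (fun z => Cmod (z - f x) < eps)).
    { apply (locally_le_locally_norm (V := C_R_NormedModule)).
      exists (mkposreal eps Heps). intros y Hy. rewrite Cmod_norm. exact Hy. }
    destruct (H _ H1) as [d Hd]. exists d. split; [apply cond_pos|]. intros y Hy. apply Hd, Hy.
  - intros H P HP.
    apply (locally_norm_le_locally (V := C_R_NormedModule)) in HP.
    destruct HP as [[eps Heps] HP]. destruct (H eps Heps) as [d [Hd H1]].
    exists (mkposreal d Hd). intros y Hy. apply HP. specialize (H1 y Hy).
    rewrite Cmod_norm in H1. exact H1.
Qed.

Lemma Ccont_CE (f : C -> C) (g : R -> C) (x : R) :
  CE f (g x) -> Ccont g x -> Ccont (fun t => f (g t)) x.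
Proof.
  intros Hf Hg. apply Ccont_eps. intros eps Heps.
  destruct (CE_cont f _ Hf eps Heps) as [d [Hd H1]].
  destruct (proj1 (Ccont_eps g x) Hg d Hd) as [d' [Hd' H2]].
  exists d'. split; auto.
Qed.

Lemma Ccont_const (a : C) (x : R) : Ccont (fun _ => a) x.
Proof. apply continuous_const. Qed.

Lemma Ccont_plus (f g : R -> C) (x : R) : Ccont f x -> Ccont g x -> Ccont (fun t => f t + g t)%C x.
Proof. apply (continuous_plus (V := C_R_NormedModule)). Qed.

Lemma Ccont_minus (f g : R -> C) (x : R) : Ccont f x -> Ccont g x -> Ccont (fun t => f t - g t)%C x.
Proof. apply (continuous_minus (V := C_R_NormedModule)). Qed.

Lemma Ccont_mult (f g : R -> C) (x : R) : Ccont f x -> Ccont g x -> Ccont (fun t => f t * g t)%C x.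
Proof.
  intros Hf Hg. apply Ccont_eps. intros eps Heps.
  assert (P1 := Cmod_ge_0 (g x)). assert (P2 := Cmod_ge_0 (f x)).
  set (e := eps / (2 * (Cmod (g x) + 1 + Cmod (f x)))).
  assert (He : 0 < e). { unfold e. apply Rdiv_lt_0_compat; lra. }
  assert (Ee : e * (Cmod (g x) + 1 + Cmod (f x)) = eps / 2) by (unfold e; field; lra).
  destruct (proj1 (Ccont_eps f x) Hf e He) as [d1 [Hd1 H1]].
  destruct (proj1 (Ccont_eps g x) Hg (Rmin e 1)) as [d2 [Hd2 H2]]; [apply Rmin_glb_lt; lra|].
  exists (Rmin d1 d2). split; [apply Rmin_glb_lt; auto|]. intros y Hy.
  assert (T1 := Rmin_l d1 d2). assert (T2 := Rmin_r d1 d2).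
  assert (T3 := Rmin_l e 1). assert (T4 := Rmin_r e 1).
  specialize (H1 y ltac:(lra)). specialize (H2 y ltac:(lra)).
  assert (Hg1 : Cmod (g y) <= Cmod (g x) + 1).
  { replace (g y) with ((g y - g x) + g x)%C by ring.
    eapply Rle_trans; [apply Cmod_triangle|]. lra. }
  replace (f y * g y - f x * g x)%C with ((f y - f x) * g y + f x * (g y - g x))%C by ring.
  eapply Rle_lt_trans; [apply Cmod_triangle|]. rewrite !Cmod_mult.
  apply Rle_lt_trans with (e * (Cmod (g x) + 1) + Cmod (f x) * e); [|nra].
  apply Rplus_le_compat.
  - apply Rmult_le_compat; auto using Cmod_ge_0; lra.
  - apply Rmult_le_compat_l; lra.
Qed.

Lemma Ccont_RtoC (f : R -> R) (x : R) : continuous f x -> Ccont (fun t => RtoC (f t)) x.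
Proof.
  intros H. apply Ccont_eps. intros eps Heps.
  destruct (H (fun z => Rabs (z - f x) < eps)) as [d Hd].
  { exists (mkposreal eps Heps). intros y Hy. exact Hy. }
  exists d. split; [apply cond_pos|]. intros y Hy. rewrite <- RtoC_minus, Cmod_R. apply Hd, Hy.
Qed.

Lemma Ccont_affine (a b : C) (x : R) : Ccont (fun t => a + RtoC t * b)%C x.
Proof.
  apply Ccont_plus; [apply Ccont_const|]. apply Ccont_mult; [|apply Ccont_const].
  apply Ccont_RtoC, continuous_id.
Qed.

Lemma affine_h (x c : R) : ((x, c) : C) = ((0, c) + RtoC x * RtoC 1)%C.
Proof. unfold RtoC, Cplus, Cmult; simpl. f_equal; ring. Qed.
Lemma affine_v (x c : R) : ((x, c) : C) = (RtoC x + RtoC c * Ci)%C.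
Proof. unfold RtoC, Ci, Cplus, Cmult; simpl. f_equal; ring. Qed.

Lemma Ccont_h (c x : R) : Ccont (fun t => (t, c) : C) x.
Proof. eapply continuous_ext; [intros t; symmetry; apply affine_h|]. apply Ccont_affine. Qed.
Lemma Ccont_v (c x : R) : Ccont (fun t => (c, t) : C) x.
Proof. eapply continuous_ext; [intros t; symmetry; apply affine_v|]. apply Ccont_affine. Qed.

(** Affine paths suffice: contours consist of horizontal and vertical segments ([b = 1] and
    [b = Ci]), and the other primitives are taken along straight segments. *)
Lemma RD_affine (f : C -> C) (a b l : C) (x : R) : CD f (a + RtoC x * b)%C l ->
  RD (fun t => f (a + RtoC t * b)%C) x (l * b)%C.
Proof.
  intros H. split; [apply is_linear_scal_l|]. intros x' Hx'.
  assert (x = x') by (apply (is_filter_lim_locally_unique (K:=R_AbsRing) (V:=R_NormedModule)); auto).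
  subst x'. intros [eps Heps].
  assert (Hb := Cmod_ge_0 b).
  destruct (proj1 (is_C_derive_eps f _ l) H (eps / (Cmod b + 1))) as [d [Hd H1]].
  { apply Rdiv_lt_0_compat; lra. }
  assert (Hd' : 0 < d / (Cmod b + 1)) by (apply Rdiv_lt_0_compat; lra).
  exists (mkposreal _ Hd'). intros y Hy. simpl.
  change (Rabs (y - x) < d / (Cmod b + 1)) in Hy.
  assert (E : Cmod (a + RtoC y * b - (a + RtoC x * b)) = Rabs (y - x) * Cmod b).
  { rewrite <- Cmod_R, <- Cmod_mult. f_equal. rewrite RtoC_minus. ring. }
  specialize (H1 (a + RtoC y * b)%C). rewrite E in H1.
  assert (T := Rabs_pos (y - x)).
  apply Rmult_lt_compat_l with (r := Cmod b + 1) in Hy; [|lra].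
  replace ((Cmod b + 1) * (d / (Cmod b + 1))) with d in Hy by (field; lra).
  specialize (H1 ltac:(nra)).
  rewrite <- Cmod_norm.
  change (norm (minus y x)) with (Rabs (y - x)).
  replace (minus _ _) with (f (a + RtoC y * b) - f (a + RtoC x * b) - l * (a + RtoC y * b - (a + RtoC x * b)))%C.
  - eapply Rle_trans; [exact H1|].
    apply Rle_trans with (eps / (Cmod b + 1) * (Rabs (y - x) * (Cmod b + 1))).
    + apply Rmult_le_compat_l; [apply Rlt_le, Rdiv_lt_0_compat; lra|]. nra.
    + right. field. lra.
  - rewrite scal_R_Cmult.
    change (f (a + y * b) - f (a + x * b) - l * (a + y * b - (a + x * b)) =
            f (a + y * b) - f (a + x * b) - RtoC (y - x) * (l * b))%C.
    rewrite RtoC_minus. ring.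
Qed.

Lemma RD_h (f : C -> C) (c x : R) (l : C) : CD f (x, c) l -> RD (fun t => f (t, c)) x l.
Proof.
  intros H. rewrite affine_h in H. apply RD_affine in H.
  replace (l * RtoC 1)%C with l in H by ring.
  eapply is_derive_ext; [|exact H]. intros t. simpl. f_equal. symmetry. apply affine_h.
Qed.

Lemma RD_v (f : C -> C) (c x : R) (l : C) : CD f (c, x) l -> RD (fun t => f (c, t)) x (l * Ci)%C.
Proof.
  intros H. rewrite affine_v in H. apply RD_affine in H.
  eapply is_derive_ext; [|exact H]. intros t. simpl. f_equal. symmetry. apply affine_v.
Qed.

(** Integrals are taken in [C] as a real normed module, where linearity only covers real scalars; a
    complex factor mixes the two components and is treated on them separately. *)
Lemma is_CInt_scal (k : C) (f : R -> C) (a b : R) (l : C) :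
  is_CInt f a b l -> is_CInt (fun x => k * f x)%C a b (k * l)%C.
Proof.
  intros H.
  assert (H1 := is_RInt_fct_extend_fst (U := R_NormedModule) (V := R_NormedModule) f a b l H).
  assert (H2 := is_RInt_fct_extend_snd (U := R_NormedModule) (V := R_NormedModule) f a b l H).
  apply (is_RInt_fct_extend_pair (U := R_NormedModule) (V := R_NormedModule)); simpl.
  - apply (is_RInt_minus (V := R_NormedModule) (fun x => fst k * fst (f x)) (fun x => snd k * snd (f x)));
    apply (is_RInt_scal (V := R_NormedModule)); auto.
  - apply (is_RInt_plus (V := R_NormedModule) (fun x => fst k * snd (f x)) (fun x => snd k * fst (f x)));
    apply (is_RInt_scal (V := R_NormedModule)); auto.
Qed.

Lemma is_CInt_gen_eps (f : R -> C) (Fa Fb : (R -> Prop) -> Prop) {FFa : Filter Fa} {FFb : Filter Fb} (l : C) :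
  is_CInt_gen f Fa Fb l <->
  forall eps, 0 < eps -> filter_prod Fa Fb (fun ab => exists I, is_CInt f (fst ab) (snd ab) I /\ Cmod (I - l) < eps).
Proof.
  split.
  - intros H eps Heps. apply (H (fun I => Cmod (I - l) < eps)).
    apply (locally_le_locally_norm (V := C_R_NormedModule)).
    exists (mkposreal eps Heps). intros y Hy. rewrite Cmod_norm. exact Hy.
  - intros H P HP.
    apply (locally_norm_le_locally (V := C_R_NormedModule)) in HP.
    destruct HP as [[eps Heps] HP].
    unfold filtermapi. eapply (filter_imp (F := filter_prod Fa Fb)); [|apply (H eps Heps)].
    intros ab [I [H1 H2]]. exists I. split; auto. apply HP. rewrite Cmod_norm in H2. exact H2.
Qed.

Lemma is_CInt_gen_scal (k : C) (f : R -> C) (Fa Fb : (R -> Prop) -> Prop) {FFa : Filter Fa} {FFb : Filter Fb} (l : C) :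
  is_CInt_gen f Fa Fb l -> is_CInt_gen (fun x => k * f x)%C Fa Fb (k * l)%C.
Proof.
  intros H. apply is_CInt_gen_eps; auto. intros eps Heps.
  assert (Hk := Cmod_ge_0 k).
  assert (He : 0 < eps / (Cmod k + 1)) by (apply Rdiv_lt_0_compat; lra).
  eapply filter_imp; [|apply (proj1 (is_CInt_gen_eps f Fa Fb l) H _ He)].
  intros ab [I [H1 H2]]. exists (k * I)%C. split; [apply is_CInt_scal; auto|].
  replace (k * I - k * l)%C with (k * (I - l))%C by ring. rewrite Cmod_mult.
  apply Rle_lt_trans with (Cmod k * (eps / (Cmod k + 1))).
  - apply Rmult_le_compat_l; lra.
  - apply Rlt_le_trans with ((Cmod k + 1) * (eps / (Cmod k + 1))).
    + apply Rmult_lt_compat_r; lra.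
    + right; field; lra.
Qed.

(** * Goursat's theorem for rectangles *)

(** The integral of [f z dz] over the boundary of [[a, b] x [c, d]], counterclockwise; the factor
    [Ci] is [dz = i dy] on the vertical sides. *)
Definition rect (f : C -> C) (a b c d : R) : C :=
  (CInt (fun x => f (x, c)) a b + Ci * CInt (fun y => f (b, y)) c d
   - CInt (fun x => f (x, d)) a b - Ci * CInt (fun y => f (a, y)) c d)%C.

Definition hol_rect (f : C -> C) (a b c d : R) : Prop :=
  forall x y, a <= x <= b -> c <= y <= d -> CE f (x, y).

Definition int_rect (f : C -> C) (a b c d : R) : Prop :=
  ex_CInt (fun x => f (x, c)) a b /\ ex_CInt (fun y => f (b, y)) c d /\
  ex_CInt (fun x => f (x, d)) a b /\ ex_CInt (fun y => f (a, y)) c d.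

Lemma ex_CInt_cont (f : R -> C) (a b : R) : a <= b ->
  (forall x, a <= x <= b -> Ccont f x) -> ex_CInt f a b.
Proof.
  intros Hab H. apply (ex_RInt_continuous (V := C_R_CompleteNormedModule)).
  rewrite Rmin_left, Rmax_right by lra. exact H.
Qed.

Lemma CInt_correct (f : R -> C) (a b : R) : ex_CInt f a b -> is_CInt f a b (CInt f a b).
Proof. apply (RInt_correct (V := C_R_CompleteNormedModule)). Qed.

Lemma CInt_unique (f : R -> C) (a b : R) (l : C) : is_CInt f a b l -> CInt f a b = l.
Proof. apply (is_RInt_unique (V := C_R_CompleteNormedModule)). Qed.

Lemma ex_CInt_h (f : C -> C) (a b y : R) : a <= b ->
  (forall x, a <= x <= b -> CE f (x, y)) -> ex_CInt (fun x => f (x, y)) a b.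
Proof.
  intros Hab H. apply ex_CInt_cont; auto. intros x Hx.
  apply Ccont_CE; auto. apply Ccont_h.
Qed.

Lemma ex_CInt_v (f : C -> C) (x c d : R) : c <= d ->
  (forall y, c <= y <= d -> CE f (x, y)) -> ex_CInt (fun y => f (x, y)) c d.
Proof.
  intros Hab H. apply ex_CInt_cont; auto. intros y Hy.
  apply Ccont_CE; auto. apply Ccont_v.
Qed.

Lemma int_hol_rect (f : C -> C) (a b c d : R) : a <= b -> c <= d ->
  hol_rect f a b c d -> int_rect f a b c d.
Proof.
  intros H1 H2 H. split; [|split; [|split]]; [apply ex_CInt_h|apply ex_CInt_v|apply ex_CInt_h|apply ex_CInt_v];
  auto; intros; apply H; lra.
Qed.

Lemma CInt_Chasles (f : R -> C) (a b c : R) : ex_CInt f a b -> ex_CInt f b c ->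
  (CInt f a b + CInt f b c)%C = CInt f a c.
Proof. apply (RInt_Chasles (V := C_R_CompleteNormedModule)). Qed.

Lemma CInt_norm (f : R -> C) (a b M : R) : a <= b -> ex_CInt f a b ->
  (forall x, a <= x <= b -> Cmod (f x) <= M) -> Cmod (CInt f a b) <= (b - a) * M.
Proof.
  intros Hab He H. rewrite Cmod_norm.
  apply (norm_RInt_le_const (V := C_R_NormedModule) f); auto.
  - intros x Hx. rewrite <- Cmod_norm. auto.
  - apply CInt_correct; auto.
Qed.

Lemma rect_split_v (f : C -> C) (a x b c d : R) :
  int_rect f a x c d -> int_rect f x b c d ->
  rect f a b c d = (rect f a x c d + rect f x b c d)%C.
Proof.
  intros [H1 [H2 [H3 H4]]] [H5 [H6 [H7 H8]]]. unfold rect.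
  rewrite <- (CInt_Chasles _ a x b H1 H5), <- (CInt_Chasles _ a x b H3 H7). ring.
Qed.

Lemma rect_split_h (f : C -> C) (a b c y d : R) :
  int_rect f a b c y -> int_rect f a b y d ->
  rect f a b c d = (rect f a b c y + rect f a b y d)%C.
Proof.
  intros [H1 [H2 [H3 H4]]] [H5 [H6 [H7 H8]]]. unfold rect.
  rewrite <- (CInt_Chasles _ c y d H2 H6), <- (CInt_Chasles _ c y d H4 H8). ring.
Qed.

Lemma rect_norm (f : C -> C) (a b c d M : R) : a <= b -> c <= d -> int_rect f a b c d ->
  (forall x y, a <= x <= b -> c <= y <= d -> x = a \/ x = b \/ y = c \/ y = d -> Cmod (f (x, y)) <= M) ->
  Cmod (rect f a b c d) <= 2 * ((b - a) + (d - c)) * M.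
Proof.
  intros Hab Hcd [H1 [H2 [H3 H4]]] H. unfold rect.
  assert (N1 := CInt_norm _ a b M Hab H1). assert (N2 := CInt_norm _ c d M Hcd H2).
  assert (N3 := CInt_norm _ a b M Hab H3). assert (N4 := CInt_norm _ c d M Hcd H4).
  simpl in N1, N2, N3, N4.
  eapply Rle_trans; [apply Cmod_triangle_minus|].
  eapply Rle_trans; [apply Rplus_le_compat_r, Cmod_triangle_minus|].
  eapply Rle_trans; [apply Rplus_le_compat_r, Rplus_le_compat_r, Cmod_triangle|].
  rewrite !Cmod_mult, Cmod_Ci, !Rmult_1_l.
  assert (M1 : Cmod (CInt (fun x => f (x, c)) a b) <= (b - a) * M) by (apply N1; intros; apply H; lra).
  assert (M2 : Cmod (CInt (fun y => f (b, y)) c d) <= (d - c) * M) by (apply N2; intros; apply H; lra).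
  assert (M3 : Cmod (CInt (fun x => f (x, d)) a b) <= (b - a) * M) by (apply N3; intros; apply H; lra).
  assert (M4 : Cmod (CInt (fun y => f (a, y)) c d) <= (d - c) * M) by (apply N4; intros; apply H; lra).
  lra.
Qed.

Lemma rect_plus (f g : C -> C) (a b c d : R) : int_rect f a b c d -> int_rect g a b c d ->
  rect (fun z => f z + g z)%C a b c d = (rect f a b c d + rect g a b c d)%C.
Proof.
  intros [H1 [H2 [H3 H4]]] [H5 [H6 [H7 H8]]]. unfold rect.
  assert (E : forall (u v : R -> C) p q, ex_CInt u p q -> ex_CInt v p q ->
    CInt (fun x => u x + v x)%C p q = (CInt u p q + CInt v p q)%C).
  { intros. apply (RInt_plus (V := C_R_CompleteNormedModule)); auto. }
  rewrite !E by assumption. ring.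
Qed.

Lemma rect_ext (f g : C -> C) (a b c d : R) : a <= b -> c <= d ->
  (forall x y, a <= x <= b -> c <= y <= d -> x = a \/ x = b \/ y = c \/ y = d -> f (x, y) = g (x, y)) ->
  rect f a b c d = rect g a b c d.
Proof.
  intros Hab Hcd H. unfold rect.
  assert (E : forall (u v : R -> C) p q, p <= q -> (forall t, p <= t <= q -> u t = v t) -> CInt u p q = CInt v p q).
  { intros u v p q Hpq E. apply (RInt_ext (V := C_R_CompleteNormedModule)).
    rewrite Rmin_left, Rmax_right by lra. intros t Ht. apply E; lra. }
  rewrite (E (fun x => f (x, c)) (fun x => g (x, c)) a b Hab) by (intros; apply H; lra).
  rewrite (E (fun x => f (x, d)) (fun x => g (x, d)) a b Hab) by (intros; apply H; lra).
  rewrite (E (fun y => f (b, y)) (fun y => g (b, y)) c d Hcd) by (intros; apply H; lra).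
  rewrite (E (fun y => f (a, y)) (fun y => g (a, y)) c d Hcd) by (intros; apply H; lra).
  reflexivity.
Qed.

Lemma is_CInt_primitive (f F : R -> C) (a b : R) : a <= b ->
  (forall x, a <= x <= b -> RD F x (f x)) -> (forall x, a <= x <= b -> Ccont f x) ->
  is_CInt f a b (F b - F a)%C.
Proof.
  intros Hab H H'. apply (is_RInt_derive (V := C_R_CompleteNormedModule)); rewrite Rmin_left, Rmax_right by lra; auto.
Qed.

Lemma is_CInt_prim_h (f F : C -> C) (a b y : R) : a <= b ->
  (forall x, a <= x <= b -> CD F (x, y) (f (x, y)) /\ CE f (x, y)) ->
  is_CInt (fun x => f (x, y)) a b (F (b, y) - F (a, y))%C.
Proof.
  intros Hab H. apply (is_CInt_primitive _ (fun x => F (x, y))); auto.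
  - intros x Hx. apply RD_h, H; auto.
  - intros x Hx. apply Ccont_CE; [apply H; auto|apply Ccont_h].
Qed.

Lemma is_CInt_prim_v (f F : C -> C) (x c d : R) : c <= d ->
  (forall y, c <= y <= d -> CD F (x, y) (f (x, y)) /\ CE f (x, y)) ->
  is_CInt (fun y => Ci * f (x, y))%C c d (F (x, d) - F (x, c))%C.
Proof.
  intros Hab H. apply (is_CInt_primitive _ (fun y => F (x, y))); auto.
  - intros y Hy. replace (Ci * f (x, y))%C with (f (x, y) * Ci)%C by ring. apply RD_v, H; auto.
  - intros y Hy. apply Ccont_mult; [apply Ccont_const|]. apply Ccont_CE; [apply H; auto|apply Ccont_v].
Qed.

Lemma rect_primitive (f F : C -> C) (a b c d : R) : a <= b -> c <= d ->
  (forall x y, a <= x <= b -> c <= y <= d -> CD F (x, y) (f (x, y)) /\ CE f (x, y)) ->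
  rect f a b c d = RtoC 0.
Proof.
  intros Hab Hcd H. unfold rect.
  assert (V : forall x, a <= x <= b -> (Ci * CInt (fun y => f (x, y)) c d)%C = (F (x, d) - F (x, c))%C).
  { intros x Hx. rewrite <- (CInt_unique _ c d _ (is_CInt_prim_v f F x c d Hcd (fun y Hy => H x y Hx Hy))).
    symmetry. apply CInt_unique, is_CInt_scal, CInt_correct.
    apply ex_CInt_v; auto. intros; apply H; auto. }
  rewrite !V by lra.
  rewrite (CInt_unique _ a b _ (is_CInt_prim_h f F a b c Hab (fun x Hx => H x c Hx ltac:(lra)))).
  rewrite (CInt_unique _ a b _ (is_CInt_prim_h f F a b d Hab (fun x Hx => H x d Hx ltac:(lra)))).
  ring.
Qed.

Lemma nested_intervals (a b : nat -> R) :
  (forall n, a n <= a (S n)) -> (forall n, b (S n) <= b n) -> (forall n, a n <= b n) ->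
  exists x, forall n, a n <= x <= b n.
Proof.
  intros Ha Hb Hab.
  assert (Ma : forall n m, (n <= m)%nat -> a n <= a m) by (intros n m H; induction H; [lra|specialize (Ha m); lra]).
  assert (Mb : forall n m, (n <= m)%nat -> b m <= b n) by (intros n m H; induction H; [lra|specialize (Hb m); lra]).
  assert (Mab : forall n m, a n <= b m).
  { intros n m. apply Rle_trans with (a (Nat.max n m)); [apply Ma; lia|].
    apply Rle_trans with (b (Nat.max n m)); [apply Hab|apply Mb; lia]. }
  destruct (completeness (fun y => exists n, y = a n)) as [x [Hx1 Hx2]].
  - exists (b 0%nat). intros y [n ->]. apply Mab.
  - exists (a 0%nat), 0%nat. reflexivity.
  - exists x. intros n. split.
    + apply Hx1. exists n; auto.
    + apply Hx2. intros y [m ->]. apply Mab.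
Qed.

Record box := mkbox { bl : R; br : R; bd : R; bu : R }.

Section Goursat.
Context (f : C -> C) (eps : R) (Heps : 0 < eps).

Let frect (Q : box) := rect f (bl Q) (br Q) (bd Q) (bu Q).
Let size (Q : box) := (br Q - bl Q) + (bu Q - bd Q).
Let bad (Q : box) := eps * size Q ^ 2 < Cmod (frect Q).
Let ok (Q : box) := bl Q <= br Q /\ bd Q <= bu Q /\ hol_rect f (bl Q) (br Q) (bd Q) (bu Q).
Let mh (Q : box) := (bl Q + br Q) / 2.
Let mv (Q : box) := (bd Q + bu Q) / 2.
Let q1 Q := mkbox (bl Q) (mh Q) (bd Q) (mv Q).
Let q2 Q := mkbox (bl Q) (mh Q) (mv Q) (bu Q).
Let q3 Q := mkbox (mh Q) (br Q) (bd Q) (mv Q).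
Let q4 Q := mkbox (mh Q) (br Q) (mv Q) (bu Q).

Let next (Q : box) : box :=
  if Rlt_dec (eps * size (q1 Q) ^ 2) (Cmod (frect (q1 Q))) then q1 Q else
  if Rlt_dec (eps * size (q2 Q) ^ 2) (Cmod (frect (q2 Q))) then q2 Q else
  if Rlt_dec (eps * size (q3 Q) ^ 2) (Cmod (frect (q3 Q))) then q3 Q else q4 Q.

(** [size] is half the perimeter: it halves under bisection, so the threshold [eps * size ^ 2] is
    divided by 4. If no quarter exceeded its threshold, the four integrals would add up to at most
    the threshold of [Q]. Hence [next] may take [q4] by default. *)
Lemma next_bad (Q : box) : ok Q -> bad Q -> bad (next Q).
Proof.
  intros [H1 [H2 H3]] HB. unfold next.
  destruct Rlt_dec as [H|G1]; [exact H|]. destruct Rlt_dec as [H|G2]; [exact H|].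
  destruct Rlt_dec as [H|G3]; [exact H|]. 
  unfold bad. apply Rnot_le_lt. intros G4. apply Rnot_lt_le in G1, G2, G3.
  unfold bad in HB.
  assert (J : forall a b c d, bl Q <= a -> a <= b -> b <= br Q -> bd Q <= c -> c <= d -> d <= bu Q ->
    int_rect f a b c d).
  { intros. apply int_hol_rect; auto. intros x y Hx Hy. apply H3; lra. }
  assert (E : frect Q = (frect (q1 Q) + frect (q2 Q) + (frect (q3 Q) + frect (q4 Q)))%C).
  { unfold frect, q1, q2, q3, q4; simpl.
    rewrite <- !rect_split_h by (apply J; unfold mh, mv; lra).
    apply rect_split_v; apply J; unfold mh, mv; lra. }
  rewrite E in HB.
  assert (T := Cmod_triangle (frect (q1 Q) + frect (q2 Q)) (frect (q3 Q) + frect (q4 Q))).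
  assert (T1 := Cmod_triangle (frect (q1 Q)) (frect (q2 Q))).
  assert (T2 := Cmod_triangle (frect (q3 Q)) (frect (q4 Q))).
  assert (S1 : size (q1 Q) = size Q / 2) by (unfold size, q1, mh, mv; simpl; field).
  assert (S2 : size (q2 Q) = size Q / 2) by (unfold size, q2, mh, mv; simpl; field).
  assert (S3 : size (q3 Q) = size Q / 2) by (unfold size, q3, mh, mv; simpl; field).
  assert (S4 : size (q4 Q) = size Q / 2) by (unfold size, q4, mh, mv; simpl; field).
  rewrite S1 in G1. rewrite S2 in G2. rewrite S3 in G3. rewrite S4 in G4.
  replace (eps * (size Q / 2) ^ 2) with (eps * size Q ^ 2 / 4) in * by field. lra.
Qed.

Lemma next_inv (Q : box) : bl Q <= br Q -> bd Q <= bu Q ->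
  bl Q <= bl (next Q) /\ bl (next Q) <= br (next Q) /\ br (next Q) <= br Q /\
  bd Q <= bd (next Q) /\ bd (next Q) <= bu (next Q) /\ bu (next Q) <= bu Q /\
  size (next Q) = size Q / 2.
Proof.
  intros H1 H2.
  assert (D : next Q = q1 Q \/ next Q = q2 Q \/ next Q = q3 Q \/ next Q = q4 Q).
  { unfold next. destruct Rlt_dec; [|destruct Rlt_dec; [|destruct Rlt_dec]]; auto. }
  destruct D as [-> | [-> | [-> | ->]]];
  unfold q1, q2, q3, q4, size, mh, mv; simpl; repeat split; lra.
Qed.

Lemma goursat_eps (Q : box) : ok Q -> ~ bad Q.
Proof.
  intros HQ HB.
  set (s := fun n => Nat.iter n next Q).
  assert (I : forall n, ok (s n) /\ bad (s n) /\ size (s n) = size Q / 2 ^ n).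
  { induction n as [|n [I1 [I2 I3]]].
    - simpl. repeat split; try apply HQ; auto. field.
    - change (s (S n)) with (next (s n)).
      destruct I1 as [J1 [J2 J3]]. assert (K := next_inv (s n) J1 J2).
      split; [|split].
      + repeat split; try lra. intros x y Hx Hy. apply J3; lra.
      + apply next_bad; auto. repeat split; auto.
      + rewrite (proj2 (proj2 (proj2 (proj2 (proj2 (proj2 K)))))), I3. simpl. field. apply pow_nonzero; lra. }
  assert (N : forall n, bl (s n) <= bl (s (S n)) /\ br (s (S n)) <= br (s n) /\
    bd (s n) <= bd (s (S n)) /\ bu (s (S n)) <= bu (s n)).
  { intros n. change (s (S n)) with (next (s n)).
    destruct (I n) as [[J1 [J2 J3]] _]. assert (K := next_inv (s n) J1 J2). lra. }
  destruct (nested_intervals (fun n => bl (s n)) (fun n => br (s n))) as [x Hx]; try (intros n; apply N).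
  { intros n. destruct (I n) as [[J1 [J2 J3]] _]. lra. }
  destruct (nested_intervals (fun n => bd (s n)) (fun n => bu (s n))) as [y Hy]; try (intros n; apply N).
  { intros n. destruct (I n) as [[J1 [J2 J3]] _]. lra. }
  destruct HQ as [H1 [H2 H3]].
  destruct (H3 x y (Hx 0%nat) (Hy 0%nat)) as [l Hl].
  (* The affine approximation has a primitive and integrates to 0. What remains is at most the
     perimeter [2 * size] times [eps / 4 * size], half of what a bad box requires. *)
  destruct (proj1 (is_C_derive_eps f _ l) Hl (eps / 4)) as [dl [Hdl Hd]]; [lra|].
  assert (HS : 0 <= size Q) by (unfold size; lra).
  assert (exists n, size Q / 2 ^ n < dl) as [n Hn].
  { destruct (pow_lt_1_zero (1/2) ltac:(rewrite Rabs_pos_eq; lra) (dl / (size Q + 1))) as [n Hn].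
    - apply Rdiv_lt_0_compat; lra.
    - exists n. specialize (Hn n (le_n n)). rewrite Rabs_pos_eq in Hn by (apply pow_le; lra).
      replace (size Q / 2 ^ n) with (size Q * (1/2) ^ n).
      2:{ unfold Rdiv at 1. rewrite Rmult_1_l, pow_inv. reflexivity. }
      assert (P := pow_lt (1/2) n ltac:(lra)).
      apply Rmult_lt_compat_l with (r := size Q + 1) in Hn; [|lra].
      replace ((size Q + 1) * (dl / (size Q + 1))) with dl in Hn by (field; lra). nra. }
  destruct (I n) as [[J1 [J2 J3]] [J4 J5]]. specialize (Hx n). specialize (Hy n). simpl in Hx, Hy.
  set (T := s n) in *. rewrite <- J5 in Hn.
  set (z := (x, y) : C) in *.
  set (A := fun w : C => (f z - l * z + l * w)%C).
  assert (HA : forall w, CD A w l).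
  { intros w. unfold A. eapply CD_eq; [|apply CD_plus; [apply CD_const|apply CD_scal, CD_id]]. ring. }
  assert (HA0 : rect A (bl T) (br T) (bd T) (bu T) = RtoC 0).
  { apply (rect_primitive A (fun w => (f z - l * z) * w + (l * / RtoC 2) * (w * w))%C); auto.
    intros u v _ _. split; [|exists l; apply HA].
    eapply CD_eq; [|apply CD_plus; [apply CD_scal, CD_id|apply CD_scal, CD_mult; apply CD_id]].
    unfold A. field. }
  assert (HfA : rect f (bl T) (br T) (bd T) (bu T) = rect (fun w => f w - A w)%C (bl T) (br T) (bd T) (bu T)).
  { transitivity (rect (fun w => (f w - A w) + A w)%C (bl T) (br T) (bd T) (bu T)).
    - apply rect_ext; auto. intros. ring.
    - rewrite rect_plus, HA0.
      + ring.
      + apply int_hol_rect; auto. intros u v Hu Hv. destruct (J3 u v Hu Hv) as [l' Hl'].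
        exists (l' - l)%C. apply CD_minus; auto.
      + apply int_hol_rect; auto. intros u v Hu Hv. exists l. apply HA. }
  unfold bad, frect in J4. rewrite HfA in J4.
  assert (B := rect_norm (fun w => f w - A w)%C (bl T) (br T) (bd T) (bu T) (eps / 4 * size T) J1 J2).
  assert (HT : 0 <= size T) by (unfold size; lra).
  assert (Cmod (rect (fun w => f w - A w)%C (bl T) (br T) (bd T) (bu T)) <= 2 * size T * (eps / 4 * size T)).
  { apply B.
    - apply int_hol_rect; auto. intros u v Hu Hv. destruct (J3 u v Hu Hv) as [l' Hl'].
        exists (l' - l)%C. apply CD_minus; auto.
    - intros u v Hu Hv _.
      assert (D : Cmod ((u, v) - z) <= size T).
      { eapply Rle_trans; [apply Cmod_le_sum|]. unfold z, size, Re, Im, Cminus, Cplus, Copp; simpl.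
        apply Rplus_le_compat; apply Rabs_le; lra. }
      specialize (Hd (u, v) ltac:(lra)).
      replace (f (u, v) - A (u, v))%C with (f (u, v) - f z - l * ((u, v) - z))%C by (unfold A; ring).
      eapply Rle_trans; [exact Hd|]. apply Rmult_le_compat_l; lra. }
  nra.
Qed.
End Goursat.

Theorem goursat (f : C -> C) (a b c d : R) : a <= b -> c <= d ->
  hol_rect f a b c d -> rect f a b c d = RtoC 0.
Proof.
  intros Hab Hcd H. apply Cmod_eq_0. apply Rle_antisym; [|apply Cmod_ge_0].
  apply le_epsilon. intros eps Heps.
  set (S := ((b - a) + (d - c)) ^ 2).
  assert (HS : 0 <= S) by (apply pow_le; lra).
  assert (He : 0 < eps / (S + 1)) by (apply Rdiv_lt_0_compat; lra).
  assert (G := goursat_eps f (eps / (S + 1)) He (mkbox a b c d)). simpl in G.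
  apply Rnot_lt_le in G; [|auto].
  assert (eps / (S + 1) * S <= eps).
  { apply Rle_trans with (eps / (S + 1) * (S + 1)); [apply Rmult_le_compat_l; lra|right; field; lra]. }
  unfold S in *. simpl in *. lra.
Qed.

(** * Cauchy's formula on squares *)

Definition two_pi_i : C := (RtoC (2 * PI) * Ci)%C.

Lemma Cmod_two_pi_i : Cmod two_pi_i = 2 * PI.
Proof.
  unfold two_pi_i. rewrite Cmod_mult, Cmod_Ci, Cmod_R, Rmult_1_r.
  assert (H := PI_RGT_0). apply Rabs_pos_eq. lra.
Qed.

Lemma two_pi_i_neq_0 : two_pi_i <> RtoC 0.
Proof. apply Cmod_gt_0. rewrite Cmod_two_pi_i. assert (H := PI_RGT_0). lra. Qed.

Lemma int_sides (f : C -> C) (a b c d : R) : a <= b -> c <= d ->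
  (forall x y, a <= x <= b -> c <= y <= d -> x = a \/ x = b \/ y = c \/ y = d -> CE f (x, y)) ->
  int_rect f a b c d.
Proof.
  intros H1 H2 H. split; [|split; [|split]]; [apply ex_CInt_h|apply ex_CInt_v|apply ex_CInt_h|apply ex_CInt_v];
  auto; intros; apply H; lra.
Qed.

Lemma rect_scal (k : C) (f : C -> C) (a b c d : R) : int_rect f a b c d ->
  rect (fun z => k * f z)%C a b c d = (k * rect f a b c d)%C.
Proof.
  intros [H1 [H2 [H3 H4]]]. unfold rect.
  assert (E : forall (u : R -> C) p q, ex_CInt u p q ->
    CInt (fun x => k * u x)%C p q = (k * CInt u p q)%C).
  { intros. apply CInt_unique, is_CInt_scal, CInt_correct; auto. }
  rewrite !E by assumption. ring.
Qed.

Lemma int_rect_scal (k : C) (f : C -> C) (a b c d : R) : int_rect f a b c d ->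
  int_rect (fun z => k * f z)%C a b c d.
Proof.
  intros [H1 [H2 [H3 H4]]].
  repeat split; eexists; apply is_CInt_scal, CInt_correct; assumption.
Qed.

Lemma is_RInt_atan_kernel (a e : R) : 0 < e ->
  is_RInt (fun x => e / ((x - a) ^ 2 + e ^ 2)) (a - e) (a + e) (PI / 2).
Proof.
  intros He.
  replace (PI / 2) with (atan ((a + e - a) / e) - atan ((a - e - a) / e)).
  2:{ replace ((a + e - a) / e) with 1 by (field; lra).
      replace ((a - e - a) / e) with (- (1)) by (field; lra).
      rewrite atan_opp, atan_1. field. }
  apply (is_RInt_derive (V := R_CompleteNormedModule) (fun x => atan ((x - a) / e))).
  - intros x _. auto_derive.
    + lra.
    + assert (0 <= (x - a) ^ 2) by (apply pow2_ge_0). unfold Rsqr. field. split; nra.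
  - intros x _. apply (ex_derive_continuous (V := R_NormedModule)). auto_derive. 
    assert (0 <= (x - a) ^ 2) by (apply pow2_ge_0). nra.
Qed.

Lemma is_RInt_ln_kernel (a e : R) : 0 < e ->
  is_RInt (fun x => (x - a) / ((x - a) ^ 2 + e ^ 2)) (a - e) (a + e) 0.
Proof.
  intros He.
  replace 0 with (ln ((a + e - a) ^ 2 + e ^ 2) / 2 - ln ((a - e - a) ^ 2 + e ^ 2) / 2).
  2:{ replace ((a + e - a) ^ 2) with ((a - e - a) ^ 2) by ring. ring. }
  apply (is_RInt_derive (V := R_CompleteNormedModule) (fun x => ln ((x - a) ^ 2 + e ^ 2) / 2)).
  - intros x _. assert (0 <= (x - a) ^ 2) by (apply pow2_ge_0). auto_derive.
    + nra.
    + field. nra.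
  - intros x _. apply (ex_derive_continuous (V := R_NormedModule)). auto_derive. 
    assert (0 <= (x - a) ^ 2) by (apply pow2_ge_0). nra.
Qed.

Lemma is_CInt_pair (f : R -> C) (a b u v : R) :
  is_RInt (fun t => fst (f t)) a b u -> is_RInt (fun t => snd (f t)) a b v -> is_CInt f a b (u, v).
Proof. apply (is_RInt_fct_extend_pair (U := R_NormedModule) (V := R_NormedModule)). Qed.

(** On each side one component of the integrand is odd, with a logarithmic primitive that gives 0,
    and the other is an arctangent kernel worth [PI / 2] up to sign. With the orientation, the four
    sides add up to [4 * (PI / 2) * Ci]. *)
Lemma rect_square_inv (z : C) (e : R) : 0 < e ->
  rect (fun w => / (w - z))%C (Re z - e) (Re z + e) (Im z - e) (Im z + e) = two_pi_i.
Proof.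
  intros He. destruct z as [a b]. unfold Re, Im; simpl fst; simpl snd.
  assert (A1 := is_RInt_atan_kernel a e He). assert (A2 := is_RInt_ln_kernel a e He).
  assert (A3 := is_RInt_atan_kernel b e He). assert (A4 := is_RInt_ln_kernel b e He).
  assert (P : forall u, 0 <= u ^ 2) by (intros; apply pow2_ge_0).
  assert (E1 : is_CInt (fun x => / ((x, (b - e)%R) - (a, b)))%C (a - e) (a + e) (0, PI / 2)).
  { apply is_CInt_pair; [eapply is_RInt_ext; [|exact A2]|eapply is_RInt_ext; [|exact A1]];
    intros x _; unfold Cinv, Cminus, Cplus, Copp; simpl; specialize (P (x - a)); field; try split; nra. }
  assert (E2 : is_CInt (fun x => / ((x, (b + e)%R) - (a, b)))%C (a - e) (a + e) (0, - (PI / 2))).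
  { apply is_CInt_pair; [eapply is_RInt_ext; [|exact A2]|
      eapply is_RInt_ext; [|exact (is_RInt_opp (V := R_NormedModule) _ _ _ _ A1)]];
    intros x _; unfold opp, Cinv, Cminus, Cplus, Copp; simpl; specialize (P (x - a)); field; try split; nra. }
  assert (E3 : is_CInt (fun y => / (((a + e)%R, y) - (a, b)))%C (b - e) (b + e) (PI / 2, - 0)).
  { apply is_CInt_pair; [eapply is_RInt_ext; [|exact A3]|
      eapply is_RInt_ext; [|exact (is_RInt_opp (V := R_NormedModule) _ _ _ _ A4)]];
    intros x _; unfold opp, Cinv, Cminus, Cplus, Copp; simpl; specialize (P (x - b)); field; try split; nra. }
  assert (E4 : is_CInt (fun y => / (((a - e)%R, y) - (a, b)))%C (b - e) (b + e) (- (PI / 2), - 0)).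
  { apply is_CInt_pair; [
      eapply is_RInt_ext; [|exact (is_RInt_opp (V := R_NormedModule) _ _ _ _ A3)]|
      eapply is_RInt_ext; [|exact (is_RInt_opp (V := R_NormedModule) _ _ _ _ A4)]];
    intros x _; unfold opp, Cinv, Cminus, Cplus, Copp; simpl; specialize (P (x - b)); field; try split; nra. }
  unfold rect.
  rewrite (CInt_unique _ _ _ _ E1), (CInt_unique _ _ _ _ E2), (CInt_unique _ _ _ _ E3), (CInt_unique _ _ _ _ E4).
  unfold two_pi_i, RtoC, Ci, Cminus, Cplus, Copp, Cmult; simpl. f_equal; field.
Qed.

Lemma Cpair_neq (x y : R) (z : C) : x <> Re z \/ y <> Im z -> ((x, y) : C) <> z.
Proof. intros H E. rewrite <- E in H. simpl in H. lra. Qed.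

Lemma CE_inv_sub (z w : C) : w <> z -> CE (fun s => / (s - z))%C w.
Proof.
  intros H. eexists. apply (CD_comp (fun s => / s)%C (fun s => s - z)%C).
  - apply CD_minus; [apply CD_id|apply CD_const].
  - apply CD_inv. intros E. apply H. replace w with ((w - z) + z)%C by ring. rewrite E. ring.
Qed.

Lemma CE_mult (f g : C -> C) (z : C) : CE f z -> CE g z -> CE (fun w => f w * g w)%C z.
Proof. intros [l H] [l' H']. eexists. apply CD_mult; eauto. Qed.
Lemma CE_plus (f g : C -> C) (z : C) : CE f z -> CE g z -> CE (fun w => f w + g w)%C z.
Proof. intros [l H] [l' H']. eexists. apply CD_plus; eauto. Qed.
Lemma CE_minus (f g : C -> C) (z : C) : CE f z -> CE g z -> CE (fun w => f w - g w)%C z.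
Proof. intros [l H] [l' H']. eexists. apply CD_minus; eauto. Qed.
Lemma CE_const (a z : C) : CE (fun _ => a) z.
Proof. eexists. apply CD_const. Qed.
Lemma CE_id (z : C) : CE (fun w => w) z.
Proof. eexists. apply CD_id. Qed.
Lemma CE_comp (g f : C -> C) (z : C) : CE f z -> CE g (f z) -> CE (fun w => g (f w)) z.
Proof. intros [l H] [l' H']. eexists. apply CD_comp; eauto. Qed.
Lemma CE_Cexp (z : C) : CE Cexp z.
Proof. eexists. apply CD_Cexp. Qed.

(** Goursat's theorem on the four surrounding pieces shrinks the rectangle to a square of half side
    [e] around [z]. There [A / (w - z)] integrates exactly, and the bounded difference contributes
    at most [8 * e * M]. Asking only for boundedness near [z] avoids removable singularities: for
    Cauchy's formula a Lipschitz bound at [z] is enough. *)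
Theorem residue_simple (f : C -> C) (a b c d : R) (z A : C) (M dl : R) :
  a < Re z < b -> c < Im z < d ->
  (forall x y, a <= x <= b -> c <= y <= d -> (x, y) <> z -> CE f (x, y)) ->
  0 < dl -> (forall w, w <> z -> Cmod (w - z) < dl -> Cmod (f w - A / (w - z)) <= M) ->
  rect f a b c d = (two_pi_i * A)%C.
Proof.
  intros Hx Hy Hf Hdl HM.
  set (x := Re z) in *. set (y := Im z) in *.
  set (e0 := Rmin (Rmin (x - a) (b - x)) (Rmin (Rmin (y - c) (d - y)) (dl / 2))).
  assert (He0 : 0 < e0 /\ e0 <= x - a /\ e0 <= b - x /\ e0 <= y - c /\ e0 <= d - y /\ e0 <= dl / 2).
  { split; [unfold e0; repeat apply Rmin_glb_lt; lra|]. 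
    assert (T1 := Rmin_l (Rmin (x - a) (b - x)) (Rmin (Rmin (y - c) (d - y)) (dl / 2))).
    assert (T2 := Rmin_r (Rmin (x - a) (b - x)) (Rmin (Rmin (y - c) (d - y)) (dl / 2))).
    assert (T3 := Rmin_l (x - a) (b - x)). assert (T4 := Rmin_r (x - a) (b - x)).
    assert (T5 := Rmin_l (Rmin (y - c) (d - y)) (dl / 2)). assert (T6 := Rmin_r (Rmin (y - c) (d - y)) (dl / 2)).
    assert (T7 := Rmin_l (y - c) (d - y)). assert (T8 := Rmin_r (y - c) (d - y)).
    fold e0 in T1, T2. lra. }
  assert (HM0 : 0 <= M).
  { eapply Rle_trans; [apply Cmod_ge_0|apply (HM ((x + dl / 2)%R, y))].
    - apply Cpair_neq. left. fold x. lra.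
    - eapply Rle_lt_trans; [apply Cmod_le_sum|]. rewrite (surjective_pairing z).
      fold (Re z) (Im z). fold x y. unfold Cminus, Cplus, Copp, Re, Im; simpl.
      replace (x + dl / 2 + - x) with (dl / 2) by ring. replace (y + - y) with 0 by ring.
      rewrite Rabs_R0, Rabs_pos_eq; lra. }
  assert (K : forall e, 0 < e < e0 -> Cmod (rect f a b c d - two_pi_i * A) <= 8 * e * M).
  { intros e He.
    assert (S : forall p q r t, a <= p -> p <= q -> q <= b -> c <= r -> r <= t -> t <= d ->
      (p < x < q /\ r < y < t) \/ x < p \/ q < x \/ y < r \/ t < y -> int_rect f p q r t).
    { intros p q r t H1 H2 H3 H4 H5 H6 H7. apply int_sides; auto. intros u v Hu Hv Hs.
      apply Hf; try lra. apply Cpair_neq. fold x y. lra. }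
    assert (Z : forall p q r t, a <= p -> p <= q -> q <= b -> c <= r -> r <= t -> t <= d ->
      x < p \/ q < x \/ y < r \/ t < y -> rect f p q r t = RtoC 0).
    { intros p q r t H1 H2 H3 H4 H5 H6 H7. apply goursat; auto. intros u v Hu Hv.
      apply Hf; try lra. apply Cpair_neq. fold x y. lra. }
    assert (E : rect f a b c d = rect f (x - e) (x + e) (y - e) (y + e)).
    { rewrite (rect_split_v f a (x - e) b c d) by (apply S; lra).
      rewrite (rect_split_v f (x - e) (x + e) b c d) by (apply S; lra).
      rewrite (rect_split_h f (x - e) (x + e) c (y - e) d) by (apply S; lra).
      rewrite (rect_split_h f (x - e) (x + e) (y - e) (y + e) d) by (apply S; lra).
      rewrite (Z a (x - e) c d), (Z (x + e) b c d), (Z (x - e) (x + e) c (y - e)), (Z (x - e) (x + e) (y + e) d) by lra.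
      ring. }
    assert (I1 : int_rect (fun w => / (w - z))%C (x - e) (x + e) (y - e) (y + e)).
    { apply int_sides; try lra. intros u v Hu Hv Hs. apply CE_inv_sub. apply Cpair_neq. fold x y. lra. }
    assert (I2 : int_rect (fun w => f w - A / (w - z))%C (x - e) (x + e) (y - e) (y + e)).
    { apply int_sides; try lra. intros u v Hu Hv Hs.
      assert ((u, v) <> z :> C) by (apply Cpair_neq; fold x y; lra).
      apply CE_minus; [apply Hf; auto; lra|].
      apply CE_mult; [apply CE_const|apply CE_inv_sub; auto]. }
    assert (E2 : rect f (x - e) (x + e) (y - e) (y + e) =
      (rect (fun w => f w - A / (w - z))%C (x - e) (x + e) (y - e) (y + e) + A * two_pi_i)%C).
    { rewrite <- (rect_square_inv z e) by lra. fold x y.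
      rewrite <- (rect_scal A _ _ _ _ _ I1), <- (rect_plus _ _ _ _ _ _ I2 (int_rect_scal A _ _ _ _ _ I1)).
      apply rect_ext; try lra. intros. unfold Cdiv. ring. }
    rewrite E, E2.
    match goal with |- Cmod (?X + ?Y - ?Z) <= _ => replace (X + Y - Z)%C with X by ring end.
    replace (8 * e * M) with (2 * ((x + e - (x - e)) + (y + e - (y - e))) * M) by ring.
    apply rect_norm; auto; try lra.
    intros u v Hu Hv Hs. apply HM; [apply Cpair_neq; fold x y; lra|].
    eapply Rle_lt_trans with (2 * e); [|lra].
    eapply Rle_trans; [apply Cmod_le_sum|]. rewrite (surjective_pairing z).
      fold (Re z) (Im z). fold x y. unfold Cminus, Cplus, Copp, Re, Im; simpl.
    assert (Rabs (u + - x) <= e) by (apply Rabs_le; lra).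
    assert (Rabs (v + - y) <= e) by (apply Rabs_le; lra). lra. }
  apply Ceq_minus, Cmod_eq_0, Rle_antisym; [|apply Cmod_ge_0].
  apply le_epsilon. intros eps Heps.
  set (e := Rmin (e0 / 2) (eps / (8 * (M + 1)))).
  assert (Hee : 0 < e) by (unfold e; apply Rmin_glb_lt; [lra|apply Rdiv_lt_0_compat; lra]).
  assert (He1 : e <= e0 / 2) by apply Rmin_l.
  assert (He2 : e <= eps / (8 * (M + 1))) by apply Rmin_r.
  specialize (K e ltac:(lra)).
  apply Rmult_le_compat_l with (r := 8 * (M + 1)) in He2; [|lra].
  replace (8 * (M + 1) * (eps / (8 * (M + 1)))) with eps in He2 by (field; lra). nra.
Qed.

Theorem cauchy_formula (f : C -> C) (a b c d : R) (z : C) :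
  a < Re z < b -> c < Im z < d -> hol_rect f a b c d ->
  rect (fun w => f w / (w - z))%C a b c d = (two_pi_i * f z)%C.
Proof.
  intros Hx Hy Hf.
  assert (Hz : CE f z). { rewrite (surjective_pairing z). apply Hf; unfold Re, Im in *; lra. }
  destruct Hz as [l Hl]. destruct (CD_lipschitz f z l Hl) as [dl [Hdl H]].
  apply residue_simple with (z := z) (M := Cmod l + 1) (dl := dl); auto.
  - intros x y H1 H2 H3. apply CE_mult; [apply Hf; auto|apply CE_inv_sub; auto].
  - intros w Hw Hd.
    assert (Hw0 : (w - z)%C <> RtoC 0) by (apply Cminus_eq_contra; auto).
    replace (f w / (w - z) - f z / (w - z))%C with ((f w - f z) / (w - z))%C by (field; auto).
    rewrite Cmod_div by auto. specialize (H w Hd).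
    apply Cmod_gt_0 in Hw0.
    apply Rmult_le_reg_r with (Cmod (w - z)); auto.
    unfold Rdiv. rewrite Rmult_assoc, Rinv_l, Rmult_1_r; lra.
Qed.

(* Closed squares of half-side r, so that no circle has to be parametrized. *)
Definition in_sq (z : C) (r : R) (w : C) : Prop := Rabs (Re w - Re z) <= r /\ Rabs (Im w - Im z) <= r.
Definition csq (f : C -> C) (z : C) (r : R) : C := rect f (Re z - r) (Re z + r) (Im z - r) (Im z + r).
Definition on_sq (z : C) (r : R) (w : C) : Prop :=
  in_sq z r w /\ (Rabs (Re w - Re z) = r \/ Rabs (Im w - Im z) = r).

Lemma CE_inv (f : C -> C) (z : C) : CE f z -> f z <> RtoC 0 -> CE (fun w => / f w)%C z.
Proof.
  intros [l H] Hz. eexists. apply (CD_comp (fun s => / s)%C f); [exact H|]. apply CD_inv, Hz.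
Qed.

Lemma CE_div (f g : C -> C) (z : C) : CE f z -> CE g z -> g z <> RtoC 0 -> CE (fun w => f w / g w)%C z.
Proof. intros. apply CE_mult; [assumption|]. apply CE_inv; assumption. Qed.

Lemma CE_opp (f : C -> C) (z : C) : CE f z -> CE (fun w => - f w)%C z.
Proof. intros [l H]. eexists. apply CD_opp; eauto. Qed.

Lemma CE_pow (f : C -> C) (n : nat) (z : C) : CE f z -> CE (fun w => f w ^ n)%C z.
Proof.
  intros [l H]. induction n as [|n [l' IH]].
  - exists (RtoC 0). apply (CD_ext (fun _ => RtoC 1)); [reflexivity|apply CD_const].
  - eexists. apply (CD_ext (fun w => f w * f w ^ n)%C); [reflexivity|apply CD_mult; eauto].
Qed.

(** Descends by the shape of the expression; constant subterms fall through to the last case on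
    [CE], and the nonvanishing of denominators is left to the caller. *)
Ltac ce := cbv beta; lazymatch goal with
  | |- CE (fun w => w) _ => apply CE_id
  | |- CE (fun w => (@?f w * @?g w)%C) _ => apply (CE_mult f g); ce
  | |- CE (fun w => (@?f w ^ ?n)%C) _ => apply (CE_pow f n); ce
  | |- CE (fun w => (@?f w - @?g w)%C) _ => apply (CE_minus f g); ce
  | |- CE (fun w => (@?f w + @?g w)%C) _ => apply (CE_plus f g); ce
  | |- CE (fun w => (- @?f w)%C) _ => apply (CE_opp f); ce
  | |- CE (fun w => (@?f w / @?g w)%C) _ => apply (CE_div f g); [ce|ce|]; cbv beta
  | |- CE (fun w => (/ @?f w)%C) _ => apply (CE_inv f); [ce|]; cbv beta
  | |- CE (fun w => Cexp (@?f w)) _ => apply (CE_comp Cexp f); [ce|apply CE_Cexp]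
  | |- CE _ _ => first [solve [auto] | exact (CE_const _ _)]
  | |- _ => auto
  end.

Lemma Re_minus (z w : C) : Re (z - w) = Re z - Re w.
Proof. unfold Cminus. rewrite re_plus, re_opp. ring. Qed.
Lemma Im_minus (z w : C) : Im (z - w) = Im z - Im w.
Proof. unfold Cminus. rewrite im_plus, im_opp. ring. Qed.

Lemma in_sq_Cmod (z w : C) (r : R) : Cmod (w - z) <= r -> in_sq z r w.
Proof.
  intros H. split; [rewrite <- Re_minus|rewrite <- Im_minus]; eapply Rle_trans; eauto;
  [apply re_le_Cmod|apply im_le_Cmod].
Qed.

Lemma Cmod_in_sq (z w : C) (r : R) : in_sq z r w -> Cmod (w - z) <= 2 * r.
Proof. intros [H1 H2]. eapply Rle_trans; [apply Cmod_le_sum|]. rewrite Re_minus, Im_minus. lra. Qed.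

Lemma on_sq_Cmod (z w : C) (r : R) : on_sq z r w -> r <= Cmod (w - z).
Proof.
  intros [_ [H|H]]; rewrite <- H; [rewrite <- Re_minus; apply re_le_Cmod|rewrite <- Im_minus; apply im_le_Cmod].
Qed.

Lemma on_sq_sides (z : C) (r x y : R) : 0 <= r ->
  Re z - r <= x <= Re z + r -> Im z - r <= y <= Im z + r ->
  x = Re z - r \/ x = Re z + r \/ y = Im z - r \/ y = Im z + r -> on_sq z r (x, y).
Proof.
  intros Hr Hx Hy H. unfold on_sq, in_sq. replace (Re (x, y)) with x by reflexivity.
  replace (Im (x, y)) with y by reflexivity.
  split; [split; apply Rabs_le; lra|].
  destruct H as [-> | [-> | [-> | ->]]].
  - left. rewrite Rabs_left1; lra.
  - left. rewrite Rabs_pos_eq; lra.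
  - right. rewrite Rabs_left1; lra.
  - right. rewrite Rabs_pos_eq; lra.
Qed.

Lemma in_sq_pair (z : C) (r x y : R) : Re z - r <= x <= Re z + r -> Im z - r <= y <= Im z + r -> in_sq z r (x, y).
Proof. intros. split; apply Rabs_le; simpl; lra. Qed.

Lemma csq_int (f : C -> C) (z : C) (r : R) : 0 <= r -> (forall w, on_sq z r w -> CE f w) ->
  int_rect f (Re z - r) (Re z + r) (Im z - r) (Im z + r).
Proof. intros Hr H. apply int_sides; try lra. intros. apply H, on_sq_sides; auto. Qed.

Lemma csq_norm (f : C -> C) (z : C) (r M : R) : 0 <= r -> (forall w, on_sq z r w -> CE f w) ->
  (forall w, on_sq z r w -> Cmod (f w) <= M) -> Cmod (csq f z r) <= 8 * r * M.
Proof.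
  intros Hr H HM. unfold csq.
  replace (8 * r * M) with (2 * ((Re z + r - (Re z - r)) + (Im z + r - (Im z - r))) * M) by ring.
  apply rect_norm; try lra. apply csq_int; auto. intros. apply HM, on_sq_sides; auto.
Qed.

Lemma csq_ext (f g : C -> C) (z : C) (r : R) : 0 <= r ->
  (forall w, on_sq z r w -> f w = g w) -> csq f z r = csq g z r.
Proof. intros Hr H. unfold csq. apply rect_ext; [lra|lra|]. intros. apply H, on_sq_sides; auto. Qed.

Lemma csq_lin3 (f g h : C -> C) (k : C) (z : C) (r : R) : 0 <= r ->
  (forall w, on_sq z r w -> CE f w) -> (forall w, on_sq z r w -> CE g w) -> (forall w, on_sq z r w -> CE h w) ->
  csq (fun w => f w + (k * g w + h w))%C z r = (csq f z r + (k * csq g z r + csq h z r))%C.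
Proof.
  intros Hr Hf Hg Hh. unfold csq.
  rewrite <- (rect_scal k g) by (apply csq_int; auto).
  rewrite <- (rect_plus (fun w => k * g w)%C h).
  - apply rect_plus; apply csq_int; auto. intros. apply CE_plus; auto. apply CE_mult; auto. apply CE_const.
  - apply int_rect_scal, csq_int; auto.
  - apply csq_int; auto.
Qed.

(** A Riemann integrable function is bounded on its segment, so integrability of the four sides
    replaces a compactness argument. *)
Lemma csq_bounded (f : C -> C) (z : C) (r : R) : 0 <= r -> (forall w, on_sq z r w -> CE f w) ->
  exists M, forall w, on_sq z r w -> Cmod (f w) <= M.
Proof.
  intros Hr H. destruct (csq_int f z r Hr H) as [I1 [I2 [I3 I4]]].
  apply ex_RInt_ub in I1, I2, I3, I4.
  destruct I1 as [M1 I1], I2 as [M2 I2], I3 as [M3 I3], I4 as [M4 I4].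
  rewrite !Rmin_left, !Rmax_right in * by lra.
  exists (Rmax (Rmax M1 M2) (Rmax M3 M4)). intros [x y] [[Hx Hy] Hs]. simpl in Hx, Hy, Hs.
  apply Rabs_le_between in Hx, Hy.
  assert (T1 := Rmax_l (Rmax M1 M2) (Rmax M3 M4)). assert (T2 := Rmax_r (Rmax M1 M2) (Rmax M3 M4)).
  assert (T3 := Rmax_l M1 M2). assert (T4 := Rmax_r M1 M2).
  assert (T5 := Rmax_l M3 M4). assert (T6 := Rmax_r M3 M4).
  rewrite Cmod_norm.
  assert (x = Re z - r \/ x = Re z + r \/ y = Im z - r \/ y = Im z + r) as [-> | [-> | [-> | ->]]].
  { destruct Hs as [Hs|Hs]; unfold Rabs in Hs; destruct Rcase_abs in Hs; lra. }
  - eapply Rle_trans; [apply (I4 y); lra|lra].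
  - eapply Rle_trans; [apply (I2 y); lra|lra].
  - eapply Rle_trans; [apply (I1 x); lra|lra].
  - eapply Rle_trans; [apply (I3 x); lra|lra].
Qed.

Lemma cauchy_sq (f : C -> C) (z w : C) (r : R) :
  (forall s, in_sq z r s -> CE f s) -> Cmod (w - z) < r ->
  csq (fun s => f s / (s - w))%C z r = (two_pi_i * f w)%C.
Proof.
  intros H Hw.
  assert (H1 := re_le_Cmod (w - z)). assert (H2 := im_le_Cmod (w - z)).
  rewrite Re_minus in H1. rewrite Im_minus in H2.
  assert (H3 : Rabs (Re w - Re z) < r) by lra. assert (H4 : Rabs (Im w - Im z) < r) by lra.
  apply Rabs_lt_between in H3, H4.
  unfold csq. apply (cauchy_formula f); [lra|lra|]. intros x y Hx Hy. apply H, in_sq_pair; auto.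
Qed.

Lemma div_le_of_ge (a b A B : R) : 0 <= a -> a <= A -> 0 < B -> B <= b -> a / b <= A / B.
Proof.
  intros H1 H2 H3 H4. unfold Rdiv. apply Rmult_le_compat; auto.
  - apply Rlt_le, Rinv_0_lt_compat; lra.
  - apply Rinv_le_contravar; auto.
Qed.

Lemma sq_ne (z w s : C) (r : R) : on_sq z r s -> Cmod (w - z) < r -> (s - w)%C <> RtoC 0 /\ r - Cmod (w - z) <= Cmod (s - w).
Proof.
  intros Hs Hw. assert (r - Cmod (w - z) <= Cmod (s - w)).
  { apply on_sq_Cmod in Hs. assert (T := Cmod_triangle (s - w) (w - z)).
    replace (s - w + (w - z))%C with (s - z)%C in T by ring. lra. }
  split; auto. apply Cmod_gt_0. lra.
Qed.

Lemma CE_div_sub (f : C -> C) (s w : C) : (s - w)%C <> RtoC 0 -> CE f s -> CE (fun s => f s / (s - w))%C s.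
Proof.
  intros H Hf. apply CE_mult; auto. apply CE_inv_sub. intros ->. apply H. ring.
Qed.

Lemma CE_sub (s w : C) : CE (fun s => s - w)%C s.
Proof. apply CE_minus; [apply CE_id|apply CE_const]. Qed.

Lemma PI_gt_3 : 3 < PI.
Proof. assert (H := PI2_3_2). lra. Qed.

(** The exact identity [1/(s-w-h) = 1/(s-w) + h/(s-w)^2 + h^2/((s-w)^2 (s-w-h))] is multiplied by
    [f s] and integrated; Cauchy's formula evaluates the two integrals with a simple kernel. *)
Lemma kernel_expand1 (f : C -> C) (z w h : C) (r : R) :
  (forall s, in_sq z r s -> CE f s) -> Cmod (w - z) < r -> 2 * Cmod h <= r - Cmod (w - z) ->
  (two_pi_i * (f (w + h) - f w) - h * csq (fun s => f s / ((s - w) * (s - w))) z r)%C =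
  (h * h * csq (fun s => f s / ((s - w) * (s - w) * (s - (w + h)))) z r)%C.
Proof.
  intros Hf Hw Hh. assert (Hh0 := Cmod_ge_0 h). assert (Hw0 := Cmod_ge_0 (w - z)).
  assert (Hwh : Cmod (w + h - z) < r).
  { replace (w + h - z)%C with ((w - z) + h)%C by ring. eapply Rle_lt_trans; [apply Cmod_triangle|]. lra. }
  assert (N : forall s, on_sq z r s -> (s - w)%C <> RtoC 0 /\ (s - (w + h))%C <> RtoC 0).
  { intros s Hs. split; eapply sq_ne; eauto. }
  assert (F : forall s, on_sq z r s -> CE f s) by (intros s Hs; apply Hf, Hs).
  assert (E : csq (fun s => f s / (s - (w + h)))%C z r =
    (csq (fun s => f s / (s - w)) z r + (h * csq (fun s => f s / ((s - w) * (s - w))) z r +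
      csq (fun s => (h * h) * (f s / ((s - w) * (s - w) * (s - (w + h))))) z r))%C).
  { rewrite <- csq_lin3.
    - apply csq_ext; [lra|]. intros s Hs. destruct (N s Hs). field. auto.
    - lra.
    - intros s Hs. apply CE_div_sub; [apply N|]; auto.
    - intros s Hs. destruct (N s Hs). apply CE_mult; auto. apply CE_inv; [|apply Cmult_neq_0; auto].
      ce.
    - intros s Hs. destruct (N s Hs). ce. repeat apply Cmult_neq_0; auto. }
  rewrite cauchy_sq in E by auto. rewrite cauchy_sq in E by auto.
  assert (E2 : csq (fun s => (h * h) * (f s / ((s - w) * (s - w) * (s - (w + h)))))%C z r =
    (h * h * csq (fun s => f s / ((s - w) * (s - w) * (s - (w + h)))) z r)%C).
  { unfold csq. apply rect_scal, csq_int; [lra|]. intros s Hs. destruct (N s Hs). ce. repeat apply Cmult_neq_0; auto. }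
  rewrite <- E2.
  replace (two_pi_i * (f (w + h) - f w))%C with (two_pi_i * f (w + h) - two_pi_i * f w)%C by ring.
  rewrite E.
  ring.
Qed.

(** The boundary of the square has length [8 * r] and distance at least [e] from [w], at least
    [e / 2] from [w + h]. Division by [2 * PI] leaves [4 / PI] and [8 / PI], rounded up to 2 and 3.
    Both bounds are linear in [M], which is what later allows [M] to be a majorant to be integrated
    or a term to be summed. *)
Theorem cauchy_second_order (f : C -> C) (z w : C) (r M : R) :
  (forall s, in_sq z r s -> CE f s) -> (forall s, on_sq z r s -> Cmod (f s) <= M) -> Cmod (w - z) < r ->
  let l := (csq (fun s => f s / ((s - w) * (s - w))) z r / two_pi_i)%C in
  let e := r - Cmod (w - z) in
  CD f w l /\ Cmod l <= 2 * r * M / (e * e) /\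
  forall h, 2 * Cmod h <= e -> Cmod (f (w + h) - f w - l * h)%C <= 3 * r * M / (e * e * e) * Cmod h ^ 2.
Proof.
  intros Hf HM Hw l e.
  assert (Hw0 := Cmod_ge_0 (w - z)). assert (He : 0 < e) by (unfold e; lra).
  assert (Her : e <= r) by (unfold e; lra).
  assert (HPI := PI_gt_3).
  assert (HM0 : 0 <= M).
  { eapply Rle_trans; [apply Cmod_ge_0|apply (HM (Re z + r, Im z)%R)].
    apply on_sq_sides; lra. }
  assert (F : forall s, on_sq z r s -> CE f s) by (intros s Hs; apply Hf, Hs).
  assert (Hl : Cmod l <= 2 * r * M / (e * e)).
  { unfold l. rewrite Cmod_div, Cmod_two_pi_i by apply two_pi_i_neq_0.
    apply Rle_trans with ((8 * r * (M / (e * e))) / (2 * PI)).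
    - unfold Rdiv at 1 2. apply Rmult_le_compat_r; [apply Rlt_le, Rinv_0_lt_compat; lra|].
      apply csq_norm; [lra| |].
      + intros s Hs. destruct (sq_ne z w s r Hs Hw). ce. repeat apply Cmult_neq_0; auto.
      + intros s Hs. destruct (sq_ne z w s r Hs Hw) as [N1 N2]. fold e in N2.
        rewrite Cmod_div, Cmod_mult by (apply Cmult_neq_0; auto).
        apply div_le_of_ge; auto using Cmod_ge_0; nra.
    - replace (8 * r * (M / (e * e)) / (2 * PI)) with (2 * r * M / (e * e) * (2 / PI)) by (field; lra).
      rewrite <- (Rmult_1_r (2 * r * M / (e * e))) at 2. apply Rmult_le_compat_l.
      + apply Rmult_le_pos; [nra|]. apply Rlt_le, Rinv_0_lt_compat. nra.
      + apply Rmult_le_reg_r with PI; [lra|]. unfold Rdiv. rewrite Rmult_assoc, Rinv_l; lra. }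
  assert (Hh : forall h, 2 * Cmod h <= e -> Cmod (f (w + h) - f w - l * h)%C <= 3 * r * M / (e * e * e) * Cmod h ^ 2).
  { intros h Hh. assert (Hh0 := Cmod_ge_0 h).
    assert (E := kernel_expand1 f z w h r Hf Hw Hh).
    assert (Hwh : Cmod (w + h - z) < r).
    { replace (w + h - z)%C with ((w - z) + h)%C by ring. eapply Rle_lt_trans; [apply Cmod_triangle|]. unfold e in *; lra. }
    assert (NZ := two_pi_i_neq_0).
    replace (f (w + h) - f w - l * h)%C with
      ((two_pi_i * (f (w + h) - f w) - h * csq (fun s => f s / ((s - w) * (s - w))) z r) / two_pi_i)%C
      by (unfold l; field; auto).
    rewrite E, Cmod_div, Cmod_two_pi_i, !Cmod_mult by auto.
    apply Rle_trans with (Cmod h * Cmod h * (8 * r * (M / (e * e * (e / 2)))) / (2 * PI)).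
    - unfold Rdiv at 1 2. apply Rmult_le_compat_r; [apply Rlt_le, Rinv_0_lt_compat; lra|].
      apply Rmult_le_compat_l; [nra|].
      apply csq_norm; [lra| |].
      + intros s Hs. destruct (sq_ne z w s r Hs Hw). destruct (sq_ne z _ s r Hs Hwh). ce. repeat apply Cmult_neq_0; auto.
      + intros s Hs. destruct (sq_ne z w s r Hs Hw) as [N1 N2]. fold e in N2.
        destruct (sq_ne z _ s r Hs Hwh) as [N3 _].
        assert (N4 : e / 2 <= Cmod (s - (w + h))).
        { assert (T := Cmod_reverse (s - w) h). replace (s - w - h)%C with (s - (w + h))%C in T by ring. lra. }
        rewrite Cmod_div, !Cmod_mult by (repeat apply Cmult_neq_0; auto).
        apply div_le_of_ge; auto using Cmod_ge_0.
        * repeat apply Rmult_lt_0_compat; lra.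
        * apply Rmult_le_compat; nra.
    - replace (Cmod h * Cmod h * (8 * r * (M / (e * e * (e / 2)))) / (2 * PI)) with
        (3 * r * M / (e * e * e) * Cmod h ^ 2 * (8 / 3 / PI)) by (field; lra).
      rewrite <- (Rmult_1_r (3 * r * M / (e * e * e) * Cmod h ^ 2)) at 2. apply Rmult_le_compat_l.
      + apply Rmult_le_pos; [|apply pow2_ge_0]. apply Rmult_le_pos; [nra|].
        apply Rlt_le, Rinv_0_lt_compat. repeat apply Rmult_lt_0_compat; lra.
      + apply Rmult_le_reg_r with PI; [lra|]. unfold Rdiv. rewrite !Rmult_assoc, Rinv_l; lra. }
  split; [|split; auto].
  apply CD_quadratic with (3 * r * M / (e * e * e)) (e / 2); [lra|].
  intros v Hv. specialize (Hh (v - w)%C). replace (w + (v - w))%C with v in Hh by ring. apply Hh. lra.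
Qed.

Corollary cauchy_center (f : C -> C) (z l : C) (r M : R) : 0 < r ->
  (forall s, in_sq z r s -> CE f s) -> (forall s, on_sq z r s -> Cmod (f s) <= M) -> CD f z l ->
  Cmod l <= 2 * M / r /\
  forall h, 2 * Cmod h <= r -> Cmod (f (z + h) - f z - l * h)%C <= 3 * M / (r * r) * Cmod h ^ 2.
Proof.
  intros Hr Hf HM Hl.
  assert (Hz : Cmod (z - z) = 0) by (replace (z - z)%C with (RtoC 0) by ring; apply Cmod_0).
  destruct (cauchy_second_order f z z r M Hf HM ltac:(lra)) as [H1 [H2 H3]].
  rewrite <- (CD_unique _ _ _ _ Hl H1) in H2, H3. rewrite Hz in H2, H3. rewrite Rminus_0_r in H2, H3.
  replace (2 * r * M / (r * r)) with (2 * M / r) in H2 by (field; lra).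
  replace (3 * r * M / (r * r * r)) with (3 * M / (r * r)) in H3 by (field; lra). auto.
Qed.

(** A maximum principle with the factor [4 / PI], rounded up to 2, since a square takes the place of
    the circle. The factor is harmless where the bound is applied once to each quotient by an [n]-th
    power. *)
Theorem cauchy_max (f : C -> C) (z : C) (r M : R) : 0 < r ->
  (forall s, in_sq z r s -> CE f s) -> (forall s, on_sq z r s -> Cmod (f s) <= M) -> Cmod (f z) <= 2 * M.
Proof.
  intros Hr Hf HM. assert (HPI := PI_gt_3).
  assert (Hz : Cmod (z - z) < r) by (replace (z - z)%C with (RtoC 0) by ring; rewrite Cmod_0; auto).
  assert (E := cauchy_sq f z z r Hf Hz).
  assert (HM0 : 0 <= M).
  { eapply Rle_trans; [apply Cmod_ge_0|apply (HM (Re z + r, Im z)%R)]. apply on_sq_sides; lra. }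
  assert (B : Cmod (csq (fun s => f s / (s - z))%C z r) <= 8 * r * (M / r)).
  { apply csq_norm; [lra| |].
    - intros s Hs. destruct (sq_ne z z s r Hs Hz). apply CE_div_sub; auto. apply Hf, Hs.
    - intros s Hs. destruct (sq_ne z z s r Hs Hz) as [N1 N2]. rewrite Cmod_div by auto.
      apply div_le_of_ge; auto using Cmod_ge_0. apply on_sq_Cmod; auto. }
  rewrite E, Cmod_mult, Cmod_two_pi_i in B.
  replace (8 * r * (M / r)) with (8 * M) in B by (field; lra).
  assert (T := Cmod_ge_0 (f z)). nra.
Qed.

(** Cauchy's integral [P2] for the derivative is differentiated once more, with a remainder
    estimated by hand. Thus all iterates [C_derive_n] of a holomorphic function are again
    holomorphic. *)
Theorem CE_C_derive (f : C -> C) (z : C) (r : R) : 0 < r ->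
  (forall s, in_sq z r s -> CE f s) -> CE (C_derive f) z.
Proof.
  intros Hr Hf.
  assert (F : forall s, on_sq z r s -> CE f s) by (intros s Hs; apply Hf, Hs).
  destruct (csq_bounded f z r (Rlt_le _ _ Hr) F) as [M HM].
  assert (Hz : Cmod (z - z) < r) by (replace (z - z)%C with (RtoC 0) by ring; rewrite Cmod_0; auto).
  assert (HM0 : 0 <= M).
  { eapply Rle_trans; [apply Cmod_ge_0|apply (HM (Re z + r, Im z)%R)]. apply on_sq_sides; lra. }
  set (P2 := fun w => csq (fun s => f s / ((s - w) * (s - w)))%C z r).
  set (P3 := csq (fun s => f s / ((s - z) * (s - z) * (s - z)))%C z r).
  assert (D : CD P2 z (RtoC 2 * P3)%C).
  { apply CD_quadratic with (8 * r * (7 * r * M / (r * r * r * (r / 2 * (r / 2))))) (r / 2); [lra|].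
    intros w Hw. set (h := (w - z)%C) in *. assert (Hh0 := Cmod_ge_0 h).
    assert (Hwr : Cmod (w - z) < r) by (fold h; lra).
    assert (N : forall s, on_sq z r s -> (s - z)%C <> RtoC 0 /\ (s - w)%C <> RtoC 0).
    { intros s Hs. split; eapply sq_ne; eauto. }
    (* With [a = s - z] this integrates [1/(a-h)^2 = 1/a^2 + 2h/a^3 + h^2 (3a - 2h)/(a^3 (a-h)^2)].
       The numerator [3a - 2h] is at most [7 * r], from [|a| <= 2 * r] and [|h| <= r / 2]. *)
    assert (E : P2 w = (P2 z + ((RtoC 2 * h) * P3 +
       csq (fun s => (h * h) * (f s * (RtoC 3 * (s - z) - RtoC 2 * h) / ((s - z) * (s - z) * (s - z) * ((s - w) * (s - w))))) z r))%C).
    { unfold P2, P3. rewrite <- csq_lin3.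
      - apply csq_ext; [lra|]. intros s Hs. destruct (N s Hs). 
        replace h with (w - z)%C by reflexivity. field. auto.
      - lra.
      - intros s Hs. destruct (N s Hs). ce. repeat apply Cmult_neq_0; auto.
      - intros s Hs. destruct (N s Hs). ce. repeat apply Cmult_neq_0; auto.
      - intros s Hs. destruct (N s Hs). ce. repeat apply Cmult_neq_0; auto. }
    rewrite E.
    match goal with |- Cmod (?A + (?B + ?X) - ?A' - ?D) <= _ => replace (A + (B + X) - A' - D)%C with X by ring end.
    replace (8 * r * (7 * r * M / (r * r * r * (r / 2 * (r / 2)))) * Cmod h ^ 2) with
      (8 * r * (Cmod h ^ 2 * (7 * r * M / (r * r * r * (r / 2 * (r / 2)))))) by ring.
    apply csq_norm; [lra| |].
    - intros s Hs. destruct (N s Hs). ce. repeat apply Cmult_neq_0; auto.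
    - intros s Hs. destruct (N s Hs) as [N1 N2].
      rewrite Cmod_mult, Cmod_mult. replace (Cmod h * Cmod h) with (Cmod h ^ 2) by ring.
      apply Rmult_le_compat_l; [apply pow2_ge_0|].
      rewrite Cmod_div by (repeat apply Cmult_neq_0; auto). rewrite !Cmod_mult.
      assert (G1 := on_sq_Cmod _ _ _ Hs). assert (G2 := Cmod_in_sq z s r (proj1 Hs)).
      assert (G3 : r / 2 <= Cmod (s - w)).
      { assert (T := Cmod_reverse (s - z) h). replace (s - z - h)%C with (s - w)%C in T by (unfold h; ring). lra. }
      assert (G4 : Cmod (RtoC 3 * (s - z) - RtoC 2 * h) <= 7 * r).
      { eapply Rle_trans; [apply Cmod_triangle_minus|]. rewrite !Cmod_mult, !Cmod_R, !Rabs_pos_eq by lra. lra. }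
      apply div_le_of_ge.
      + apply Rmult_le_pos; apply Cmod_ge_0.
      + rewrite (Rmult_comm (7 * r)). apply Rmult_le_compat; auto using Cmod_ge_0.
      + repeat apply Rmult_lt_0_compat; lra.
      + assert (0 < r * r) by nra. repeat apply Rmult_le_compat; try lra; nra. }
  exists (RtoC 2 * P3 / two_pi_i)%C.
  apply (CD_ext_loc (fun w => (P2 w * / two_pi_i)%C)) with (d := r); auto.
  - intros w Hw. symmetry. apply is_C_derive_unique.
    apply (cauchy_second_order f z w r M Hf HM Hw).
  - eapply CD_eq; [|apply CD_mult; [exact D|apply CD_const]]. unfold Cdiv. ring.
Qed.

(** * The identity theorem along a segment *)

Lemma Rle_pow_0 (x M q : R) : 0 <= q < 1 -> (forall n : nat, x <= M * q ^ n) -> x <= 0.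
Proof.
  intros Hq H. apply le_epsilon. intros eps Heps.
  destruct (pow_lt_1_zero q ltac:(rewrite Rabs_pos_eq; lra) (eps / (Rabs M + 1))) as [n Hn].
  { apply Rdiv_lt_0_compat; auto. assert (T := Rabs_pos M). lra. }
  specialize (Hn n (le_n n)). specialize (H n).
  assert (P := pow_le q n (proj1 Hq)). rewrite Rabs_pos_eq in Hn by auto.
  assert (T := Rabs_pos M). assert (T' := Rle_abs M).
  apply Rmult_lt_compat_l with (r := Rabs M + 1) in Hn; [|lra].
  replace ((Rabs M + 1) * (eps / (Rabs M + 1))) with eps in Hn by (field; lra). nra.
Qed.

(* Near a zero of infinite order the quotients f / (s - z0)^n stay holomorphic,
   so the maximum principle on a square around z gives |f z| <= 2 M / 3^n. *)
Lemma identity_local (f : C -> C) (z0 : C) (r dl : R) : 0 < r -> 0 < dl ->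
  (forall s, in_sq z0 r s -> CE f s) -> (forall w, Cmod (w - z0) < dl -> f w = RtoC 0) ->
  forall z, Cmod (z - z0) <= r / 8 -> f z = RtoC 0.
Proof.
  intros Hr Hdl Hf H0 z Hz.
  destruct (Ceq_dec z z0) as [->|Nz].
  { apply H0. replace (z0 - z0)%C with (RtoC 0) by ring. rewrite Cmod_0; auto. }
  assert (Nz' : (z - z0)%C <> RtoC 0) by (apply Cminus_eq_contra; auto).
  assert (Pz := proj1 (Cmod_gt_0 _) Nz').
  assert (Hsub : forall s, in_sq z (r / 2) s -> in_sq z0 r s).
  { intros s [H1 H2]. apply in_sq_Cmod in Hz. destruct Hz as [H3 H4].
    apply Rabs_le_between in H1, H2, H3, H4. split; apply Rabs_le; lra. }
  destruct (csq_bounded f z (r / 2)) as [M HM]; [lra|intros w Hw; apply Hf, Hsub, Hw|].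
  assert (HM0 : 0 <= M).
  { eapply Rle_trans; [apply Cmod_ge_0|apply (HM (Re z + r / 2, Im z)%R)]. apply on_sq_sides; lra. }
  apply Cmod_eq_0, Rle_antisym; [|apply Cmod_ge_0].
  apply Rle_pow_0 with (2 * M) (1 / 3); [lra|]. intros n.
  assert (B : Cmod (f z / (z - z0) ^ n) <= 2 * (M / (3 * r / 8) ^ n)).
  { apply (cauchy_max (fun s => f s / (s - z0) ^ n)%C z (r / 2)); [lra| |].
    - intros s Hs. destruct (Ceq_dec s z0) as [->|Ns].
      (* At [z0] the denominator may vanish, but [f] is 0 on a whole disc, so the quotient is
         locally the zero function whatever value the inverse of 0 has. *)
      + exists (RtoC 0). apply (CD_ext_loc (fun _ => RtoC 0)) with dl; auto.
        * intros w Hw. rewrite H0 by auto. unfold Cdiv. ring.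
        * apply CD_const.
      + assert (Ns' : (s - z0)%C <> RtoC 0) by (apply Cminus_eq_contra; auto).
        apply CE_div; [apply Hf; auto| |apply Cpow_nz; auto].
        ce.
    - intros s Hs. assert (G := on_sq_Cmod _ _ _ Hs).
      (* The half side [r / 2] around [z] less the distance from [z] to [z0], which is at most
         [r / 8]. The ratio of [r / 8] to [3 * r / 8] is the [1 / 3] whose powers tend to 0. *)
      assert (G2 : 3 * r / 8 <= Cmod (s - z0)).
      { assert (T := Cmod_triangle (s - z0) (z0 - z)). replace (s - z0 + (z0 - z))%C with (s - z)%C in T by ring.
        rewrite (Cmod_minus_sym z0) in T. lra. }
      assert (Ns' : (s - z0)%C <> RtoC 0) by (apply Cmod_gt_0; lra).
      rewrite Cmod_div, Cmod_pow by (apply Cpow_nz; auto).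
      apply div_le_of_ge; auto using Cmod_ge_0; [apply pow_lt; lra|].
      apply pow_incr; lra. }
  rewrite Cmod_div, Cmod_pow in B by (apply Cpow_nz; auto).
  assert (Pn : 0 < Cmod (z - z0) ^ n) by (apply pow_lt; auto).
  apply Rmult_le_compat_r with (r := Cmod (z - z0) ^ n) in B; [|lra].
  unfold Rdiv at 1 in B. rewrite Rmult_assoc, Rinv_l, Rmult_1_r in B by lra.
  eapply Rle_trans; [exact B|].
  assert (P3 : 0 < (3 * r / 8) ^ n) by (apply pow_lt; lra).
  assert (E : (r / 8) ^ n = (1 / 3) ^ n * (3 * r / 8) ^ n).
  { rewrite <- Rpow_mult_distr. f_equal. field. }
  apply Rle_trans with (2 * (M / (3 * r / 8) ^ n) * (r / 8) ^ n).
  - apply Rmult_le_compat_l.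
    + apply Rmult_le_pos; [lra|]. apply Rmult_le_pos; [auto|]. apply Rlt_le, Rinv_0_lt_compat; auto.
    + apply pow_incr; lra.
  - rewrite E. right. field. lra.
Qed.

(** The radius [r] is uniform along the segment, so finitely many steps of length at most [r / 16]
    reach [b]. Each step passes on the vanishing to a disc of radius [r / 16] around the next point,
    which lies within [r / 8] of the previous one. *)
Lemma identity_segment (f : C -> C) (a b : C) (r dl : R) : 0 < r -> 0 < dl ->
  (forall t s, 0 <= t <= 1 -> in_sq (a + RtoC t * (b - a))%C r s -> CE f s) ->
  (forall w, Cmod (w - a) < dl -> f w = RtoC 0) ->
  exists dl', 0 < dl' /\ forall w, Cmod (w - b) < dl' -> f w = RtoC 0.
Proof.
  intros Hr Hdl Hf H0.
  assert (Hab := Cmod_ge_0 (b - a)).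
  destruct (nfloor_ex (Cmod (b - a) / (r / 16))) as [N [_ HN]].
  { apply Rmult_le_pos; auto. apply Rlt_le, Rinv_0_lt_compat; lra. }
  set (n := S N). assert (Hn : 0 < INR n) by (apply lt_0_INR; unfold n; lia).
  assert (Hstep : Cmod (b - a) / INR n <= r / 16).
  { unfold n in *. rewrite S_INR in *. apply Rmult_le_reg_r with (INR N + 1); [lra|].
    unfold Rdiv at 1. rewrite Rmult_assoc, Rinv_l, Rmult_1_r by lra.
    apply Rmult_lt_compat_r with (r := r / 16) in HN; [|lra].
    unfold Rdiv at 1 in HN. rewrite Rmult_assoc, Rinv_l, Rmult_1_r in HN by lra. lra. }
  set (p := fun k : nat => (a + RtoC (INR k / INR n) * (b - a))%C).
  assert (K : forall k : nat, (k <= n)%nat -> exists dl', 0 < dl' /\ forall w, Cmod (w - p k) < dl' -> f w = RtoC 0).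
  { induction k as [|k IH]; intros Hk.
    - exists dl. split; auto. intros w Hw. apply H0.
      assert (E : p 0%nat = a).
      { unfold p. change (INR 0) with 0. replace (0 / INR n) with 0 by (field; lra). ring. }
      rewrite <- E. exact Hw.
    - destruct (IH ltac:(lia)) as [d [Hd H1]].
      exists (r / 16). split; [lra|]. intros w Hw.
      apply (identity_local f (p k) r d); auto.
      + intros s. apply Hf. split.
        * apply Rmult_le_pos; [apply pos_INR|]. apply Rlt_le, Rinv_0_lt_compat; auto.
        * apply Rmult_le_reg_r with (INR n); auto. unfold Rdiv. rewrite Rmult_assoc, Rinv_l by lra.
          rewrite Rmult_1_r, Rmult_1_l. apply le_INR. lia.
      + assert (E : (p (S k) - p k)%C = (RtoC (/ INR n) * (b - a))%C).
        { unfold p. rewrite S_INR. replace ((INR k + 1) / INR n) with (INR k / INR n + / INR n) by (field; lra).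
          rewrite RtoC_plus. ring. }
        assert (E' : Cmod (p (S k) - p k) <= r / 16).
        { rewrite E, Cmod_mult, Cmod_R, Rabs_pos_eq by (apply Rlt_le, Rinv_0_lt_compat; auto).
          rewrite Rmult_comm. exact Hstep. }
        assert (T := Cmod_triangle (w - p (S k)) (p (S k) - p k)).
        replace (w - p (S k) + (p (S k) - p k))%C with (w - p k)%C in T by ring. lra. }
  destruct (K n (le_n n)) as [d [Hd H1]]. exists d. split; auto. intros w Hw. apply H1.
  unfold p. replace (INR n / INR n) with 1 by (field; lra).
  replace (a + RtoC 1 * (b - a))%C with b by ring. exact Hw.
Qed.

(** * Integrals depending holomorphically on a parameter *)

(* psi is an integrable majorant on E, given with a primitive Psi having the
   limits la and lb along the two filters, so that its integral is lb - la. *)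
Record majorant (Fa Fb : (R -> Prop) -> Prop) (E : R -> Prop) (Psi psi : R -> R) (la lb : R) : Prop := {
  maj_conv : forall x y t, E x -> E y -> x <= t <= y -> E t;
  maj_a : Fa E;
  maj_b : Fb E;
  maj_le : filter_prod Fa Fb (fun ab => fst ab <= snd ab);
  maj_der : forall x, E x -> is_derive Psi x (psi x);
  maj_cont : forall x, E x -> continuous psi x;
  maj_la : filterlim Psi Fa (locally la);
  maj_lb : filterlim Psi Fb (locally lb)
}.

Lemma filterlim_eps (Psi : R -> R) (F : (R -> Prop) -> Prop) (l eps : R) :
  filterlim Psi F (locally l) -> 0 < eps -> F (fun x => Rabs (Psi x - l) < eps).
Proof.
  intros H Heps. apply (H (fun y => Rabs (y - l) < eps)). exists (mkposreal eps Heps). auto.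
Qed.

Section Majorant.
Context (Fa Fb : (R -> Prop) -> Prop) {FFa : ProperFilter Fa} {FFb : ProperFilter Fb}.
Context (E : R -> Prop) (Psi psi : R -> R) (la lb : R).
Context (HM : majorant Fa Fb E Psi psi la lb).

Lemma maj_ex (phi : R -> C) (x y : R) : (forall t, E t -> Ccont phi t) -> E x -> E y -> ex_CInt phi x y.
Proof.
  intros Hc Hx Hy. apply (ex_RInt_continuous (V := C_R_CompleteNormedModule)).
  intros t Ht. apply Hc. unfold Rmin, Rmax in Ht. destruct (Rle_dec x y).
  - apply (maj_conv _ _ _ _ _ _ _ HM x y); auto.
  - apply (maj_conv _ _ _ _ _ _ _ HM y x); auto.
Qed.

Lemma maj_seg (phi : R -> C) (x y : R) : (forall t, E t -> Ccont phi t) ->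
  (forall t, E t -> Cmod (phi t) <= psi t) -> E x -> E y -> x <= y ->
  Cmod (CInt phi x y) <= Psi y - Psi x.
Proof.
  intros Hc Hb Hx Hy Hxy. rewrite Cmod_norm.
  assert (HE : forall t, x <= t <= y -> E t) by (intros; apply (maj_conv _ _ _ _ _ _ _ HM x y); auto).
  apply (norm_RInt_le (V := C_R_NormedModule) phi psi x y); auto.
  - intros t Ht. rewrite <- Cmod_norm. auto.
  - apply CInt_correct, maj_ex; auto.
  - apply (is_RInt_derive (V := R_CompleteNormedModule) Psi); rewrite Rmin_left, Rmax_right by lra; intros t Ht;
    apply HM; auto.
Qed.

Lemma maj_seg_abs (phi : R -> C) (x y : R) : (forall t, E t -> Ccont phi t) ->
  (forall t, E t -> Cmod (phi t) <= psi t) -> E x -> E y ->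
  Cmod (CInt phi x y) <= Rabs (Psi y - Psi x).
Proof.
  intros Hc Hb Hx Hy. destruct (Rle_dec x y) as [H|H].
  - eapply Rle_trans; [apply maj_seg; auto|apply Rle_abs].
  - assert (O := opp_RInt_swap (V := C_R_CompleteNormedModule) phi y x ltac:(apply maj_ex; auto)).
    rewrite <- O. change (Cmod (- CInt phi y x) <= Rabs (Psi y - Psi x)).
    rewrite Cmod_opp, Rabs_minus_sym. eapply Rle_trans; [apply maj_seg; auto; lra|apply Rle_abs].
Qed.

(** Cauchy's criterion on the product filter: a change of endpoints alters the integral by at most
    increments of [Psi], and [Psi] converges at both ends. Working with abstract filters treats
    lines, half lines and segments at once. *)
Theorem maj_integrable (phi : R -> C) : (forall t, E t -> Ccont phi t) ->
  (forall t, E t -> Cmod (phi t) <= psi t) -> exists I, is_CInt_gen phi Fa Fb I.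
Proof.
  intros Hc Hb.
  apply (filterlimi_locally_cauchy (U := C_R_CompleteNormedModule) (F := filter_prod Fa Fb) (FF := filter_prod_proper)
    (fun ab => is_CInt phi (fst ab) (snd ab))).
  - exists E E; [apply HM|apply HM|]. intros x y Hx Hy. simpl. split.
    + exists (CInt phi x y). apply CInt_correct, maj_ex; auto.
    + intros y1 y2 H1 H2. apply CInt_unique in H1, H2. congruence.
  - intros [eps Heps].
    exists (fun ab => (E (fst ab) /\ Rabs (Psi (fst ab) - la) < eps / 4) /\ (E (snd ab) /\ Rabs (Psi (snd ab) - lb) < eps / 4)).
    split.
    + exists (fun x => E x /\ Rabs (Psi x - la) < eps / 4) (fun x => E x /\ Rabs (Psi x - lb) < eps / 4); auto.
      * apply filter_and; [apply HM|]. apply filterlim_eps; [apply HM|lra].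
      * apply filter_and; [apply HM|]. apply filterlim_eps; [apply HM|lra].
    + intros [a b] [a' b'] [[A1 A2] [A3 A4]] [[B1 B2] [B3 B4]] I I' HI HI'. simpl in *.
      apply (norm_compat1 (V := C_R_NormedModule)).
      rewrite <- Cmod_norm. change (Cmod (I' - I) < eps). apply CInt_unique in HI, HI'. subst I I'.
      rewrite <- (CInt_Chasles phi a a' b) by (apply maj_ex; auto).
      rewrite <- (CInt_Chasles phi a' b b') by (apply maj_ex; auto).
      match goal with |- Cmod (?X + ?Y - (?Z + ?X)) < _ => replace (X + Y - (Z + X))%C with (Y - Z)%C by ring end.
      eapply Rle_lt_trans; [apply Cmod_triangle_minus|].
      eapply Rle_lt_trans; [apply Rplus_le_compat; apply maj_seg_abs; auto|].
      apply Rabs_lt_between in A2, A4, B2, B4.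
      assert (Rabs (Psi b' - Psi b) < eps / 2) by (apply Rabs_lt_between; lra).
      assert (Rabs (Psi a' - Psi a) < eps / 2) by (apply Rabs_lt_between; lra). lra.
Qed.

Theorem maj_norm (phi : R -> C) (I : C) : (forall t, E t -> Ccont phi t) ->
  (forall t, E t -> Cmod (phi t) <= psi t) -> is_CInt_gen phi Fa Fb I -> Cmod I <= lb - la.
Proof.
  intros Hc Hb HI. apply le_epsilon. intros eps Heps.
  assert (FP := filter_prod_proper (F := Fa) (G := Fb)).
  assert (P1 := proj1 (is_CInt_gen_eps phi Fa Fb I) HI (eps / 4) ltac:(lra)).
  assert (P2 : filter_prod Fa Fb (fun ab => (E (fst ab) /\ Rabs (Psi (fst ab) - la) < eps / 4) /\ (E (snd ab) /\ Rabs (Psi (snd ab) - lb) < eps / 4))).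
  { exists (fun x => E x /\ Rabs (Psi x - la) < eps / 4) (fun x => E x /\ Rabs (Psi x - lb) < eps / 4); auto.
      * apply filter_and; [apply HM|]. apply filterlim_eps; [apply HM|lra].
      * apply filter_and; [apply HM|]. apply filterlim_eps; [apply HM|lra]. }
  destruct (filter_ex _ (filter_and _ _ P1 (filter_and _ _ P2 (maj_le _ _ _ _ _ _ _ HM))))
    as [[a b] [[J [HJ1 HJ2]] [[[A1 A2] [A3 A4]] A5]]]. simpl in *.
  apply CInt_unique in HJ1. subst J.
  assert (S := maj_seg phi a b Hc Hb A1 A3 A5).
  assert (T := Cmod_reverse I (CInt phi a b)). rewrite Cmod_minus_sym in T.
  apply Rabs_lt_between in A2, A4. lra.
Qed.

(** Cauchy's estimates on the square of half side [r] bound [DK x] by [2 * psi x / r] and the second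
    order remainder of [K x] by a multiple of [psi x * |h|^2]. The first makes [DK] integrable, the
    second integrates to a quadratic remainder for [I]. *)
Theorem hol_param (K : R -> C -> C) (DK : R -> C) (I : C -> C) (z0 : C) (r : R) : 0 < r ->
  (forall x z, E x -> in_sq z0 r z -> CE (K x) z) ->
  (forall x z, E x -> in_sq z0 r z -> Cmod (K x z) <= psi x) ->
  (forall x z, E x -> in_sq z0 r z -> Ccont (fun x => K x z) x) ->
  (forall x, E x -> CD (K x) z0 (DK x)) -> (forall x, E x -> Ccont DK x) ->
  (forall z, in_sq z0 r z -> is_CInt_gen (fun x => K x z) Fa Fb (I z)) ->
  exists l, is_CInt_gen DK Fa Fb l /\ CD I z0 l.
Proof.
  intros Hr H1 H2 H3 H4 H5 H6.
  assert (Hz0 : in_sq z0 r z0) by (apply in_sq_Cmod; replace (z0 - z0)%C with (RtoC 0) by ring; rewrite Cmod_0; lra).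
  assert (B : forall x, E x -> Cmod (DK x) <= 2 * psi x / r /\ forall h, 2 * Cmod h <= r ->
    Cmod (K x (z0 + h) - K x z0 - DK x * h)%C <= 3 * psi x / (r * r) * Cmod h ^ 2).
  { intros x Hx. apply cauchy_center; auto. intros s Hs. apply H2; auto. apply Hs. }
  assert (exists l, is_CInt_gen DK Fa Fb l) as [l Hl].
  { destruct (maj_integrable (fun x => RtoC (r / 2) * DK x)%C) as [l Hl].
    - intros t Ht. apply Ccont_mult; [apply Ccont_const|auto].
    - intros t Ht. rewrite Cmod_mult, Cmod_R, Rabs_pos_eq by lra.
      destruct (B t Ht) as [B1 _].
      apply Rmult_le_compat_l with (r := r / 2) in B1; [|lra].
      replace (r / 2 * (2 * psi t / r)) with (psi t) in B1 by (field; lra). exact B1.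
    - exists (RtoC (2 / r) * l)%C.
      apply (is_RInt_gen_ext (V := C_R_NormedModule) (fun x => RtoC (2 / r) * (RtoC (r / 2) * DK x))%C).
      + apply filter_forall. intros ab x _. rewrite Cmult_assoc, <- RtoC_mult.
        replace (2 / r * (r / 2)) with 1 by (field; lra). apply Cmult_1_l.
      + apply is_CInt_gen_scal; auto; typeclasses eauto. }
  exists l. split; auto.
  apply CD_quadratic with (3 / (r * r) * (lb - la)) (r / 2); [lra|].
  intros w Hw. set (h := (w - z0)%C) in *.
  assert (Hw' : in_sq z0 r w) by (apply in_sq_Cmod; fold h; lra).
  assert (Iw := H6 w Hw'). assert (Iz := H6 z0 Hz0).
  (* The scalar brings the remainder below [psi] itself, so that [maj_norm] applies with the
     majorant already at hand. It has no meaning at [h = 0], a case settled separately. *)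
  assert (J : is_CInt_gen (fun x => RtoC (r * r / (3 * (Cmod h ^ 2 + 0))) * (K x w - K x z0 - h * DK x))%C Fa Fb
     (RtoC (r * r / (3 * (Cmod h ^ 2 + 0))) * (I w - I z0 - h * l))%C).
  { apply is_CInt_gen_scal; try typeclasses eauto.
    apply (is_RInt_gen_minus (V := C_R_NormedModule) (fun x => K x w - K x z0)%C (fun x => h * DK x)%C).
    - apply (is_RInt_gen_minus (V := C_R_NormedModule) (fun x => K x w) (fun x => K x z0)); auto.
    - apply is_CInt_gen_scal; auto; typeclasses eauto. }
  replace (l * h)%C with (h * l)%C by ring.
  destruct (Req_dec (Cmod h) 0) as [Z|Z].
  { apply Cmod_eq_0 in Z. replace w with z0.
    - rewrite Z, Cmod_0. replace (I z0 - I z0 - 0 * l)%C with (RtoC 0) by ring. rewrite Cmod_0. simpl. lra.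
    - replace z0 with (w - h)%C by (unfold h; ring). rewrite Z. ring. }
  assert (Ph : 0 < Cmod h ^ 2).
  { assert (T := Cmod_ge_0 h). apply pow_lt. lra. }
  rewrite Rplus_0_r in J.
  assert (Pc : 0 < r * r / (3 * Cmod h ^ 2)) by (apply Rdiv_lt_0_compat; nra).
  apply maj_norm in J.
  - rewrite Cmod_mult, Cmod_R, Rabs_pos_eq in J by lra.
    apply Rmult_le_compat_l with (r := 3 * Cmod h ^ 2 / (r * r)) in J.
    + rewrite <- Rmult_assoc in J.
      replace (3 * Cmod h ^ 2 / (r * r) * (r * r / (3 * Cmod h ^ 2))) with 1 in J by (field; split; lra).
      rewrite Rmult_1_l in J. eapply Rle_trans; [exact J|]. right. field. lra.
    + apply Rlt_le, Rdiv_lt_0_compat; nra.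
  - intros t Ht. apply Ccont_mult; [apply Ccont_const|]. apply Ccont_minus; [apply Ccont_minus; auto|].
    apply Ccont_mult; [apply Ccont_const|auto].
  - intros t Ht. rewrite Cmod_mult, Cmod_R, Rabs_pos_eq by lra.
    destruct (B t Ht) as [_ B2]. specialize (B2 h ltac:(lra)).
    replace (z0 + h)%C with w in B2 by (unfold h; ring).
    replace (h * DK t)%C with (DK t * h)%C by ring.
    apply Rmult_le_compat_l with (r := r * r / (3 * Cmod h ^ 2)) in B2; [|lra].
    eapply Rle_trans; [exact B2|]. right. field. split; lra.
Qed.
End Majorant.

Lemma majorant_segment (a b M : R) : a <= b ->
  majorant (at_point a) (at_point b) (fun x => a <= x <= b) (fun x => M * x) (fun _ => M) (M * a) (M * b).
Proof.
  intros Hab. constructor.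
  - intros; lra.
  - unfold at_point. lra.
  - unfold at_point. lra.
  - exists (fun x => x = a) (fun x => x = b); try reflexivity. simpl. intros x y -> ->. auto.
  - intros x _. auto_derive; auto. ring.
  - intros x _. apply continuous_const.
  - intros P HP. apply locally_singleton in HP. exact HP.
  - intros P HP. apply locally_singleton in HP. exact HP.
Qed.

Lemma majorant_left (r c M : R) : 0 < c ->
  majorant (Rbar_locally m_infty) (at_point r) (fun x => x <= r) (fun x => M * exp (c * x) / c) (fun x => M * exp (c * x))
    0 (M * exp (c * r) / c).
Proof.
  intros Hc. constructor.
  - intros; lra.
  - exists r. intros; lra.
  - unfold at_point. lra.
  - exists (fun x => x < r) (fun x => x = r).
    + exists r. auto.
    + reflexivity.
    + simpl. intros x y H ->. lra.
  - intros x _. auto_derive; auto. field. lra.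
  - intros x _. apply (ex_derive_continuous (V := R_NormedModule)). auto_derive; auto.
  - assert (L : is_lim (fun x => M / c * exp (c * x)) m_infty (Rbar_mult (M / c) 0)).
    { apply is_lim_scal_l. apply is_lim_comp with (l := m_infty).
      - apply is_lim_exp_m.
      - assert (L := is_lim_scal_l (fun x => x) c m_infty m_infty (is_lim_id _)).
        replace (Rbar_mult c m_infty) with m_infty in L; [exact L|].
        simpl. destruct (Rle_dec 0 c) as [H|H]; [|lra]. destruct (Rle_lt_or_eq_dec 0 c H); [reflexivity|lra].
      - exists 0. discriminate. }
    simpl in L. rewrite Rmult_0_r in L.
    eapply filterlim_ext; [|exact L]. intros x. simpl. field. lra.
  - intros P HP. apply locally_singleton in HP. exact HP.
Qed.

(** The shape of [|kap|] along a horizontal line: [exp x] is the derivative of the inner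
    exponential, so there is an elementary primitive, and the total mass is [M / q]. *)
Lemma majorant_line (q M : R) : 0 < q ->
  majorant (Rbar_locally m_infty) (Rbar_locally p_infty) (fun _ => True)
    (fun x => M * - exp (- q * exp x) / q) (fun x => M * (exp x * exp (- q * exp x))) (- M / q) 0.
Proof.
  intros Hq. constructor; auto.
  - exists 0. auto.
  - exists 0. auto.
  - exists (fun x => x < 0) (fun x => 0 < x).
    + exists 0. auto.
    + exists 0. auto.
    + simpl. intros; lra.
  - intros x _. auto_derive; auto. field. lra.
  - intros x _. apply (ex_derive_continuous (V := R_NormedModule)). auto_derive; auto.
  - assert (L : is_lim (fun x => - M / q * exp (- q * exp x)) m_infty (Rbar_mult (- M / q) (exp (- q * 0)))).
    { apply is_lim_scal_l. apply (is_lim_comp_continuous exp (fun y => exp (- q * y))).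
      - apply is_lim_exp_m.
      - apply (ex_derive_continuous (V := R_NormedModule)). auto_derive; auto. }
    simpl in L. rewrite Rmult_0_r, exp_0, Rmult_1_r in L.
    eapply filterlim_ext; [|exact L]. intros x. simpl. field. lra.
  - assert (L : is_lim (fun x => - M / q * exp (- q * exp x)) p_infty (Rbar_mult (- M / q) 0)).
    { apply is_lim_scal_l. apply is_lim_comp with (l := m_infty).
      - apply is_lim_exp_m.
      - assert (L := is_lim_scal_l exp (- q) p_infty p_infty is_lim_exp_p).
        replace (Rbar_mult (- q) p_infty) with m_infty in L; [exact L|].
        simpl. destruct (Rle_dec 0 (- q)) as [H|H]; [exfalso; lra|]. reflexivity.
      - exists 0. discriminate. }
    simpl in L. rewrite Rmult_0_r in L.
    eapply filterlim_ext; [|exact L]. intros x. simpl. field. lra.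
Qed.

(** * The Laplace kernel and the Gamma function in logarithmic coordinates *)

(* For z = exp (p zeta + i theta) and u = exp (p w + i theta) with m p = 1,
   m z^-m exp (-(u/z)^m) u^(m-1) du = kap (w - zeta) dw. *)
Definition kap (w : C) : C := Cexp (w - Cexp w).

Local Notation is_line phi I := (is_CInt_gen phi (Rbar_locally m_infty) (Rbar_locally p_infty) I).

Lemma Re_Cexp (w : C) : Re (Cexp w) = exp (Re w) * cos (Im w).
Proof. reflexivity. Qed.

Lemma Cmod_kap (w : C) : Cmod (kap w) = exp (Re w - exp (Re w) * cos (Im w)).
Proof. unfold kap. rewrite Cmod_Cexp, Re_minus, Re_Cexp. reflexivity. Qed.

Lemma CE_kap (w : C) : CE kap w.
Proof. unfold kap. ce. Qed.

(** One term of the exponential series against its sum. The factorials of all Gevrey bounds from 2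
    to 1 originate here, both those of the Laplace transform and those of the derivatives. *)
Lemma pow_le_fact_exp (n : nat) (y : R) : 0 <= y -> y ^ n <= INR (fact n) * exp y.
Proof.
  revert y. induction n as [|n IH]; intros y Hy.
  - simpl. assert (T := exp_ineq1_le y). lra.
  - assert (D : forall t, is_derive (fun t => INR (fact (S n)) * exp t - t ^ S n) t
      (INR (S n) * (INR (fact n) * exp t - t ^ n))).
    { intros t. rewrite fact_simpl, mult_INR. auto_derive; auto.
      change (Nat.pred (S n)) with n. change (match n with 0%nat => 1 | S _ => INR n + 1 end) with (INR (S n)). ring. }
    destruct (MVT_gen (fun t => INR (fact (S n)) * exp t - t ^ S n) 0 y
      (fun t => INR (S n) * (INR (fact n) * exp t - t ^ n))) as [c [Hc E]].
    + intros t _. apply D.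
    + intros t _. apply continuity_pt_filterlim.
      exact (ex_derive_continuous (V := R_NormedModule) _ t (ex_intro _ _ (D t))).
    + rewrite Rmin_left, Rmax_right in Hc by lra. specialize (IH c ltac:(lra)).
      rewrite exp_0, pow_ne_zero in E by lia.
      assert (P := pos_INR (S n)). assert (P' := pos_INR (fact (S n))).
      assert (0 <= INR (S n) * (INR (fact n) * exp c - c ^ n) * (y - 0)) by (repeat apply Rmult_le_pos; lra).
      lra.
Qed.

Lemma fact_le_pow (n : nat) : INR (fact n) <= (INR n + 1) ^ n.
Proof.
  induction n as [|n IH]; [simpl; lra|].
  rewrite fact_simpl, mult_INR, S_INR. assert (P := pos_INR n). simpl.
  apply Rmult_le_compat; try lra; [apply pos_INR|].
  eapply Rle_trans; [exact IH|]. apply pow_incr. lra.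
Qed.

Lemma INR_fact_pos (n : nat) : 0 < INR (fact n).
Proof. apply lt_0_INR, lt_O_fact. Qed.

Lemma Rpower_pow_exp (n : nat) (p y : R) : exp (INR n * p * y) = Rpower (exp y ^ n) p.
Proof.
  rewrite <- Rpower_pow by apply exp_pos. unfold Rpower. rewrite !ln_exp. f_equal. ring.
Qed.

Lemma Rpower_le_l (a b p : R) : 0 <= p -> 0 < a -> a <= b -> Rpower a p <= Rpower b p.
Proof. intros. apply Rle_Rpower_l; lra. Qed.

Lemma Rpower_pow_comm (a p : R) (n : nat) : 0 < a -> Rpower (a ^ n) p = Rpower a p ^ n.
Proof.
  intros Ha. rewrite <- Rpower_pow by auto. rewrite <- (Rpower_pow n (Rpower a p)) by apply exp_pos.
  rewrite !Rpower_mult. f_equal. ring.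
Qed.

(* (y/k)^n / n! <= exp (y/k) with y = e^x, k = 2 p / q, raised to the power p *)
Lemma exp_np_bound (n : nat) (p q x : R) : 0 < p -> 0 < q ->
  exp (INR n * p * x) <= Rpower (INR (fact n)) p * Rpower (2 * p / q) p ^ n * exp (q / 2 * exp x).
Proof.
  intros Hp Hq. assert (Hk : 0 < 2 * p / q) by (apply Rdiv_lt_0_compat; lra).
  assert (F := INR_fact_pos n). assert (X := exp_pos x).
  rewrite Rpower_pow_exp.
  assert (B : exp x ^ n <= INR (fact n) * (2 * p / q) ^ n * exp (exp x / (2 * p / q))).
  { assert (B := pow_le_fact_exp n (exp x / (2 * p / q)) ltac:(apply Rlt_le, Rdiv_lt_0_compat; lra)).
    assert (P := pow_lt (2 * p / q) n Hk).
    apply Rmult_le_compat_r with (r := (2 * p / q) ^ n) in B; [|lra].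
    rewrite <- Rpow_mult_distr in B.
    replace (exp x / (2 * p / q) * (2 * p / q)) with (exp x) in B by (field; lra). lra. }
  eapply Rle_trans; [apply Rpower_le_l; [lra|apply pow_lt; auto|exact B]|].
  rewrite <- !Rpower_mult_distr by (repeat apply Rmult_lt_0_compat; try apply exp_pos; try apply pow_lt; auto).
  rewrite Rpower_pow_comm by auto. right. f_equal.
  unfold Rpower. rewrite ln_exp. f_equal. field. lra.
Qed.

Lemma is_CInt_gen_R (f : R -> R) (Fa Fb : (R -> Prop) -> Prop) {FFa : Filter Fa} {FFb : Filter Fb} (I : C) :
  is_CInt_gen (fun x => RtoC (f x)) Fa Fb I -> is_RInt_gen (V := R_NormedModule) f Fa Fb (Re I).
Proof.
  intros H P [[eps Heps] HP]. 
  assert (H1 := proj1 (is_CInt_gen_eps _ Fa Fb I) H eps Heps).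
  unfold filtermapi. eapply (filter_imp (F := filter_prod Fa Fb)); [|exact H1].
  intros ab [J [HJ1 HJ2]]. exists (Re J). split.
  - exact (is_RInt_fct_extend_fst (U := R_NormedModule) (V := R_NormedModule) _ _ _ _ HJ1).
  - apply HP. change (Rabs (Re J - Re I) < eps). rewrite <- Re_minus.
    eapply Rle_lt_trans; [apply re_le_Cmod|exact HJ2].
Qed.

(** The substitution [t = exp (p * y)], through which integrals over [(0, oo)] in the definitions
    are reached from integrals over a line: [p = 1] for [Gamma], [p = s - 1] for the Laplace
    transform along a ray. *)
Lemma is_CInt_gen_exp_subst (phi : R -> C) (p : R) (I : C) : 0 < p ->
  (forall x, 0 < x -> Ccont phi x) ->
  is_line (fun y => RtoC (p * exp (p * y)) * phi (exp (p * y)))%C I ->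
  is_CInt_gen phi (at_right 0) (Rbar_locally p_infty) I.
Proof.
  intros Hp Hc H.
  apply is_CInt_gen_eps; try typeclasses eauto. intros eps Heps.
  destruct (proj1 (is_CInt_gen_eps _ _ _ I) H eps Heps) as [P Q [M1 HP] [M2 HQ] HPQ].
  exists (fun a => 0 < a < exp (p * M1)) (fun b => exp (p * M2) < b).
  - exists (mkposreal _ (exp_pos (p * M1))). intros y Hy1 Hy2.
    change (Rabs (y - 0) < exp (p * M1)) in Hy1. rewrite Rminus_0_r in Hy1.
    assert (T := Rle_abs y). lra.
  - exists (exp (p * M2)). auto.
  - intros a b [Ha1 Ha2] Hb. simpl.
    assert (Hb0 : 0 < b) by (assert (T := exp_pos (p * M2)); lra).
    assert (Ea : exp (p * (ln a / p)) = a).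
    { replace (p * (ln a / p)) with (ln a) by (field; lra). apply exp_ln; auto. }
    assert (Eb : exp (p * (ln b / p)) = b).
    { replace (p * (ln b / p)) with (ln b) by (field; lra). apply exp_ln; auto. }
    assert (La : ln a / p < M1).
    { apply Rmult_lt_reg_l with p; auto. apply exp_lt_inv. rewrite Ea. auto. }
    assert (Lb : M2 < ln b / p).
    { apply Rmult_lt_reg_l with p; auto. apply exp_lt_inv. rewrite Eb. auto. }
    destruct (HPQ _ _ (HP _ La) (HQ _ Lb)) as [J [HJ1 HJ2]]. simpl in HJ1.
    exists J. split; auto.
    assert (S := is_RInt_comp (V := C_R_CompleteNormedModule) phi (fun y => exp (p * y)) (fun y => p * exp (p * y)) (ln a / p) (ln b / p)).
    cbv beta in S. rewrite Ea, Eb in S.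
    assert (S' := S (fun x _ => Hc _ (exp_pos (p * x)))). clear S.
    assert (S : is_CInt (fun y => scal (p * exp (p * y)) (phi (exp (p * y)))) (ln a / p) (ln b / p) (CInt phi a b)).
    { apply S'. intros x _. split.
      - auto_derive; auto. ring.
      - apply (ex_derive_continuous (V := R_NormedModule)). auto_derive; auto. }
    apply CInt_unique in S.
    assert (E : CInt (fun y => scal (p * exp (p * y)) (phi (exp (p * y)))) (ln a / p) (ln b / p) = J).
    { rewrite <- (CInt_unique _ _ _ _ HJ1). apply (RInt_ext (V := C_R_CompleteNormedModule)).
      intros x _. apply scal_R_Cmult. }
    rewrite <- E, S. apply CInt_correct. apply (ex_RInt_continuous (V := C_R_CompleteNormedModule)).
    intros x Hx. apply Hc. assert (0 < Rmin a b) by (apply Rmin_glb_lt; auto). lra.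
Qed.

(** Euler's integrand for [Gamma (1 + x)] after [t = exp y], with the Jacobian [exp y] included. *)
Definition gamma_kernel (x y : R) : R := exp ((1 + x) * y - exp y).

Lemma gamma_kernel_cont (x y : R) : continuous (gamma_kernel x) y.
Proof. apply (ex_derive_continuous (V := R_NormedModule)). unfold gamma_kernel. auto_derive; auto. Qed.

Lemma gamma_kernel_maj (n : nat) (p y : R) : 0 < p ->
  gamma_kernel (INR n * p) y <= Rpower (INR (fact n)) p * Rpower (2 * p / 1) p ^ n * (exp y * exp (- (1 / 2) * exp y)).
Proof.
  intros Hp. assert (B := exp_np_bound n p 1 y Hp Rlt_0_1).
  unfold gamma_kernel.
  replace ((1 + INR n * p) * y - exp y) with (INR n * p * y + (y + - exp y)) by ring.
  rewrite !exp_plus.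
  apply Rmult_le_compat_r with (r := exp y * exp (- exp y)) in B; [|apply Rlt_le, Rmult_lt_0_compat; apply exp_pos].
  eapply Rle_trans; [exact B|]. right.
  replace (exp (- (1 / 2) * exp y)) with (exp (1 / 2 * exp y) * exp (- exp y)).
  - ring.
  - rewrite <- exp_plus. f_equal. field.
Qed.

(** [Gamma] is defined by a total integral operator, so convergence has to be proved before its
    value means anything. The integral is first found as a complex limit [I]; integrals of a real
    function over segments are real, which forces [I = RtoC (Re I)]. *)
Lemma gamma_line (n : nat) (p : R) : 0 < p ->
  is_line (fun y => RtoC (gamma_kernel (INR n * p) y)) (RtoC (Gamma (1 + INR n * p))) /\
  Gamma (1 + INR n * p) <= 2 * (Rpower (INR (fact n)) p * Rpower (2 * p / 1) p ^ n).
Proof.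
  intros Hp. set (x := INR n * p).
  set (M := Rpower (INR (fact n)) p * Rpower (2 * p / 1) p ^ n).
  assert (HM := majorant_line (1 / 2) M ltac:(lra)).
  assert (H1 : forall t, True -> Ccont (fun y => RtoC (gamma_kernel x y)) t).
  { intros t _. apply Ccont_RtoC, gamma_kernel_cont. }
  assert (H2 : forall t, True -> Cmod (RtoC (gamma_kernel x t)) <= M * (exp t * exp (- (1 / 2) * exp t))).
  { intros t _. rewrite Cmod_R, Rabs_pos_eq by apply Rlt_le, exp_pos. apply gamma_kernel_maj; auto. }
  destruct (maj_integrable _ _ _ _ _ _ _ HM _ H1 H2) as [I HI].
  assert (N := maj_norm _ _ _ _ _ _ _ HM _ I H1 H2 HI).
  assert (EI : I = RtoC (Re I)).
  { apply (is_RInt_gen_unique (V := C_R_CompleteNormedModule)) in HI as U; try typeclasses eauto.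
    assert (H3 : is_line (fun y => RtoC (gamma_kernel x y)) (RtoC (Re I))).
    { apply is_CInt_gen_eps; try typeclasses eauto. intros eps Heps.
      eapply (filter_imp (F := filter_prod _ _)); [|apply (proj1 (is_CInt_gen_eps _ _ _ I) HI eps Heps)].
      intros ab [J [HJ1 HJ2]]. exists (RtoC (Re J)). split.
      - apply is_CInt_pair; simpl.
        + exact (is_RInt_fct_extend_fst (U := R_NormedModule) (V := R_NormedModule) _ _ _ _ HJ1).
        + assert (Z := is_RInt_const (V := R_NormedModule) (fst ab) (snd ab) 0).
          assert (E0 : scal (snd ab - fst ab) (0 : R_NormedModule) = 0) by apply Rmult_0_r.
          rewrite E0 in Z. exact Z.
      - rewrite <- RtoC_minus, Cmod_R, <- Re_minus. eapply Rle_lt_trans; [apply re_le_Cmod|auto]. }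
    apply (is_RInt_gen_unique (V := C_R_CompleteNormedModule)) in H3; try typeclasses eauto.
    exact (eq_trans (eq_sym U) H3). }
  assert (G : Gamma (1 + x) = Re I).
  { unfold Gamma. apply (is_RInt_gen_unique (V := R_CompleteNormedModule)); try typeclasses eauto.
    apply is_CInt_gen_R; try typeclasses eauto.
    apply (is_CInt_gen_exp_subst _ 1); [lra| |].
    - intros t Ht. apply Ccont_RtoC. apply (ex_derive_continuous (V := R_NormedModule)). unfold Rpower. auto_derive. auto.
    - eapply (is_RInt_gen_ext (V := C_R_NormedModule)); [|exact HI].
      apply filter_forall. intros ab y _. rewrite <- RtoC_mult. f_equal. unfold gamma_kernel, Rpower.
      rewrite !Rmult_1_l, ln_exp. replace (1 + x - 1) with x by ring.
      rewrite <- !exp_plus. f_equal. ring. }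
  rewrite G, <- EI. split; auto.
  assert (T := re_le_Cmod I). assert (T' := Rle_abs (Re I)).
  replace (0 - - M / (1 / 2)) with (2 * M) in N by field. lra.
Qed.

(** Only the part of the integral with [n + 1 <= exp y <= n + 2] is kept. There
    [exp (n p y) >= (n + 1)^(n p) >= n!^p] and [exp (- exp y) >= exp (- (n + 2))], while the
    remaining factor [exp y] has integral exactly 1. *)
Lemma gamma_lower (n : nat) (p : R) : 0 < p ->
  Rpower (INR (fact n)) p * exp (- (INR n + 2)) <= Gamma (1 + INR n * p).
Proof.
  intros Hp. destruct (gamma_line n p Hp) as [H _].
  set (L := Rpower (INR (fact n)) p * exp (- (INR n + 2))).
  set (x := INR n * p) in *. assert (Pn := pos_INR n).
  set (u := ln (INR n + 1)). set (v := ln (INR n + 2)).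
  assert (Huv : u < v) by (apply ln_increasing; lra).
  apply is_CInt_gen_R in H; try typeclasses eauto. simpl in H.
  apply le_epsilon. intros eps Heps.
  assert (H1 : filter_prod (Rbar_locally m_infty) (Rbar_locally p_infty)
    (fun ab => exists J, is_RInt (V := R_NormedModule) (gamma_kernel x) (fst ab) (snd ab) J /\ Rabs (J - Gamma (1 + x)) < eps)).
  { apply (H (fun J => Rabs (J - Gamma (1 + x)) < eps)). exists (mkposreal eps Heps). auto. }
  assert (H2 : filter_prod (Rbar_locally m_infty) (Rbar_locally p_infty) (fun ab => fst ab < u /\ v < snd ab)).
  { exists (fun a => a < u) (fun b => v < b); [exists u; auto|exists v; auto|]. simpl; auto. }
  destruct (filter_ex _ (filter_and _ _ H1 H2)) as [[a b] [[J [HJ1 HJ2]] [Ha Hb]]]. simpl in *.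
  assert (Ex : forall s t, ex_RInt (V := R_NormedModule) (gamma_kernel x) s t).
  { intros s t. apply (ex_RInt_continuous (V := R_CompleteNormedModule)). intros; apply gamma_kernel_cont. }
  assert (J1 := RInt_correct (V := R_CompleteNormedModule) _ _ _ (Ex a u)).
  assert (J2 := RInt_correct (V := R_CompleteNormedModule) _ _ _ (Ex u v)).
  assert (J3 := RInt_correct (V := R_CompleteNormedModule) _ _ _ (Ex v b)).
  assert (P : forall s t, s <= t -> 0 <= RInt (V := R_CompleteNormedModule) (gamma_kernel x) s t).
  { intros s t Hst. apply RInt_ge_0; auto. intros; apply Rlt_le, exp_pos. }
  assert (EJ : J = RInt (V := R_CompleteNormedModule) (gamma_kernel x) a u + (RInt (V := R_CompleteNormedModule) (gamma_kernel x) u v + RInt (V := R_CompleteNormedModule) (gamma_kernel x) v b)).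
  { apply (is_RInt_unique (V := R_CompleteNormedModule)) in HJ1. rewrite <- HJ1.
    apply (is_RInt_unique (V := R_CompleteNormedModule)).
    apply (is_RInt_Chasles (V := R_NormedModule) _ a u b); auto.
    apply (is_RInt_Chasles (V := R_NormedModule) _ u v b); auto. }
  assert (K : L <= RInt (V := R_CompleteNormedModule) (gamma_kernel x) u v).
  { assert (D : is_RInt (V := R_NormedModule) (fun y => L * exp y) u v (L * exp v - L * exp u)).
    { apply (is_RInt_derive (V := R_CompleteNormedModule) (fun y => L * exp y)).
      - intros y _. auto_derive; auto. ring.
      - intros y _. apply (ex_derive_continuous (V := R_NormedModule)). auto_derive; auto. }
    replace (L * exp v - L * exp u) with L in D.
    2:{ unfold u, v. rewrite !exp_ln by lra. ring. }
    rewrite <- (is_RInt_unique (V := R_CompleteNormedModule) _ _ _ _ D).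
    apply RInt_le; [lra|exists L; exact D|apply Ex|].
    intros y Hy. unfold gamma_kernel, L.
    replace ((1 + x) * y - exp y) with (x * y + - exp y + y) by ring.
    rewrite (exp_plus _ y), exp_plus. apply Rmult_le_compat_r; [apply Rlt_le, exp_pos|].
    apply Rmult_le_compat; try (apply Rlt_le, exp_pos).
    - unfold x. rewrite Rpower_pow_exp. apply Rpower_le_l; [lra|apply INR_fact_pos|].
      eapply Rle_trans; [apply fact_le_pow|]. apply pow_incr. split; [lra|].
      rewrite <- (exp_ln (INR n + 1)) by lra. apply Rlt_le, exp_increasing. fold u. lra.
    - assert (exp y <= INR n + 2).
      { rewrite <- (exp_ln (INR n + 2)) by lra. apply Rlt_le, exp_increasing. fold v. lra. }
      destruct (Req_dec (exp y) (INR n + 2)) as [->|]; [lra|].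
      apply Rlt_le, exp_increasing. lra. }
  assert (P1 := P a u ltac:(lra)). assert (P3 := P v b ltac:(lra)).
  apply Rabs_lt_between in HJ2. lra.
Qed.

Lemma gamma_pos (n : nat) (p : R) : 0 < p -> 0 < Gamma (1 + INR n * p).
Proof.
  intros Hp. eapply Rlt_le_trans; [|apply gamma_lower; auto].
  apply Rmult_lt_0_compat; apply exp_pos.
Qed.

Lemma exp_le (x y : R) : x <= y -> exp x <= exp y.
Proof. intros [H|H]; [apply Rlt_le, exp_increasing; auto|rewrite H; lra]. Qed.

(** * Laplace transform along a horizontal line *)

Lemma is_line_eps (phi : R -> C) (I : C) : is_line phi I <->
  forall eps, 0 < eps -> exists X, forall a b, a < - X -> X < b ->
    exists J, is_CInt phi a b J /\ Cmod (J - I) < eps.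
Proof.
  split.
  - intros H eps Heps. destruct (proj1 (is_CInt_gen_eps _ _ _ I) H eps Heps) as [P Q [M1 HP] [M2 HQ] HPQ].
    exists (Rmax (- M1) M2). intros a b Ha Hb.
    assert (T1 := Rmax_l (- M1) M2). assert (T2 := Rmax_r (- M1) M2).
    apply (HPQ a b); [apply HP|apply HQ]; lra.
  - intros H. apply is_CInt_gen_eps; try typeclasses eauto. intros eps Heps.
    destruct (H eps Heps) as [X HX].
    exists (fun a => a < - X) (fun b => X < b); [exists (- X); auto|exists X; auto|].
    intros a b Ha Hb. apply HX; auto.
Qed.

Lemma is_line_unique (phi : R -> C) (I J : C) : is_line phi I -> is_line phi J -> I = J.
Proof.
  intros H1 H2. apply (is_RInt_gen_unique (V := C_R_CompleteNormedModule)) in H1, H2; try typeclasses eauto.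
  exact (eq_trans (eq_sym H1) H2).
Qed.

Lemma is_line_ext (phi psi : R -> C) (I : C) : (forall x, phi x = psi x) -> is_line phi I -> is_line psi I.
Proof.
  intros E. apply (is_RInt_gen_ext (V := C_R_NormedModule)); try typeclasses eauto.
  apply filter_forall. intros ab x _. apply E.
Qed.

Lemma is_line_shift (phi : R -> C) (I : C) (s : R) : is_line phi I -> is_line (fun x => phi (x - s)) I.
Proof.
  intros H. apply is_line_eps. intros eps Heps.
  destruct (proj1 (is_line_eps _ _) H eps Heps) as [X HX].
  exists (X + Rabs s). intros a b Ha Hb.
  assert (T1 := Rle_abs s). assert (T2 := Rle_abs (- s)). rewrite Rabs_Ropp in T2.
  destruct (HX (a - s) (b - s)) as [J [HJ1 HJ2]]; [lra|lra|]. exists J. split; auto.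
  apply (is_RInt_ext (V := C_R_NormedModule) (fun y => scal 1 (phi (1 * y + - s)))).
  - intros x _. rewrite scal_R_Cmult. rewrite Cmult_1_l. f_equal. ring.
  - apply (is_RInt_comp_lin (V := C_R_NormedModule) phi 1 (- s)).
    replace (1 * a + - s) with (a - s) by ring. replace (1 * b + - s) with (b - s) by ring. exact HJ1.
Qed.

Definition LI (H : C -> C) (eta : R) (zeta : C) (x : R) : C := (H (x, eta) * kap ((x, eta) - zeta))%C.
Definition Lap (H : C -> C) (eta : R) (zeta : C) : C :=
  CInt_gen (LI H eta zeta) (Rbar_locally m_infty) (Rbar_locally p_infty).
(** If [H] grows like [exp (b * exp x)] along [Im w = eta], the Laplace integrand is bounded by a
    multiple of [exp x * exp (- decay * exp x)]. Positivity is the convergence condition, the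
    counterpart of [laplace_domain]. *)
Definition decay (eta : R) (zeta : C) (b : R) : R := exp (- Re zeta) * cos (eta - Im zeta) - b.

Lemma Cmod_kap_line (x eta : R) (zeta : C) :
  Cmod (kap ((x, eta) - zeta)) = exp (- Re zeta) * (exp x * exp (- (exp (- Re zeta) * cos (eta - Im zeta)) * exp x)).
Proof.
  rewrite Cmod_kap, Re_minus, Im_minus. change (Re (x, eta)) with x. change (Im (x, eta)) with eta.
  rewrite <- !exp_plus. f_equal. replace (x - Re zeta) with (x + - Re zeta) by ring. rewrite exp_plus. ring.
Qed.

Lemma LI_bound (H : C -> C) (eta : R) (zeta : C) (B b x : R) :
  Cmod (H (x, eta)) <= B * exp (b * exp x) ->
  Cmod (LI H eta zeta x) <= B * exp (- Re zeta) * (exp x * exp (- decay eta zeta b * exp x)).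
Proof.
  intros HB. unfold LI. rewrite Cmod_mult, Cmod_kap_line.
  apply Rmult_le_compat_r with (r := exp (- Re zeta) * (exp x * exp (- (exp (- Re zeta) * cos (eta - Im zeta)) * exp x))) in HB.
  - eapply Rle_trans; [exact HB|]. right. unfold decay.
    replace (- (exp (- Re zeta) * cos (eta - Im zeta) - b) * exp x) with
      (b * exp x + - (exp (- Re zeta) * cos (eta - Im zeta)) * exp x) by ring.
    rewrite exp_plus. ring.
  - repeat apply Rmult_le_pos; apply Rlt_le, exp_pos.
Qed.

Lemma LI_cont (H : C -> C) (eta : R) (zeta : C) (x : R) :
  Ccont (fun t => H (t, eta)) x -> Ccont (LI H eta zeta) x.
Proof.
  intros Hc. apply Ccont_mult; auto.
  apply (Ccont_CE (fun w => kap (w - zeta))); [|apply Ccont_h].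
  apply (CE_comp kap (fun w => w - zeta)%C); [apply CE_sub|apply CE_kap].
Qed.

Lemma Lap_correct (H : C -> C) (eta : R) (zeta : C) (I : C) : is_line (LI H eta zeta) I -> Lap H eta zeta = I.
Proof. apply (is_RInt_gen_unique (V := C_R_CompleteNormedModule)); typeclasses eauto. Qed.

Section Laplace.
Context (H : C -> C) (eta b B : R).
Context (Hcont : forall x, Ccont (fun t => H (t, eta)) x).
Context (Hgrowth : forall x, Cmod (H (x, eta)) <= B * exp (b * exp x)).

Lemma Lap_is_line (zeta : C) : 0 < decay eta zeta b -> is_line (LI H eta zeta) (Lap H eta zeta).
Proof.
  intros Hq. assert (HM := majorant_line (decay eta zeta b) (B * exp (- Re zeta)) Hq).
  destruct (maj_integrable _ _ _ _ _ _ _ HM (LI H eta zeta)) as [I HI].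
  - intros t _. apply LI_cont, Hcont.
  - intros t _. apply LI_bound; auto.
  - rewrite (Lap_correct _ _ _ _ HI). exact HI.
Qed.

Lemma decay_near (zeta : C) : 0 < decay eta zeta b -> exists r q, 0 < r /\ 0 < q /\
  forall z, in_sq zeta r z -> q <= decay eta z b.
Proof.
  intros Hq. set (q := decay eta zeta b) in *.
  destruct (CE_cont (fun z => Cexp ((0, eta) - z)) zeta ltac:(ce) (q / 2)) as [d [Hd Hw]]; [lra|].
  exists (d / 3), (q / 2). repeat split; try lra. intros z Hz.
  specialize (Hw z). apply Cmod_in_sq in Hz. specialize (Hw ltac:(lra)).
  assert (T := re_le_Cmod (Cexp ((0, eta) - z) - Cexp ((0, eta) - zeta))).
  rewrite Re_minus, !Re_Cexp, !Re_minus, !Im_minus in T. simpl in T.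
  rewrite !Rminus_0_l in T. unfold q, decay in *. assert (T' := Rabs_lt_between' (exp (- Re z) * cos (eta - Im z))
    (exp (- Re zeta) * cos (eta - Im zeta)) ((exp (- Re zeta) * cos (eta - Im zeta) - b) / 2)).
  destruct T' as [T' _]. specialize (T' ltac:(unfold Re, Im in *; simpl in *; lra)). lra.
Qed.

(** On a small square around [zeta] the decay stays above a positive [q], so one majorant serves all
    nearby parameters and the integral may be differentiated. *)
Lemma Lap_CE (zeta : C) : 0 < decay eta zeta b -> CE (Lap H eta) zeta.
Proof.
  intros Hq. destruct (decay_near zeta Hq) as [r [q [Hr [Hq' Hd]]]].
  assert (HB : 0 <= B).
  { specialize (Hgrowth 0). assert (T := Cmod_ge_0 (H (0, eta))). assert (T' := exp_pos (b * exp 0)). nra. }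
  assert (HM := majorant_line q (B * exp (- Re zeta + r)) Hq').
  destruct (hol_param _ _ _ _ _ _ _ HM (fun x z => LI H eta z x) (fun x => H (x, eta) * (C_derive kap ((x, eta) - zeta) * - RtoC 1))%C (Lap H eta) zeta r Hr)
    as [l [_ Hl]].
  - intros x z _ Hz. unfold LI. apply CE_mult; [apply CE_const|].
    apply (CE_comp kap (fun w => (x, eta) - w)%C); [ce|apply CE_kap].
  - intros x z _ Hz. eapply Rle_trans; [apply LI_bound, Hgrowth|].
    apply Rmult_le_compat.
    + apply Rmult_le_pos; auto. apply Rlt_le, exp_pos.
    + apply Rlt_le, Rmult_lt_0_compat; apply exp_pos.
    + apply Rmult_le_compat_l; auto. apply exp_le. destruct Hz as [Hz _]. apply Rabs_le_between in Hz. lra.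
    + apply Rmult_le_compat_l; [apply Rlt_le, exp_pos|]. apply exp_le. specialize (Hd z Hz). assert (T := exp_pos x). nra.
  - intros x z _ Hz. apply LI_cont, Hcont.
  - intros x _. unfold LI. eapply CD_eq; [|apply CD_mult; [apply CD_const|
      apply (CD_comp kap (fun w => (x, eta) - w)%C); [apply CD_minus; [apply CD_const|apply CD_id]|apply CE_derive, CE_kap]]].
    cbv beta. ring.
  - intros x _. apply Ccont_mult; [apply Hcont|]. apply Ccont_mult; [|apply Ccont_const].
    apply (Ccont_CE (fun w => C_derive kap (w - zeta))); [|apply Ccont_h].
    apply (CE_comp (C_derive kap) (fun w => w - zeta)%C); [apply CE_sub|].
    apply (CE_C_derive kap _ 1); [lra|]. intros; apply CE_kap.
  - intros z Hz. apply Lap_is_line. specialize (Hd z Hz). lra.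
  - exists l. exact Hl.
Qed.
End Laplace.

Lemma cos_min_interval (t1 t2 t : R) : - (PI / 2) <= t1 -> t1 <= t -> t <= t2 -> t2 <= PI / 2 ->
  Rmin (cos t1) (cos t2) <= cos t.
Proof.
  intros H1 H2 H3 H4. assert (HPI := PI_RGT_0).
  destruct (Rle_dec 0 t) as [Ht|Ht].
  - eapply Rle_trans; [apply Rmin_r|]. destruct (Req_dec t t2) as [->|]; [lra|].
    apply Rlt_le, cos_decreasing_1; lra.
  - eapply Rle_trans; [apply Rmin_l|]. rewrite <- (cos_neg t), <- (cos_neg t1).
    destruct (Req_dec t t1) as [->|]; [lra|]. apply Rlt_le, cos_decreasing_1; lra.
Qed.

Lemma exp_exp_decay (q A : R) : 0 < q -> exp A * exp (- q * exp A) <= 2 / (q * q) * exp (- A).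
Proof.
  intros Hq. assert (E := exp_pos A).
  assert (B := pow_le_fact_exp 2 (q * exp A) ltac:(nra)). simpl INR in B.
  rewrite (exp_Ropp A).
  replace (- q * exp A) with (- (q * exp A)) by ring. rewrite (exp_Ropp (q * exp A)).
  assert (E' := exp_pos (q * exp A)).
  apply Rmult_le_reg_r with (q * q * exp A * exp (q * exp A)); [repeat apply Rmult_lt_0_compat; auto|].
  replace (exp A * / exp (q * exp A) * (q * q * exp A * exp (q * exp A))) with ((q * exp A) ^ 2) by (field; lra).
  replace (2 / (q * q) * / exp A * (q * q * exp A * exp (q * exp A))) with (2 * exp (q * exp A)) by (field; lra).
  lra.
Qed.

(** Goursat's theorem on [[- A, A] x [eta1, eta2]]. Both vertical sides are at most a multiple of
    [exp (- A)]: on the left through the factor [exp x] of the kernel, on the right because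
    [exp (- q * exp A)] beats every exponential. Hence growth is only needed where [|Re w|] is
    large. *)
Lemma Lap_rotate (H : C -> C) (eta1 eta2 b B X : R) (zeta I1 I2 : C) : eta1 <= eta2 -> 0 <= B ->
  (forall w, eta1 <= Im w <= eta2 -> CE H w) ->
  (forall w, eta1 <= Im w <= eta2 -> X <= Rabs (Re w) -> Cmod (H w) <= B * exp (b * exp (Re w))) ->
  Rabs (eta1 - Im zeta) <= PI / 2 -> Rabs (eta2 - Im zeta) <= PI / 2 ->
  0 < decay eta1 zeta b -> 0 < decay eta2 zeta b ->
  is_line (LI H eta1 zeta) I1 -> is_line (LI H eta2 zeta) I2 -> I1 = I2.
Proof.
  intros H12 HB Hhol Hb Ha1 Ha2 Hd1 Hd2 HI1 HI2.
  set (q := Rmin (decay eta1 zeta b) (decay eta2 zeta b)).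
  assert (Hq : 0 < q) by (apply Rmin_glb_lt; auto).
  apply Rabs_le_between in Ha1, Ha2.
  (* Inside [[- PI / 2, PI / 2]] the cosine on an interval is at least its smaller value at the
     ends, so positive decay in the two directions gives it in all directions between. *)
  assert (Hqd : forall eta, eta1 <= eta <= eta2 -> q <= decay eta zeta b).
  { intros eta Heta. assert (T := cos_min_interval (eta1 - Im zeta) (eta2 - Im zeta) (eta - Im zeta) ltac:(lra) ltac:(lra) ltac:(lra) ltac:(lra)).
    assert (T' := exp_pos (- Re zeta)). unfold q, decay.
    unfold Rmin in T. destruct (Rle_dec (cos (eta1 - Im zeta)) (cos (eta2 - Im zeta))).
    - eapply Rle_trans; [apply Rmin_l|]. nra.
    - eapply Rle_trans; [apply Rmin_r|]. nra. }
  set (f := fun w => (H w * kap (w - zeta))%C).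
  assert (Hf : forall w, eta1 <= Im w <= eta2 -> CE f w).
  { intros w Hw. apply CE_mult; auto. apply (CE_comp kap (fun w => w - zeta)%C); [apply CE_sub|apply CE_kap]. }
  set (K := B * exp (- Re zeta) * (1 + 2 / (q * q))).
  assert (HK : 0 <= K).
  { unfold K. apply Rmult_le_pos; [apply Rmult_le_pos; auto; apply Rlt_le, exp_pos|].
    assert (0 < 2 / (q * q)) by (apply Rdiv_lt_0_compat; nra). lra. }
  assert (Hfb : forall A y, 0 <= A -> X <= A -> eta1 <= y <= eta2 -> Cmod (f (A, y)) <= K * exp (- A) /\ Cmod (f (- A, y)) <= K * exp (- A)).
  { intros A y HA HX Hy.
    assert (G : 0 <= B * exp (- Re zeta)) by (apply Rmult_le_pos; auto; apply Rlt_le, exp_pos).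
    assert (P : 0 < 2 / (q * q)) by (apply Rdiv_lt_0_compat; nra).
    split.
    - eapply Rle_trans; [apply (LI_bound H y zeta B b A)|].
      + apply (Hb (A, y)); simpl; auto. rewrite Rabs_pos_eq; auto.
      + unfold K. rewrite (Rmult_assoc (B * exp (- Re zeta)) (1 + 2 / (q * q))). apply Rmult_le_compat_l; auto.
        apply Rle_trans with (exp A * exp (- q * exp A)).
        * apply Rmult_le_compat_l; [apply Rlt_le, exp_pos|]. apply exp_le.
          specialize (Hqd y Hy). assert (T := exp_pos A). nra.
        * eapply Rle_trans; [apply exp_exp_decay; auto|]. apply Rmult_le_compat_r; [apply Rlt_le, exp_pos|lra].
    - eapply Rle_trans; [apply (LI_bound H y zeta B b (- A))|].
      + apply (Hb (- A, y)%R); simpl; auto. rewrite Rabs_Ropp, Rabs_pos_eq; auto.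
      + unfold K. rewrite (Rmult_assoc (B * exp (- Re zeta)) (1 + 2 / (q * q))). apply Rmult_le_compat_l; auto.
        apply Rle_trans with (exp (- A) * 1).
        * apply Rmult_le_compat_l; [apply Rlt_le, exp_pos|]. rewrite <- exp_0. apply exp_le.
          specialize (Hqd y Hy). assert (T := exp_pos (- A)). nra.
        * assert (T := exp_pos (- A)). nra. }
  apply Ceq_minus, Cmod_eq_0, Rle_antisym; [|apply Cmod_ge_0].
  apply le_epsilon. intros eps Heps. rewrite Rplus_0_l.
  destruct (proj1 (is_line_eps _ _) HI1 (eps / 4)) as [X1 HX1]; [lra|].
  destruct (proj1 (is_line_eps _ _) HI2 (eps / 4)) as [X2 HX2]; [lra|].
  set (D := 2 * (eta2 - eta1) * K + 1). assert (HD : 0 < D) by (unfold D; nra).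
  set (A := Rmax (Rmax X1 X2) (Rmax (Rmax 0 X) (- ln (eps / 4 / D))) + 1).
  assert (HA : X1 < A /\ X2 < A /\ 0 < A /\ X < A /\ - ln (eps / 4 / D) < A).
  { unfold A. assert (T1 := Rmax_l (Rmax X1 X2) (Rmax (Rmax 0 X) (- ln (eps / 4 / D)))).
    assert (T2 := Rmax_r (Rmax X1 X2) (Rmax (Rmax 0 X) (- ln (eps / 4 / D)))).
    assert (T3 := Rmax_l X1 X2). assert (T4 := Rmax_r X1 X2).
    assert (T5 := Rmax_l (Rmax 0 X) (- ln (eps / 4 / D))). assert (T6 := Rmax_r (Rmax 0 X) (- ln (eps / 4 / D))).
    assert (T7 := Rmax_l 0 X). assert (T8 := Rmax_r 0 X). lra. }
  destruct HA as [A1 [A2 [A3 [A4 A5]]]].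
  assert (Hexp : D * exp (- A) <= eps / 4).
  { assert (exp (- A) <= eps / 4 / D).
    { rewrite <- (exp_ln (eps / 4 / D)) by (repeat apply Rdiv_lt_0_compat; lra). apply exp_le. lra. }
    apply Rmult_le_compat_l with (r := D) in H0; [|lra].
    replace (D * (eps / 4 / D)) with (eps / 4) in H0 by (field; lra). exact H0. }
  destruct (HX1 (- A) A) as [J1 [HJ1 EJ1]]; [lra|lra|].
  destruct (HX2 (- A) A) as [J2 [HJ2 EJ2]]; [lra|lra|].
  assert (G := goursat f (- A) A eta1 eta2 ltac:(lra) H12 (fun x y _ Hy => Hf (x, y) Hy)).
  unfold rect in G.
  change (fun x => f (x, eta1)) with (LI H eta1 zeta) in G.
  change (fun x => f (x, eta2)) with (LI H eta2 zeta) in G.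
  rewrite (CInt_unique _ _ _ _ HJ1), (CInt_unique _ _ _ _ HJ2) in G.
  assert (V1 : Cmod (CInt (fun y => f (A, y)) eta1 eta2) <= (eta2 - eta1) * (K * exp (- A))).
  { apply CInt_norm; [exact H12| |].
    - apply ex_CInt_v; [exact H12|]. intros y Hy. apply Hf. exact Hy.
    - intros y Hy. apply Hfb; lra. }
  assert (V2 : Cmod (CInt (fun y => f (- A, y)) eta1 eta2) <= (eta2 - eta1) * (K * exp (- A))).
  { apply CInt_norm; [exact H12| |].
    - apply ex_CInt_v; [exact H12|]. intros y Hy. apply Hf. exact Hy.
    - intros y Hy. apply Hfb; lra. }
  assert (E : (I1 - I2)%C = ((J2 - I2) - (J1 - I1) + Ci * (CInt (fun y => f (- A, y)%R) eta1 eta2 - CInt (fun y => f (A, y)) eta1 eta2))%C).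
  { apply Ceq_minus. rewrite <- G. ring. }
  rewrite E. eapply Rle_trans; [apply Cmod_triangle|].
  rewrite Cmod_mult, Cmod_Ci, Rmult_1_l.
  assert (T1 := Cmod_triangle_minus (J2 - I2) (J1 - I1)).
  assert (T2 := Cmod_triangle_minus (CInt (fun y => f (- A, y)%R) eta1 eta2) (CInt (fun y => f (A, y)) eta1 eta2)).
  unfold D in Hexp. assert (T := exp_pos (- A)). nra.
Qed.

Lemma is_line_scal (k : C) (phi : R -> C) (I : C) : is_line phi I -> is_line (fun x => k * phi x)%C (k * I)%C.
Proof. apply is_CInt_gen_scal; typeclasses eauto. Qed.

Lemma is_line_plus (phi psi : R -> C) (I J : C) : is_line phi I -> is_line psi J ->
  is_line (fun x => phi x + psi x)%C (I + J)%C.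
Proof. apply (is_RInt_gen_plus (V := C_R_NormedModule)). Qed.

Lemma is_line_minus (phi psi : R -> C) (I J : C) : is_line phi I -> is_line psi J ->
  is_line (fun x => phi x - psi x)%C (I - J)%C.
Proof. apply (is_RInt_gen_minus (V := C_R_NormedModule)). Qed.

Lemma is_line_0 : is_line (fun _ => RtoC 0) (RtoC 0).
Proof.
  apply is_line_eps. intros eps Heps. exists 0. intros a b _ _. exists (RtoC 0). split.
  - assert (Z := is_RInt_const (V := C_R_NormedModule) a b (RtoC 0)).
    rewrite scal_R_Cmult, Cmult_0_r in Z. exact Z.
  - replace (0 - 0)%C with (RtoC 0) by ring. rewrite Cmod_0. auto.
Qed.

(** Half of the decay [q] is spent on absorbing [exp (n p x)], at the price of [n!^p] and a power
    [q^(- n p)]. Since [q] is at least [q0 * exp (- Re zeta)], this power turns into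
    [exp (n p Re zeta)], that is [|z|^n]. Applied to Taylor remainders of [g], it gives the Gevrey
    bound. *)
Lemma Lap_remainder (H : C -> C) (eta b N p q0 : R) (n : nat) (zeta I : C) :
  0 < p -> 0 <= N -> 0 < q0 -> q0 <= exp (Re zeta) * decay eta zeta b ->
  (forall x, Ccont (fun t => H (t, eta)) x) ->
  (forall x, Cmod (H (x, eta)) <= N * exp (INR n * p * x) * exp (b * exp x)) ->
  is_line (LI H eta zeta) I ->
  Cmod I <= N * Rpower (INR (fact n)) p * Rpower (2 * p / q0) p ^ n * exp (INR n * p * Re zeta) * (2 / q0).
Proof.
  intros Hp HN Hq0 Hq Hc Hb HI.
  set (q := decay eta zeta b) in *. assert (Ez := exp_pos (Re zeta)).
  assert (Hq' : 0 < q) by nra.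
  set (F := Rpower (INR (fact n)) p). assert (HF : 0 < F) by apply exp_pos.
  set (B := N * F * Rpower (2 * p / q) p ^ n).
  assert (HP : 0 < Rpower (2 * p / q) p ^ n) by (apply pow_lt, exp_pos).
  assert (HB : 0 <= B) by (unfold B; repeat apply Rmult_le_pos; lra).
  assert (Hb' : forall x, Cmod (H (x, eta)) <= B * exp ((b + q / 2) * exp x)).
  { intros x. eapply Rle_trans; [apply Hb|].
    assert (T := exp_np_bound n p q x Hp Hq'). fold F in T.
    replace ((b + q / 2) * exp x) with (q / 2 * exp x + b * exp x) by ring. rewrite exp_plus.
    unfold B. rewrite <- !Rmult_assoc. apply Rmult_le_compat_r; [apply Rlt_le, exp_pos|].
    replace (N * F * Rpower (2 * p / q) p ^ n * exp (q / 2 * exp x)) with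
      (N * (F * Rpower (2 * p / q) p ^ n * exp (q / 2 * exp x))) by ring.
    apply Rmult_le_compat_l; auto. }
  assert (HD : decay eta zeta (b + q / 2) = q / 2) by (unfold q, decay; field).
  assert (HM := majorant_line (q / 2) (B * exp (- Re zeta)) ltac:(lra)).
  assert (Hn : Cmod I <= 0 - - (B * exp (- Re zeta)) / (q / 2)).
  { apply (maj_norm _ _ _ _ _ _ _ HM (LI H eta zeta)); auto.
    - intros t _. apply LI_cont, Hc.
    - intros t _. rewrite <- HD. apply LI_bound. apply Hb'. }
  eapply Rle_trans; [exact Hn|].
  replace (0 - - (B * exp (- Re zeta)) / (q / 2)) with (B * (2 / (exp (Re zeta) * q))).
  2:{ rewrite exp_Ropp. field. split; lra. }
  apply Rmult_le_compat; auto.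
  - apply Rlt_le, Rdiv_lt_0_compat; nra.
  - unfold B. rewrite (Rmult_assoc (N * F)). apply Rmult_le_compat_l; [nra|].
    replace (exp (INR n * p * Re zeta)) with (Rpower (exp (Re zeta)) p ^ n).
    2:{ rewrite Rpower_pow_exp, Rpower_pow_comm; auto. }
    rewrite <- Rpow_mult_distr. apply pow_incr. split; [apply Rlt_le, exp_pos|].
    rewrite Rpower_mult_distr; auto; [|apply Rdiv_lt_0_compat; lra].
    apply Rpower_le_l; [lra|apply Rdiv_lt_0_compat; lra|].
    apply Rmult_le_reg_r with (q * q0); [nra|].
    replace (2 * p / q * (q * q0)) with (2 * p * q0) by (field; lra).
    replace (2 * p / q0 * exp (Re zeta) * (q * q0)) with (2 * p * (exp (Re zeta) * q)) by (field; lra).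
    apply Rmult_le_compat_l; lra.
  - unfold Rdiv. apply Rmult_le_compat_l; [lra|]. apply Rinv_le_contravar; auto.
Qed.

(** * Laplace transforms of monomials *)

Definition mono (x : R) (w : C) : C := Cexp (RtoC x * w).

Lemma CE_mono (x : R) (w : C) : CE (mono x) w.
Proof. unfold mono. ce. Qed.

Lemma Cmod_mono (x : R) (w : C) : Cmod (mono x w) = exp (x * Re w).
Proof. unfold mono. rewrite Cmod_Cexp, re_scal_l. reflexivity. Qed.

Lemma mono_plus (x : R) (z w : C) : mono x (z + w) = (mono x z * mono x w)%C.
Proof. unfold mono. rewrite <- Cexp_plus. f_equal. ring. Qed.

Lemma kap_R (x : R) : kap (RtoC x) = RtoC (exp (x - exp x)).
Proof. unfold kap. rewrite Cexp_R, <- RtoC_minus, Cexp_R. reflexivity. Qed.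

(** In the direction [eta = Im zeta] the kernel is real: translation by [zeta] turns the integral
    into Euler's integral and takes out the factor [mono (n p) zeta]. *)
Lemma Lap_mono_center (n : nat) (p : R) (zeta : C) : 0 < p ->
  is_line (LI (mono (INR n * p)) (Im zeta) zeta) (RtoC (Gamma (1 + INR n * p)) * mono (INR n * p) zeta)%C.
Proof.
  intros Hp. destruct (gamma_line n p Hp) as [G _].
  apply (is_line_shift _ _ (Re zeta)) in G.
  apply (is_line_scal (mono (INR n * p) zeta)) in G.
  rewrite Cmult_comm. eapply is_line_ext; [|exact G].
  intros x. unfold LI. cbv beta.
  assert (E : ((x, Im zeta) - zeta)%C = RtoC (x - Re zeta)).
  { destruct zeta as [u v]. unfold RtoC, Cminus, Cplus, Copp, Re, Im; simpl. f_equal; ring. }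
  rewrite E, kap_R.
  replace ((x, Im zeta) : C) with (zeta + RtoC (x - Re zeta))%C by (rewrite <- E; ring).
  rewrite mono_plus, <- Cmult_assoc. f_equal.
  unfold mono. rewrite <- RtoC_mult, Cexp_R, <- RtoC_mult. f_equal. unfold gamma_kernel.
  rewrite <- exp_plus. f_equal. ring.
Qed.

Lemma mono_growth (n : nat) (p b : R) (w : C) : 0 < p -> 0 < b ->
  Cmod (mono (INR n * p) w) <= Rpower (INR (fact n)) p * Rpower (2 * p / (2 * b)) p ^ n * exp (b * exp (Re w)).
Proof.
  intros Hp Hb. rewrite Cmod_mono. assert (T := exp_np_bound n p (2 * b) (Re w) Hp ltac:(lra)).
  replace (2 * b / 2) with b in T by field. exact T.
Qed.

(** Rotated from the central direction. A monomial grows more slowly than [exp (b * exp x)] for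
    every [b > 0]; half of the available [exp (- Re zeta) * cos (eta - Im zeta)] is taken for [b],
    so that decay stays positive in both directions. *)
Lemma Lap_mono (n : nat) (p eta : R) (zeta : C) : 0 < p -> Rabs (eta - Im zeta) < PI / 2 ->
  is_line (LI (mono (INR n * p)) eta zeta) (RtoC (Gamma (1 + INR n * p)) * mono (INR n * p) zeta)%C.
Proof.
  intros Hp He. assert (HPI := PI_RGT_0).
  assert (He' := He). apply Rabs_lt_between in He'.
  assert (Hc : 0 < cos (eta - Im zeta)) by (apply cos_gt_0; lra).
  assert (Ez := exp_pos (- Re zeta)).
  set (b := exp (- Re zeta) * cos (eta - Im zeta) / 2).
  assert (Hb : 0 < b) by (unfold b; apply Rdiv_lt_0_compat; [apply Rmult_lt_0_compat; auto|lra]).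
  set (B := Rpower (INR (fact n)) p * Rpower (2 * p / (2 * b)) p ^ n).
  assert (HB : 0 <= B) by (apply Rmult_le_pos; [|apply pow_le]; apply Rlt_le, exp_pos).
  assert (D1 : 0 < decay eta zeta b) by (unfold decay, b; nra).
  assert (D2 : 0 < decay (Im zeta) zeta b).
  { unfold decay, b. rewrite Rminus_diag, cos_0. assert (T := COS_bound (eta - Im zeta)). nra. }
  assert (HM : forall w, Cmod (mono (INR n * p) w) <= B * exp (b * exp (Re w))) by (intros; apply mono_growth; auto).
  assert (L1 := Lap_is_line (mono (INR n * p)) eta b B
    (fun x => Ccont_CE _ _ x (CE_mono _ _) (Ccont_h eta x)) (fun x => HM (x, eta)) zeta D1).
  assert (L2 := Lap_mono_center n p zeta Hp).
  assert (Z : Rabs (Im zeta - Im zeta) <= PI / 2) by (rewrite Rminus_diag, Rabs_R0; lra).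
  destruct (Rle_dec eta (Im zeta)) as [Hle|Hle].
  - rewrite <- (Lap_rotate (mono (INR n * p)) eta (Im zeta) b B 0 zeta _ _ Hle HB (fun w _ => CE_mono _ w) (fun w _ _ => HM w)
      ltac:(lra) Z D1 D2 L1 L2). exact L1.
  - rewrite (Lap_rotate (mono (INR n * p)) (Im zeta) eta b B 0 zeta _ _ ltac:(lra) HB (fun w _ => CE_mono _ w) (fun w _ _ => HM w)
      Z ltac:(lra) D2 D1 L2 L1). exact L1.
Qed.

(** Counts terms instead of naming the last index: at [n = 0] the sum is empty, and a remainder
    estimate becomes a bound of the function itself. *)
Fixpoint csum (f : nat -> C) (n : nat) : C :=
  match n with O => RtoC 0 | S n' => (csum f n' + f n')%C end.

Lemma CE_csum (f : nat -> C -> C) (n : nat) (z : C) : (forall k, CE (f k) z) -> CE (fun w => csum (fun k => f k w) n) z.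
Proof.
  intros H. induction n as [|n IH].
  - exact (CE_const (RtoC 0) z).
  - exact (CE_plus _ _ z IH (H n)).
Qed.

Lemma csum_ext (f g : nat -> C) (n : nat) : (forall k, f k = g k) -> csum f n = csum g n.
Proof. intros E. induction n; simpl; congruence. Qed.

Lemma Lap_poly (g : nat -> C) (n : nat) (p eta : R) (zeta : C) : 0 < p -> Rabs (eta - Im zeta) < PI / 2 ->
  is_line (LI (fun w => csum (fun k => g k * mono (INR k * p) w)%C n) eta zeta)
    (csum (fun k => g k * RtoC (Gamma (1 + INR k * p)) * mono (INR k * p) zeta)%C n).
Proof.
  intros Hp He. induction n as [|n IH].
  - eapply is_line_ext; [|apply is_line_0]. intros x. unfold LI. simpl. ring.
  - simpl. eapply is_line_ext; [|apply is_line_plus; [exact IH|]].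
    2:{ replace (g n * RtoC (Gamma (1 + INR n * p)) * mono (INR n * p) zeta)%C with
          (g n * (RtoC (Gamma (1 + INR n * p)) * mono (INR n * p) zeta))%C by ring.
        apply is_line_scal, (Lap_mono n p eta zeta Hp He). }
    intros x. unfold LI. cbv beta. ring.
Qed.

Lemma LI_minus (H G : C -> C) (eta : R) (zeta I J : C) :
  is_line (LI H eta zeta) I -> is_line (LI G eta zeta) J ->
  is_line (LI (fun w => H w - G w)%C eta zeta) (I - J)%C.
Proof.
  intros H1 H2. eapply is_line_ext; [|apply is_line_minus; [exact H1|exact H2]].
  intros x. unfold LI. ring.
Qed.

(** * Borel transform by a contour integral *)

Local Notation is_left phi r I := (is_CInt_gen phi (Rbar_locally m_infty) (at_point r) I).

(* The boundary of the half strip Re <= r, |Im| <= beta, traversed from -oo - i beta to -oo + i beta. *)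
Definition on_U (r beta : R) (s : C) : Prop :=
  Re s <= r /\ Rabs (Im s) <= beta /\ (Im s = - beta \/ Im s = beta \/ Re s = r).

(** The relation includes convergence on the two half lines; [UI] is the total function that has the
    same value once they converge. *)
Definition is_U (phi : C -> C) (r beta : R) (I : C) : Prop :=
  exists I1 I2, is_left (fun x => phi (x, - beta)) r I1 /\ is_left (fun x => phi (x, beta)) r I2 /\
    I = (I1 + Ci * CInt (fun y => phi (r, y)) (- beta) beta - I2)%C.

Definition UI (phi : C -> C) (r beta : R) : C :=
  (CInt_gen (fun x => phi (x, - beta)%R) (Rbar_locally m_infty) (at_point r)
   + Ci * CInt (fun y => phi (r, y)) (- beta) beta
   - CInt_gen (fun x => phi (x, beta)) (Rbar_locally m_infty) (at_point r))%C.

Lemma is_left_unique (phi : R -> C) (r : R) (I : C) : is_left phi r I ->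
  CInt_gen phi (Rbar_locally m_infty) (at_point r) = I.
Proof. apply (is_RInt_gen_unique (V := C_R_CompleteNormedModule)); typeclasses eauto. Qed.

Lemma is_U_unique (phi : C -> C) (r beta : R) (I : C) : is_U phi r beta I -> UI phi r beta = I.
Proof.
  intros [I1 [I2 [H1 [H2 ->]]]]. unfold UI. rewrite (is_left_unique _ _ _ H1), (is_left_unique _ _ _ H2). reflexivity.
Qed.

Lemma on_U_low (r beta x : R) : 0 <= beta -> x <= r -> on_U r beta (x, - beta).
Proof. intros. split; [auto|]. split; [simpl; rewrite Rabs_Ropp, Rabs_pos_eq; lra|auto]. Qed.
Lemma on_U_up (r beta x : R) : 0 <= beta -> x <= r -> on_U r beta (x, beta).
Proof. intros. split; [auto|]. split; [simpl; rewrite Rabs_pos_eq; lra|auto]. Qed.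
Lemma on_U_mid (r beta y : R) : - beta <= y <= beta -> on_U r beta (r, y).
Proof. intros. split; [simpl; lra|]. split; [apply Rabs_le; auto|auto]. Qed.

Lemma at_point_RInt (phi : R -> C) (a b : R) (I : C) : is_CInt_gen phi (at_point a) (at_point b) I <-> is_CInt phi a b I.
Proof. apply (is_RInt_gen_at_point (V := C_R_NormedModule)). Qed.

Section UContour.
Context (r beta c : R) (Hbeta : 0 <= beta) (Hc : 0 < c).

(** Each half line contributes at most [M * exp (c * r) / c] and the vertical side its length
    [2 * beta] times [M * exp (c * r)]. The rate [c] is left free, since one of the later bounds
    only decays at rate [1 / 2]. *)
Lemma U_ex (phi : C -> C) (M : R) :
  (forall s, on_U r beta s -> CE phi s) ->
  (forall s, on_U r beta s -> Cmod (phi s) <= M * exp (c * Re s)) ->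
  is_U phi r beta (UI phi r beta) /\ Cmod (UI phi r beta) <= M * exp (c * r) * (2 / c + 2 * beta).
Proof.
  intros H1 H2. assert (HM := majorant_left r c M Hc).
  assert (A1 : forall x, x <= r -> Ccont (fun x => phi (x, - beta)) x).
  { intros x Hx. apply (Ccont_CE phi); [apply H1, on_U_low; auto|apply Ccont_h]. }
  assert (A2 : forall x, x <= r -> Ccont (fun x => phi (x, beta)) x).
  { intros x Hx. apply (Ccont_CE phi); [apply H1, on_U_up; auto|apply Ccont_h]. }
  assert (B1 : forall x, x <= r -> Cmod (phi (x, - beta)) <= M * exp (c * x)).
  { intros x Hx. apply H2, on_U_low; auto. }
  assert (B2 : forall x, x <= r -> Cmod (phi (x, beta)) <= M * exp (c * x)).
  { intros x Hx. apply H2, on_U_up; auto. }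
  destruct (maj_integrable _ _ _ _ _ _ _ HM _ A1 B1) as [I1 HI1].
  destruct (maj_integrable _ _ _ _ _ _ _ HM _ A2 B2) as [I2 HI2].
  assert (N1 := maj_norm _ _ _ _ _ _ _ HM _ _ A1 B1 HI1).
  assert (N2 := maj_norm _ _ _ _ _ _ _ HM _ _ A2 B2 HI2).
  assert (N3 : Cmod (CInt (fun y => phi (r, y)) (- beta) beta) <= (beta - - beta) * (M * exp (c * r))).
  { apply CInt_norm; [lra| |].
    - apply ex_CInt_v; [lra|]. intros y Hy. apply H1, on_U_mid; auto.
    - intros y Hy. apply (H2 (r, y)), on_U_mid; auto. }
  assert (HU : is_U phi r beta (I1 + Ci * CInt (fun y => phi (r, y)) (- beta) beta - I2)%C).
  { exists I1, I2. auto. }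
  rewrite (is_U_unique _ _ _ _ HU). split; auto.
  eapply Rle_trans; [apply Cmod_triangle_minus|].
  eapply Rle_trans; [apply Rplus_le_compat_r, Cmod_triangle|].
  rewrite Cmod_mult, Cmod_Ci, Rmult_1_l.
  replace (M * exp (c * r) * (2 / c + 2 * beta)) with
    ((M * exp (c * r) / c - 0) + (beta - - beta) * (M * exp (c * r)) + (M * exp (c * r) / c - 0)) by (field; lra).
  lra.
Qed.

(** [hol_param] on each of the three sides, with the half line majorant twice and a constant one on
    the vertical side. *)
Lemma U_hol (K : C -> C -> C) (DK : C -> C) (M rho : R) (z0 : C) : 0 < rho ->
  (forall s z, on_U r beta s -> in_sq z0 rho z -> CE (K s) z) ->
  (forall s z, on_U r beta s -> in_sq z0 rho z -> CE (fun s => K s z) s) ->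
  (forall s z, on_U r beta s -> in_sq z0 rho z -> Cmod (K s z) <= M * exp (c * Re s)) ->
  (forall s, on_U r beta s -> CD (K s) z0 (DK s)) -> (forall s, on_U r beta s -> CE DK s) ->
  exists l, is_U DK r beta l /\ CD (fun z => UI (fun s => K s z) r beta) z0 l.
Proof.
  intros Hrho H1 H2 H3 H4 H5. assert (HM := majorant_left r c M Hc).
  assert (HMs := majorant_segment (- beta) beta (M * exp (c * r)) ltac:(lra)).
  assert (X : forall z, in_sq z0 rho z -> is_U (fun s => K s z) r beta (UI (fun s => K s z) r beta)).
  { intros z Hz. apply (U_ex (fun s => K s z) M); auto. }
  destruct (hol_param _ _ _ _ _ _ _ HM (fun x z => K (x, - beta) z) (fun x => DK (x, - beta))
    (fun z => CInt_gen (fun x => K (x, - beta) z) (Rbar_locally m_infty) (at_point r)) z0 rho Hrho) as [l1 [L1 D1]].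
  { intros x z Hx Hz. apply H1; auto. apply on_U_low; auto. }
  { intros x z Hx Hz. apply (H3 (x, - beta)); auto. apply on_U_low; auto. }
  { intros x z Hx Hz. apply (Ccont_CE (fun s => K s z)); [apply H2; auto; apply on_U_low; auto|apply Ccont_h]. }
  { intros x Hx. apply H4, on_U_low; auto. }
  { intros x Hx. apply (Ccont_CE DK); [apply H5, on_U_low; auto|apply Ccont_h]. }
  { intros z Hz. destruct (X z Hz) as [I1 [I2 [HI1 [HI2 _]]]]. rewrite (is_left_unique _ _ _ HI1). exact HI1. }
  destruct (hol_param _ _ _ _ _ _ _ HM (fun x z => K (x, beta) z) (fun x => DK (x, beta))
    (fun z => CInt_gen (fun x => K (x, beta) z) (Rbar_locally m_infty) (at_point r)) z0 rho Hrho) as [l2 [L2 D2]].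
  { intros x z Hx Hz. apply H1; auto. apply on_U_up; auto. }
  { intros x z Hx Hz. apply (H3 (x, beta)); auto. apply on_U_up; auto. }
  { intros x z Hx Hz. apply (Ccont_CE (fun s => K s z)); [apply H2; auto; apply on_U_up; auto|apply Ccont_h]. }
  { intros x Hx. apply H4, on_U_up; auto. }
  { intros x Hx. apply (Ccont_CE DK); [apply H5, on_U_up; auto|apply Ccont_h]. }
  { intros z Hz. destruct (X z Hz) as [I1 [I2 [HI1 [HI2 _]]]]. rewrite (is_left_unique _ _ _ HI2). exact HI2. }
  destruct (hol_param _ _ _ _ _ _ _ HMs (fun y z => K (r, y) z) (fun y => DK (r, y))
    (fun z => CInt (fun y => K (r, y) z) (- beta) beta) z0 rho Hrho) as [l3 [L3 D3]].
  { intros y z Hy Hz. apply H1; auto. apply on_U_mid; auto. }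
  { intros y z Hy Hz. apply (H3 (r, y)); auto. apply on_U_mid; auto. }
  { intros y z Hy Hz. apply (Ccont_CE (fun s => K s z)); [apply H2; auto; apply on_U_mid; auto|apply Ccont_v]. }
  { intros y Hy. apply H4, on_U_mid; auto. }
  { intros y Hy. apply (Ccont_CE DK); [apply H5, on_U_mid; auto|apply Ccont_v]. }
  { intros z Hz. apply at_point_RInt, CInt_correct, (ex_CInt_v (fun s => K s z)); [lra|]. intros y Hy. apply H2; auto. apply on_U_mid; auto. }
  exists (l1 + Ci * l3 - l2)%C. split.
  - exists l1, l2. repeat split; auto. apply at_point_RInt, CInt_unique in L3. rewrite L3. reflexivity.
  - unfold UI. apply CD_minus; auto. apply CD_plus; auto. apply CD_scal; auto.
Qed.
End UContour.

Lemma is_left_scal (k : C) (phi : R -> C) (r : R) (I : C) : is_left phi r I -> is_left (fun x => k * phi x)%C r (k * I)%C.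
Proof. apply is_CInt_gen_scal; typeclasses eauto. Qed.

Lemma is_left_ext (phi psi : R -> C) (r : R) (I : C) : (forall x, x <= r -> phi x = psi x) -> is_left phi r I -> is_left psi r I.
Proof.
  intros E. apply (is_RInt_gen_ext (V := C_R_NormedModule)); try typeclasses eauto.
  exists (fun x => x < r) (fun x => x = r).
  - exists r. auto.
  - reflexivity.
  - simpl. intros x y Hx -> t. rewrite Rmin_left, Rmax_right by lra. intros Ht. apply E. lra.
Qed.

Lemma is_U_ext (phi psi : C -> C) (r beta : R) (I : C) : 0 <= beta -> (forall s, on_U r beta s -> phi s = psi s) ->
  is_U phi r beta I -> is_U psi r beta I.
Proof.
  intros Hb E [I1 [I2 [H1 [H2 ->]]]]. exists I1, I2. repeat split.
  - eapply is_left_ext; [|exact H1]. intros x Hx. apply E, on_U_low; auto.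
  - eapply is_left_ext; [|exact H2]. intros x Hx. apply E, on_U_up; auto.
  - f_equal. f_equal. f_equal. apply (RInt_ext (V := C_R_CompleteNormedModule)).
    rewrite Rmin_left, Rmax_right by lra. intros y Hy. apply E, on_U_mid. lra.
Qed.

Lemma is_U_scal (k : C) (phi : C -> C) (r beta : R) (I : C) : 0 <= beta -> (forall s, on_U r beta s -> CE phi s) ->
  is_U phi r beta I -> is_U (fun s => k * phi s)%C r beta (k * I)%C.
Proof.
  intros Hb Hphi [I1 [I2 [H1 [H2 ->]]]]. exists (k * I1)%C, (k * I2)%C. repeat split; try (apply is_left_scal; assumption).
  assert (E : CInt (fun y => k * phi (r, y))%C (- beta) beta = (k * CInt (fun y => phi (r, y)) (- beta) beta)%C).
  { apply CInt_unique, is_CInt_scal, CInt_correct, ex_CInt_v; [lra|]. intros y Hy. apply Hphi, on_U_mid; auto. }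
  rewrite E. ring.
Qed.

Lemma is_U_plus (phi psi : C -> C) (r beta : R) (I J : C) : 0 <= beta ->
  (forall s, on_U r beta s -> CE phi s) -> (forall s, on_U r beta s -> CE psi s) ->
  is_U phi r beta I -> is_U psi r beta J -> is_U (fun s => phi s + psi s)%C r beta (I + J)%C.
Proof.
  intros Hb Hphi Hpsi [I1 [I2 [H1 [H2 ->]]]] [J1 [J2 [H3 [H4 ->]]]].
  exists (I1 + J1)%C, (I2 + J2)%C. repeat split.
  - apply (is_RInt_gen_plus (V := C_R_NormedModule)); assumption.
  - apply (is_RInt_gen_plus (V := C_R_NormedModule)); assumption.
  - assert (E : CInt (fun y => phi (r, y) + psi (r, y))%C (- beta) beta =
      (CInt (fun y => phi (r, y)) (- beta) beta + CInt (fun y => psi (r, y)) (- beta) beta)%C).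
    { apply (RInt_plus (V := C_R_CompleteNormedModule)); (apply ex_CInt_v; [lra|]; intros y Hy);
      [apply Hphi|apply Hpsi]; apply on_U_mid; auto. }
    rewrite E. ring.
Qed.

Lemma is_left_eps (phi : R -> C) (r : R) (I : C) : is_left phi r I ->
  forall eps, 0 < eps -> exists X, forall a, a < X -> exists J, is_CInt phi a r J /\ Cmod (J - I) < eps.
Proof.
  intros H eps Heps. destruct (proj1 (is_CInt_gen_eps _ _ _ I) H eps Heps) as [P Q [M1 HP] HQ HPQ].
  exists M1. intros a Ha. apply (HPQ a r); auto.
Qed.

Lemma is_left_of_eps (phi : R -> C) (r : R) (I : C) :
  (forall eps, 0 < eps -> exists X, forall a, a < X -> exists J, is_CInt phi a r J /\ Cmod (J - I) < eps) -> is_left phi r I.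
Proof.
  intros H. apply is_CInt_gen_eps; try typeclasses eauto. intros eps Heps.
  destruct (H eps Heps) as [X HX].
  exists (fun a => a < X) (fun b => b = r); [exists X; auto|reflexivity|].
  intros a b Ha ->. apply HX; auto.
Qed.

(* The contour integral is the limit of rect plus the missing left side, which tends to 0. *)
Lemma is_U_rect (phi : C -> C) (r beta M X : R) (I A : C) : 0 <= beta ->
  is_U phi r beta I ->
  (forall a y, a <= X -> Rabs y <= beta -> CE phi (a, y) /\ Cmod (phi (a, y)) <= M * exp a) ->
  (forall a, a < X -> rect phi a r (- beta) beta = A) -> I = A.
Proof.
  intros Hb [I1 [I2 [H1 [H2 ->]]]] HX HA.
  apply Ceq_minus, Cmod_eq_0, Rle_antisym; [|apply Cmod_ge_0].
  apply le_epsilon. intros eps Heps. rewrite Rplus_0_l.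
  destruct (is_left_eps _ _ _ H1 (eps / 3)) as [X1 HX1]; [lra|].
  destruct (is_left_eps _ _ _ H2 (eps / 3)) as [X2 HX2]; [lra|].
  set (D := 2 * beta * Rabs M + 1). assert (HD : 0 < D) by (assert (T := Rabs_pos M); unfold D; nra).
  set (X3 := ln (eps / 3 / D)).
  set (a := Rmin (Rmin X1 X2) (Rmin X3 X) - 1).
  assert (Ha : a < X1 /\ a < X2 /\ a < X3 /\ a < X).
  { unfold a. assert (T1 := Rmin_l (Rmin X1 X2) (Rmin X3 X)). assert (T2 := Rmin_r (Rmin X1 X2) (Rmin X3 X)).
    assert (T3 := Rmin_l X1 X2). assert (T4 := Rmin_r X1 X2). assert (T5 := Rmin_l X3 X). assert (T6 := Rmin_r X3 X). lra. }
  destruct Ha as [A1 [A2 [A3 A4]]].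
  destruct (HX1 a A1) as [J1 [HJ1 EJ1]]. destruct (HX2 a A2) as [J2 [HJ2 EJ2]].
  specialize (HA a A4). unfold rect in HA.
  rewrite (CInt_unique _ _ _ _ HJ1), (CInt_unique _ _ _ _ HJ2) in HA.
  assert (V : Cmod (CInt (fun y => phi (a, y)) (- beta) beta) <= (beta - - beta) * (M * exp a)).
  { apply CInt_norm; [lra| |].
    - apply ex_CInt_v; [lra|]. intros y Hy. apply HX; [lra|apply Rabs_le; lra].
    - intros y Hy. apply HX; [lra|apply Rabs_le; lra]. }
  assert (E : exp a <= eps / 3 / D).
  { rewrite <- (exp_ln (eps / 3 / D)) by (repeat apply Rdiv_lt_0_compat; lra). apply exp_le. unfold X3 in A3. lra. }
  assert (E2 : (beta - - beta) * (M * exp a) <= eps / 3).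
  { apply Rmult_le_compat_l with (r := D) in E; [|lra].
    replace (D * (eps / 3 / D)) with (eps / 3) in E by (field; lra).
    assert (T := Rle_abs M). assert (T' := exp_pos a). unfold D in E.
    assert (M * exp a <= Rabs M * exp a) by (apply Rmult_le_compat_r; lra).
    assert (2 * beta * (M * exp a) <= 2 * beta * (Rabs M * exp a)) by (apply Rmult_le_compat_l; lra). lra. }
  replace (I1 + Ci * CInt (fun y => phi (r, y)) (- beta) beta - I2 - A)%C with
    ((J2 - I2) - (J1 - I1) + Ci * CInt (fun y => phi (a, y)) (- beta) beta)%C by (rewrite <- HA; ring).
  eapply Rle_trans; [apply Cmod_triangle|]. rewrite Cmod_mult, Cmod_Ci, Rmult_1_l.
  assert (T := Cmod_triangle_minus (J2 - I2) (J1 - I1)). lra.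
Qed.

(** The half lines are cut at [r'], and Goursat's theorem on the rectangle between the two vertical
    sides accounts for the difference. *)
Lemma is_U_shift (phi : C -> C) (r r' beta : R) (I : C) : 0 <= beta -> r' <= r ->
  (forall s, r' <= Re s <= r -> Rabs (Im s) <= beta -> CE phi s) ->
  is_U phi r beta I -> is_U phi r' beta I.
Proof.
  intros Hb Hr Hphi [I1 [I2 [H1 [H2 ->]]]].
  assert (K : forall y J, Rabs y <= beta -> is_left (fun x => phi (x, y)) r J ->
    is_left (fun x => phi (x, y)) r' (J - CInt (fun x => phi (x, y)) r' r)%C).
  { intros y J Hy HJ.
    assert (Ex : ex_CInt (fun x => phi (x, y)) r' r) by (apply ex_CInt_h; auto).
    apply CInt_correct in Ex.
    apply is_left_of_eps. intros eps Heps. destruct (is_left_eps _ _ _ HJ eps Heps) as [X HX].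
    exists X. intros a Ha. destruct (HX a Ha) as [L [HL EL]].
    exists (L - CInt (fun x => phi (x, y)) r' r)%C. split.
    - assert (S := is_RInt_Chasles (V := C_R_NormedModule) _ _ _ _ _ _ HL (is_RInt_swap (V := C_R_NormedModule) _ _ _ _ Ex)).
      exact S.
    - replace (L - CInt (fun x => phi (x, y)) r' r - (J - CInt (fun x => phi (x, y)) r' r))%C with (L - J)%C by ring. exact EL. }
  assert (Hy1 : Rabs (- beta) <= beta) by (rewrite Rabs_Ropp, Rabs_pos_eq; lra).
  assert (Hy2 : Rabs beta <= beta) by (rewrite Rabs_pos_eq; lra).
  exists (I1 - CInt (fun x => phi (x, - beta)%R) r' r)%C, (I2 - CInt (fun x => phi (x, beta)) r' r)%C.
  repeat split; [apply (K (- beta)); auto|apply (K beta); auto|].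
  assert (G : rect phi r' r (- beta) beta = RtoC 0).
  { apply goursat; auto; [lra|]. intros x y Hx Hy. apply Hphi; simpl; auto. apply Rabs_le; auto. }
  unfold rect in G. apply Ceq_minus. rewrite <- G. ring.
Qed.

Definition ee (w : C) : C := Cexp (Cexp w).

Lemma Cmod_ee (w : C) : Cmod (ee w) = exp (exp (Re w) * cos (Im w)).
Proof. unfold ee. rewrite Cmod_Cexp, Re_Cexp. reflexivity. Qed.

Lemma CD_ee (w : C) : CD ee w (ee w * Cexp w)%C.
Proof. unfold ee. apply (CD_comp Cexp Cexp); apply CD_Cexp. Qed.

Lemma CE_ee (w : C) : CE ee w.
Proof. eexists. apply CD_ee. Qed.

Lemma exp_neg_le_inv (y : R) : 0 < y -> exp (- y) <= / y.
Proof.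
  intros Hy. rewrite exp_Ropp. apply Rinv_le_contravar; auto. assert (T := exp_ineq1_le y). lra.
Qed.

(** The excess [dl] over [PI / 2] makes [cos (Im (w - s))] negative on both horizontal sides as long
    as [|Im w| < dl], so that [exp (exp (w - s))] is small there. *)
Definition Ubeta (dl : R) : R := PI / 2 + dl.

(* Majorant of |ee (w - s)| e^{- Re s} on the contour, for |Im w| <= d. *)
Definition EM (dl d r x : R) : R := exp (- x) / sin (dl - d) + exp (- r) * exp (exp (x - r)).

Lemma EM_mono (dl d r x x' rho : R) : 0 < sin (dl - d) -> Rabs (x' - x) <= rho ->
  EM dl d r x' <= exp (- x + rho) / sin (dl - d) + exp (- r) * exp (exp (x + rho - r)).
Proof.
  intros Hs Hx. apply Rabs_le_between in Hx. unfold EM. apply Rplus_le_compat.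
  - apply Rmult_le_compat_r; [apply Rlt_le, Rinv_0_lt_compat; auto|]. apply exp_le. lra.
  - apply Rmult_le_compat_l; [apply Rlt_le, exp_pos|]. apply exp_le, exp_le. lra.
Qed.

Section Kernel.
Context (dl d r : R) (Hdl : 0 < dl <= PI / 4) (Hd : 0 <= d < dl).

Lemma sin_gap_pos : 0 < sin (dl - d).
Proof. assert (T := PI_RGT_0). apply sin_gt_0; lra. Qed.

(** [dl <= PI / 4] keeps [|t|] below [PI], where the cosine is still decreasing; its value at the
    lower end [PI / 2 + (dl - d)] is the bound. *)
Lemma cos_gap (t : R) : Ubeta dl - d <= Rabs t <= Ubeta dl + d -> cos t <= - sin (dl - d).
Proof.
  unfold Ubeta. intros Ht. assert (T := PI_RGT_0).
  replace (cos t) with (cos (Rabs t)).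
  2:{ unfold Rabs. destruct Rcase_abs; [apply cos_neg|reflexivity]. }
  rewrite <- cos_shift. rewrite <- Rtrigo_facts.cos_pi_minus.
  replace (PI - (PI / 2 - (dl - d))) with (PI / 2 + (dl - d)) by field.
  destruct (Req_dec (PI / 2 + (dl - d)) (Rabs t)) as [->|]; [lra|].
  apply Rlt_le, cos_decreasing_1; lra.
Qed.

(** On the horizontal sides the doubly exponential decay is used only through [exp (- y) <= 1 / y];
    with [y = exp (Re w - Re s) * sin (dl - d)] this already gives the factor [exp (Re s)] that
    makes the contour integral converge. On the vertical side the trivial bound by
    [exp (exp (Re w - r))] is written with the same factor. *)
Lemma ee_bound (w s : C) : on_U r (Ubeta dl) s -> Rabs (Im w) <= d ->
  Cmod (ee (w - s)) <= EM dl d r (Re w) * exp (1 * Re s).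
Proof.
  intros [H1 [H2 H3]] Hw. assert (S := sin_gap_pos). assert (T := PI_RGT_0).
  rewrite Cmod_ee, Re_minus, Im_minus. unfold EM. rewrite Rmult_1_l.
  assert (Es := exp_pos (Re s)).
  assert (P1 : 0 < exp (- Re w) / sin (dl - d)) by (apply Rdiv_lt_0_compat; auto; apply exp_pos).
  assert (P2 : 0 < exp (- r) * exp (exp (Re w - r))) by (apply Rmult_lt_0_compat; apply exp_pos).
  assert (Horiz : Rabs (Im s) = Ubeta dl -> exp (exp (Re w - Re s) * cos (Im w - Im s)) <=
     exp (- Re w) / sin (dl - d) * exp (Re s)).
  { intros Hs.
    assert (G : cos (Im w - Im s) <= - sin (dl - d)).
    { apply cos_gap. split.
      - rewrite Rabs_minus_sym. eapply Rle_trans; [|apply Rabs_triang_inv]. lra.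
      - eapply Rle_trans; [apply Rabs_triang|]. rewrite Rabs_Ropp. lra. }
    assert (X := exp_pos (Re w - Re s)).
    apply Rle_trans with (exp (- (exp (Re w - Re s) * sin (dl - d)))).
    - apply exp_le. nra.
    - eapply Rle_trans; [apply exp_neg_le_inv, Rmult_lt_0_compat; auto|].
      right. unfold Rminus at 1. rewrite exp_plus, !exp_Ropp. field.
      assert (T1 := exp_pos (Re w)). repeat split; lra. }
  assert (Hb : 0 <= Ubeta dl) by (unfold Ubeta; lra).
  destruct H3 as [H3|[H3|H3]].
  - eapply Rle_trans; [apply Horiz; rewrite H3, Rabs_Ropp, Rabs_pos_eq; lra|]. apply Rmult_le_compat_r; lra.
  - eapply Rle_trans; [apply Horiz; rewrite H3, Rabs_pos_eq; lra|]. apply Rmult_le_compat_r; lra.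
  - apply Rle_trans with (exp (- r) * exp (exp (Re w - r)) * exp (Re s)).
    + rewrite H3. replace (exp (- r) * exp (exp (Re w - r)) * exp r) with (exp (exp (Re w - r))).
      * apply exp_le. assert (C := COS_bound (Im w - Im s)). assert (X := exp_pos (Re w - r)). nra.
      * rewrite exp_Ropp. field. apply Rgt_not_eq, exp_pos.
    + apply Rmult_le_compat_r; lra.
Qed.
End Kernel.

Definition BI (F : C -> C) (w s : C) : C := (F s * ee (w - s))%C.
Definition Bor (F : C -> C) (r dl : R) (w : C) : C := (UI (BI F w) r (Ubeta dl) / two_pi_i)%C.

Definition half_hol (F : C -> C) (r beta : R) : Prop := forall s, Re s <= r -> Rabs (Im s) <= beta -> CE F s.

Lemma CE_BI (F : C -> C) (w s : C) : CE F s -> CE (BI F w) s.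
Proof.
  intros H. unfold BI. apply CE_mult; auto. apply (CE_comp ee (fun s => w - s)%C); [ce|apply CE_ee].
Qed.

Section Borel.
Context (F : C -> C) (r dl M0 : R) (Hdl : 0 < dl <= PI / 4).
Context (HF : half_hol F r (Ubeta dl)).
Context (HM : forall s, Re s <= r -> Rabs (Im s) <= Ubeta dl -> Cmod (F s) <= M0).

Lemma Ubeta_pos : 0 <= Ubeta dl.
Proof. unfold Ubeta. assert (T := PI_RGT_0). lra. Qed.

Lemma HM_pos : 0 <= M0.
Proof.
  eapply Rle_trans; [apply Cmod_ge_0|apply (HM (r, 0))]; simpl; [lra|]. rewrite Rabs_R0. apply Ubeta_pos.
Qed.

Lemma BI_bound (d : R) (w s : C) : 0 <= d < dl -> on_U r (Ubeta dl) s -> Rabs (Im w) <= d ->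
  Cmod (BI F w s) <= M0 * EM dl d r (Re w) * exp (1 * Re s).
Proof.
  intros Hd Hs Hw. unfold BI. rewrite Cmod_mult, Rmult_assoc. apply Rmult_le_compat; auto using Cmod_ge_0.
  - apply HM; apply Hs.
  - apply ee_bound; auto.
Qed.

Lemma Bor_is_U (w : C) : Rabs (Im w) < dl -> is_U (BI F w) r (Ubeta dl) (two_pi_i * Bor F r dl w)%C.
Proof.
  intros Hw. assert (P := Rabs_pos (Im w)).
  destruct (U_ex r (Ubeta dl) 1 Ubeta_pos Rlt_0_1 (BI F w) (M0 * EM dl (Rabs (Im w)) r (Re w))) as [H _].
  - intros s Hs. apply CE_BI, HF; apply Hs.
  - intros s Hs. apply BI_bound; auto; lra.
  - unfold Bor. replace (two_pi_i * (UI (BI F w) r (Ubeta dl) / two_pi_i))%C with (UI (BI F w) r (Ubeta dl)); auto.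
    field. apply two_pi_i_neq_0.
Qed.

Lemma Bor_bound (d : R) (w : C) : 0 <= d < dl -> Rabs (Im w) <= d ->
  Cmod (Bor F r dl w) <= M0 * EM dl d r (Re w) * exp r * (2 + 2 * Ubeta dl).
Proof.
  intros Hd Hw.
  destruct (U_ex r (Ubeta dl) 1 Ubeta_pos Rlt_0_1 (BI F w) (M0 * EM dl d r (Re w))) as [_ H].
  - intros s Hs. apply CE_BI, HF; apply Hs.
  - intros s Hs. apply BI_bound; auto; lra.
  - unfold Bor. rewrite Cmod_div, Cmod_two_pi_i by apply two_pi_i_neq_0.
    rewrite Rmult_1_l in H. replace (2 / 1) with 2 in H by field.
    assert (T := PI_gt_3). assert (T' := Cmod_ge_0 (UI (BI F w) r (Ubeta dl))).
    eapply Rle_trans; [|exact H].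
    apply Rmult_le_reg_r with (2 * PI); [lra|]. unfold Rdiv. rewrite Rmult_assoc, Rinv_l by lra. nra.
Qed.

Lemma Bor_CD (w : C) : Rabs (Im w) < dl -> exists l, is_U (fun s => F s * (ee (w - s) * Cexp (w - s)))%C r (Ubeta dl) l /\
  CD (Bor F r dl) w (l / two_pi_i)%C.
Proof.
  (* Half way between [|Im w|] and [dl]: the square of half side [rho] around [w] stays in the strip
     of half height [d], where one majorant with the fixed [sin (dl - d)] is valid. *)
  intros Hw. set (d := (Rabs (Im w) + dl) / 2). set (rho := (dl - Rabs (Im w)) / 2).
  assert (P := Rabs_pos (Im w)).
  assert (Hd : 0 <= d < dl) by (unfold d; lra). assert (Hr : 0 < rho) by (unfold rho; lra).
  assert (S := sin_gap_pos dl d Hdl Hd).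
  set (EMX := exp (- Re w + rho) / sin (dl - d) + exp (- r) * exp (exp (Re w + rho - r))).
  destruct (U_hol r (Ubeta dl) 1 Ubeta_pos Rlt_0_1 (fun s z => BI F z s) (fun s => F s * (ee (w - s) * Cexp (w - s)))%C
    (M0 * EMX) rho w Hr) as [l [H1 H2]].
  - intros s z _ _. unfold BI. apply CE_mult; [apply CE_const|]. apply (CE_comp ee (fun z => z - s)%C); [ce|apply CE_ee].
  - intros s z Hs _. apply CE_BI, HF; apply Hs.
  - intros s z Hs Hz. eapply Rle_trans; [apply (BI_bound d z s Hd Hs)|].
    + destruct Hz as [_ Hz]. unfold rho in Hz. unfold d.
      replace (Im z) with ((Im z - Im w) + Im w) by ring. eapply Rle_trans; [apply Rabs_triang|]. lra.
    + apply Rmult_le_compat_r; [apply Rlt_le, exp_pos|]. apply Rmult_le_compat_l; [apply HM_pos|].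
      apply EM_mono; auto. apply Hz.
  - intros s _. unfold BI. eapply CD_eq; [|apply CD_mult; [apply CD_const|
      apply (CD_comp ee (fun z => z - s)%C); [apply CD_minus; [apply CD_id|apply CD_const]|apply CD_ee]]].
    cbv beta. ring.
  - intros s Hs. apply CE_mult; [apply HF; apply Hs|]. apply CE_mult; [|ce].
    apply (CE_comp ee (fun s => w - s)%C); [ce|apply CE_ee].
  - exists l. split; auto. unfold Bor, Cdiv. eapply CD_eq; [|apply CD_mult; [exact H2|apply CD_const]]. cbv beta. ring.
Qed.

(** For [Re w >= 0] the vertical side dominates. Its type is [exp (- r)], and in
    [exp (Re w) = |u|^m] this is growth of order [m]. *)
Lemma Bor_growth (d : R) : 0 <= d < dl -> exists B, 0 < B /\ forall w, Rabs (Im w) <= d -> 0 <= Re w ->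
  Cmod (Bor F r dl w) <= B * exp (exp (- r) * exp (Re w)).
Proof.
  intros Hd. assert (S := sin_gap_pos dl d Hdl Hd). assert (UB := Ubeta_pos). assert (M := HM_pos).
  exists (M0 * (/ sin (dl - d) + exp (- r)) * exp r * (2 + 2 * Ubeta dl) + 1).
  assert (Q : 0 < / sin (dl - d)) by (apply Rinv_0_lt_compat; auto). assert (Q' := exp_pos (- r)). assert (Q2 := exp_pos r).
  split.
  { assert (0 <= M0 * (/ sin (dl - d) + exp (- r)) * exp r * (2 + 2 * Ubeta dl)) by (repeat apply Rmult_le_pos; lra). lra. }
  intros w Hw Hre. eapply Rle_trans; [apply (Bor_bound d w Hd Hw)|].
  assert (E1 : 1 <= exp (exp (- r) * exp (Re w))).
  { rewrite <- exp_0 at 1. apply exp_le. apply Rmult_le_pos; apply Rlt_le, exp_pos. }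
  assert (E2 : EM dl d r (Re w) <= (/ sin (dl - d) + exp (- r)) * exp (exp (- r) * exp (Re w))).
  { unfold EM. rewrite Rmult_plus_distr_r. apply Rplus_le_compat.
    - assert (exp (- Re w) <= 1) by (rewrite <- exp_0; apply exp_le; lra).
      assert (T := exp_pos (- Re w)). unfold Rdiv. nra.
    - right. f_equal. f_equal. unfold Rminus. rewrite exp_plus. ring. }
  replace (M0 * EM dl d r (Re w) * exp r * (2 + 2 * Ubeta dl)) with (M0 * exp r * (2 + 2 * Ubeta dl) * EM dl d r (Re w)) by ring.
  apply Rle_trans with (M0 * exp r * (2 + 2 * Ubeta dl) * ((/ sin (dl - d) + exp (- r)) * exp (exp (- r) * exp (Re w)))).
  - apply Rmult_le_compat_l; auto. repeat apply Rmult_le_pos; lra.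
  - replace (M0 * exp r * (2 + 2 * Ubeta dl) * ((/ sin (dl - d) + exp (- r)) * exp (exp (- r) * exp (Re w)))) with
      (M0 * (/ sin (dl - d) + exp (- r)) * exp r * (2 + 2 * Ubeta dl) * exp (exp (- r) * exp (Re w))) by ring.
    apply Rmult_le_compat_r; lra.
Qed.
End Borel.

(* Moving the vertical side to Re s = Re w - ln (n + 1) balances e^{n p Re s} against exp (e^{Re w - Re s}). *)
Lemma Bor_remainder (F : C -> C) (r dl d N p : R) (n : nat) (w : C) : 0 < dl <= PI / 4 -> 0 <= d < dl -> 0 < p -> 0 <= N ->
  half_hol F r (Ubeta dl) ->
  (forall s, Re s <= r -> Rabs (Im s) <= Ubeta dl -> Cmod (F s) <= N * exp (INR n * p * Re s)) ->
  Rabs (Im w) <= d -> Re w <= r ->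
  Cmod (Bor F r dl w) <= N * exp (INR n * p * Re w) * / Rpower ((INR n + 1) ^ n) p *
     ((/ sin (dl - d) + 1) * exp (INR n + 1)) * (2 + 2 * Ubeta dl).
Proof.
  intros Hdl Hd Hp HN HF HM Hw Hr. assert (Pn := pos_INR n).
  set (r' := Re w - ln (INR n + 1)).
  assert (Hln : 0 <= ln (INR n + 1)).
  { rewrite <- ln_1. destruct (Req_dec (INR n) 0) as [->|]; [rewrite Rplus_0_l; lra|]. apply Rlt_le, ln_increasing; lra. }
  assert (Hr' : r' <= r) by (unfold r'; lra).
  assert (UB := Ubeta_pos dl Hdl).
  assert (HM1 : forall s, Re s <= r -> Rabs (Im s) <= Ubeta dl -> Cmod (F s) <= N * exp (INR n * p * r)).
  { intros s H1 H2. eapply Rle_trans; [apply HM; auto|]. apply Rmult_le_compat_l; auto. apply exp_le.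
    apply Rmult_le_compat_l; auto. apply Rmult_le_pos; lra. }
  assert (HM2 : forall s, Re s <= r' -> Rabs (Im s) <= Ubeta dl -> Cmod (F s) <= N * exp (INR n * p * r')).
  { intros s H1 H2. eapply Rle_trans; [apply HM; auto; lra|]. apply Rmult_le_compat_l; auto. apply exp_le.
    apply Rmult_le_compat_l; auto. apply Rmult_le_pos; lra. }
  assert (HF' : half_hol F r' (Ubeta dl)) by (intros s H1 H2; apply HF; lra).
  assert (E : Bor F r dl w = Bor F r' dl w).
  { assert (B1 := Bor_is_U F r dl _ Hdl HF HM1 w ltac:(lra)).
    assert (B2 := Bor_is_U F r' dl _ Hdl HF' HM2 w ltac:(lra)).
    apply (is_U_shift _ r r') in B1; auto.
    - apply is_U_unique in B1, B2. rewrite B1 in B2.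
      replace (Bor F r dl w) with (two_pi_i * Bor F r dl w / two_pi_i)%C by (field; apply two_pi_i_neq_0).
      rewrite B2. field. apply two_pi_i_neq_0.
    - intros s H1 H2. apply CE_BI, HF; auto. lra. }
  rewrite E. eapply Rle_trans; [apply (Bor_bound F r' dl _ Hdl HF' HM2 d w Hd Hw)|].
  assert (S := sin_gap_pos dl d Hdl Hd).
  replace (N * exp (INR n * p * r') * EM dl d r' (Re w) * exp r' * (2 + 2 * Ubeta dl)) with
    (N * exp (INR n * p * r') * (EM dl d r' (Re w) * exp r') * (2 + 2 * Ubeta dl)) by ring.
  apply Rmult_le_compat_r; [lra|].
  assert (E1 : exp (INR n * p * r') = exp (INR n * p * Re w) * / Rpower ((INR n + 1) ^ n) p).
  { unfold r'. unfold Rminus. rewrite Rmult_plus_distr_l, exp_plus. f_equal.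
    rewrite <- (exp_ln (INR n + 1)) at 2 by lra. rewrite <- Rpower_pow_exp, <- exp_Ropp. f_equal. ring. }
  rewrite E1, <- (Rmult_assoc N (exp (INR n * p * Re w))). apply Rmult_le_compat_l.
  { repeat apply Rmult_le_pos; auto; [apply Rlt_le, exp_pos|]. apply Rlt_le, Rinv_0_lt_compat, exp_pos. }
  unfold EM. replace (Re w - r') with (ln (INR n + 1)) by (unfold r'; ring). rewrite exp_ln by lra.
  rewrite Rmult_plus_distr_r.
  replace (exp (- r') * exp (INR n + 1) * exp r') with (exp (INR n + 1)).
  2:{ rewrite (Rmult_comm (exp (- r'))), Rmult_assoc, <- exp_plus. replace (- r' + r') with 0 by ring. rewrite exp_0. ring. }
  replace (exp (- Re w) / sin (dl - d) * exp r') with (/ sin (dl - d) * / (INR n + 1)).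
  2:{ assert (Er : exp r' = exp (Re w) * / (INR n + 1)).
      { unfold r', Rminus. rewrite exp_plus, exp_Ropp, exp_ln by lra. reflexivity. }
      rewrite Er, exp_Ropp. field. assert (T := exp_pos (Re w)). repeat split; lra. }
  rewrite Rmult_plus_distr_r, Rmult_1_l. apply Rplus_le_compat_r.
  apply Rmult_le_compat_l; [apply Rlt_le, Rinv_0_lt_compat; auto|].
  apply Rle_trans with 1.
  - rewrite <- Rinv_1. apply Rinv_le_contravar; lra.
  - assert (T := exp_ineq1_le (INR n + 1)). lra.
Qed.

(** * The Laplace transform inverts the Borel transform *)

Lemma Cexp_eq_1 (w : C) : Cexp w = RtoC 1 -> Rabs (Im w) < 2 * PI -> w = RtoC 0.
Proof.
  intros H Hw. assert (HPI := PI_RGT_0).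
  assert (Hr : Re w = 0).
  { assert (E := Cmod_Cexp w). rewrite H, Cmod_1 in E. rewrite <- exp_0 in E. symmetry. apply exp_inv, E. }
  assert (Hc : cos (Im w) = 1).
  { assert (E : Re (Cexp w) = 1) by (rewrite H; reflexivity). rewrite Re_Cexp, Hr, exp_0 in E. lra. }
  assert (Hi : Im w = 0).
  { replace (Im w) with (2 * (Im w / 2)) in Hc by field. rewrite cos_2a_sin in Hc.
    assert (Hs : sin (Im w / 2) = 0) by nra.
    apply Rabs_lt_between in Hw.
    destruct (Rtotal_order (Im w) 0) as [L|[E|L]]; auto; exfalso.
    - assert (0 < sin (- (Im w / 2))) by (apply sin_gt_0; lra). rewrite sin_neg in H0. lra.
    - assert (0 < sin (Im w / 2)) by (apply sin_gt_0; lra). lra. }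
  rewrite (Re_Im_C w), Hr, Hi. ring.
Qed.

(** The left side is an integral over the segment from 0 to [w], in a half plane where [exp (- t)]
    has modulus at most 1. *)
Lemma one_minus_Cexp_le (w : C) : 0 <= Re w -> Cmod (1 - Cexp (- w)) <= Cmod w.
Proof.
  intros Hw.
  assert (H : is_CInt (fun t => Cexp (- (0 + RtoC t * w)) * w)%C 0 1 (- Cexp (- (0 + RtoC 1 * w)) - - Cexp (- (0 + RtoC 0 * w)))%C).
  { apply (is_CInt_primitive _ (fun t => - Cexp (- (0 + RtoC t * w)))%C); [lra| |].
    - intros x _. apply (RD_affine (fun s => - Cexp (- s))%C (RtoC 0) w).
      eapply CD_eq; [|apply CD_opp, (CD_comp Cexp (fun s => - s)%C); [apply CD_opp, CD_id|apply CD_Cexp]]. ring.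
    - intros x _. apply Ccont_mult; [|apply Ccont_const].
      apply (Ccont_CE (fun s => Cexp (- s))); [ce|apply Ccont_affine]. }
  replace (1 - Cexp (- w))%C with (- Cexp (- (0 + RtoC 1 * w)) - - Cexp (- (0 + RtoC 0 * w)))%C.
  - rewrite Cmod_norm. replace (Cmod w) with ((1 - 0) * Cmod w) by ring.
    refine (norm_RInt_le_const (V := C_R_NormedModule) _ 0 1 _ _ _ _ H); [lra|].
    intros x Hx. rewrite <- Cmod_norm, Cmod_mult, Cmod_Cexp.
    rewrite <- (Rmult_1_l (Cmod w)) at 2. apply Rmult_le_compat_r; [apply Cmod_ge_0|].
    rewrite <- exp_0. apply exp_le. rewrite re_opp, re_plus, re_scal_l. simpl. nra.
  - replace (- (0 + RtoC 1 * w))%C with (- w)%C by ring. replace (- (0 + RtoC 0 * w))%C with (RtoC 0) by ring.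
    rewrite Cexp_0. ring.
Qed.

(** Interpolation between two bounds, one integrable along the contour but not small, the other
    small but not integrable. *)
Lemma le_sqrt_of_le (x a b : R) : 0 <= x -> x <= a -> x <= b -> x <= sqrt (a * b).
Proof.
  intros H1 H2 H3. rewrite <- (sqrt_square x) by auto. apply sqrt_le_1_alt. nra.
Qed.

Section Inversion.
Context (F : C -> C) (r dl M0 : R) (zeta : C) (Hdl : 0 < dl <= PI / 4).
Context (HF : half_hol F r (Ubeta dl)).
Context (HM : forall s, Re s <= r -> Rabs (Im s) <= Ubeta dl -> Cmod (F s) <= M0).
Context (Hz1 : Rabs (Im zeta) < PI / 2) (Hz2 : exp (- r) < Re (Cexp (- zeta))).

Let c0 := Re (Cexp (- zeta)) - exp (- r).
Let dd (s : C) := (Cexp (- zeta) - Cexp (- s))%C.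
Let GG (s : C) := (1 - Cexp (zeta - s))%C.
Let DM := exp (- Re zeta) * (/ sin dl + exp (- r) / c0).
(** The primitive in [w] of [kap (w - zeta) * ee (w - s)] that tends to 0 at [Re w = -oo]: the
    product is [exp (w - zeta) * exp (- exp w * dd s)], and [GG s = exp zeta * dd s]. At [+oo] it
    tends to [1 / GG s], which has a simple pole with residue 1 at [s = zeta]. *)
Let Q (w s : C) := ((1 - Cexp (- (Cexp w * dd s))) / GG s)%C.
Let beta := Ubeta dl.

Lemma c0_pos : 0 < c0.
Proof. unfold c0. lra. Qed.

Lemma beta_pos : 0 <= beta.
Proof. apply Ubeta_pos, Hdl. Qed.

Lemma beta_lt : beta <= 3 * PI / 4.
Proof. unfold beta, Ubeta. lra. Qed.

Lemma sin_dl_pos : 0 < sin dl.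
Proof. assert (T := PI_RGT_0). apply sin_gt_0; lra. Qed.

Lemma GG_dd (s : C) : GG s = (Cexp zeta * dd s)%C.
Proof.
  unfold GG, dd. replace (Cexp (zeta - s))%C with (Cexp zeta * Cexp (- s))%C by (rewrite <- Cexp_plus; f_equal; ring).
  replace (RtoC 1) with (Cexp zeta * Cexp (- zeta))%C at 1.
  - ring.
  - rewrite <- Cexp_plus. replace (zeta + - zeta)%C with (RtoC 0) by ring. apply Cexp_0.
Qed.

Lemma cos_beta_horizontal (s : C) : Im s = - beta \/ Im s = beta -> cos (Im (- s)) = - sin dl.
Proof.
  assert (E : cos beta = - sin dl).
  { unfold beta, Ubeta. replace (PI / 2 + dl) with (PI - (PI / 2 - dl)) by field.
    rewrite Rtrigo_facts.cos_pi_minus, cos_shift. reflexivity. }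
  rewrite im_opp. intros [-> | ->]; rewrite ?Ropp_involutive, ?cos_neg; auto.
Qed.

(** On the vertical side [Re (dd s)] is at least [Re (exp (- zeta)) - exp (- r) = c0]. On the
    horizontal sides [- cos (Im s) = sin dl], so it is even at least [sin dl * exp (- Re s)]. The
    first keeps [exp (- exp w * dd s)] bounded for real [w], the second makes [1 / dd s] decay
    towards the left. *)
Lemma Re_dd (s : C) : on_U r beta s ->
  c0 <= Re (dd s) /\ (/ Cmod (dd s) <= (/ sin dl + exp (- r) / c0) * exp (Re s)).
Proof.
  intros [H1 [H2 H3]]. assert (S := sin_dl_pos). assert (C0 := c0_pos).
  assert (Er := exp_pos (- r)). assert (Es := exp_pos (Re s)).
  unfold dd. rewrite Re_minus, (Re_Cexp (- s)), re_opp.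
  assert (Em := exp_pos (- Re s)).
  assert (Ex : exp (- Re s) * exp (Re s) = 1) by (rewrite <- exp_plus; replace (- Re s + Re s) with 0 by ring; apply exp_0).
  assert (P1 : 0 < / sin dl) by (apply Rinv_0_lt_compat; auto).
  assert (P2 : 0 < exp (- r) / c0) by (apply Rdiv_lt_0_compat; auto).
  set (X := (Cexp (- zeta) - Cexp (- s))%C).
  assert (HX : Re X <= Cmod X) by (eapply Rle_trans; [apply Rle_abs|apply re_le_Cmod]).
  assert (EX : Re X = Re (Cexp (- zeta)) - exp (- Re s) * cos (Im (- s))).
  { unfold X. rewrite Re_minus, (Re_Cexp (- s)), re_opp. reflexivity. }
  rewrite <- EX.
  destruct (Req_dec (Re s) r) as [E|E].
  - assert (K : c0 <= Re X).
    { rewrite EX, E. unfold c0. assert (T := COS_bound (Im (- s))). nra. }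
    split; auto.
    apply Rle_trans with (exp (- r) / c0 * exp (Re s)).
    + rewrite E. replace (exp (- r) / c0 * exp r) with (/ c0).
      * apply Rinv_le_contravar; lra.
      * rewrite E in Ex. unfold Rdiv. rewrite (Rmult_comm (exp (- r))), Rmult_assoc, Ex. ring.
    + apply Rmult_le_compat_r; lra.
  - rewrite cos_beta_horizontal in EX by (destruct H3 as [|[|]]; auto; contradiction).
    assert (K : c0 <= Re X) by (rewrite EX; unfold c0; nra).
    split; auto.
    apply Rle_trans with (/ sin dl * exp (Re s)); [|apply Rmult_le_compat_r; lra].
    replace (/ sin dl * exp (Re s)) with (/ (sin dl * exp (- Re s))).
    + apply Rinv_le_contravar; [apply Rmult_lt_0_compat; auto|]. unfold c0 in *. lra.
    + rewrite exp_Ropp. field. split; lra.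
Qed.

Lemma dd_neq (s : C) : on_U r beta s -> dd s <> RtoC 0.
Proof.
  intros Hs E. destruct (Re_dd s Hs) as [H _]. rewrite E in H. simpl in H. assert (C0 := c0_pos). lra.
Qed.

Lemma GG_neq_U (s : C) : on_U r beta s -> GG s <> RtoC 0.
Proof. intros Hs. rewrite GG_dd. apply Cmult_neq_0; [apply Cexp_neq_0|apply dd_neq; auto]. Qed.

Lemma GG_bound (s : C) : on_U r beta s -> Cmod (/ GG s) <= DM * exp (Re s).
Proof.
  intros Hs. rewrite GG_dd, Cmod_inv by (apply Cmult_neq_0; [apply Cexp_neq_0|apply dd_neq; auto]).
  rewrite Cmod_mult, Cmod_Cexp, Rinv_mult. unfold DM. rewrite Rmult_assoc, <- exp_Ropp.
  apply Rmult_le_compat_l; [apply Rlt_le, exp_pos|]. apply Re_dd; auto.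
Qed.

Lemma CE_dd (s : C) : CE dd s.
Proof. unfold dd. ce. Qed.
Lemma CE_GG (s : C) : CE GG s.
Proof. unfold GG. ce. Qed.

Lemma DM_pos : 0 < DM.
Proof.
  assert (S := sin_dl_pos). assert (C0 := c0_pos). unfold DM. apply Rmult_lt_0_compat; [apply exp_pos|].
  assert (0 < / sin dl) by (apply Rinv_0_lt_compat; auto).
  assert (0 < exp (- r) / c0) by (apply Rdiv_lt_0_compat; auto; apply exp_pos). lra.
Qed.

Lemma M0_pos : 0 <= M0.
Proof. apply (HM_pos F r dl M0 Hdl HM). Qed.

Lemma exp_dd_split (w s : C) : (Cexp (- (Cexp w * dd s)) = Cexp (- Cexp (w - zeta)) * ee (w - s))%C.
Proof.
  unfold ee. rewrite <- Cexp_plus. f_equal. unfold dd.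
  replace (Cexp (w - zeta)) with (Cexp w * Cexp (- zeta))%C by (rewrite <- Cexp_plus; f_equal).
  replace (Cexp (w - s)) with (Cexp w * Cexp (- s))%C by (rewrite <- Cexp_plus; f_equal). ring.
Qed.

(** For real [w] the sign of [Re (dd s)] would suffice; differentiation under the integral needs a
    bound on a complex neighbourhood, and there the two factors of [exp_dd_split] are estimated
    separately. *)
Lemma exp_dd_bound (w s : C) : on_U r beta s -> Rabs (Im w) <= dl -> Rabs (Im w - Im zeta) <= PI / 2 ->
  Cmod (Cexp (- (Cexp w * dd s))) <= exp (exp (Re w - r)).
Proof.
  intros [H1 [H2 H3]] Hw Hwz. assert (HPI := PI_RGT_0). assert (B := beta_pos).
  rewrite exp_dd_split, Cmod_mult, Cmod_ee, Cmod_Cexp, re_opp, Re_Cexp, !Re_minus, !Im_minus.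
  rewrite <- (Rmult_1_l (exp (exp (Re w - r)))).
  apply Rmult_le_compat; try (apply Rlt_le, exp_pos).
  - rewrite <- exp_0. apply exp_le.
    assert (0 <= cos (Im w - Im zeta)) by (apply Rabs_le_between in Hwz; apply cos_ge_0; lra).
    assert (T := exp_pos (Re w - Re zeta)). nra.
  - apply exp_le. assert (X := exp_pos (Re w - Re s)). assert (Y := exp_pos (Re w - r)).
    destruct (Req_dec (Re s) r) as [->|E].
    + assert (C := COS_bound (Im w - Im s)). nra.
    + assert (Hs : Rabs (Im s) = beta).
      { destruct H3 as [-> | [-> | H3]]; [rewrite Rabs_Ropp, Rabs_pos_eq; auto|rewrite Rabs_pos_eq; auto|contradiction]. }
      assert (C : cos (Im w - Im s) <= 0).
      { assert (G1 : PI / 2 <= Rabs (Im w - Im s)).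
        { rewrite Rabs_minus_sym. eapply Rle_trans; [|apply Rabs_triang_inv]. unfold beta, Ubeta in Hs. lra. }
        assert (G2 : Rabs (Im w - Im s) <= PI).
        { eapply Rle_trans; [apply Rabs_triang|]. rewrite Rabs_Ropp. unfold beta, Ubeta in Hs. lra. }
        replace (cos (Im w - Im s)) with (cos (Rabs (Im w - Im s))).
        2:{ unfold Rabs. destruct Rcase_abs; [apply cos_neg|reflexivity]. }
        apply cos_le_0; lra. }
      nra.
Qed.

Let T (w : C) := UI (fun s => F s * Q w s)%C r beta.

Lemma CE_FQ (w s : C) : on_U r beta s -> CE (fun s => F s * Q w s)%C s.
Proof.
  intros Hs. apply CE_mult; [apply HF; apply Hs|]. unfold Q. apply CE_div; [|apply CE_GG|apply GG_neq_U; auto].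
  apply CE_minus; [apply CE_const|]. apply (CE_comp Cexp); [|apply CE_Cexp].
  apply CE_opp. apply CE_mult; [apply CE_const|apply CE_dd].
Qed.

(** Differentiating [Q] under the contour integral cancels the denominator [GG] and leaves
    [kap (w - zeta)] times the Borel integrand. This is the exchange of the two integrations. *)
Lemma T_CD (x : R) : CD T (x, 0) (kap ((x, 0) - zeta) * (two_pi_i * Bor F r dl (x, 0)))%C.
Proof.
  set (rho := Rmin dl (PI / 2 - Rabs (Im zeta))).
  assert (Hrho : 0 < rho) by (apply Rmin_glb_lt; lra).
  assert (R1 : rho <= dl) by apply Rmin_l. assert (R2 : rho <= PI / 2 - Rabs (Im zeta)) by apply Rmin_r.
  assert (D := DM_pos). assert (M := M0_pos).
  set (w0 := (x, 0) : C).
  destruct (U_hol r beta 1 beta_pos Rlt_0_1 (fun s w => F s * Q w s)%C (fun s => F s * (kap (w0 - zeta) * ee (w0 - s)))%C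
    (M0 * (1 + exp (exp (x + rho - r))) * DM) rho w0 Hrho) as [l [H1 H2]].
  - intros s w Hs Hw. apply CE_mult; [apply CE_const|]. unfold Q.
    apply CE_mult; [|apply CE_const]. ce.
  - intros s w Hs Hw. apply CE_FQ; auto.
  - intros s w Hs [Hw1 Hw2]. simpl in Hw1, Hw2. rewrite Rminus_0_r in Hw2. apply Rabs_le_between in Hw1.
    rewrite Cmod_mult, !Rmult_assoc. apply Rmult_le_compat; auto using Cmod_ge_0.
    { apply HM; apply Hs. }
    unfold Q, Cdiv. rewrite Cmod_mult. rewrite Rmult_1_l. apply Rmult_le_compat; auto using Cmod_ge_0.
    + eapply Rle_trans; [apply Cmod_triangle_minus|]. rewrite Cmod_1. apply Rplus_le_compat_l.
      eapply Rle_trans; [apply exp_dd_bound; auto; try lra|].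
      * eapply Rle_trans; [apply Rabs_triang|]. rewrite Rabs_Ropp. lra.
      * apply exp_le, exp_le. lra.
    + apply GG_bound; auto.
  - intros s Hs. assert (N := GG_neq_U s Hs).
    eapply CD_eq; [|apply CD_mult; [apply CD_const|]].
    2:{ unfold Q. apply CD_mult; [|apply CD_const]. apply CD_minus; [apply CD_const|].
        apply (CD_comp Cexp); [|apply CD_Cexp]. apply CD_opp. apply CD_mult; [apply CD_Cexp|apply CD_const]. }
    cbv beta. rewrite exp_dd_split.
    assert (E : (dd s * / GG s)%C = Cexp (- zeta)).
    { rewrite GG_dd, Cexp_opp. assert (N1 := Cexp_neq_0 zeta). assert (N2 := dd_neq s Hs). field. auto. }
    replace (kap (w0 - zeta)) with (Cexp w0 * Cexp (- zeta) * Cexp (- Cexp (w0 - zeta)))%C.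
    2:{ unfold kap. rewrite <- !Cexp_plus. f_equal. }
    rewrite <- E. ring.
  - intros s Hs. apply CE_mult; [apply HF; apply Hs|]. apply CE_mult; [apply CE_const|].
    apply (CE_comp ee (fun s => w0 - s)%C); [ce|apply CE_ee].
  - assert (Hi : Rabs (Im w0) < dl) by (simpl; rewrite Rabs_R0; lra).
    assert (B := Bor_is_U F r dl M0 Hdl HF HM w0 Hi).
    apply (is_U_scal (kap (w0 - zeta))) in B; [|apply beta_pos|intros s Hs; apply CE_BI, HF; apply Hs].
    apply is_U_ext with (psi := (fun s => F s * (kap (w0 - zeta) * ee (w0 - s)))%C) in B;
      [|apply beta_pos|intros s _; unfold BI; ring].
    apply is_U_unique in B, H1. rewrite <- B. fold beta. rewrite H1. exact H2.
Qed.

(** In the closed half strip [1 - exp (zeta - s)] vanishes only at [zeta], as [|Im (zeta - s)| < PI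
    / 2 + 3 * PI / 4 < 2 * PI]. Closing the contour far to the left, where the quotient is of size
    [exp a], leaves this residue; [1 - exp (- h) = h + O(h^2)] shows that it equals [F zeta]. *)
Lemma U_F_over_GG : is_U (fun s => F s / GG s)%C r beta (two_pi_i * F zeta)%C.
Proof.
  assert (D := DM_pos). assert (M := M0_pos). assert (B := beta_pos). assert (HPI := PI_RGT_0).
  assert (Ez : exp (- r) < exp (- Re zeta)).
  { eapply Rlt_le_trans; [exact Hz2|]. rewrite Re_Cexp, re_opp. assert (T1 := COS_bound (Im (- zeta))).
    assert (T2 := exp_pos (- Re zeta)). nra. }
  assert (Hzr : Re zeta < r) by (apply exp_lt_inv in Ez; lra).
  assert (NZ : forall s, Re s <= r -> Rabs (Im s) <= beta -> s <> zeta -> GG s <> RtoC 0).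
  { intros s H1 H2 H3 E. apply H3. unfold GG in E.
    assert (E1 : Cexp (zeta - s) = RtoC 1) by (symmetry; apply Ceq_minus; exact E).
    apply Cexp_eq_1 in E1.
    - replace s with (zeta - (zeta - s))%C by ring. rewrite E1. ring.
    - rewrite Im_minus. eapply Rle_lt_trans; [apply Rabs_triang|]. rewrite Rabs_Ropp. assert (T1 := beta_lt). lra. }
  destruct (U_ex r beta 1 B Rlt_0_1 (fun s => F s / GG s)%C (M0 * DM)) as [H _].
  { intros s Hs. apply CE_div; [apply HF; apply Hs|apply CE_GG|apply GG_neq_U; auto]. }
  { intros s Hs. unfold Cdiv. rewrite Cmod_mult, Rmult_1_l, Rmult_assoc. apply Rmult_le_compat; auto using Cmod_ge_0.
    - apply HM; apply Hs.
    - apply GG_bound; auto. }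
  assert (E : UI (fun s => F s / GG s)%C r beta = (two_pi_i * F zeta)%C); [|rewrite <- E; exact H].
  apply (is_U_rect _ r beta (2 * M0 * exp (- Re zeta)) (Re zeta - 1) _ (two_pi_i * F zeta)%C B H).
  - intros a y Ha Hy.
    assert (Hs : ((a, y) : C) <> zeta) by (apply Cpair_neq; left; lra).
    split.
    { apply CE_div; [apply HF; simpl; auto; lra|apply CE_GG|apply NZ; simpl; auto; lra]. }
    assert (G : exp (Re zeta - a) / 2 <= Cmod (GG (a, y))).
    { unfold GG. rewrite Cmod_minus_sym. assert (T1 := Cmod_reverse (Cexp (zeta - (a, y))) 1).
      rewrite Cmod_Cexp, Cmod_1, Re_minus in T1. simpl in T1. fold (Re zeta) in T1.
      assert (T2 := exp_ineq1_le (Re zeta - a)). lra. }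
    assert (Ep := exp_pos (Re zeta - a)).
    rewrite Cmod_div by (apply NZ; simpl; auto; lra).
    replace (2 * M0 * exp (- Re zeta) * exp a) with (M0 / (exp (Re zeta - a) / 2)).
    + apply div_le_of_ge; auto using Cmod_ge_0; [|lra]. apply HM; simpl; auto; lra.
    + unfold Rminus. rewrite exp_plus, !exp_Ropp. field. split; apply Rgt_not_eq, exp_pos.
  - intros a Ha.
    assert (Hzi := Hz1). apply Rabs_lt_between in Hzi.
    assert (Hcz : CE F zeta) by (apply HF; [lra|unfold Ubeta; lra]).
    destruct Hcz as [l Hl]. destruct (CD_lipschitz F zeta l Hl) as [d1 [Hd1 L1]].
    apply (residue_simple _ _ _ _ _ zeta (F zeta) (2 * (Cmod l + 1 + 12 * Cmod (F zeta))) (Rmin d1 (1 / 24))).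
    + lra.
    + unfold beta, Ubeta. lra.
    + intros x y Hx Hy Hn. apply CE_div; [apply HF; simpl; [lra|apply Rabs_le; auto]|apply CE_GG|
        apply NZ; simpl; auto; [lra|apply Rabs_le; auto]].
    + apply Rmin_glb_lt; lra.
    + intros w Hw Hdw. assert (T1 := Rmin_l d1 (1 / 24)). assert (T2 := Rmin_r d1 (1 / 24)).
      set (h := (w - zeta)%C) in *.
      assert (Hh : h <> RtoC 0) by (apply Cminus_eq_contra; auto).
      assert (Ph := proj1 (Cmod_gt_0 h) Hh).
      assert (Eg : GG w = (1 - Cexp (- h))%C) by (unfold GG, h; f_equal; f_equal; f_equal; ring).
      assert (Q1 := Cexp_quadratic (- h)%C). rewrite Cmod_opp in Q1. specialize (Q1 ltac:(lra)).
      assert (Q2 : Cmod (GG w - h) <= 12 * Cmod h ^ 2).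
      { rewrite Eg, Cmod_minus_sym. replace (h - (1 - Cexp (- h)))%C with (Cexp (- h) - 1 - - h)%C by ring. exact Q1. }
      assert (Q3 : Cmod h / 2 <= Cmod (GG w)).
      { assert (T3 := Cmod_reverse h (GG w)). rewrite Cmod_minus_sym in T3. nra. }
      assert (NG : GG w <> RtoC 0) by (apply Cmod_gt_0; lra).
      replace (F w / GG w - F zeta / h)%C with (((F w - F zeta) * h - F zeta * (GG w - h)) / (GG w * h))%C by (field; auto).
      rewrite Cmod_div, Cmod_mult by (apply Cmult_neq_0; auto).
      specialize (L1 w). fold h in L1. specialize (L1 ltac:(lra)).
      replace (2 * (Cmod l + 1 + 12 * Cmod (F zeta))) with
        (((Cmod l + 1 + 12 * Cmod (F zeta)) * Cmod h ^ 2) / (Cmod h / 2 * Cmod h)) by (field; lra).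
      apply div_le_of_ge; [apply Cmod_ge_0| | |].
      * eapply Rle_trans; [apply Cmod_triangle_minus|]. rewrite !Cmod_mult.
        assert (T3 := Cmod_ge_0 (F zeta)). assert (T4 := Cmod_ge_0 (F w - F zeta)).
        assert (Cmod (F w - F zeta) * Cmod h <= (Cmod l + 1) * Cmod h * Cmod h) by (apply Rmult_le_compat_r; lra).
        assert (Cmod (F zeta) * Cmod (GG w - h) <= Cmod (F zeta) * (12 * Cmod h ^ 2)) by (apply Rmult_le_compat_l; lra).
        nra.
      * nra.
      * nra.
Qed.

Lemma T_is_U (x : R) : is_U (fun s => F s * Q (x, 0) s)%C r beta (T (x, 0)) /\
  forall M c, 0 < c -> (forall s, on_U r beta s -> Cmod (F s * Q (x, 0) s) <= M * exp (c * Re s)) ->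
  Cmod (T (x, 0)) <= M * exp (c * r) * (2 / c + 2 * beta).
Proof.
  assert (Hi : Rabs 0 <= dl) by (rewrite Rabs_R0; lra).
  assert (Hj : Rabs (0 - Im zeta) <= PI / 2) by (rewrite Rminus_0_l, Rabs_Ropp; lra).
  split.
  - apply (U_ex r beta 1 beta_pos Rlt_0_1 _ (M0 * (1 + exp (exp (x - r))) * DM)).
    + intros s Hs. apply CE_FQ; auto.
    + intros s Hs. rewrite Cmod_mult, !Rmult_assoc. apply Rmult_le_compat; auto using Cmod_ge_0.
      { apply HM; apply Hs. }
      unfold Q, Cdiv. rewrite Cmod_mult. rewrite Rmult_1_l. apply Rmult_le_compat; auto using Cmod_ge_0.
      * eapply Rle_trans; [apply Cmod_triangle_minus|]. rewrite Cmod_1. apply Rplus_le_compat_l.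
        apply (exp_dd_bound (x, 0)); auto.
      * apply GG_bound; auto.
  - intros M c Hc H.
    destruct (U_ex r beta c beta_pos Hc (fun s => F s * Q (x, 0) s)%C M (fun s Hs => CE_FQ (x, 0) s Hs) H) as [_ X].
    exact X.
Qed.

(** Two bounds on [Q]: it is at most [2 * DM * exp (Re s)], which is integrable along the contour,
    and at most [exp (a - Re zeta)], which tends to 0 with [a -> -oo]. Their geometric mean has both
    properties, each at rate [1 / 2]. *)
Lemma T_left (a : R) : Cmod (T (a, 0)) <=
  M0 * (sqrt (2 * DM * exp (- Re zeta)) * exp (1 / 2 * a)) * exp (1 / 2 * r) * (2 / (1 / 2) + 2 * beta).
Proof.
  assert (D := DM_pos). assert (M := M0_pos). 
  apply T_is_U; [lra|]. intros s Hs.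
  assert (Ea := exp_pos a). assert (Es := exp_pos (Re s)). assert (Ez := exp_pos (- Re zeta)).
  rewrite Cmod_mult, Rmult_assoc. apply Rmult_le_compat; auto using Cmod_ge_0; [apply HM; apply Hs|].
  assert (E : sqrt (2 * DM * exp (- Re zeta)) * exp (1 / 2 * a) * exp (1 / 2 * Re s) =
    sqrt ((2 * (DM * exp (Re s))) * (exp a * exp (- Re zeta)))).
  { replace (2 * (DM * exp (Re s)) * (exp a * exp (- Re zeta))) with ((2 * DM * exp (- Re zeta)) * (exp a * exp (Re s))) by ring.
    rewrite (sqrt_mult_alt (2 * DM * exp (- Re zeta))) by nra.
    replace (exp a * exp (Re s)) with ((exp (1 / 2 * a) * exp (1 / 2 * Re s)) * (exp (1 / 2 * a) * exp (1 / 2 * Re s))).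
    - rewrite sqrt_square by (apply Rmult_le_pos; apply Rlt_le, exp_pos). ring.
    - rewrite <- !exp_plus. f_equal. field. }
  rewrite E. apply le_sqrt_of_le; [apply Cmod_ge_0| |].
  - unfold Q, Cdiv. rewrite Cmod_mult. apply Rmult_le_compat; auto using Cmod_ge_0; [|apply GG_bound; auto].
    destruct (Re_dd s Hs) as [R1 _]. assert (C0 := c0_pos).
    eapply Rle_trans; [apply Cmod_triangle_minus|]. rewrite Cmod_1, Cmod_Cexp.
    assert (exp (Re (- (Cexp (a, 0) * dd s))) <= 1).
    { rewrite <- exp_0. apply exp_le. change ((a, 0) : C) with (RtoC a). rewrite Cexp_R, re_opp, re_scal_l. nra. }
    lra.
  - destruct (Re_dd s Hs) as [R1 _]. assert (C0 := c0_pos). assert (N := dd_neq s Hs).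
    unfold Q. rewrite Cmod_div by (apply GG_neq_U; auto).
    assert (B : Cmod (1 - Cexp (- (Cexp (a, 0) * dd s))) <= exp a * Cmod (dd s)).
    { change ((a, 0) : C) with (RtoC a). rewrite Cexp_R. eapply Rle_trans; [apply one_minus_Cexp_le|].
      - rewrite re_scal_l. nra.
      - rewrite Cmod_mult, Cmod_R, Rabs_pos_eq; lra. }
    rewrite GG_dd, Cmod_mult, Cmod_Cexp. apply Cmod_gt_0 in N. assert (Ezp := exp_pos (Re zeta)).
    replace (exp a * exp (- Re zeta)) with (exp a * Cmod (dd s) / (exp (Re zeta) * Cmod (dd s))).
    + unfold Rdiv. apply Rmult_le_compat_r; auto. apply Rlt_le, Rinv_0_lt_compat. nra.
    + rewrite exp_Ropp. field. split; lra.
Qed.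

(** The numerator of [Q] splits into 1, which gives the residue, and an exponential that is at most
    [exp (- exp b * c0)] on the whole contour. *)
Lemma T_right (b : R) : Cmod (T (b, 0) - two_pi_i * F zeta) <=
  M0 * (exp (- exp b * c0) * DM) * exp (1 * r) * (2 / 1 + 2 * beta).
Proof.
  assert (D := DM_pos). assert (M := M0_pos). assert (B := beta_pos).
  set (phi := fun s => (- RtoC 1 * (F s * Cexp (- (Cexp (b, 0) * dd s)) / GG s))%C).
  assert (Hphi : forall s, on_U r beta s -> CE phi s).
  { intros s Hs. unfold phi. apply CE_mult; [apply CE_const|]. apply CE_div; [|apply CE_GG|apply GG_neq_U; auto].
    apply CE_mult; [apply HF; apply Hs|]. apply (CE_comp Cexp); [|apply CE_Cexp].
    apply CE_opp. apply CE_mult; [apply CE_const|apply CE_dd]. }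
  destruct (U_ex r beta 1 B Rlt_0_1 phi (M0 * (exp (- exp b * c0) * DM))) as [H1 H2]; auto.
  { intros s Hs. unfold phi. rewrite Cmod_mult, Cmod_opp, Cmod_1, Rmult_1_l. unfold Cdiv. rewrite !Cmod_mult.
    rewrite !Rmult_assoc. apply Rmult_le_compat; auto using Cmod_ge_0.
    - apply Rmult_le_pos; apply Cmod_ge_0.
    - apply HM; apply Hs.
    - rewrite Rmult_1_l. apply Rmult_le_compat; auto using Cmod_ge_0; [|apply GG_bound; auto].
      rewrite Cmod_Cexp. apply exp_le. change ((b, 0) : C) with (RtoC b). rewrite Cexp_R, re_opp, re_scal_l.
      destruct (Re_dd s Hs) as [R1 _]. assert (T1 := exp_pos b). nra. }
  assert (E : T (b, 0) = (two_pi_i * F zeta + UI phi r beta)%C).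
  { unfold T. apply is_U_unique. apply (is_U_ext (fun s => F s / GG s + phi s)%C); [exact B| |].
    - intros s Hs. unfold phi, Q, Cdiv. ring.
    - apply is_U_plus; [exact B| |exact Hphi|exact U_F_over_GG|exact H1].
      intros s Hs. apply CE_div; [apply HF; apply Hs|apply CE_GG|apply GG_neq_U; auto]. }
  rewrite E. replace (two_pi_i * F zeta + UI phi r beta - two_pi_i * F zeta)%C with (UI phi r beta) by ring. exact H2.
Qed.

(** Since [T / two_pi_i] is a primitive of the Laplace integrand on the real line, the integral over
    [[a, b]] is the difference of two values, with limits [F zeta] and 0. *)
Theorem Laplace_Borel : is_line (LI (Bor F r dl) 0 zeta) (F zeta).
Proof.
  assert (D := DM_pos). assert (M := M0_pos). assert (B := beta_pos). assert (C0 := c0_pos).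
  assert (TP := Cmod_two_pi_i). assert (NT := two_pi_i_neq_0). assert (P3 := PI_gt_3).
  apply is_line_eps. intros eps Heps.
  set (K1 := M0 * sqrt (2 * DM * exp (- Re zeta)) * exp (1 / 2 * r) * (2 / (1 / 2) + 2 * beta)).
  set (K2 := M0 * DM * exp (1 * r) * (2 / 1 + 2 * beta)).
  assert (HK1 : 0 <= K1).
  { unfold K1. repeat apply Rmult_le_pos; auto; try apply sqrt_pos; try (apply Rlt_le, exp_pos); lra. }
  assert (HK2 : 0 <= K2).
  { unfold K2. apply Rmult_le_pos; [|lra]. apply Rmult_le_pos; [|apply Rlt_le, exp_pos].
    apply Rmult_le_pos; [exact M|lra]. }
  set (e1 := eps / (K1 + 1)). assert (He1 : 0 < e1) by (apply Rdiv_lt_0_compat; lra).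
  set (e2 := eps / (K2 + 1)). assert (He2 : 0 < e2) by (apply Rdiv_lt_0_compat; lra).
  (* Chosen so that [exp (a / 2) <= e1] on the left and, by [b <= exp b], [exp (- exp b * c0) <= e2]
     on the right. Each end then costs at most [eps], and division by [2 * PI] brings the sum below
     [eps]. *)
  exists (Rmax (- (2 * ln e1)) (Rabs (ln e2) / c0)).
  intros a b Ha Hb.
  assert (X1 := Rmax_l (- (2 * ln e1)) (Rabs (ln e2) / c0)).
  assert (X2 := Rmax_r (- (2 * ln e1)) (Rabs (ln e2) / c0)).
  assert (X3 : 0 <= Rabs (ln e2) / c0) by (apply Rmult_le_pos; [apply Rabs_pos|apply Rlt_le, Rinv_0_lt_compat; auto]).
  assert (Hab : a <= b) by lra.
  exists ((T (b, 0) / two_pi_i) - (T (a, 0) / two_pi_i))%C. split.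
  - apply (is_CInt_prim_h (fun w => Bor F r dl w * kap (w - zeta))%C (fun w => T w / two_pi_i)%C a b 0 Hab).
    intros x Hx. split.
    + unfold Cdiv. eapply CD_eq; [|apply CD_mult; [apply T_CD|apply CD_const]]. cbv beta. field. auto.
    + assert (Hi : Rabs (Im (x, 0)) < dl) by (simpl; rewrite Rabs_R0; lra).
      destruct (Bor_CD F r dl M0 Hdl HF HM (x, 0) Hi) as [l [_ Hl]].
      apply CE_mult; [eexists; exact Hl|]. apply (CE_comp kap (fun w => w - zeta)%C); [apply CE_sub|apply CE_kap].
  - replace (T (b, 0) / two_pi_i - T (a, 0) / two_pi_i - F zeta)%C with
      (((T (b, 0) - two_pi_i * F zeta) - T (a, 0)) / two_pi_i)%C by (field; auto).
    rewrite Cmod_div, TP by auto.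
    assert (L := T_left a). assert (R := T_right b).
    assert (L' : Cmod (T (a, 0)) <= eps).
    { eapply Rle_trans; [exact L|].
      assert (exp (1 / 2 * a) <= e1).
      { rewrite <- (exp_ln e1) by auto. apply exp_le. lra. }
      replace (M0 * (sqrt (2 * DM * exp (- Re zeta)) * exp (1 / 2 * a)) * exp (1 / 2 * r) * (2 / (1 / 2) + 2 * beta)) with
        (K1 * exp (1 / 2 * a)) by (unfold K1; ring).
      apply Rle_trans with (K1 * e1); [apply Rmult_le_compat_l; auto|].
      apply Rle_trans with ((K1 + 1) * e1); [apply Rmult_le_compat_r; lra|]. unfold e1. right. field. lra. }
    assert (R' : Cmod (T (b, 0) - two_pi_i * F zeta) <= eps).
    { eapply Rle_trans; [exact R|].
      assert (exp (- exp b * c0) <= e2).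
      { rewrite <- (exp_ln e2) by auto. apply exp_le.
        assert (b <= exp b) by (assert (T1 := exp_ineq1_le b); lra).
        assert (Rabs (ln e2) <= b * c0).
        { apply Rmult_le_reg_r with (/ c0); [apply Rinv_0_lt_compat; auto|]. rewrite Rmult_assoc, Rinv_r by lra. unfold Rdiv in X2. lra. }
        assert (T2 := Rle_abs (- ln e2)). rewrite Rabs_Ropp in T2. nra. }
      replace (M0 * (exp (- exp b * c0) * DM) * exp (1 * r) * (2 / 1 + 2 * beta)) with
        (K2 * exp (- exp b * c0)) by (unfold K2; ring).
      apply Rle_trans with (K2 * e2); [apply Rmult_le_compat_l; auto|].
      apply Rle_trans with ((K2 + 1) * e2); [apply Rmult_le_compat_r; lra|]. unfold e2. right. field. lra. }
    assert (TT := Cmod_triangle_minus (T (b, 0) - two_pi_i * F zeta) (T (a, 0))).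
    apply Rmult_lt_reg_r with (2 * PI); [lra|]. unfold Rdiv. rewrite Rmult_assoc, Rinv_l by lra. nra.
Qed.
End Inversion.

(** * Borel transform of an asymptotic expansion *)

Lemma constant_of_zero_derivative (G : C -> C) (a b : C) :
  (forall t, 0 <= t <= 1 -> CD G (a + RtoC t * (b - a))%C (RtoC 0)) -> G a = G b.
Proof.
  intros H.
  assert (I : is_CInt (fun _ => RtoC 0) 0 1 (G (a + RtoC 1 * (b - a)) - G (a + RtoC 0 * (b - a)))%C).
  { apply (is_CInt_primitive _ (fun t => G (a + RtoC t * (b - a))%C)); [lra| |].
    - intros x Hx. replace (RtoC 0) with (RtoC 0 * (b - a))%C by ring. apply RD_affine, H; auto.
    - intros; apply Ccont_const. }
  apply CInt_unique in I.
  assert (Z := is_RInt_const (V := C_R_NormedModule) 0 1 (RtoC 0)).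
  rewrite scal_R_Cmult, Cmult_0_r in Z. apply CInt_unique in Z. rewrite Z in I.
  replace (a + RtoC 1 * (b - a))%C with b in I by ring. replace (a + RtoC 0 * (b - a))%C with a in I by ring.
  symmetry. apply Ceq_minus. auto.
Qed.

(** The values of the primitive cancel at the two corners and vanish at both infinite ends, so such
    a contour integral is 0. It serves as integration by parts. *)
Lemma is_U_derivative (Phi phi : C -> C) (r beta M : R) : 0 <= beta ->
  (forall s, on_U r beta s -> CD Phi s (phi s)) -> (forall s, on_U r beta s -> CE phi s) ->
  (forall s, on_U r beta s -> Cmod (Phi s) <= M * exp (1 * Re s)) -> is_U phi r beta (RtoC 0).
Proof.
  intros Hb H1 H2 H3.
  assert (K : forall y, (forall x, x <= r -> on_U r beta (x, y)) -> is_left (fun x => phi (x, y)) r (Phi (r, y))).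
  { intros y Hy. apply is_left_of_eps. intros eps Heps.
    assert (HD : 0 < Rabs M + 1) by (assert (T := Rabs_pos M); lra).
    exists (Rmin r (ln (eps / (Rabs M + 1)))). intros a Ha.
    assert (A1 := Rmin_l r (ln (eps / (Rabs M + 1)))). assert (A2 := Rmin_r r (ln (eps / (Rabs M + 1)))).
    exists (Phi (r, y) - Phi (a, y))%C. split.
    - apply (is_CInt_prim_h phi Phi); [lra|]. intros x Hx. split; [apply H1|apply H2]; apply Hy; lra.
    - replace (Phi (r, y) - Phi (a, y) - Phi (r, y))%C with (- Phi (a, y))%C by ring. rewrite Cmod_opp.
      eapply Rle_lt_trans; [apply H3, Hy; lra|]. rewrite Rmult_1_l. simpl.
      assert (E : exp a < eps / (Rabs M + 1)).
      { rewrite <- (exp_ln (eps / (Rabs M + 1))) by (apply Rdiv_lt_0_compat; auto). apply exp_increasing. lra. }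
      apply Rmult_lt_compat_l with (r := Rabs M + 1) in E; auto.
      replace ((Rabs M + 1) * (eps / (Rabs M + 1))) with eps in E by (field; lra).
      assert (T := Rle_abs M). assert (T' := exp_pos a). nra. }
  exists (Phi (r, - beta)%R), (Phi (r, beta)). repeat split.
  - apply (K (- beta)). intros. apply on_U_low; auto.
  - apply (K beta). intros. apply on_U_up; auto.
  - assert (V : (Ci * CInt (fun y => phi (r, y)) (- beta) beta)%C = (Phi (r, beta) - Phi (r, - beta)%R)%C).
    { rewrite <- (CInt_unique _ _ _ _ (is_CInt_prim_v phi Phi r (- beta) beta ltac:(lra)
        (fun y Hy => conj (H1 _ (on_U_mid r beta y Hy)) (H2 _ (on_U_mid r beta y Hy))))).
      symmetry. apply CInt_unique, is_CInt_scal, CInt_correct, ex_CInt_v; [lra|].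
      intros y Hy. apply H2, on_U_mid; auto. }
    rewrite V. ring.
Qed.

Section BorelMono.
Context (r dl : R) (Hdl : 0 < dl <= PI / 4).

Lemma mono_half (x : R) : half_hol (mono x) r (Ubeta dl).
Proof. intros s _ _. apply CE_mono. Qed.

Lemma mono_half_bound (x : R) (s : C) : 0 <= x -> Re s <= r -> Rabs (Im s) <= Ubeta dl -> Cmod (mono x s) <= exp (x * r).
Proof. intros Hx Hs _. rewrite Cmod_mono. apply exp_le. apply Rmult_le_compat_l; auto. Qed.

(** The [s]-derivative of [mono x s * ee (w - s)] is [x] times the Borel integrand minus its
    [w]-derivative. Its contour integral is 0, which is the differential equation [P' = x P] for the
    Borel transform. *)
Lemma Bor_mono_derivative (x : R) (w : C) : 0 <= x -> Rabs (Im w) < dl ->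
  CD (Bor (mono x) r dl) w (RtoC x * Bor (mono x) r dl w)%C.
Proof.
  intros Hx Hw. assert (B := Ubeta_pos dl Hdl). assert (P := Rabs_pos (Im w)).
  assert (HM := fun s => mono_half_bound x s Hx).
  destruct (Bor_CD (mono x) r dl _ Hdl (mono_half x) HM w Hw) as [l [H1 H2]].
  assert (HB := Bor_is_U (mono x) r dl _ Hdl (mono_half x) HM w Hw).
  assert (C1 : forall s, CE (BI (mono x) w) s) by (intros s; apply CE_BI, CE_mono).
  assert (C2 : forall s, CE (fun s => mono x s * (ee (w - s) * Cexp (w - s)))%C s).
  { intros s. apply CE_mult; [apply CE_mono|]. apply CE_mult; [apply (CE_comp ee (fun s => w - s)%C); [ce|apply CE_ee]|ce]. }
  assert (D : is_U (fun s => RtoC x * BI (mono x) w s + - RtoC 1 * (mono x s * (ee (w - s) * Cexp (w - s))))%C r (Ubeta dl) (RtoC 0)).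
  { apply (is_U_derivative (BI (mono x) w) _ r (Ubeta dl) (exp (x * r) * EM dl (Rabs (Im w)) r (Re w))); auto.
    - intros s _. unfold BI. eapply CD_eq; [|apply CD_mult].
      3:{ apply (CD_comp ee (fun s => w - s)%C); [apply CD_minus; [apply CD_const|apply CD_id]|apply CD_ee]. }
      2:{ unfold mono. apply (CD_comp Cexp); [apply CD_scal, CD_id|apply CD_Cexp]. }
      cbv beta. unfold mono. ring.
    - intros s _. apply CE_plus; (apply CE_mult; [apply CE_const|]); auto.
    - intros s Hs. apply (BI_bound (mono x) r dl _ Hdl HM); auto; lra. }
  assert (D2 : is_U (fun s => RtoC x * BI (mono x) w s + - RtoC 1 * (mono x s * (ee (w - s) * Cexp (w - s))))%C r (Ubeta dl)
     (RtoC x * (two_pi_i * Bor (mono x) r dl w) + - RtoC 1 * l)%C).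
  { apply is_U_plus; [exact B| | | |].
    - intros s _. apply CE_mult; [apply CE_const|apply C1].
    - intros s _. apply CE_mult; [apply CE_const|apply C2].
    - apply is_U_scal; [exact B|intros; apply C1|exact HB].
    - apply is_U_scal; [exact B|intros; apply C2|exact H1]. }
  apply is_U_unique in D, D2. rewrite D in D2.
  assert (N := two_pi_i_neq_0).
  eapply CD_eq; [|exact H2].
  assert (E : l = (RtoC x * (two_pi_i * Bor (mono x) r dl w))%C).
  { replace l with (RtoC x * (two_pi_i * Bor (mono x) r dl w) - (RtoC x * (two_pi_i * Bor (mono x) r dl w) + - RtoC 1 * l))%C by ring.
    rewrite <- D2. ring. }
  rewrite E. field. auto.
Qed.

Lemma Bor_mono_shape (x : R) (w : C) : 0 <= x -> Rabs (Im w) < dl ->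
  Bor (mono x) r dl w = (Bor (mono x) r dl (RtoC 0) * mono x w)%C.
Proof.
  intros Hx Hw. set (P := Bor (mono x) r dl).
  assert (E : (P w * mono (- x) w)%C = (P (RtoC 0) * mono (- x) (RtoC 0))%C).
  { symmetry. apply (constant_of_zero_derivative (fun z => P z * mono (- x) z)%C). intros t Ht.
    set (z := (RtoC 0 + RtoC t * (w - RtoC 0))%C).
    assert (Hz : Rabs (Im z) < dl).
    { unfold z. rewrite im_plus, im_scal_l, Im_minus, !im_RtoC, Rplus_0_l, Rminus_0_r, Rabs_mult, Rabs_pos_eq by lra.
      assert (T := Rabs_pos (Im w)). nra. }
    eapply CD_eq; [|apply CD_mult; [apply (Bor_mono_derivative x z Hx Hz)|
      unfold mono; apply (CD_comp Cexp); [apply CD_scal, CD_id|apply CD_Cexp]]].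
    cbv beta. fold P. change (Cexp (RtoC (- x) * z)) with (mono (- x) z). rewrite RtoC_opp. ring. }
  assert (E0 : mono (- x) (RtoC 0) = RtoC 1) by (unfold mono; rewrite Cmult_0_r; apply Cexp_0).
  rewrite E0 in E.
  assert (E1 : (mono (- x) w * mono x w)%C = RtoC 1).
  { unfold mono. rewrite <- Cexp_plus, RtoC_opp. replace (- RtoC x * w + RtoC x * w)%C with (RtoC 0) by ring. apply Cexp_0. }
  replace (P w) with (P w * (mono (- x) w * mono x w))%C by (rewrite E1; ring).
  rewrite Cmult_assoc, E. ring.
Qed.

(** The differential equation determines the transform up to its value at 0. Comparing the Laplace
    transforms at the single point [zeta = r - 1], by inversion on one side and Euler's integral on
    the other, shows that this value is [1 / Gamma (1 + n p)]. *)
Lemma Bor_mono (n : nat) (p : R) (w : C) : 0 < p -> Rabs (Im w) < dl ->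
  Bor (mono (INR n * p)) r dl w = (mono (INR n * p) w / RtoC (Gamma (1 + INR n * p)))%C.
Proof.
  intros Hp Hw. set (x := INR n * p). assert (HPI := PI_RGT_0).
  assert (Hx : 0 <= x) by (apply Rmult_le_pos; [apply pos_INR|lra]).
  set (zeta := RtoC (r - 1)).
  assert (L1 := Laplace_Borel (mono x) r dl _ zeta Hdl (mono_half x) (fun s => mono_half_bound x s Hx)
    ltac:(simpl; rewrite Rabs_R0; lra)
    ltac:(unfold zeta; rewrite Re_Cexp, re_opp, im_opp; simpl; rewrite Ropp_0, cos_0, Rmult_1_r; apply exp_increasing; lra)).
  assert (L2 := Lap_mono_center n p zeta Hp). fold x in L2.
  apply (is_line_scal (Bor (mono x) r dl (RtoC 0))) in L2.
  assert (E : mono x zeta = (Bor (mono x) r dl (RtoC 0) * (RtoC (Gamma (1 + x)) * mono x zeta))%C).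
  { eapply is_line_unique; [exact L1|]. eapply is_line_ext; [|exact L2].
    intros t. unfold LI. change (Im zeta) with 0. rewrite (Bor_mono_shape x (t, 0) Hx) by (simpl; rewrite Rabs_R0; lra). ring. }
  assert (G : RtoC (Gamma (1 + x)) <> RtoC 0).
  { intros Z. apply RtoC_inj in Z. assert (T := gamma_pos n p Hp). fold x in T. lra. }
  assert (N : mono x zeta <> RtoC 0) by apply Cexp_neq_0.
  rewrite (Bor_mono_shape x w Hx Hw).
  assert (E2 : (Bor (mono x) r dl (RtoC 0) * RtoC (Gamma (1 + x)))%C = RtoC 1).
  { replace (Bor (mono x) r dl (RtoC 0) * RtoC (Gamma (1 + x)))%C with
      (Bor (mono x) r dl (RtoC 0) * (RtoC (Gamma (1 + x)) * mono x zeta) / mono x zeta)%C by (field; auto).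
    rewrite <- E. field. auto. }
  replace (Bor (mono x) r dl (RtoC 0)) with (Bor (mono x) r dl (RtoC 0) * RtoC (Gamma (1 + x)) / RtoC (Gamma (1 + x)))%C by (field; auto).
  rewrite E2. field. auto.
Qed.

Definition expansion (p : R) (c : nat -> C) (n : nat) (w : C) : C := csum (fun k => c k * mono (INR k * p) w)%C n.

Lemma CE_expansion (p : R) (c : nat -> C) (n : nat) (w : C) : CE (expansion p c n) w.
Proof. apply (CE_csum (fun k w => c k * mono (INR k * p) w)%C). intros k. apply CE_mult; [apply CE_const|apply CE_mono]. Qed.

Definition borel_coef (p : R) (c : nat -> C) (k : nat) : C := (c k / RtoC (Gamma (1 + INR k * p)))%C.

Lemma U_expansion (p : R) (c : nat -> C) (n : nat) (w : C) : 0 < p -> Rabs (Im w) < dl ->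
  is_U (BI (expansion p c n) w) r (Ubeta dl) (two_pi_i * expansion p (borel_coef p c) n w)%C.
Proof.
  intros Hp Hw. assert (B := Ubeta_pos dl Hdl). induction n as [|n IH].
  - unfold expansion; simpl.
    (* The empty sum is presented as 0 times a contour integral already known to converge. *)
    assert (Z := Bor_is_U (mono 0) r dl _ Hdl (mono_half 0) (fun s => mono_half_bound 0 s (Rle_refl 0)) w Hw).
    apply (is_U_scal (RtoC 0)) in Z; auto; [|intros s _; apply CE_BI, CE_mono].
    eapply is_U_ext in Z; [|exact B|].
    2:{ intros s _. instantiate (1 := BI (fun _ => RtoC 0) w). unfold BI. ring. }
    replace (two_pi_i * RtoC 0)%C with (RtoC 0 * (two_pi_i * Bor (mono 0) r dl w))%C by ring. exact Z.
  - assert (Hx : 0 <= INR n * p) by (apply Rmult_le_pos; [apply pos_INR|lra]).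
    assert (Z := Bor_is_U (mono (INR n * p)) r dl _ Hdl (mono_half _) (fun s => mono_half_bound _ s Hx) w Hw).
    rewrite Bor_mono in Z by auto.
    apply (is_U_scal (c n)) in Z; auto; [|intros s _; apply CE_BI, CE_mono].
    assert (SU := is_U_plus _ _ _ _ _ _ B (fun s _ => CE_BI _ w s (CE_expansion p c n s))
      (fun s _ => CE_mult _ _ s (CE_const (c n) s) (CE_BI _ w s (CE_mono (INR n * p) s))) IH Z).
    replace (two_pi_i * expansion p (borel_coef p c) (S n) w)%C with
      (two_pi_i * expansion p (borel_coef p c) n w + c n * (two_pi_i * (mono (INR n * p) w / RtoC (Gamma (1 + INR n * p)))))%C.
    + eapply is_U_ext; [exact B| |exact SU]. intros s _. unfold BI, expansion. simpl. ring.
    + unfold expansion, borel_coef, Cdiv. simpl. ring.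
Qed.

(** In [Bor_remainder] the denominator [(n + 1)^(n p)] absorbs the Gevrey factor [n!^p]. The
    remaining bound is geometric in [n], with the extra ratio [exp 1] coming from the displaced
    vertical side, so the series of the transform converges for small [exp (p * Re w)]. *)
Theorem Bor_series (F : C -> C) (c : nat -> C) (p M K d : R) : 0 < p -> 0 <= M -> 0 < K -> 0 <= d < dl ->
  half_hol F r (Ubeta dl) ->
  (forall n s, Re s <= r -> Rabs (Im s) <= Ubeta dl ->
    Cmod (F s - expansion p c n s) <= M * K ^ n * Rpower (INR (fact n)) p * exp (INR n * p * Re s)) ->
  exists A, 0 <= A /\ forall n w, Rabs (Im w) <= d -> Re w <= r ->
    Cmod (Bor F r dl w - expansion p (borel_coef p c) n w) <= A * (K * exp 1 * exp (p * Re w)) ^ n.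
Proof.
  intros Hp HM HK Hd HF HR. assert (B := Ubeta_pos dl Hdl). assert (S := sin_gap_pos dl d Hdl Hd).
  assert (S' : 0 < / sin (dl - d)) by (apply Rinv_0_lt_compat; auto).
  assert (E1 := exp_pos 1).
  exists (M * (/ sin (dl - d) + 1) * exp 1 * (2 + 2 * Ubeta dl)).
  split; [repeat apply Rmult_le_pos; lra|]. intros n w Hw Hr.
  assert (HF0 : forall s, Re s <= r -> Rabs (Im s) <= Ubeta dl -> Cmod (F s) <= M).
  { intros s H1 H2. specialize (HR 0%nat s H1 H2). unfold expansion in HR. simpl in HR.
    rewrite Rmult_0_l, Rmult_0_l, exp_0 in HR. unfold Rpower in HR. rewrite ln_1, Rmult_0_r, exp_0 in HR.
    replace (F s - 0)%C with (F s) in HR by ring. lra. }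
  set (N := M * K ^ n * Rpower (INR (fact n)) p).
  assert (HKn : 0 < K ^ n) by (apply pow_lt; auto).
  assert (HN : 0 <= N) by (unfold N; repeat apply Rmult_le_pos; try lra; apply Rlt_le, exp_pos).
  assert (HFn : half_hol (fun s => F s - expansion p c n s)%C r (Ubeta dl)).
  { intros s H1 H2. apply CE_minus; [apply HF; auto|apply CE_expansion]. }
  assert (R := Bor_remainder _ r dl d N p n w Hdl Hd Hp HN HFn (HR n) Hw Hr).
  assert (E : Bor (fun s => F s - expansion p c n s)%C r dl w = (Bor F r dl w - expansion p (borel_coef p c) n w)%C).
  { assert (U1 := Bor_is_U F r dl M Hdl HF HF0 w ltac:(lra)).
    assert (U2 := U_expansion p c n w Hp ltac:(lra)).
    apply (is_U_scal (- RtoC 1)) in U2; auto; [|intros s _; apply CE_BI, CE_expansion].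
    assert (CF : forall s, on_U r (Ubeta dl) s -> CE (BI F w) s) by (intros s Hs; apply CE_BI, HF; apply Hs).
    assert (U := is_U_plus _ _ _ _ _ _ B CF
      (fun s _ => CE_mult _ _ s (CE_const (- RtoC 1) s) (CE_BI _ w s (CE_expansion p c n s))) U1 U2).
    apply (is_U_ext _ (BI (fun s => F s - expansion p c n s)%C w)) in U; [|exact B|intros s _; unfold BI; ring].
    apply is_U_unique in U. unfold Bor. rewrite U. unfold Bor. field. apply two_pi_i_neq_0. }
  rewrite E in R. eapply Rle_trans; [exact R|].
  assert (Pf : 0 < Rpower ((INR n + 1) ^ n) p) by apply exp_pos.
  assert (HQ : Rpower (INR (fact n)) p <= Rpower ((INR n + 1) ^ n) p).
  { apply Rpower_le_l; [lra|apply INR_fact_pos|apply fact_le_pow]. }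
  assert (En : exp (INR n * p * Re w) = exp (p * Re w) ^ n).
  { rewrite Rpower_pow_exp, Rpower_pow_comm by apply exp_pos. f_equal. unfold Rpower. rewrite ln_exp. reflexivity. }
  assert (Ee : exp (INR n + 1) = exp 1 ^ n * exp 1).
  { rewrite exp_plus. f_equal. rewrite <- (Rpower_pow n (exp 1)) by apply exp_pos. unfold Rpower. rewrite ln_exp, Rmult_1_r. reflexivity. }
  rewrite En, Ee, !Rpow_mult_distr. unfold N.
  set (X := exp (p * Re w) ^ n). set (Y := exp 1 ^ n).
  assert (HX : 0 < X) by (apply pow_lt, exp_pos). assert (HY : 0 < Y) by (apply pow_lt, exp_pos).
  apply Rle_trans with (M * K ^ n * X * ((/ sin (dl - d) + 1) * (Y * exp 1)) * (2 + 2 * Ubeta dl)).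
  - apply Rmult_le_compat_r; [lra|]. apply Rmult_le_compat_r; [apply Rlt_le; repeat apply Rmult_lt_0_compat; lra|].
    apply Rmult_le_reg_r with (Rpower ((INR n + 1) ^ n) p); auto.
    rewrite Rmult_assoc, Rinv_l, Rmult_1_r by lra.
    replace (M * K ^ n * X * Rpower ((INR n + 1) ^ n) p) with (M * K ^ n * Rpower ((INR n + 1) ^ n) p * X) by ring.
    apply Rmult_le_compat_r; [lra|]. apply Rmult_le_compat_l; auto. apply Rmult_le_pos; lra.
  - right. ring.
Qed.
End BorelMono.

(** * Logarithm and power series *)

(* The half-angle formula gives the argument in (-pi, pi) off the negative real axis. *)
Definition Clog (z : C) : C := (ln (Cmod z), 2 * atan (Im z / (Cmod z + Re z))).

Lemma Clog_Cexp (w : C) : Rabs (Im w) < PI -> Clog (Cexp w) = w.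
Proof.
  intros Hw. apply Rabs_lt_between in Hw. unfold Clog. rewrite Cmod_Cexp, ln_exp.
  assert (E := exp_pos (Re w)).
  assert (Hc : 0 < cos (Im w / 2)) by (apply cos_gt_0; lra).
  replace (Im (Cexp w) / (exp (Re w) + Re (Cexp w))) with (tan (Im w / 2)).
  - rewrite atan_tan by lra. destruct w as [u v]. simpl. f_equal. field.
  - rewrite Re_Cexp. change (Im (Cexp w)) with (exp (Re w) * sin (Im w)).
    replace (sin (Im w)) with (2 * sin (Im w / 2) * cos (Im w / 2)) by (rewrite <- sin_2a; f_equal; field).
    replace (cos (Im w)) with (2 * cos (Im w / 2) * cos (Im w / 2) - 1) by (rewrite <- cos_2a_cos; f_equal; field).
    assert (Hc2 : 0 < cos (Im w / 2) * cos (Im w / 2)) by (apply Rmult_lt_0_compat; auto).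
    assert (0 < exp (Re w) * (cos (Im w / 2) * cos (Im w / 2))) by (apply Rmult_lt_0_compat; auto).
    unfold tan. field. repeat split; apply Rgt_not_eq; nra.
Qed.

Lemma Cmod_sqr (z : C) : Cmod z * Cmod z = Re z * Re z + Im z * Im z.
Proof. assert (H := Cmod2_alt z). simpl in H. lra. Qed.

Lemma Cexp_Clog (z : C) : 0 < Cmod z + Re z -> Cexp (Clog z) = z.
Proof.
  intros HD. set (D := Cmod z + Re z) in *.
  assert (T := re_le_Cmod z). apply Rabs_le_between in T.
  assert (Hm : 0 < Cmod z) by (unfold D in HD; lra).
  assert (S := Cmod_sqr z).
  set (t := Im z / D).
  assert (Ht : 0 < 1 + t ^ 2) by (assert (0 <= t ^ 2) by apply pow2_ge_0; lra).
  assert (Hs : 0 < sqrt (1 + t ^ 2)) by (apply sqrt_lt_R0; auto).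
  assert (Hs2 : sqrt (1 + t ^ 2) * sqrt (1 + t ^ 2) = 1 + t ^ 2) by (apply sqrt_sqrt; lra).
  assert (Et : (1 + t ^ 2) * (D * D) = 2 * Cmod z * D).
  { replace ((1 + t ^ 2) * (D * D)) with (D * D + Im z * Im z) by (unfold t; field; lra). unfold D. nra. }
  assert (Es : sqrt (1 + t²) = sqrt (1 + t ^ 2)) by (f_equal; unfold Rsqr; ring).
  assert (C1 : cos (atan t) * cos (atan t) = / (1 + t ^ 2)).
  { rewrite cos_atan, Es. replace (1 / sqrt (1 + t ^ 2) * (1 / sqrt (1 + t ^ 2))) with (/ (sqrt (1 + t ^ 2) * sqrt (1 + t ^ 2))) by (field; lra).
    rewrite Hs2. reflexivity. }
  assert (C2 : sin (atan t) * cos (atan t) = t / (1 + t ^ 2)).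
  { rewrite cos_atan, sin_atan, Es. replace (t / sqrt (1 + t ^ 2) * (1 / sqrt (1 + t ^ 2))) with (t / (sqrt (1 + t ^ 2) * sqrt (1 + t ^ 2))) by (field; lra).
    rewrite Hs2. reflexivity. }
  assert (Ei : / (1 + t ^ 2) = D / (2 * Cmod z)).
  { apply Rmult_eq_reg_l with (1 + t ^ 2); [|lra]. rewrite Rinv_r by lra.
    apply Rmult_eq_reg_r with (2 * Cmod z * D); [|nra].
    rewrite Rmult_1_l. rewrite <- Et at 1. field. lra. }
  unfold Cexp, Clog, polar. simpl. fold D. fold t. rewrite exp_ln by auto.
  rewrite cos_2a_cos, sin_2a. destruct z as [x y]. f_equal.
  - replace (2 * cos (atan t) * cos (atan t) - 1) with (2 * (cos (atan t) * cos (atan t)) - 1) by ring.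
    rewrite C1, Ei. unfold D. simpl. field. lra.
  - replace (2 * sin (atan t) * cos (atan t)) with (2 * (sin (atan t) * cos (atan t))) by ring.
    rewrite C2. unfold Rdiv at 1. rewrite Ei. unfold t. simpl. field. lra.
Qed.

Definition contRC (phi : C -> R) (z : C) : Prop :=
  forall eps, 0 < eps -> exists d, 0 < d /\ forall w, Cmod (w - z) < d -> Rabs (phi w - phi z) < eps.

Lemma contRC_lip (phi : C -> R) (z : C) : (forall w, Rabs (phi w - phi z) <= Cmod (w - z)) -> contRC phi z.
Proof. intros H eps Heps. exists eps. split; auto. intros w Hw. specialize (H w). lra. Qed.

Lemma contRC_Cmod (z : C) : contRC Cmod z.
Proof.
  apply contRC_lip. intros w. apply Rabs_le. assert (T1 := Cmod_reverse w z). assert (T2 := Cmod_reverse z w).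
  rewrite (Cmod_minus_sym z) in T2. lra.
Qed.
Lemma contRC_Re (z : C) : contRC Re z.
Proof. apply contRC_lip. intros w. rewrite <- Re_minus. apply re_le_Cmod. Qed.
Lemma contRC_Im (z : C) : contRC Im z.
Proof. apply contRC_lip. intros w. rewrite <- Im_minus. apply im_le_Cmod. Qed.

Lemma contRC_continuous (phi : C -> R) (z : C) : contRC phi z <-> continuous (T := C_UniformSpace) (U := R_UniformSpace) phi z.
Proof.
  split.
  - intros H P [[e He] HP]. destruct (H e He) as [d [Hd Hw]].
    apply (locally_le_locally_norm (V := C_R_NormedModule)). exists (mkposreal d Hd).
    intros y Hy. apply HP. apply Hw. rewrite Cmod_norm. exact Hy.
  - intros H eps Heps.
    assert (L : locally (phi z) (fun y => Rabs (y - phi z) < eps)) by (exists (mkposreal eps Heps); auto).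
    specialize (H _ L). apply (locally_norm_le_locally (V := C_R_NormedModule)) in H.
    destruct H as [d Hd]. exists d. split; [apply cond_pos|]. intros w Hw. apply Hd.
    rewrite Cmod_norm in Hw. exact Hw.
Qed.

Lemma Clog_cont (z : C) : 0 < Cmod z + Re z ->
  forall eps, 0 < eps -> exists d, 0 < d /\ forall w, Cmod (w - z) < d -> Cmod (Clog w - Clog z) < eps.
Proof.
  intros HD eps Heps. assert (T := re_le_Cmod z). apply Rabs_le_between in T.
  assert (Hm : 0 < Cmod z) by lra.
  assert (C1 := proj1 (contRC_continuous _ _) (contRC_Cmod z)).
  assert (C2 := proj1 (contRC_continuous _ _) (contRC_Re z)).
  assert (C3 := proj1 (contRC_continuous _ _) (contRC_Im z)).
  assert (K1 : contRC (fun w => ln (Cmod w)) z).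
  { apply contRC_continuous. apply (continuous_comp Cmod ln); auto.
    apply (ex_derive_continuous (V := R_NormedModule)). auto_derive. auto. }
  assert (K2 : contRC (fun w => 2 * atan (Im w / (Cmod w + Re w))) z).
  { apply contRC_continuous. apply (continuous_comp (fun w => Im w / (Cmod w + Re w)) (fun x => 2 * atan x)).
    - apply (continuous_mult (K := R_AbsRing) Im (fun w => / (Cmod w + Re w))); auto.
      apply (continuous_comp (fun w => Cmod w + Re w) Rinv).
      + apply (continuous_plus (V := R_NormedModule) Cmod Re); auto.
      + apply (ex_derive_continuous (V := R_NormedModule)). auto_derive. lra.
    - apply (ex_derive_continuous (V := R_NormedModule)). auto_derive. auto. }
  destruct (K1 (eps / 2) ltac:(lra)) as [d1 [Hd1 H1]]. destruct (K2 (eps / 2) ltac:(lra)) as [d2 [Hd2 H2]].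
  exists (Rmin d1 d2). split; [apply Rmin_glb_lt; auto|]. intros w Hw.
  assert (T1 := Rmin_l d1 d2). assert (T2 := Rmin_r d1 d2).
  eapply Rle_lt_trans; [apply Cmod_le_sum|]. rewrite Re_minus, Im_minus.
  specialize (H1 w ltac:(lra)). specialize (H2 w ltac:(lra)). unfold Clog; simpl. simpl in H1, H2. lra.
Qed.

(** Continuity of [g] brings [g z] into the range where [f] is nearly linear; this yields
    [|g z - g z0| <= 2 / |l| * |z - z0|], with which the error of [f] is turned into an error of
    [g]. *)
Lemma CD_inverse (f g : C -> C) (z0 l : C) (d0 : R) : 0 < d0 -> l <> RtoC 0 ->
  (forall z, Cmod (z - z0) < d0 -> f (g z) = z) ->
  (forall eps, 0 < eps -> exists d, 0 < d /\ forall z, Cmod (z - z0) < d -> Cmod (g z - g z0) < eps) ->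
  CD f (g z0) l -> CD g z0 (/ l)%C.
Proof.
  intros Hd0 Hl Hfg Hc Hf. apply is_C_derive_eps. intros eps Heps.
  assert (Pl := proj1 (Cmod_gt_0 l) Hl).
  set (e := Rmin (Cmod l / 2) (eps * (Cmod l * Cmod l / 2))).
  assert (He : 0 < e) by (apply Rmin_glb_lt; [lra|]; apply Rmult_lt_0_compat; nra).
  assert (E1 : e <= Cmod l / 2) by apply Rmin_l. assert (E2 : e <= eps * (Cmod l * Cmod l / 2)) by apply Rmin_r.
  destruct (proj1 (is_C_derive_eps f _ l) Hf e He) as [d1 [Hd1 H1]].
  destruct (Hc d1 Hd1) as [d2 [Hd2 H2]].
  exists (Rmin d0 d2). split; [apply Rmin_glb_lt; auto|]. intros w Hw.
  assert (T1 := Rmin_l d0 d2). assert (T2 := Rmin_r d0 d2).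
  specialize (H1 (g w) (H2 w ltac:(lra))).
  rewrite (Hfg w), (Hfg z0) in H1; [|replace (z0 - z0)%C with (RtoC 0) by ring; rewrite Cmod_0; auto|lra].
  set (u := (g w - g z0)%C) in *. set (v := (w - z0)%C) in *.
  assert (B : Cmod u <= 2 / Cmod l * Cmod v).
  { assert (T := Cmod_reverse (l * u) v). rewrite Cmod_mult in T.
    rewrite (Cmod_minus_sym (l * u) v) in T. assert (Hu := Cmod_ge_0 u).
    assert (Cmod l / 2 * Cmod u <= Cmod v) by nra.
    apply Rmult_le_reg_l with (Cmod l / 2); [lra|]. eapply Rle_trans; [exact H|]. right. field. lra. }
  replace (u - / l * v)%C with (- (/ l) * (v - l * u))%C by (field; auto).
  rewrite Cmod_mult, Cmod_opp, Cmod_inv by auto.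
  apply Rmult_le_reg_l with (Cmod l); auto. rewrite <- Rmult_assoc, Rinv_r, Rmult_1_l by lra.
  eapply Rle_trans; [exact H1|].
  apply Rle_trans with (eps * (Cmod l * Cmod l / 2) * (2 / Cmod l * Cmod v)).
  - apply Rmult_le_compat; auto; [lra|apply Cmod_ge_0].
  - right. field. lra.
Qed.

Lemma CE_Clog (z : C) : 0 < Cmod z + Re z -> CE Clog z.
Proof.
  intros HD.
  destruct (contRC_Cmod z ((Cmod z + Re z) / 2)) as [d1 [Hd1 H1]]; [lra|].
  destruct (contRC_Re z ((Cmod z + Re z) / 2)) as [d2 [Hd2 H2]]; [lra|].
  eexists. apply (CD_inverse Cexp Clog z (Cexp (Clog z)) (Rmin d1 d2)).
  - apply Rmin_glb_lt; auto.
  - apply Cexp_neq_0.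
  - intros w Hw. assert (T1 := Rmin_l d1 d2). assert (T2 := Rmin_r d1 d2).
    apply Cexp_Clog. specialize (H1 w ltac:(lra)). specialize (H2 w ltac:(lra)).
    apply Rabs_lt_between in H1, H2. lra.
  - apply Clog_cont; auto.
  - apply CD_Cexp.
Qed.

Lemma slit_Cexp (w : C) : Rabs (Im w) < PI -> 0 < Cmod (Cexp w) + Re (Cexp w).
Proof.
  intros Hw. apply Rabs_lt_between in Hw. rewrite Cmod_Cexp, Re_Cexp.
  assert (Hc : 0 < cos (Im w / 2)) by (apply cos_gt_0; lra).
  replace (cos (Im w)) with (2 * cos (Im w / 2) * cos (Im w / 2) - 1) by (rewrite <- cos_2a_cos; f_equal; field).
  assert (E := exp_pos (Re w)). replace (exp (Re w) + exp (Re w) * (2 * cos (Im w / 2) * cos (Im w / 2) - 1)) with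
    (2 * exp (Re w) * (cos (Im w / 2) * cos (Im w / 2))) by ring.
  repeat apply Rmult_lt_0_compat; lra.
Qed.

(** * Complex series with geometric bounds *)

Definition is_sum (a : nat -> C) (l : C) : Prop :=
  forall eps, 0 < eps -> exists N, forall n, (N <= n)%nat -> Cmod (csum a n - l) < eps.

Lemma csum_sum_n (a : nat -> C) (n : nat) : csum a (S n) = sum_n a n.
Proof.
  induction n as [|n IH].
  - rewrite sum_O. simpl. ring.
  - rewrite sum_Sn, <- IH. reflexivity.
Qed.

(** The factor [1 - q ^ k], the exact geometric partial sum, makes the induction on [k] close. *)
Lemma csum_tail (a : nat -> C) (M q : R) (n k : nat) : 0 <= q < 1 -> 0 <= M ->
  (forall j, Cmod (a j) <= M * q ^ j) -> Cmod (csum a (n + k) - csum a n) <= M * q ^ n / (1 - q) * (1 - q ^ k).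
Proof.
  intros Hq HM Ha. induction k as [|k IH].
  - rewrite Nat.add_0_r. replace (csum a n - csum a n)%C with (RtoC 0) by ring. rewrite Cmod_0. simpl. lra.
  - rewrite Nat.add_succ_r. simpl csum.
    replace (csum a (n + k) + a (n + k)%nat - csum a n)%C with ((csum a (n + k) - csum a n) + a (n + k)%nat)%C by ring.
    eapply Rle_trans; [apply Cmod_triangle|]. specialize (Ha (n + k)%nat). rewrite pow_add in Ha.
    replace (M * q ^ n / (1 - q) * (1 - q ^ S k)) with (M * q ^ n / (1 - q) * (1 - q ^ k) + M * (q ^ n * q ^ k)) by (simpl; field; lra).
    lra.
Qed.

Lemma is_sum_geom (a : nat -> C) (M q : R) : 0 <= q < 1 -> 0 <= M ->
  (forall j, Cmod (a j) <= M * q ^ j) -> exists l, is_sum a l /\ forall n, Cmod (l - csum a n) <= M * q ^ n / (1 - q).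
Proof.
  intros Hq HM Ha.
  assert (Ex : ex_series (K := C_AbsRing) (V := C_CompleteNormedModule) a).
  { apply (ex_series_le (K := C_AbsRing) (V := C_CompleteNormedModule) a (fun k => M * q ^ k)).
    - exact Ha.
    - apply (ex_series_scal (K := R_AbsRing) (V := R_NormedModule) M (fun k => q ^ k)). apply ex_series_geom. rewrite Rabs_pos_eq; lra. }
  destruct Ex as [l Hl]. exists l.
  assert (S : is_sum a l).
  { intros eps Heps.
    assert (L : locally (T := C_UniformSpace) l (fun z => Cmod (z - l) < eps)).
    { apply (locally_le_locally_norm (V := C_R_NormedModule)).
      exists (mkposreal eps Heps). intros y Hy. rewrite Cmod_norm. exact Hy. }
    destruct (Hl _ L) as [N HN]. exists (S N). intros n Hn. destruct n as [|n]; [lia|].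
    rewrite csum_sum_n. apply HN. lia. }
  split; auto. intros n. apply le_epsilon. intros eps Heps.
  destruct (S eps Heps) as [N HN]. specialize (HN (n + N)%nat ltac:(lia)).
  assert (T := csum_tail a M q n N Hq HM Ha).
  replace (l - csum a n)%C with ((csum a (n + N) - csum a n) - (csum a (n + N) - l))%C by ring.
  eapply Rle_trans; [apply Cmod_triangle_minus|].
  assert (P : 0 <= q ^ n) by (apply pow_le; lra). assert (P' : 0 <= q ^ N) by (apply pow_le; lra).
  assert (G : 0 <= M * q ^ n / (1 - q)) by (apply Rmult_le_pos; [nra|apply Rlt_le, Rinv_0_lt_compat; lra]).
  assert (M * q ^ n / (1 - q) * (1 - q ^ N) <= M * q ^ n / (1 - q)) by nra. lra.
Qed.

Lemma is_sum_unique (a : nat -> C) (l l' : C) : is_sum a l -> is_sum a l' -> l = l'.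
Proof.
  intros H H'. apply Ceq_minus, Cmod_eq_0, Rle_antisym; [|apply Cmod_ge_0].
  apply le_epsilon. intros eps Heps. rewrite Rplus_0_l.
  destruct (H (eps / 2) ltac:(lra)) as [N HN]. destruct (H' (eps / 2) ltac:(lra)) as [N' HN'].
  specialize (HN (N + N')%nat ltac:(lia)). specialize (HN' (N + N')%nat ltac:(lia)).
  replace (l - l')%C with ((csum a (N + N') - l') - (csum a (N + N') - l))%C by ring.
  eapply Rle_trans; [apply Cmod_triangle_minus|]. lra.
Qed.

Lemma is_pseries_is_sum (a : nat -> C) (u l : C) :
  is_pseries (K := C_AbsRing) (V := C_NormedModule) a u l <-> is_sum (fun k => a k * u ^ k)%C l.
Proof.
  assert (E : forall k, scal (pow_n (K := C_AbsRing) u k) (a k) = (a k * u ^ k)%C).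
  { intros k. change (pow_n (K := C_AbsRing) u k * a k = a k * u ^ k)%C. apply Cmult_comm. }
  assert (E' : forall n, sum_n (fun k => scal (pow_n (K := C_AbsRing) u k) (a k) : C_NormedModule) n = csum (fun k => a k * u ^ k)%C (S n)).
  { intros n. rewrite csum_sum_n. apply sum_n_ext, E. }
  split.
  - intros H eps Heps.
    assert (L : locally (T := C_UniformSpace) l (fun z => Cmod (z - l) < eps)).
    { apply (locally_le_locally_norm (V := C_R_NormedModule)).
      exists (mkposreal eps Heps). intros y Hy. rewrite Cmod_norm. exact Hy. }
    destruct (H _ L) as [N HN]. exists (S N). intros n Hn. destruct n as [|n]; [lia|].
    rewrite <- E'. apply HN. lia.
  - intros H P HP.
    apply (locally_norm_le_locally (V := C_R_NormedModule)) in HP.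
    destruct HP as [[eps Heps] HP]. destruct (H eps Heps) as [N HN].
    exists N. intros n Hn. apply HP. specialize (HN (S n) ltac:(lia)). rewrite <- E' in HN.
    rewrite Cmod_norm in HN. exact HN.
Qed.

Lemma csum_plus (a b : nat -> C) (n : nat) : csum (fun k => a k + b k)%C n = (csum a n + csum b n)%C.
Proof. induction n; simpl; [ring|rewrite IHn; ring]. Qed.
Lemma csum_scal (c : C) (a : nat -> C) (n : nat) : csum (fun k => c * a k)%C n = (c * csum a n)%C.
Proof. induction n; simpl; [ring|rewrite IHn; ring]. Qed.

Lemma is_sum_plus (a b : nat -> C) (l l' : C) : is_sum a l -> is_sum b l' -> is_sum (fun k => a k + b k)%C (l + l')%C.
Proof.
  intros H H' eps Heps. destruct (H (eps / 2) ltac:(lra)) as [N HN]. destruct (H' (eps / 2) ltac:(lra)) as [N' HN'].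
  exists (N + N')%nat. intros n Hn. specialize (HN n ltac:(lia)). specialize (HN' n ltac:(lia)).
  rewrite csum_plus. replace (csum a n + csum b n - (l + l'))%C with ((csum a n - l) + (csum b n - l'))%C by ring.
  eapply Rle_lt_trans; [apply Cmod_triangle|]. lra.
Qed.

Lemma is_sum_scal (c : C) (a : nat -> C) (l : C) : is_sum a l -> is_sum (fun k => c * a k)%C (c * l)%C.
Proof.
  intros H eps Heps. assert (P := Cmod_ge_0 c).
  destruct (H (eps / (Cmod c + 1))) as [N HN]; [apply Rdiv_lt_0_compat; lra|].
  exists N. intros n Hn. specialize (HN n Hn). rewrite csum_scal.
  replace (c * csum a n - c * l)%C with (c * (csum a n - l))%C by ring. rewrite Cmod_mult.
  apply Rmult_lt_compat_l with (r := Cmod c + 1) in HN; [|lra].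
  replace ((Cmod c + 1) * (eps / (Cmod c + 1))) with eps in HN by (field; lra).
  assert (T := Cmod_ge_0 (csum a n - l)). nra.
Qed.

Lemma is_sum_bound (a : nat -> C) (l : C) (M q : R) : 0 <= q < 1 -> 0 <= M ->
  (forall j, Cmod (a j) <= M * q ^ j) -> is_sum a l -> Cmod l <= M / (1 - q).
Proof.
  intros Hq HM Ha Hl. destruct (is_sum_geom a M q Hq HM Ha) as [l' [H1 H2]].
  rewrite (is_sum_unique _ _ _ Hl H1). specialize (H2 0%nat). simpl in H2.
  replace (l' - 0)%C with l' in H2 by ring. rewrite Rmult_1_r in H2. exact H2.
Qed.

(* Sum of the Cauchy second order estimates of the individual terms. *)
Lemma CE_series (f : nat -> C -> C) (g : C -> C) (z0 : C) (r M q : R) : 0 < r -> 0 <= q < 1 -> 0 <= M ->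
  (forall k z, CE (f k) z) ->
  (forall k z, in_sq z0 r z -> Cmod (f k z) <= M * q ^ k) ->
  (forall z, in_sq z0 r z -> is_sum (fun k => f k z) (g z)) -> CE g z0.
Proof.
  intros Hr Hq HM Hf Hb Hg.
  assert (Hz0 : in_sq z0 r z0) by (apply in_sq_Cmod; replace (z0 - z0)%C with (RtoC 0) by ring; rewrite Cmod_0; lra).
  assert (B : forall k, Cmod (C_derive (f k) z0) <= 2 * (M * q ^ k) / r /\ forall h, 2 * Cmod h <= r ->
    Cmod (f k (z0 + h) - f k z0 - C_derive (f k) z0 * h)%C <= 3 * (M * q ^ k) / (r * r) * Cmod h ^ 2).
  { intros k. apply cauchy_center; auto.
    - intros s Hs. apply Hb, Hs.
    - apply CE_derive, Hf. }
  destruct (is_sum_geom (fun k => C_derive (f k) z0) (2 * M / r) q Hq) as [l [Hl _]].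
  { apply Rmult_le_pos; [lra|apply Rlt_le, Rinv_0_lt_compat; auto]. }
  { intros k. destruct (B k) as [B1 _]. eapply Rle_trans; [exact B1|]. right. field. lra. }
  exists l. apply CD_quadratic with (3 * M / (r * r) / (1 - q)) (r / 2); [lra|].
  intros w Hw. set (h := (w - z0)%C) in *.
  assert (Hw' : in_sq z0 r w) by (apply in_sq_Cmod; fold h; lra).
  assert (S := is_sum_plus _ _ _ _ (is_sum_plus _ _ _ _ (Hg w Hw') (is_sum_scal (- RtoC 1) _ _ (Hg z0 Hz0)))
    (is_sum_scal (- h) _ _ Hl)).
  replace (g w - g z0 - l * h)%C with (g w + - RtoC 1 * g z0 + - h * l)%C by ring.
  replace (3 * M / (r * r) / (1 - q) * Cmod h ^ 2) with (3 * M / (r * r) * Cmod h ^ 2 / (1 - q)) by (field; split; lra).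
  assert (Prr : 0 < / (r * r)) by (apply Rinv_0_lt_compat; nra).
  refine (is_sum_bound _ _ _ q Hq _ _ S).
  - apply Rmult_le_pos; [|apply pow2_ge_0]. unfold Rdiv. apply Rmult_le_pos; lra.
  - intros k. destruct (B k) as [_ B2]. specialize (B2 h ltac:(lra)).
    replace (z0 + h)%C with w in B2 by (unfold h; ring).
    replace (f k w + - RtoC 1 * f k z0 + - h * C_derive (f k) z0)%C with (f k w - f k z0 - C_derive (f k) z0 * h)%C by ring.
    eapply Rle_trans; [exact B2|]. right. field. lra.
Qed.

Section PowerSeries.
Context (a : nat -> C) (M K : R) (HM : 0 <= M) (HK : 0 < K) (Ha : forall k, Cmod (a k) <= M * K ^ k).

Lemma pseries_term (u : C) (k : nat) : Cmod (a k * u ^ k) <= M * (K * Cmod u) ^ k.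
Proof.
  rewrite Cmod_mult, Cmod_pow, Rpow_mult_distr, <- Rmult_assoc.
  apply Rmult_le_compat_r; auto. apply pow_le, Cmod_ge_0.
Qed.

Lemma power_series_sum_correct (u : C) : K * Cmod u < 1 ->
  is_sum (fun k => a k * u ^ k)%C (power_series_sum a u) /\
  forall n, Cmod (power_series_sum a u - csum (fun k => a k * u ^ k)%C n) <= M * (K * Cmod u) ^ n / (1 - K * Cmod u).
Proof.
  intros Hu. assert (P := Cmod_ge_0 u).
  destruct (is_sum_geom (fun k => a k * u ^ k)%C M (K * Cmod u)) as [l [H1 H2]]; auto.
  { split; auto. nra. }
  { intros k. apply pseries_term. }
  assert (E : power_series_sum a u = l).
  { unfold power_series_sum. apply eq_close.
    assert (X := iota_correct (V := C_CompleteNormedModule) (is_pseries (K := C_AbsRing) (V := C_NormedModule) a u)).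
    assert (Y : is_pseries (K := C_AbsRing) (V := C_NormedModule) a u (iota (T := C_CompleteNormedModule) (is_pseries (K := C_AbsRing) (V := C_NormedModule) a u))).
    { apply X. exists l. split; [apply is_pseries_is_sum; auto|]. intros y Hy. apply is_pseries_is_sum in Hy. eapply is_sum_unique; eauto. }
    apply is_pseries_is_sum in Y. rewrite (is_sum_unique _ _ _ Y H1). apply close_refl. }
  rewrite E. auto.
Qed.

Lemma CE_power_series_sum (u : C) : K * Cmod u < 1 -> CE (power_series_sum a) u.
Proof.
  intros Hu. assert (P := Cmod_ge_0 u).
  set (r := (1 - K * Cmod u) / (4 * K)).
  assert (Hr : 0 < r) by (apply Rdiv_lt_0_compat; lra).
  assert (Hq : forall z, in_sq u r z -> K * Cmod z <= (1 + K * Cmod u) / 2).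
  { intros z Hz. apply Cmod_in_sq in Hz. assert (T := Cmod_triangle (z - u) u). replace (z - u + u)%C with z in T by ring.
    assert (K * Cmod z <= K * (2 * r + Cmod u)) by (apply Rmult_le_compat_l; lra).
    replace (K * (2 * r + Cmod u)) with ((1 + K * Cmod u) / 2) in H by (unfold r; field; lra). exact H. }
  apply (CE_series (fun k u => a k * u ^ k)%C _ u r M ((1 + K * Cmod u) / 2)); auto.
  - nra.
  - intros k z. ce.
  - intros k z Hz. eapply Rle_trans; [apply pseries_term|]. apply Rmult_le_compat_l; auto.
    apply pow_incr. split; [apply Rmult_le_pos; [lra|apply Cmod_ge_0]|apply Hq; auto].
  - intros z Hz. apply power_series_sum_correct. specialize (Hq z Hz). lra.
Qed.
End PowerSeries.

(** * Derivative estimates and logarithmic coordinates *)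

Definition poly_deriv (a : nat -> C) (k : nat) : C := (RtoC (INR (S k)) * a (S k))%C.

Lemma CD_pow (n : nat) (w : C) : CD (fun z => z ^ S n)%C w (RtoC (INR (S n)) * w ^ n)%C.
Proof.
  induction n as [|n IH].
  - eapply CD_eq; [|eapply CD_ext; [|apply (CD_id w)]].
    + simpl. ring.
    + intros z. simpl. ring.
  - eapply CD_eq; [|eapply CD_ext; [|apply (CD_mult _ _ _ _ _ (CD_id w) IH)]].
    + cbv beta. rewrite (S_INR (S n)), RtoC_plus. simpl (w ^ S n)%C. ring.
    + intros z. reflexivity.
Qed.

Lemma CD_poly (a : nat -> C) (n : nat) (w : C) :
  CD (fun z => csum (fun k => a k * z ^ k)%C (S n)) w (csum (fun k => poly_deriv a k * w ^ k)%C n).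
Proof.
  induction n as [|n IH].
  - eapply CD_ext; [|apply (CD_const (a 0%nat))]. intros z. simpl. ring.
  - eapply CD_eq; [|eapply CD_ext; [|apply (CD_plus _ _ _ _ _ IH (CD_scal (a (S n)) _ _ _ (CD_pow n w)))]].
    + cbv beta. cbn [csum]. unfold poly_deriv. ring.
    + intros z. reflexivity.
Qed.

(* Cauchy's estimate for the first derivative, iterated n times with radius proportional to 1/n;
   subtracting a polynomial of degree < n does not change the n-th derivative. *)
Lemma C_derive_n_sub_poly (f : C -> C) (a : nat -> C) (z0 : C) (n : nat) (dl M : R) : 0 < dl ->
  (forall w, Cmod (w - z0) <= 2 * dl * INR n -> CE f w) ->
  (forall w, Cmod (w - z0) <= 2 * dl * INR n -> Cmod (f w - csum (fun k => a k * w ^ k) n)%C <= M) ->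
  Cmod (C_derive_n f n z0) <= M * (2 / dl) ^ n.
Proof.
  intros Hd Hf HM.
  assert (K : forall j, (j <= n)%nat -> forall w, Cmod (w - z0) <= 2 * dl * INR (n - j) ->
    CE (C_derive_n f j) w /\
    Cmod (C_derive_n f j w - csum (fun k => Nat.iter j poly_deriv a k * w ^ k)%C (n - j)) <= M * (2 / dl) ^ j).
  { induction j as [|j IH]; intros Hj w Hw.
    - rewrite Nat.sub_0_r in *. split; [apply Hf; auto|]. simpl. rewrite Rmult_1_r. apply HM; auto.
    - assert (Hin : forall s, in_sq w dl s -> Cmod (s - z0) <= 2 * dl * INR (n - j)).
      { intros s Hs. apply Cmod_in_sq in Hs. assert (T := Cmod_triangle (s - w) (w - z0)).
        replace (s - w + (w - z0))%C with (s - z0)%C in T by ring.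
        replace (n - j)%nat with (S (n - S j)) by lia. rewrite S_INR. lra. }
      assert (Hw0 : Cmod (w - z0) <= 2 * dl * INR (n - j)).
      { apply Hin, in_sq_Cmod. replace (w - w)%C with (RtoC 0) by ring. rewrite Cmod_0. lra. }
      assert (IH' := fun s Hs => IH ltac:(lia) s (Hin s Hs)).
      split.
      + simpl. apply (CE_C_derive _ w dl Hd). intros s Hs. apply IH', Hs.
      + assert (E : (n - j)%nat = S (n - S j)) by lia. rewrite E in IH'.
        destruct (cauchy_center (fun s => C_derive_n f j s - csum (fun k => Nat.iter j poly_deriv a k * s ^ k)%C (S (n - S j)))%C w
          (C_derive_n f (S j) w - csum (fun k => Nat.iter (S j) poly_deriv a k * w ^ k)%C (n - S j)) dl (M * (2 / dl) ^ j)) as [B _]; auto.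
        * intros s Hs. apply CE_minus; [apply IH'; auto|]. eexists. apply CD_poly.
        * intros s Hs. apply IH', Hs.
        * apply CD_minus; [|apply CD_poly]. apply CE_derive. apply (IH ltac:(lia) w Hw0).
        * eapply Rle_trans; [exact B|]. right. simpl. field. lra. }
  destruct (K n (le_n n) z0) as [_ B].
  - rewrite Nat.sub_diag. replace (z0 - z0)%C with (RtoC 0) by ring. rewrite Cmod_0. simpl. lra.
  - rewrite Nat.sub_diag in B. simpl in B. replace (C_derive_n f n z0 - 0)%C with (C_derive_n f n z0) in B by ring. exact B.
Qed.

(** The step [dl = rho / (2 n)] uses up the radius in [n] applications of Cauchy's estimate, giving
    [(4 n / rho)^n]; then [n^n <= n! * exp n]. *)
Lemma C_derive_n_bound (f : C -> C) (a : nat -> C) (z0 : C) (n : nat) (rho M : R) : 0 < rho -> 0 <= M ->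
  (forall w, Cmod (w - z0) <= rho -> CE f w) ->
  (forall w, Cmod (w - z0) <= rho -> Cmod (f w - csum (fun k => a k * w ^ k) n)%C <= M) ->
  Cmod (C_derive_n f n z0) <= M * (4 * exp 1 / rho) ^ n * INR (fact n).
Proof.
  intros Hr HM Hf Hb. assert (E1 := exp_pos 1).
  destruct n as [|n].
  - simpl. rewrite !Rmult_1_r. specialize (Hb z0). replace (z0 - z0)%C with (RtoC 0) in Hb by ring. rewrite Cmod_0 in Hb.
    specialize (Hb ltac:(lra)). simpl in Hb. replace (f z0 - 0)%C with (f z0) in Hb by ring. exact Hb.
  - set (N := S n) in *. assert (HN : 0 < INR N) by (apply lt_0_INR; unfold N; lia).
    set (dl := rho / (2 * INR N)). assert (Hd : 0 < dl) by (apply Rdiv_lt_0_compat; lra).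
    assert (E : 2 * dl * INR N = rho) by (unfold dl; field; lra).
    eapply Rle_trans; [apply (C_derive_n_sub_poly f a z0 N dl M Hd)|].
    + rewrite E. exact Hf.
    + rewrite E. exact Hb.
    + assert (P := pow_le_fact_exp N (INR N) ltac:(lra)).
      assert (Ee : exp (INR N) = exp 1 ^ N).
      { rewrite <- (Rpower_pow N (exp 1)) by auto. unfold Rpower. rewrite ln_exp, Rmult_1_r. reflexivity. }
      rewrite Ee in P.
      replace (2 / dl) with (4 / rho * INR N) by (unfold dl; field; lra).
      replace (4 * exp 1 / rho) with (4 / rho * exp 1) by (field; lra).
      rewrite !Rpow_mult_distr. rewrite Rmult_assoc. apply Rmult_le_compat_l; auto.
      rewrite Rmult_assoc. apply Rmult_le_compat_l; [apply pow_le, Rlt_le, Rdiv_lt_0_compat; lra|]. lra.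
Qed.

Definition Zc (p theta : R) (w : C) : C := Cexp (RtoC p * w + (0, theta)).
(** A left inverse of [Zc]. Turning by [- theta] first puts the cut of [Clog] on the ray opposite to
    [theta], which a sector around [theta] of opening at most [2 * PI] does not meet. *)
Definition Lg (p theta : R) (z : C) : C := (RtoC (/ p) * Clog (z * Cexp (- (0, theta))))%C.

Lemma Zc_polar (p theta : R) (w : C) : Zc p theta w = polar (exp (p * Re w)) (p * Im w + theta).
Proof.
  unfold Zc, Cexp. rewrite re_plus, im_plus, re_scal_l, im_scal_l. simpl. rewrite Rplus_0_r. reflexivity.
Qed.

Lemma polar_Zc (p theta t phi : R) : 0 < p -> 0 < t -> polar t phi = Zc p theta (ln t / p, (phi - theta) / p)%R.
Proof.
  intros Hp Ht. rewrite Zc_polar. simpl. f_equal.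
  - replace (p * (ln t / p)) with (ln t) by (field; lra). rewrite exp_ln; auto.
  - field. lra.
Qed.

Lemma Cmod_Zc (p theta : R) (w : C) : Cmod (Zc p theta w) = exp (p * Re w).
Proof. rewrite Zc_polar. apply Cmod_polar, Rlt_le, exp_pos. Qed.

Lemma CE_Zc (p theta : R) (w : C) : CE (Zc p theta) w.
Proof. unfold Zc. ce. Qed.

Lemma Zc_unrot (p theta : R) (w : C) : (Zc p theta w * Cexp (- (0, theta)))%C = Cexp (RtoC p * w).
Proof. unfold Zc. rewrite <- Cexp_plus. f_equal. ring. Qed.

Lemma Lg_Zc (p theta : R) (w : C) : 0 < p -> Rabs (p * Im w) < PI -> Lg p theta (Zc p theta w) = w.
Proof.
  intros Hp Hw. unfold Lg. rewrite Zc_unrot, Clog_Cexp by (rewrite im_scal_l; auto).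
  rewrite Cmult_assoc, <- RtoC_mult, Rinv_l by lra. apply Cmult_1_l.
Qed.

Lemma CE_Lg (p theta : R) (w : C) : 0 < p -> Rabs (p * Im w) < PI -> CE (Lg p theta) (Zc p theta w).
Proof.
  intros Hp Hw. unfold Lg. apply CE_mult; [apply CE_const|].
  apply (CE_comp Clog (fun z => z * Cexp (- (0, theta)))%C); [ce|].
  rewrite Zc_unrot. apply CE_Clog, slit_Cexp. rewrite im_scal_l. auto.
Qed.

Lemma CE_comp_Lg (H : C -> C) (p theta : R) (w : C) : 0 < p -> Rabs (p * Im w) < PI ->
  CE H w -> CE (fun z => H (Lg p theta z)) (Zc p theta w).
Proof.
  intros Hp Hw HH. apply (CE_comp H (Lg p theta)); [apply CE_Lg; auto|]. rewrite Lg_Zc; auto.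
Qed.

(** Discs with radius proportional to [|z|] correspond to sets of bounded size in the logarithmic
    coordinate, uniformly in [w]: dividing by [Zc p theta w] reduces the claim to continuity of
    [Clog] at 1. *)
Lemma Zc_ball (p theta eps : R) : 0 < p -> 0 < eps -> exists k, 0 < k < 1 /\
  forall w z, Cmod (z - Zc p theta w) <= k * Cmod (Zc p theta w) -> exists w', z = Zc p theta w' /\ Cmod (w' - w) < eps.
Proof.
  intros Hp Heps.
  assert (H1 : 0 < Cmod 1 + Re 1) by (rewrite Cmod_1; simpl; lra).
  destruct (Clog_cont 1 H1 (p * eps)) as [d [Hd Hc]]; [nra|].
  assert (L1 : Clog 1 = RtoC 0).
  { rewrite <- Cexp_0. apply Clog_Cexp. simpl. rewrite Rabs_R0. apply PI_RGT_0. }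
  rewrite L1 in Hc.
  set (k := Rmin (d / 2) (1 / 2)).
  assert (Hk : 0 < k) by (apply Rmin_glb_lt; lra).
  assert (K1 : k <= d / 2) by apply Rmin_l. assert (K2 : k <= 1 / 2) by apply Rmin_r.
  exists k. split; [lra|]. intros w z Hz.
  set (z0 := Zc p theta w) in *. assert (N : z0 <> RtoC 0) by apply Cexp_neq_0.
  assert (P := proj1 (Cmod_gt_0 z0) N).
  set (v := (z / z0)%C).
  assert (Hv : Cmod (v - 1) <= k).
  { unfold v. replace (z / z0 - 1)%C with ((z - z0) / z0)%C by (field; auto). rewrite Cmod_div by auto.
    apply Rmult_le_reg_r with (Cmod z0); auto. unfold Rdiv. rewrite Rmult_assoc, Rinv_l, Rmult_1_r by lra. exact Hz. }
  assert (Hv2 : 0 < Cmod v + Re v).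
  { assert (T := re_le_Cmod (v - 1)). rewrite Re_minus, re_RtoC in T. apply Rabs_le_between in T.
    assert (T' := Cmod_ge_0 v). lra. }
  exists (w + RtoC (/ p) * Clog v)%C. split.
  - unfold Zc. replace (RtoC p * (w + RtoC (/ p) * Clog v) + (0, theta))%C with
      (RtoC p * w + (0, theta) + (RtoC p * RtoC (/ p)) * Clog v)%C by ring.
    rewrite <- RtoC_mult, Rinv_r, Cmult_1_l, Cexp_plus by lra.
    change (Cexp (RtoC p * w + (0, theta))) with z0. rewrite Cexp_Clog by auto. unfold v. field. auto.
  - replace (w + RtoC (/ p) * Clog v - w)%C with (RtoC (/ p) * (Clog v - 0))%C by ring.
    rewrite Cmod_mult, Cmod_R, Rabs_pos_eq by (apply Rlt_le, Rinv_0_lt_compat; auto).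
    specialize (Hc v ltac:(lra)).
    apply Rmult_lt_reg_l with p; auto. rewrite <- Rmult_assoc, Rinv_r, Rmult_1_l by lra. exact Hc.
Qed.

Lemma sector_Zc (p theta alpha : R) (r : Rbar) (z : C) : 0 < p ->
  sector theta alpha r z <-> exists w, z = Zc p theta w /\ Rabs (p * Im w) < alpha / 2 /\ Rbar_lt (exp (p * Re w)) r.
Proof.
  intros Hp. split.
  - intros [t [phi [Ht [Hr [Hphi ->]]]]]. exists (ln t / p, (phi - theta) / p)%R. split; [apply polar_Zc; auto|]. simpl.
    replace (p * ((phi - theta) / p)) with (phi - theta) by (field; lra).
    replace (p * (ln t / p)) with (ln t) by (field; lra). rewrite exp_ln; auto.
  - intros [w [-> [H1 H2]]]. exists (exp (p * Re w)), (p * Im w + theta).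
    split; [apply exp_pos|]. split; auto. split; [|apply Zc_polar].
    replace (p * Im w + theta - theta) with (p * Im w) by ring. auto.
Qed.

Lemma arg_sector_Zc (p theta eta eta' : R) (r : Rbar) (z : C) : 0 < p ->
  arg_sector eta eta' r z <-> exists w, z = Zc p theta w /\ eta < p * Im w + theta < eta' /\ Rbar_lt (exp (p * Re w)) r.
Proof.
  intros Hp. split.
  - intros [t [phi [Ht [Hr [Hphi ->]]]]]. exists (ln t / p, (phi - theta) / p)%R. split; [apply polar_Zc; auto|]. simpl.
    replace (p * ((phi - theta) / p)) with (phi - theta) by (field; lra).
    replace (p * (ln t / p)) with (ln t) by (field; lra). rewrite exp_ln; auto. split; auto. lra.
  - intros [w [-> [H1 H2]]]. exists (exp (p * Re w)), (p * Im w + theta).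
    split; [apply exp_pos|]. split; auto. split; [auto|apply Zc_polar].
Qed.

(** Absorbs the factors [exp (i k theta)] into the coefficients, so that [z^k] becomes the pure
    exponential [mono (k p)] and the direction [theta] becomes the real line. *)
Definition rot (theta : R) (c : nat -> C) (k : nat) : C := (c k * Cexp (RtoC (INR k) * (0, theta)))%C.

Lemma Cexp_pow (w : C) (k : nat) : (Cexp w ^ k)%C = Cexp (RtoC (INR k) * w).
Proof.
  induction k as [|k IH].
  - simpl. rewrite Cmult_0_l, Cexp_0. reflexivity.
  - rewrite Cpow_S, IH, <- Cexp_plus, S_INR, RtoC_plus. f_equal. ring.
Qed.

Lemma Cmod_rot (theta : R) (c : nat -> C) (k : nat) : Cmod (rot theta c k) = Cmod (c k).
Proof.
  unfold rot. rewrite Cmod_mult, Cmod_Cexp, re_scal_l. simpl. rewrite Rmult_0_r, exp_0, Rmult_1_r. reflexivity.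
Qed.

Lemma rot_term (p theta : R) (c : nat -> C) (k : nat) (w : C) :
  (c k * Zc p theta w ^ k)%C = (rot theta c k * mono (INR k * p) w)%C.
Proof.
  unfold rot, Zc, mono. rewrite Cexp_pow, <- Cmult_assoc, <- Cexp_plus, RtoC_mult. f_equal. f_equal. ring.
Qed.

Lemma csum_rot (p theta : R) (c : nat -> C) (n : nat) (w : C) :
  csum (fun k => c k * Zc p theta w ^ k)%C n = expansion p (rot theta c) n w.
Proof. apply csum_ext. intros k. apply rot_term. Qed.

Lemma partial_sum_csum (c : nat -> C) (n : nat) (z : C) : partial_sum c n z = csum (fun k => c k * z ^ k)%C n.
Proof. destruct n as [|n]; [reflexivity|]. simpl partial_sum. rewrite <- csum_sum_n. reflexivity. Qed.

Lemma rot_borel (p m theta : R) (c : nat -> C) (k : nat) : 0 < p -> m = / p ->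
  rot theta (formal_borel m c) k = borel_coef p (rot theta c) k.
Proof.
  intros Hp ->. unfold rot, formal_borel, borel_coef, Cdiv.
  replace (INR k / / p) with (INR k * p) by (field; lra). ring.
Qed.

Lemma expansion_ext (p : R) (c c' : nat -> C) (n : nat) (w : C) : (forall k, c k = c' k) -> expansion p c n w = expansion p c' n w.
Proof. intros E. apply csum_ext. intros k. rewrite E. reflexivity. Qed.

(** The factor [n!^p] in [gamma_lower] cancels the Gevrey growth of [c]; its loss [exp (n + 2)]
    accounts for [M * exp 2] and [K * exp 1]. *)
Lemma formal_borel_bound (s m : R) (c : nat -> C) : 1 < s -> m = / (s - 1) -> formal_gevrey s c ->
  exists M K, 0 < M /\ 0 < K /\ forall k, Cmod (formal_borel m c k) <= M * K ^ k.
Proof.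
  intros Hs -> [M [K [HM [HK H]]]]. set (p := s - 1). assert (Hp : 0 < p) by (unfold p; lra).
  exists (M * exp 2), (K * exp 1). assert (E1 := exp_pos 1). assert (E2 := exp_pos 2).
  split; [nra|]. split; [nra|]. intros k. unfold formal_borel.
  replace (INR k / / p) with (INR k * p) by (field; lra).
  assert (G := gamma_lower k p Hp). assert (G0 := gamma_pos k p Hp).
  assert (Pf : 0 < Rpower (INR (fact k)) p) by apply exp_pos.
  rewrite Cmod_div by (intros E; apply RtoC_inj in E; lra). rewrite Cmod_R, Rabs_pos_eq by lra.
  eapply Rle_trans; [eapply div_le_of_ge; [apply Cmod_ge_0|apply (H k)| |exact G]|].
  - apply Rmult_lt_0_compat; auto. apply exp_pos.
  - fold p. right. rewrite Rpow_mult_distr.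
    replace (exp 1 ^ k) with (exp (INR k)).
    2:{ rewrite <- (Rpower_pow k (exp 1)) by auto. unfold Rpower. rewrite ln_exp, Rmult_1_r. reflexivity. }
    rewrite exp_Ropp, exp_plus. field. repeat split; apply Rgt_not_eq; auto; apply exp_pos.
Qed.

(** * From an asymptotic function to a growing continuation *)

Definition log_dom (p alpha : R) (rho : Rbar) (w : C) : Prop :=
  Rabs (p * Im w) < alpha / 2 /\ Rbar_lt (exp (p * Re w)) rho.

Lemma Rbar_lt_between (x : R) (rho : Rbar) : Rbar_lt x rho -> exists y : R, x < y /\ Rbar_lt y rho.
Proof.
  destruct rho as [r| |]; simpl; intros H.
  - exists ((x + r) / 2). lra.
  - exists (x + 1). split; [lra|auto].
  - contradiction.
Qed.

(** The logarithmic image of a sector extends to [Re = -oo], so one margin [R0] serves for all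
    points to the left and nearer the axis. This provides the uniform radius for the identity
    theorem on segments. *)
Lemma log_dom_open (p alpha : R) (rho : Rbar) (z : C) : 0 < p -> log_dom p alpha rho z ->
  exists R0, 0 < R0 /\ forall s, Re s <= Re z + R0 -> Rabs (Im s) <= Rabs (Im z) + R0 -> log_dom p alpha rho s.
Proof.
  intros Hp [H1 H2]. destruct (Rbar_lt_between _ _ H2) as [y [Hy1 Hy2]].
  assert (E := exp_pos (p * Re z)).
  rewrite Rabs_mult, (Rabs_pos_eq p) in H1 by lra.
  set (d1 := (alpha / 2 - p * Rabs (Im z)) / (2 * p)). set (d2 := (ln y - p * Re z) / (2 * p)).
  assert (Hln : p * Re z < ln y) by (rewrite <- (ln_exp (p * Re z)); apply ln_increasing; auto).
  assert (Hd1 : 0 < d1) by (apply Rdiv_lt_0_compat; lra).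
  assert (Hd2 : 0 < d2) by (apply Rdiv_lt_0_compat; lra).
  exists (Rmin d1 d2). split; [apply Rmin_glb_lt; auto|]. intros s Hs1 Hs2.
  assert (T1 := Rmin_l d1 d2). assert (T2 := Rmin_r d1 d2).
  split.
  - rewrite Rabs_mult, (Rabs_pos_eq p) by lra.
    assert (p * Rabs (Im s) <= p * (Rabs (Im z) + d1)) by (apply Rmult_le_compat_l; lra).
    assert (E1 : p * d1 = (alpha / 2 - p * Rabs (Im z)) / 2) by (unfold d1; field; lra). lra.
  - apply Rbar_le_lt_trans with (Finite y); auto. simpl.
    rewrite <- (exp_ln y) by lra. apply exp_le.
    assert (p * Re s <= p * (Re z + d2)) by (apply Rmult_le_compat_l; lra).
    assert (E1 : p * d2 = (ln y - p * Re z) / 2) by (unfold d2; field; lra). lra.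
Qed.

Lemma is_sum_of_geom (a : nat -> C) (l : C) (A q : R) : 0 <= q < 1 -> 0 <= A ->
  (forall n, Cmod (l - csum a n) <= A * q ^ n) -> is_sum a l.
Proof.
  intros Hq HA H eps Heps.
  destruct (pow_lt_1_zero q ltac:(rewrite Rabs_pos_eq; lra) (eps / (A + 1))) as [N HN]; [apply Rdiv_lt_0_compat; lra|].
  exists N. intros n Hn. rewrite Cmod_minus_sym. specialize (H n). specialize (HN n Hn).
  assert (P := pow_le q n (proj1 Hq)). rewrite Rabs_pos_eq in HN by auto.
  apply Rmult_lt_compat_l with (r := A + 1) in HN; [|lra].
  replace ((A + 1) * (eps / (A + 1))) with eps in HN by (field; lra). nra.
Qed.

Lemma Rpower_exp_m (m p x : R) : m * p = 1 -> Rpower (exp (p * x)) m = exp x.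
Proof. intros H. unfold Rpower. rewrite ln_exp. f_equal. rewrite <- Rmult_assoc, H. ring. Qed.

Lemma exp_nat_mul (n : nat) (p x : R) : exp (INR n * p * x) = exp (p * x) ^ n.
Proof.
  rewrite Rpower_pow_exp, Rpower_pow_comm by apply exp_pos. f_equal. unfold Rpower. rewrite ln_exp. reflexivity.
Qed.

Section Forward.
Context (s m theta : R) (c : nat -> C) (Hs : 1 < s < 3) (Hm : m = / (s - 1)) (Hc : formal_gevrey s c).
Let p := s - 1.
Let g := power_series_sum (formal_borel m c).

Lemma p_pos : 0 < p.
Proof. unfold p. lra. Qed.
Lemma mp_1 : m * p = 1.
Proof. rewrite Hm. unfold p. field. lra. Qed.
(** Passes from the sector to a closed half strip on which a single pair [M], [K] is valid, in the
    form required by the Borel transform. *)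
Lemma realization_log (alpha : R) (rho : Rbar) (f : C -> C) : wide_realization s theta c alpha rho f ->
  (forall w, log_dom p alpha rho w -> CE (fun w => f (Zc p theta w)) w) /\
  exists r dl M K, 0 < dl <= PI / 4 /\ 0 < M /\ 0 < K /\ half_hol (fun w => f (Zc p theta w)) r (Ubeta dl) /\
    forall n w, Re w <= r -> Rabs (Im w) <= Ubeta dl ->
    Cmod (f (Zc p theta w) - expansion p (rot theta c) n w) <= M * K ^ n * Rpower (INR (fact n)) p * exp (INR n * p * Re w).
Proof.
  intros [[Ha1 Ha2] [Hr [[Hf _] Has]]]. assert (Hp := p_pos). assert (HPI := PI_RGT_0).
  assert (CF : forall w, log_dom p alpha rho w -> CE (fun w => f (Zc p theta w)) w).
  { intros w [H1 H2]. apply (CE_comp f (Zc p theta)); [apply CE_Zc|].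
    apply Hf. apply (sector_Zc p); auto. exists w. auto. }
  split; auto.
  destruct (Rbar_lt_between 0 rho Hr) as [r' [Hr1 Hr2]].
  set (r := ln (r' / 2) / p).
  assert (Er : exp (p * r) = r' / 2).
  { unfold r. replace (p * (ln (r' / 2) / p)) with (ln (r' / 2)) by (field; lra). apply exp_ln; lra. }
  set (a := alpha / (2 * p)).
  assert (Ea : p * a = alpha / 2) by (unfold a; field; lra).
  assert (Ha : PI / 2 < a).
  { apply Rmult_lt_reg_l with p; auto. rewrite Ea. unfold p. lra. }
  (* [a] is half the opening in the logarithmic coordinate and exceeds [PI / 2] because the opening
     exceeds [(s - 1) * PI]. Half of this excess is spent on the contour; [PI / 4] is needed for the
     sign of the cosine. *)
  set (dl := Rmin (PI / 4) ((a - PI / 2) / 2)).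
  assert (Hdl : 0 < dl) by (apply Rmin_glb_lt; lra).
  assert (D1 : dl <= PI / 4) by apply Rmin_l. assert (D2 : dl <= (a - PI / 2) / 2) by apply Rmin_r.
  (* The half strip is closed, while the hypothesis speaks of open proper subsectors; [b1] lies
     strictly between its half height and that of the full sector. *)
  set (b1 := (Ubeta dl + a) / 2).
  assert (Hb1 : Ubeta dl < b1 < a) by (unfold b1, Ubeta; lra).
  assert (Hex : forall w, Re w <= r -> exp (p * Re w) <= r' / 2).
  { intros w Hw. rewrite <- Er. apply exp_le. apply Rmult_le_compat_l; lra. }
  assert (Hin : forall w, Re w <= r -> Rabs (Im w) <= Ubeta dl -> log_dom p alpha rho w).
  { intros w H1 H2. split.
    - rewrite Rabs_mult, Rabs_pos_eq, <- Ea by lra. apply Rmult_lt_compat_l; lra.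
    - apply Rbar_lt_trans with (Finite r'); auto. simpl. specialize (Hex w H1). lra. }
  destruct (Has (theta - p * b1) (theta + p * b1) r') as [M [K [HM [HK H]]]].
  { split; [auto|]. split; auto. assert (p * b1 < p * a) by (apply Rmult_lt_compat_l; lra).
    assert (0 < p * b1) by (apply Rmult_lt_0_compat; auto; unfold b1, Ubeta; lra). lra. }
  exists r, dl, M, K. split; [split; auto|]. split; auto. split; auto. split.
  - intros w H1 H2. apply CF, Hin; auto.
  - intros n w H1 H2.
    assert (Hw : arg_sector (theta - p * b1) (theta + p * b1) r' (Zc p theta w)).
    { apply (arg_sector_Zc p theta); auto. exists w. split; auto. split.
      - apply Rabs_le_between in H2. assert (p * Im w < p * b1) by (apply Rmult_lt_compat_l; lra).
        assert (p * - b1 < p * Im w) by (apply Rmult_lt_compat_l; lra). lra.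
      - simpl. specialize (Hex w H1). lra. }
    specialize (H n _ Hw). rewrite partial_sum_csum, csum_rot, Cmod_Zc in H.
    rewrite exp_nat_mul. exact H.
Qed.

(** The continuation is the Borel integral of [f], of opening [2 * p * dl]. The Laplace
    representation is recorded for points near the ray and close to the vertex, where uniqueness
    starts from. *)
Theorem realization_to_continuation (alpha : R) (rho : Rbar) (f : C -> C) : wide_realization s theta c alpha rho f ->
  exists eps h, growing_continuation m theta g eps h /\
    exists X, forall zeta, Re zeta < X -> Rabs (Im zeta) < PI / 3 ->
      is_line (LI (fun w => h (Zc p theta w)) 0 zeta) (f (Zc p theta zeta)).
Proof.
  intros Hw. destruct (realization_log alpha rho f Hw) as [_ [r [dl [M [K [Hdl [HM [HK [HF Has]]]]]]]]].
  set (F := fun w => f (Zc p theta w)) in *.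
  assert (Hp := p_pos). assert (HPI := PI_RGT_0). assert (Hmp := mp_1).
  assert (Hp2 : p < 2) by (unfold p; lra).
  assert (HB : forall w, Re w <= r -> Rabs (Im w) <= Ubeta dl -> Cmod (F w) <= M).
  { intros w H1 H2. specialize (Has 0%nat w H1 H2). unfold expansion in Has. simpl in Has.
    rewrite !Rmult_0_l, exp_0 in Has. unfold Rpower in Has. rewrite ln_1, Rmult_0_r, exp_0 in Has.
    unfold F. replace (f (Zc p theta w) - 0)%C with (f (Zc p theta w)) in Has by ring. lra. }
  set (h := fun u => Bor F r dl (Lg p theta u)).
  assert (Hpdl : p * dl < PI) by nra.
  assert (HL : forall w, Rabs (Im w) < dl -> Rabs (p * Im w) < PI).
  { intros w H. rewrite Rabs_mult, Rabs_pos_eq by lra. nra. }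
  assert (Hh : forall w, Rabs (Im w) < dl -> h (Zc p theta w) = Bor F r dl w).
  { intros w H. unfold h. rewrite Lg_Zc; auto. }
  assert (Hdiv : forall w, Rabs (p * Im w) < 2 * p * dl / 2 -> Rabs (Im w) < dl).
  { intros w H. rewrite Rabs_mult, Rabs_pos_eq in H by lra. apply Rmult_lt_reg_l with p; lra. }
  exists (2 * p * dl), h. split.
  - split; [nra|]. split.
    + split.
      * intros u Hu. apply (sector_Zc p) in Hu; auto. destruct Hu as [w [-> [H1 _]]].
        apply Hdiv in H1. apply CE_comp_Lg; auto.
        destruct (Bor_CD F r dl M Hdl HF HB w H1) as [l [_ Hl]]. eexists; exact Hl.
      * destruct (formal_borel_bound s m c ltac:(lra) Hm Hc) as [Mg [Kg [HMg [HKg Hg]]]].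
        assert (E1 := exp_pos 1).
        (* The three bounds make the remainders of [Bor_series] decay like [(1 / 2)^n], make the
           power series of [g] converge, and give [Re w <= r]. Borel integral and [g] are then sums
           of the same series. *)
        set (dlt := Rmin (Rmin (/ (2 * K * exp 1)) (/ Kg)) (exp (p * r))).
        assert (Pd : 0 < dlt).
        { repeat apply Rmin_glb_lt; try apply Rinv_0_lt_compat; try apply exp_pos; auto. repeat apply Rmult_lt_0_compat; lra. }
        exists dlt. split; auto. intros u Hu Hud.
        apply (sector_Zc p) in Hu; auto. destruct Hu as [w [-> [H1 _]]]. apply Hdiv in H1.
        rewrite Hh by auto.
        assert (T1 := Rmin_l (Rmin (/ (2 * K * exp 1)) (/ Kg)) (exp (p * r))).
        assert (T2 := Rmin_r (Rmin (/ (2 * K * exp 1)) (/ Kg)) (exp (p * r))).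
        assert (T3 := Rmin_l (/ (2 * K * exp 1)) (/ Kg)). assert (T4 := Rmin_r (/ (2 * K * exp 1)) (/ Kg)).
        fold dlt in T1, T2.
        rewrite Cmod_Zc in Hud.
        assert (Hwr : Re w <= r).
        { assert (p * Re w < p * r) by (apply exp_lt_inv; lra). apply Rlt_le, Rmult_lt_reg_l with p; auto. }
        assert (Hq : K * exp 1 * exp (p * Re w) <= 1 / 2).
        { assert (exp (p * Re w) <= / (2 * K * exp 1)) by lra.
          apply Rmult_le_compat_l with (r := K * exp 1) in H; [|nra].
          replace (K * exp 1 * / (2 * K * exp 1)) with (1 / 2) in H by (field; lra). exact H. }
        assert (Hg1 : Kg * Cmod (Zc p theta w) < 1).
        { rewrite Cmod_Zc. assert (exp (p * Re w) < / Kg) by lra.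
          apply Rmult_lt_compat_l with (r := Kg) in H; auto. rewrite Rinv_r in H by lra. exact H. }
        assert (Pw := Rabs_pos (Im w)).
        destruct (Bor_series r dl Hdl F (rot theta c) p M K (Rabs (Im w)) Hp ltac:(lra) HK ltac:(lra) HF Has) as [A [HA HS]].
        assert (S1 : is_sum (fun k => borel_coef p (rot theta c) k * mono (INR k * p) w)%C (Bor F r dl w)).
        { apply (is_sum_of_geom _ _ A (1 / 2)); [lra|auto|]. intros n.
          eapply Rle_trans; [apply (HS n w); lra|]. apply Rmult_le_compat_l; auto. apply pow_incr. split; auto.
          assert (T := exp_pos (p * Re w)). repeat apply Rmult_le_pos; lra. }
        destruct (power_series_sum_correct (formal_borel m c) Mg Kg ltac:(lra) HKg Hg (Zc p theta w) Hg1) as [S2 _].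
        eapply is_sum_unique; [exact S1|].
        intros e He. destruct (S2 e He) as [N HN]. exists N. intros n Hn. specialize (HN n Hn).
        rewrite csum_rot in HN.
        assert (EE : expansion p (rot theta (formal_borel m c)) n w = csum (fun k => borel_coef p (rot theta c) k * mono (INR k * p) w)%C n).
        { apply expansion_ext. intros k. apply rot_borel; auto. }
        rewrite EE in HN. exact HN.
    + intros eta1 eta2 He1 He2 He3.
      set (d := Rmax (Rabs ((eta1 - theta) / p)) (Rabs ((eta2 - theta) / p))).
      assert (Hd : 0 <= d < dl).
      { split; [eapply Rle_trans; [apply Rabs_pos|apply Rmax_l]|].
        assert (Q : forall x, Rabs (x - theta) < p * dl -> Rabs ((x - theta) / p) < dl).
        { intros x Hx. unfold Rdiv. rewrite Rabs_mult, (Rabs_pos_eq (/ p)) by (apply Rlt_le, Rinv_0_lt_compat; auto).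
          apply Rmult_lt_reg_r with p; auto. rewrite Rmult_assoc, Rinv_l, Rmult_1_r by lra. lra. }
        unfold d. apply Rmax_lub_lt; apply Q, Rabs_lt_between; lra. }
      destruct (Bor_growth F r dl M Hdl HF HB d Hd) as [B [HB0 HBg]].
      exists 1, (exp (- r)), B. split; [lra|]. split; [apply exp_pos|]. split; auto.
      intros z Hz Hz1. apply (arg_sector_Zc p theta) in Hz; auto. destruct Hz as [w [-> [Hw1 _]]].
      rewrite Cmod_Zc in *. rewrite Rpower_exp_m by auto.
      assert (HIm : Rabs (Im w) <= d).
      { assert (Q : forall x, (x - theta) / p * p = x - theta) by (intros; field; lra).
        assert (Q1 : (eta1 - theta) / p < Im w) by (apply Rmult_lt_reg_r with p; auto; rewrite Q; lra).
        assert (Q2 : Im w < (eta2 - theta) / p) by (apply Rmult_lt_reg_r with p; auto; rewrite Q; lra).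
        assert (A1 := Rmax_l (Rabs ((eta1 - theta) / p)) (Rabs ((eta2 - theta) / p))).
        assert (A2 := Rmax_r (Rabs ((eta1 - theta) / p)) (Rabs ((eta2 - theta) / p))). fold d in A1, A2.
        assert (A3 := Rle_abs (- ((eta1 - theta) / p))). rewrite Rabs_Ropp in A3.
        assert (A4 := Rle_abs ((eta2 - theta) / p)). apply Rabs_le. lra. }
      assert (HRe : 0 <= Re w).
      { rewrite <- exp_0 in Hz1 at 1. apply exp_lt_inv in Hz1. apply Rlt_le, Rmult_lt_reg_l with p; lra. }
      rewrite Hh by lra. apply HBg; auto.
  (* The inversion needs [exp (- r) < Re (exp (- zeta))]: the cosine is above [1 / 2] for
     [|Im zeta| < PI / 3], and moving left by 1 gains a factor [exp 1 > 2]. *)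
  - exists (r - 1). intros zeta Hz1 Hz2.
    assert (HC : 1 / 2 < cos (Im zeta)).
    { rewrite <- cos_PI3. replace (cos (Im zeta)) with (cos (Rabs (Im zeta))).
      2:{ unfold Rabs. destruct Rcase_abs; [apply cos_neg|reflexivity]. }
      assert (T := Rabs_pos (Im zeta)). apply cos_decreasing_1; lra. }
    assert (L := Laplace_Borel F r dl M zeta Hdl HF HB ltac:(lra)).
    eapply is_line_ext; [|apply L].
    + intros x. unfold LI. rewrite Hh; auto. simpl. rewrite Rabs_R0. lra.
    + rewrite Re_Cexp, re_opp, im_opp, cos_neg.
      assert (E1 : 2 < exp 1) by (assert (T := exp_ineq1 1 ltac:(lra)); lra).
      assert (E2 : exp (1 - r) < exp (- Re zeta)) by (apply exp_increasing; lra).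
      unfold Rminus in E2. rewrite exp_plus in E2. assert (E3 := exp_pos (- r)).
      assert (E4 := exp_pos (- Re zeta)).
      assert (exp (- Re zeta) * (1 / 2) < exp (- Re zeta) * cos (Im zeta)) by (apply Rmult_lt_compat_l; auto).
      assert (2 * exp (- r) < exp 1 * exp (- r)) by (apply Rmult_lt_compat_r; auto). lra.
Qed.
End Forward.

(** * From a growing continuation to an asymptotic function *)

Lemma line_bounded_on_segment (f : R -> C) (a b : R) : (forall x, Ccont f x) -> exists M, 0 <= M /\ forall x, a <= x <= b -> Cmod (f x) <= M.
Proof.
  intros Hc. destruct (Rle_dec a b) as [Hab|Hab].
  - assert (E : ex_CInt f a b) by (apply ex_CInt_cont; auto).
    apply ex_RInt_ub in E. destruct E as [M HM]. rewrite Rmin_left, Rmax_right in HM by auto.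
    exists M. split.
    + eapply Rle_trans; [apply Cmod_ge_0|]. rewrite (Cmod_norm (f a)). apply HM. lra.
    + intros x Hx. rewrite Cmod_norm. apply HM; auto.
  - exists 0. split; [lra|]. intros; lra.
Qed.

(** The ratio [v / 2] leaves a convergent factor [(1 / 2)^k] beside [v^k], and [v >= 1] raises every
    power to [v^n]. *)
Lemma csum_norm_geom (a : nat -> C) (M v : R) (n : nat) : 0 <= M -> 1 <= v ->
  (forall k, Cmod (a k) <= M * (v / 2) ^ k) -> Cmod (csum a n) <= M * 2 * v ^ n.
Proof.
  intros HM Hv Ha.
  assert (K : Cmod (csum a n) <= M * 2 * (1 - (1 / 2) ^ n) * v ^ n).
  { induction n as [|n IH].
    - simpl. rewrite Cmod_0. lra.
    - simpl csum. eapply Rle_trans; [apply Cmod_triangle|]. specialize (Ha n).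
      assert (P : 0 < v ^ n) by (apply pow_lt; lra). assert (P2 : 0 < (1 / 2) ^ n) by (apply pow_lt; lra).
      assert (Eh : (v / 2) ^ n = (1 / 2) ^ n * v ^ n) by (rewrite <- Rpow_mult_distr; f_equal; field).
      rewrite Eh in Ha.
      assert (P3 : (1 / 2) ^ n <= 1) by (assert (T := pow_incr (1 / 2) 1 n ltac:(lra)); rewrite pow1 in T; exact T).
      assert (Q : 0 <= M * 2 * (1 - (1 / 2) ^ S n) * v ^ n).
      { repeat apply Rmult_le_pos; try lra. simpl. lra. }
      apply Rle_trans with (M * 2 * (1 - (1 / 2) ^ S n) * v ^ n).
      + simpl in *. nra.
      + simpl (v ^ S n). rewrite <- (Rmult_1_l (M * 2 * (1 - (1 / 2) ^ S n) * v ^ n)).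
        replace (M * 2 * (1 - (1 / 2) ^ S n) * (v * v ^ n)) with (v * (M * 2 * (1 - (1 / 2) ^ S n) * v ^ n)) by ring.
        apply Rmult_le_compat_r; auto. }
  eapply Rle_trans; [exact K|]. assert (P : 0 < v ^ n) by (apply pow_lt; lra). assert (P2 : 0 < (1 / 2) ^ n) by (apply pow_lt; lra).
  apply Rmult_le_compat_r; [lra|]. nra.
Qed.

Section Growth.
Context (s m theta : R) (c : nat -> C) (Hs : 1 < s < 3) (Hm : m = / (s - 1)) (Hc : formal_gevrey s c).
Let p := s - 1.
Let g := power_series_sum (formal_borel m c).
Context (eps : R) (h : C -> C) (Hgc : growing_continuation m theta g eps h).
Let H (w : C) : C := h (Zc p theta w).

Lemma order_pos : 0 < p.
Proof. unfold p. lra. Qed.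

Lemma continuation_CE (w : C) : Rabs (p * Im w) < eps / 2 -> CE H w.
Proof.
  intros Hw. destruct Hgc as [_ [[Hh _] _]]. apply (CE_comp h (Zc p theta)); [apply CE_Zc|].
  apply Hh. apply (sector_Zc p); [apply order_pos|]. exists w. simpl. auto.
Qed.

Lemma continuation_cont (eta x : R) : Rabs (p * eta) < eps / 2 -> Ccont (fun t => H (t, eta)) x.
Proof. intros He. apply (Ccont_CE H); [apply continuation_CE; auto|apply Ccont_h]. Qed.

(** For [|u| <= nu] the continuation equals [g] and [Kg * |u| <= 1 / 2], so the geometric tail costs
    only a factor 2. The case [n = 0] bounds [H] towards [Re w = -oo]. *)
Lemma continuation_near_origin : exists nu Mg Kg, 0 < nu /\ 0 < Mg /\ 0 < Kg /\ Kg * nu <= 1 / 2 /\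
  (forall k, Cmod (borel_coef p (rot theta c) k) <= Mg * Kg ^ k) /\
  forall w, Rabs (p * Im w) < eps / 2 -> exp (p * Re w) <= nu ->
    forall n, Cmod (H w - expansion p (borel_coef p (rot theta c)) n w) <= 2 * Mg * (Kg * exp (p * Re w)) ^ n.
Proof.
  assert (Hp := order_pos).
  destruct (formal_borel_bound s m c ltac:(lra) Hm Hc) as [Mg [Kg [HMg [HKg Hg]]]].
  destruct Hgc as [_ [[_ [dl [Hdl Hag]]] _]].
  set (nu := Rmin (dl / 2) (/ (2 * Kg))).
  assert (Hnu : 0 < nu) by (apply Rmin_glb_lt; [lra|apply Rinv_0_lt_compat; lra]).
  assert (N1 : nu <= dl / 2) by apply Rmin_l. assert (N2 : nu <= / (2 * Kg)) by apply Rmin_r.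
  assert (N3 : Kg * nu <= 1 / 2).
  { apply Rmult_le_compat_l with (r := Kg) in N2; [|lra].
    replace (Kg * / (2 * Kg)) with (1 / 2) in N2 by (field; lra). exact N2. }
  exists nu, Mg, Kg. repeat (split; auto).
  - intros k. rewrite <- (rot_borel p m) by auto. rewrite Cmod_rot. apply Hg.
  - intros w Hw He n. unfold H. rewrite Hag.
    + assert (E := exp_pos (p * Re w)).
      assert (Q : Kg * Cmod (Zc p theta w) <= 1 / 2) by (rewrite Cmod_Zc; nra).
      destruct (power_series_sum_correct (formal_borel m c) Mg Kg ltac:(lra) HKg Hg (Zc p theta w) ltac:(lra)) as [_ S].
      specialize (S n). rewrite csum_rot in S.
      rewrite (expansion_ext p _ (borel_coef p (rot theta c))) in S by (intros; apply rot_borel; auto).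
      fold g in S. rewrite Cmod_Zc in *. eapply Rle_trans; [exact S|].
      assert (P : 0 <= (Kg * exp (p * Re w)) ^ n) by (apply pow_le; nra).
      apply Rle_trans with (Mg * (Kg * exp (p * Re w)) ^ n / (1 / 2)); [|right; field].
      apply div_le_of_ge; try lra. apply Rmult_le_pos; lra.
    + apply (sector_Zc p); auto. exists w. simpl. auto.
    + rewrite Cmod_Zc. lra.
Qed.

(** The power series controls small [|u|] and the growth hypothesis large [|u|]. The annulus between
    is left out: contour rotation does not need it, and on single lines it is filled in below. *)
Lemma continuation_growth_strip (d : R) : 0 <= d -> p * d < eps / 2 -> exists X b B, 0 < b /\ 0 <= B /\
  forall w, Rabs (Im w) <= d -> X <= Rabs (Re w) -> Cmod (H w) <= B * exp (b * exp (Re w)).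
Proof.
  intros Hd Hpd. assert (Hp := order_pos).
  destruct continuation_near_origin as [nu [Mg [Kg [Hnu [HMg [HKg [_ [_ Hn]]]]]]]].
  set (e := (p * d + eps / 2) / 2).
  destruct Hgc as [_ [_ Hgr]].
  destruct (Hgr (theta - e) (theta + e)) as [r [b [B [Hr [Hb [HB Hbd]]]]]]; try (unfold e; nra).
  assert (Hmp : m * p = 1) by (rewrite Hm; unfold p; field; lra).
  set (X := Rmax 0 (Rmax (- (ln nu / p)) (ln r / p + 1))).
  assert (X1 := Rmax_l 0 (Rmax (- (ln nu / p)) (ln r / p + 1))).
  assert (X2 := Rmax_r 0 (Rmax (- (ln nu / p)) (ln r / p + 1))).
  assert (X3 := Rmax_l (- (ln nu / p)) (ln r / p + 1)). assert (X4 := Rmax_r (- (ln nu / p)) (ln r / p + 1)).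
  fold X in X1, X2.
  exists X, b, (B + 2 * Mg). split; auto. split; [lra|]. intros w Hw HX.
  assert (E0 := exp_pos (b * exp (Re w))).
  assert (HpI : Rabs (p * Im w) <= p * d) by (rewrite Rabs_mult, Rabs_pos_eq by lra; apply Rmult_le_compat_l; lra).
  unfold Rabs in HX. destruct Rcase_abs as [L|L].
  - assert (Hsm : exp (p * Re w) <= nu).
    { rewrite <- (exp_ln nu) by auto. apply exp_le.
      assert (T : p * Re w <= p * (ln nu / p)) by (apply Rmult_le_compat_l; lra).
      replace (p * (ln nu / p)) with (ln nu) in T by (field; lra). exact T. }
    specialize (Hn w ltac:(lra) Hsm 0%nat). unfold expansion in Hn. simpl in Hn.
    replace (H w - 0)%C with (H w) in Hn by ring.
    assert (E1 : 1 <= exp (b * exp (Re w))).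
    { rewrite <- exp_0 at 1. apply exp_le. apply Rmult_le_pos; [lra|apply Rlt_le, exp_pos]. }
    nra.
  - assert (Hbig : r < Cmod (Zc p theta w)).
    { rewrite Cmod_Zc. rewrite <- (exp_ln r) by auto. apply exp_increasing.
      assert (T : p * (ln r / p + 1) <= p * Re w) by (apply Rmult_le_compat_l; lra).
      replace (p * (ln r / p + 1)) with (ln r + p) in T by (field; lra). lra. }
    assert (Hbd' := Hbd (Zc p theta w)). rewrite Cmod_Zc, Rpower_exp_m in Hbd' by auto. rewrite Cmod_Zc in Hbig.
    eapply Rle_trans; [apply Hbd'; auto|].
    + apply (arg_sector_Zc p theta); auto. exists w. split; auto. split; [|simpl; auto].
      apply Rabs_le_between in HpI. unfold e. lra.
    + apply Rmult_le_compat_r; lra.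
Qed.

(** The bounded middle segment and the neighbourhood of the origin only enlarge the constant [B];
    the type [b] is preserved, as the domain of the Laplace transform depends on it. *)
Lemma continuation_growth_line (eta b : R) : Rabs (p * eta) < eps / 2 -> 0 <= b ->
  (exists X B0, 0 <= B0 /\ forall x, X <= x -> Cmod (H (x, eta)) <= B0 * exp (b * exp x)) ->
  exists B, 0 <= B /\ forall x, Cmod (H (x, eta)) <= B * exp (b * exp x).
Proof.
  intros He Hb [X [B0 [HB0 HX]]]. assert (Hp := order_pos).
  destruct continuation_near_origin as [nu [Mg [Kg [Hnu [HMg [HKg [_ [_ Hn]]]]]]]].
  destruct (line_bounded_on_segment (fun x => H (x, eta)) (ln nu / p) X) as [M [HM HMb]].
  { intros x. apply continuation_cont; auto. }
  exists (B0 + M + 2 * Mg). split; [lra|]. intros x.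
  assert (E1 : 1 <= exp (b * exp x)).
  { rewrite <- exp_0 at 1. apply exp_le. apply Rmult_le_pos; [lra|apply Rlt_le, exp_pos]. }
  destruct (Rle_dec X x) as [L|L].
  - eapply Rle_trans; [apply HX; auto|]. apply Rmult_le_compat_r; lra.
  - destruct (Rle_dec (ln nu / p) x) as [L2|L2].
    + specialize (HMb x ltac:(lra)). cbv beta in HMb. nra.
    + assert (Hsm : exp (p * x) <= nu).
      { rewrite <- (exp_ln nu) by auto. apply exp_le.
        assert (T : p * x <= p * (ln nu / p)) by (apply Rmult_le_compat_l; lra).
        replace (p * (ln nu / p)) with (ln nu) in T by (field; lra). exact T. }
      specialize (Hn (x, eta) He Hsm 0%nat). unfold expansion in Hn. simpl in Hn.
      replace (H (x, eta) - 0)%C with (H (x, eta)) in Hn by ring. nra.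
Qed.

Lemma continuation_growth_line_exists (eta : R) : Rabs (p * eta) < eps / 2 ->
  exists b B, 0 < b /\ 0 <= B /\ forall x, Cmod (H (x, eta)) <= B * exp (b * exp x).
Proof.
  intros He. assert (Hp := order_pos).
  destruct (continuation_growth_strip (Rabs eta) (Rabs_pos _)) as [X [b [B [Hb [HB Hs2]]]]].
  { rewrite Rabs_mult, (Rabs_pos_eq p) in He by lra. exact He. }
  destruct (continuation_growth_line eta b He ltac:(lra)) as [B' [HB' HL]].
  - exists (Rmax X 0), B. split; auto. intros x Hx. apply (Hs2 (x, eta)); simpl; [lra|].
    assert (T1 := Rmax_l X 0). assert (T2 := Rmax_r X 0). rewrite Rabs_pos_eq; lra.
  - exists b, B'. auto.
Qed.

Lemma continuation_line_expansion (eta b B : R) : Rabs (p * eta) < eps / 2 -> 0 <= b -> 0 <= B ->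
  (forall x, Cmod (H (x, eta)) <= B * exp (b * exp x)) ->
  exists M1 K1, 0 <= M1 /\ 0 < K1 /\ forall n x,
    Cmod (H (x, eta) - expansion p (borel_coef p (rot theta c)) n (x, eta)) <= M1 * K1 ^ n * exp (INR n * p * x) * exp (b * exp x).
Proof.
  intros He Hb HB HL. assert (Hp := order_pos).
  destruct continuation_near_origin as [nu [Mg [Kg [Hnu [HMg [HKg [HKn [Hco Hn]]]]]]]].
  assert (Hnui : 0 < / nu) by (apply Rinv_0_lt_compat; auto).
  exists (B + 2 * Mg), (/ nu). split; [lra|]. split; auto. intros n x.
  rewrite exp_nat_mul. set (v := exp (p * x)). assert (Hv : 0 < v) by apply exp_pos.
  assert (E1 : 1 <= exp (b * exp x)).
  { rewrite <- exp_0 at 1. apply exp_le. apply Rmult_le_pos; [lra|apply Rlt_le, exp_pos]. }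
  replace ((B + 2 * Mg) * (/ nu) ^ n * v ^ n * exp (b * exp x)) with ((B + 2 * Mg) * (/ nu * v) ^ n * exp (b * exp x)) by (rewrite Rpow_mult_distr; ring).
  assert (HKv : Kg * v <= / nu * v / 2).
  { assert (Kg <= / nu / 2).
    { apply Rmult_le_reg_r with nu; auto. replace (/ nu / 2 * nu) with (1 / 2) by (field; lra). exact HKn. }
    nra. }
  destruct (Rle_dec v nu) as [L|L].
  - eapply Rle_trans; [apply (Hn (x, eta)); auto|]. simpl. fold v.
    assert (P : 0 <= (Kg * v) ^ n) by (apply pow_le; nra).
    assert (P2 : (Kg * v) ^ n <= (/ nu * v) ^ n) by (apply pow_incr; split; nra).
    apply Rle_trans with ((B + 2 * Mg) * (/ nu * v) ^ n * 1).
    + rewrite Rmult_1_r. apply Rmult_le_compat; lra.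
    + apply Rmult_le_compat_l; auto. apply Rmult_le_pos; lra.
  - assert (Hv1 : 1 <= / nu * v).
    { apply Rmult_le_reg_l with nu; auto. rewrite <- Rmult_assoc, Rinv_r by lra. lra. }
    assert (Hvn : 1 <= (/ nu * v) ^ n) by (apply pow_R1_Rle; auto).
    eapply Rle_trans; [apply Cmod_triangle_minus|].
    assert (C2 : Cmod (expansion p (borel_coef p (rot theta c)) n (x, eta)) <= Mg * 2 * (/ nu * v) ^ n).
    { apply csum_norm_geom; auto; [lra|]. intros k. rewrite Cmod_mult, Cmod_mono. simpl.
      rewrite exp_nat_mul. fold v. eapply Rle_trans; [apply Rmult_le_compat_r; [apply pow_le; lra|apply Hco]|].
      rewrite Rmult_assoc, <- Rpow_mult_distr. apply Rmult_le_compat_l; [lra|]. apply pow_incr. split; nra. }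
    specialize (HL x).
    assert (G1 : B * exp (b * exp x) <= B * ((/ nu * v) ^ n * exp (b * exp x))).
    { apply Rmult_le_compat_l; auto. nra. }
    assert (G2 : Mg * 2 * (/ nu * v) ^ n <= Mg * 2 * ((/ nu * v) ^ n * exp (b * exp x))).
    { apply Rmult_le_compat_l; [lra|]. nra. }
    replace ((B + 2 * Mg) * (/ nu * v) ^ n * exp (b * exp x)) with
      (B * ((/ nu * v) ^ n * exp (b * exp x)) + Mg * 2 * ((/ nu * v) ^ n * exp (b * exp x))) by ring.
    lra.
Qed.
End Growth.

Lemma cos_ge_sin_gap (t e : R) : 0 <= e <= PI / 2 -> Rabs t <= PI / 2 - e -> sin e <= cos t.
Proof.
  intros He Ht. assert (HPI := PI_RGT_0).
  replace (cos t) with (cos (Rabs t)).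
  2:{ unfold Rabs. destruct Rcase_abs; [apply cos_neg|reflexivity]. }
  rewrite <- cos_shift. assert (T := Rabs_pos t).
  destruct (Req_dec (Rabs t) (PI / 2 - e)) as [->|]; [lra|].
  apply Rlt_le, cos_decreasing_1; lra.
Qed.

(** An angular margin [e] makes the cosine at least [sin e], and [x1] is the point where
    [b * exp (Re zeta)] uses up half of it. *)
Lemma decay_lower (eta b e x1 : R) (zeta : C) : 0 < e <= PI / 2 -> 0 < b -> x1 = ln (sin e / (2 * b)) ->
  Rabs (eta - Im zeta) <= PI / 2 - e -> Re zeta <= x1 -> sin e / 2 <= exp (Re zeta) * decay eta zeta b.
Proof.
  intros He Hb -> Ha Hr. assert (HPI := PI_RGT_0).
  assert (S : 0 < sin e) by (apply sin_gt_0; lra).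
  assert (Hc := cos_ge_sin_gap (eta - Im zeta) e ltac:(lra) Ha).
  assert (E : exp (Re zeta) <= sin e / (2 * b)).
  { rewrite <- (exp_ln (sin e / (2 * b))) by (apply Rdiv_lt_0_compat; lra). apply exp_le; auto. }
  apply Rmult_le_compat_l with (r := b) in E; [|lra].
  replace (b * (sin e / (2 * b))) with (sin e / 2) in E by (field; lra).
  unfold decay. rewrite Rmult_minus_distr_l, <- Rmult_assoc, <- exp_plus.
  replace (Re zeta + - Re zeta) with 0 by ring. rewrite exp_0. lra.
Qed.

Lemma growth_weaken (B b b' x X : R) : 0 <= B -> b <= b' -> X <= B * exp (b * exp x) -> X <= B * exp (b' * exp x).
Proof.
  intros HB Hb HX. eapply Rle_trans; [exact HX|]. apply Rmult_le_compat_l; auto. apply exp_le.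
  apply Rmult_le_compat_r; auto. apply Rlt_le, exp_pos.
Qed.

Lemma CE_ext_loc (f g : C -> C) (z : C) (d : R) : 0 < d -> (forall w, Cmod (w - z) < d -> f w = g w) -> CE f z -> CE g z.
Proof. intros Hd E [l Hl]. exists l. apply (CD_ext_loc f g z l d); auto. Qed.

Lemma Im_near (w z : C) (d : R) : Cmod (w - z) < d -> Im z - d < Im w < Im z + d.
Proof. intros H. assert (T := im_le_Cmod (w - z)). rewrite Im_minus in T. apply Rabs_le_between in T. lra. Qed.
Lemma Re_near (w z : C) (d : R) : Cmod (w - z) < d -> Re z - d < Re w < Re z + d.
Proof. intros H. assert (T := re_le_Cmod (w - z)). rewrite Re_minus in T. apply Rabs_le_between in T. lra. Qed.

Section Backward.
Context (s m theta : R) (c : nat -> C) (Hs : 1 < s < 3) (Hm : m = / (s - 1)) (Hc : formal_gevrey s c).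
Let p := s - 1.
Let g := power_series_sum (formal_borel m c).
Context (eps : R) (h : C -> C) (Hgc : growing_continuation m theta g eps h).
Let H (w : C) : C := h (Zc p theta w).

(** Watson's lemma with Gevrey control. The Borel polynomial has the original partial sum as its
    Laplace transform, so the remainder of the transform is the transform of the remainder of [H],
    to which [Lap_remainder] applies. *)
Lemma Lap_expansion (eta b e x1 : R) : Rabs (p * eta) < eps / 2 -> 0 < b -> 0 < e <= PI / 2 ->
  x1 = ln (sin e / (2 * b)) ->
  (exists B, 0 <= B /\ forall x, Cmod (H (x, eta)) <= B * exp (b * exp x)) ->
  exists M K, 0 < M /\ 0 < K /\ forall zeta, Rabs (eta - Im zeta) <= PI / 2 - e -> Re zeta <= x1 ->
    CE (Lap H eta) zeta /\ is_line (LI H eta zeta) (Lap H eta zeta) /\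
    forall n, Cmod (Lap H eta zeta - expansion p (rot theta c) n zeta) <=
      M * K ^ n * Rpower (INR (fact n)) p * exp (INR n * p * Re zeta).
Proof.
  intros He Hb Hee Hx1 [B [HB HL]]. assert (Hp := order_pos s Hs). fold p in Hp. assert (HPI := PI_RGT_0).
  destruct (continuation_line_expansion s m theta c Hs Hm Hc eps h Hgc eta b B He ltac:(lra) HB HL) as [M1 [K1 [HM1 [HK1 HE]]]].
  set (q0 := sin e / 2). assert (S : 0 < sin e) by (apply sin_gt_0; lra). assert (Hq0 : 0 < q0) by (unfold q0; lra).
  assert (HP : 0 < Rpower (2 * p / q0) p) by apply exp_pos.
  exists (M1 * (2 / q0) + 1), (K1 * Rpower (2 * p / q0) p).
  assert (H2q : 0 < 2 / q0) by (apply Rdiv_lt_0_compat; lra).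
  split; [nra|]. split; [nra|]. intros zeta Ha Hr.
  assert (HD : q0 <= exp (Re zeta) * decay eta zeta b) by (apply decay_lower with (x1 := x1); auto).
  assert (HD0 : 0 < decay eta zeta b) by (assert (T := exp_pos (Re zeta)); nra).
  assert (Hcont := fun x => continuation_cont s m theta c Hs eps h Hgc eta x He).
  assert (HLine := Lap_is_line H eta b B Hcont HL zeta HD0).
  split; [apply (Lap_CE H eta b B Hcont HL zeta HD0)|]. split; auto. intros n.
  assert (HaS : Rabs (eta - Im zeta) < PI / 2) by lra.
  assert (HP2 := Lap_poly (borel_coef p (rot theta c)) n p eta zeta Hp HaS).
  assert (EP : csum (fun k => borel_coef p (rot theta c) k * RtoC (Gamma (1 + INR k * p)) * mono (INR k * p) zeta)%C n = expansion p (rot theta c) n zeta).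
  { apply csum_ext. intros k. unfold borel_coef. f_equal. field. intros E. apply RtoC_inj in E.
    assert (T := gamma_pos k p Hp). lra. }
  rewrite EP in HP2.
  assert (HI := LI_minus H (expansion p (borel_coef p (rot theta c)) n) eta zeta _ _ HLine HP2).
  assert (HK1n : 0 < K1 ^ n) by (apply pow_lt; auto).
  assert (R := Lap_remainder (fun w => H w - expansion p (borel_coef p (rot theta c)) n w)%C eta b (M1 * K1 ^ n) p q0 n zeta _
    Hp ltac:(nra) Hq0 HD
    (fun x => Ccont_minus _ _ x (Hcont x) (Ccont_CE _ _ x (CE_expansion p _ n _) (Ccont_h eta x))) (HE n) HI).
  eapply Rle_trans; [exact R|]. rewrite Rpow_mult_distr.
  assert (F : 0 < Rpower (INR (fact n)) p) by apply exp_pos.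
  assert (G : 0 < Rpower (2 * p / q0) p ^ n) by (apply pow_lt; auto).
  assert (Ex := exp_pos (INR n * p * Re zeta)).
  replace (M1 * K1 ^ n * Rpower (INR (fact n)) p * Rpower (2 * p / q0) p ^ n * exp (INR n * p * Re zeta) * (2 / q0)) with
    (M1 * (2 / q0) * (K1 ^ n * Rpower (2 * p / q0) p ^ n * Rpower (INR (fact n)) p * exp (INR n * p * Re zeta))) by ring.
  replace ((M1 * (2 / q0) + 1) * (K1 ^ n * Rpower (2 * p / q0) p ^ n) * Rpower (INR (fact n)) p * exp (INR n * p * Re zeta)) with
    ((M1 * (2 / q0) + 1) * (K1 ^ n * Rpower (2 * p / q0) p ^ n * Rpower (INR (fact n)) p * exp (INR n * p * Re zeta))) by ring.
  apply Rmult_le_compat_r; [|lra]. apply Rlt_le; repeat apply Rmult_lt_0_compat; auto.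
Qed.

(* The transforms along the two directions +-e0 agree on an overlap and together cover an opening larger than pi. *)
Lemma glued_transform : exists e0 x1 F M K, 0 < e0 /\ p * (PI + e0) <= 2 * PI /\ 0 < M /\ 0 < K /\
  forall zeta, Rabs (Im zeta) < PI / 2 + e0 / 2 -> Re zeta < x1 -> CE F zeta /\
    forall n, Cmod (F zeta - expansion p (rot theta c) n zeta) <=
      M * K ^ n * Rpower (INR (fact n)) p * exp (INR n * p * Re zeta).
Proof.
  assert (Hp := order_pos s Hs). fold p in Hp. assert (HPI := PI_RGT_0). assert (Hp2 : p < 2) by (unfold p; lra).
  assert (Heps := proj1 Hgc).
  (* The bounds keep both directions well inside the sector of [h], leave a wide overlap of the two
     transforms, and ensure [p * (PI + e0) <= 2 * PI]; the last one is positive because [p < 2]. *)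
  set (e0 := Rmin (eps / (4 * p)) (Rmin (PI / 4) (PI * (2 - p) / (2 * p)))).
  assert (He0 : 0 < e0).
  { unfold e0. repeat apply Rmin_glb_lt; [apply Rdiv_lt_0_compat; lra|lra|apply Rdiv_lt_0_compat; nra]. }
  assert (L1 : e0 <= eps / (4 * p)) by apply Rmin_l.
  assert (L2 : e0 <= PI / 4) by (eapply Rle_trans; [apply Rmin_r|apply Rmin_l]).
  assert (L3 : e0 <= PI * (2 - p) / (2 * p)) by (eapply Rle_trans; [apply Rmin_r|apply Rmin_r]).
  assert (Q1 : p * e0 <= eps / 4).
  { apply Rmult_le_compat_l with (r := p) in L1; [|lra]. replace (p * (eps / (4 * p))) with (eps / 4) in L1 by (field; lra). auto. }
  assert (Q3 : p * e0 <= PI * (2 - p) / 2).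
  { apply Rmult_le_compat_l with (r := p) in L3; [|lra]. replace (p * (PI * (2 - p) / (2 * p))) with (PI * (2 - p) / 2) in L3 by (field; lra). auto. }
  assert (Hu : Rabs (p * e0) < eps / 2) by (rewrite Rabs_pos_eq; nra).
  assert (Hl : Rabs (p * - e0) < eps / 2) by (replace (p * - e0) with (- (p * e0)) by ring; rewrite Rabs_Ropp; auto).
  destruct (continuation_growth_line_exists s m theta c Hs Hm Hc eps h Hgc e0 Hu) as [b1 [B1 [Hb1 [HB1 HL1]]]].
  destruct (continuation_growth_line_exists s m theta c Hs Hm Hc eps h Hgc (- e0) Hl) as [b2 [B2 [Hb2 [HB2 HL2]]]].
  destruct (continuation_growth_strip s m theta c Hs Hm Hc eps h Hgc e0 ltac:(lra) ltac:(fold p; lra)) as [X [b3 [B3 [Hb3 [HB3 HS]]]]].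
  (* One type for both lines and for the strip between them, so that a common [x1] delimits
     convergence and rotation alike. *)
  set (b := b1 + b2 + b3).
  set (x1 := ln (sin (e0 / 2) / (2 * b))).
  destruct (Lap_expansion e0 b (e0 / 2) x1 Hu ltac:(unfold b; lra) ltac:(lra) eq_refl) as [M1 [K1 [HM1 [HK1 U]]]].
  { exists B1. split; auto. intros x. apply growth_weaken with b1; auto. unfold b; lra. apply HL1. }
  destruct (Lap_expansion (- e0) b (e0 / 2) x1 Hl ltac:(unfold b; lra) ltac:(lra) eq_refl) as [M2 [K2 [HM2 [HK2 V]]]].
  { exists B2. split; auto. intros x. apply growth_weaken with b2; auto. unfold b; lra. apply HL2. }
  set (F := fun zeta => if Rle_dec 0 (Im zeta) then Lap H e0 zeta else Lap H (- e0) zeta).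
  assert (Ag : forall zeta, Rabs (Im zeta) < e0 / 2 -> Re zeta < x1 -> Lap H e0 zeta = Lap H (- e0) zeta).
  { intros zeta Hi Hr. apply Rabs_lt_between in Hi.
    assert (A1 : Rabs (e0 - Im zeta) <= PI / 2 - e0 / 2) by (apply Rabs_le; lra).
    assert (A2 : Rabs (- e0 - Im zeta) <= PI / 2 - e0 / 2) by (apply Rabs_le; lra).
    assert (S : 0 < sin (e0 / 2)) by (apply sin_gt_0; lra). assert (Ez := exp_pos (Re zeta)).
    assert (D1 := decay_lower e0 b (e0 / 2) x1 zeta ltac:(lra) ltac:(unfold b; lra) eq_refl A1 ltac:(lra)).
    assert (D2 := decay_lower (- e0) b (e0 / 2) x1 zeta ltac:(lra) ltac:(unfold b; lra) eq_refl A2 ltac:(lra)).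
    symmetry. apply (Lap_rotate H (- e0) e0 b B3 X zeta); try lra; try nra.
    - intros w Hw. apply (continuation_CE s m theta c Hs eps h Hgc). fold p. rewrite Rabs_mult, (Rabs_pos_eq p) by lra.
      assert (Rabs (Im w) <= e0) by (apply Rabs_le; lra). nra.
    - intros w Hw Hx. apply growth_weaken with b3; auto; [unfold b; lra|]. apply HS; auto. apply Rabs_le; lra.
    - apply V; lra.
    - apply U; lra. }
  assert (Up : forall zeta, - (e0 / 2) < Im zeta -> Re zeta < x1 -> F zeta = Lap H e0 zeta).
  { intros zeta Hi Hr. unfold F. destruct Rle_dec; auto. symmetry. apply Ag; auto. apply Rabs_lt_between; lra. }
  assert (Lo : forall zeta, Im zeta < e0 / 2 -> Re zeta < x1 -> F zeta = Lap H (- e0) zeta).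
  { intros zeta Hi Hr. unfold F. destruct Rle_dec; auto. apply Ag; auto. apply Rabs_lt_between; lra. }
  exists e0, x1, F, (M1 + M2), (K1 + K2). split; auto. split; [nra|]. split; [lra|]. split; [lra|].
  intros zeta Hi Hr. apply Rabs_lt_between in Hi.
  assert (W : forall n M' K', 0 < M' <= M1 + M2 -> 0 < K' <= K1 + K2 ->
    M' * K' ^ n * Rpower (INR (fact n)) p * exp (INR n * p * Re zeta) <=
    (M1 + M2) * (K1 + K2) ^ n * Rpower (INR (fact n)) p * exp (INR n * p * Re zeta)).
  { intros n M' K' HM' HK'. apply Rmult_le_compat_r; [apply Rlt_le, exp_pos|]. apply Rmult_le_compat_r; [apply Rlt_le, exp_pos|].
    apply Rmult_le_compat; [lra|apply pow_le; lra|lra|apply pow_incr; lra]. }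
  set (d := Rmin (e0 / 2) (x1 - Re zeta)).
  assert (Hd : 0 < d) by (apply Rmin_glb_lt; lra).
  assert (Dd1 : d <= e0 / 2) by apply Rmin_l. assert (Dd2 : d <= x1 - Re zeta) by apply Rmin_r.
  destruct (Rle_dec 0 (Im zeta)) as [L|L].
  - destruct (U zeta) as [U1 [_ U2]]; [apply Rabs_le; lra|lra|]. split.
    + apply (CE_ext_loc (Lap H e0) F zeta d Hd); auto. intros w Hw. symmetry.
      assert (N1 := Im_near w zeta d Hw). assert (N2 := Re_near w zeta d Hw). apply Up; lra.
    + intros n. rewrite Up by lra. eapply Rle_trans; [apply U2|]. apply W; lra.
  - destruct (V zeta) as [U1 [_ U2]]; [apply Rabs_le; lra|lra|]. split.
    + apply (CE_ext_loc (Lap H (- e0)) F zeta d Hd); auto. intros w Hw. symmetry.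
      assert (N1 := Im_near w zeta d Hw). assert (N2 := Re_near w zeta d Hw). apply Lo; lra.
    + intros n. rewrite Lo by lra. eapply Rle_trans; [apply U2|]. apply W; lra.
Qed.

(** The glued function, carried back by [Lg]. The exponent [s = p + 1] of the derivatives is the [p]
    of the asymptotic remainder plus one factorial from Cauchy's estimate. *)
Theorem continuation_to_realization : exists alpha rho f, wide_realization s theta c alpha rho f.
Proof.
  destruct glued_transform as [e0 [x1 [F [M [K [He0 [Hpe [HM [HK HF]]]]]]]]].
  assert (Hp := order_pos s Hs). fold p in Hp. assert (HPI := PI_RGT_0).
  set (alpha := p * (PI + e0)). set (rho := exp (p * x1)). set (f := fun z => F (Lg p theta z)).
  assert (Ea : alpha / 2 = p * (PI / 2 + e0 / 2)) by (unfold alpha; field).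
  assert (Dom : forall w, log_dom p alpha rho w -> Rabs (Im w) < PI / 2 + e0 / 2 /\ Re w < x1 /\ Rabs (p * Im w) < PI).
  { intros w [H1 H2]. rewrite Ea in H1. split.
    - rewrite Rabs_mult, (Rabs_pos_eq p) in H1 by lra. apply Rmult_lt_reg_l in H1; auto.
    - split; [|unfold alpha in Ea; lra]. simpl in H2. apply exp_lt_inv in H2. apply Rmult_lt_reg_l in H2; auto. }
  assert (Hf : forall w, log_dom p alpha rho w -> f (Zc p theta w) = F w).
  { intros w Hw. unfold f. rewrite Lg_Zc; auto. apply Dom; auto. }
  assert (CF : forall w, log_dom p alpha rho w -> CE f (Zc p theta w)).
  { intros w Hw. destruct (Dom w Hw) as [H1 [H2 H3]]. apply CE_comp_Lg; auto. apply HF; auto. }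
  assert (BF : forall n w, log_dom p alpha rho w -> Cmod (f (Zc p theta w) - csum (fun k => c k * Zc p theta w ^ k) n)%C <=
    M * K ^ n * Rpower (INR (fact n)) p * Cmod (Zc p theta w) ^ n).
  { intros n w Hw. rewrite csum_rot, Hf, Cmod_Zc, <- exp_nat_mul by auto. apply HF; apply Dom; auto. }
  (* A proper subsector keeps a positive distance, in the logarithmic coordinate, from the boundary
     of the domain; [e] is the smallest of the margins at the two arguments and at the radius. *)
  assert (Sub : forall eta' theta' r', proper_subsector theta alpha rho eta' theta' r' -> exists e, 0 < e /\
    forall w w', eta' < p * Im w + theta < theta' -> exp (p * Re w) < r' -> Cmod (w' - w) < e -> log_dom p alpha rho w').
  { intros eta' theta' r' [Hr1 [Hr2 [G1 [G2 G3]]]]. simpl in Hr2.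
    set (e1 := (eta' - (theta - alpha / 2)) / p). set (e2 := (theta + alpha / 2 - theta') / p). set (e3 := (p * x1 - ln r') / p).
    assert (Hl : ln r' < p * x1) by (rewrite <- (ln_exp (p * x1)); apply ln_increasing; auto).
    assert (P1 : 0 < e1) by (apply Rdiv_lt_0_compat; lra). assert (P2 : 0 < e2) by (apply Rdiv_lt_0_compat; lra).
    assert (P3 : 0 < e3) by (apply Rdiv_lt_0_compat; lra).
    exists (Rmin e1 (Rmin e2 e3)). split; [repeat apply Rmin_glb_lt; auto|].
    intros w w' Hw1 Hw2 Hww. assert (N1 := Im_near _ _ _ Hww). assert (N2 := Re_near _ _ _ Hww).
    assert (T1 := Rmin_l e1 (Rmin e2 e3)). assert (T2 := Rmin_r e1 (Rmin e2 e3)).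
    assert (T3 := Rmin_l e2 e3). assert (T4 := Rmin_r e2 e3).
    assert (E1 : p * e1 = eta' - (theta - alpha / 2)) by (unfold e1; field; lra).
    assert (E2 : p * e2 = theta + alpha / 2 - theta') by (unfold e2; field; lra).
    assert (E3 : p * e3 = p * x1 - ln r') by (unfold e3; field; lra).
    split.
    - apply Rabs_lt_between. split.
      + assert (p * (Im w - e1) < p * Im w') by (apply Rmult_lt_compat_l; lra). lra.
      + assert (p * Im w' < p * (Im w + e2)) by (apply Rmult_lt_compat_l; lra). lra.
    - simpl. apply exp_increasing.
      assert (p * Re w < ln r') by (rewrite <- (ln_exp (p * Re w)); apply ln_increasing; auto; apply exp_pos).
      assert (p * Re w' < p * (Re w + e3)) by (apply Rmult_lt_compat_l; lra). lra. }
  exists alpha, rho, f. split.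
  { split; [|auto]. fold p. unfold alpha. nra. }
  split; [apply exp_pos|]. split.
  - split.
    + intros z Hz. apply (sector_Zc p) in Hz; auto. destruct Hz as [w [-> Hw]]. apply CF. exact Hw.
    + intros eta' theta' r' Hps. destruct (Sub _ _ _ Hps) as [e [He HSub]].
      destruct (Zc_ball p theta e Hp He) as [k [Hk HB]].
      assert (E1 := exp_pos 1).
      exists M, (K * (1 + k) * (4 * exp 1 / k)). split; auto.
      assert (Pk : 0 < 4 * exp 1 / k) by (apply Rdiv_lt_0_compat; lra).
      split; [apply Rmult_lt_0_compat; [apply Rmult_lt_0_compat; lra|exact Pk]|].
      intros n z Hz. apply (arg_sector_Zc p theta) in Hz; auto. destruct Hz as [w [-> [Hw1 Hw2]]]. simpl in Hw2.
      set (z := Zc p theta w). assert (Pz : 0 < Cmod z) by (unfold z; rewrite Cmod_Zc; apply exp_pos).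
      assert (HKn : 0 <= K ^ n) by (apply pow_le; lra).
      assert (HR : 0 < Rpower (INR (fact n)) p) by apply exp_pos.
      (* The radius is proportional to [|z|], which costs [|z|^(- n)]. Subtracting the partial sum
         of order [n], invisible to the [n]-th derivative, leaves a remainder of size [|z|^n], so
         that the powers cancel and the bound is uniform up to the vertex. *)
      assert (B := C_derive_n_bound f c z n (k * Cmod z) (M * K ^ n * Rpower (INR (fact n)) p * ((1 + k) * Cmod z) ^ n)).
      eapply Rle_trans; [apply B|].
      * nra.
      * repeat apply Rmult_le_pos; try lra. apply pow_le. nra.
      * intros u Hu. destruct (HB w u Hu) as [w' [-> Hw']]. apply CF. apply (HSub w w'); auto.
      * intros u Hu. destruct (HB w u Hu) as [w' [-> Hw']]. eapply Rle_trans; [apply BF, (HSub w w'); auto|].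
        apply Rmult_le_compat_l; [repeat apply Rmult_le_pos; lra|]. apply pow_incr. split; [apply Cmod_ge_0|].
        assert (T := Cmod_triangle (Zc p theta w' - z) z). replace (Zc p theta w' - z + z)%C with (Zc p theta w') in T by ring.
        fold z in Hu. lra.
      * right. rewrite !Rpow_mult_distr.
        replace (4 * exp 1 / (k * Cmod z)) with (4 * exp 1 / k * / Cmod z) by (field; lra).
        rewrite !Rpow_mult_distr.
        assert (Ez : (/ Cmod z) ^ n * Cmod z ^ n = 1) by (rewrite <- Rpow_mult_distr, Rinv_l by lra; apply pow1).
        replace (Rpower (INR (fact n)) s) with (Rpower (INR (fact n)) p * INR (fact n)).
        2:{ rewrite <- (Rpower_1 (INR (fact n))) at 2 by apply INR_fact_pos. rewrite <- Rpower_plus. f_equal. unfold p. ring. }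
        transitivity (M * (K ^ n * (1 + k) ^ n * (4 * exp 1 / k) ^ n) * (Rpower (INR (fact n)) p * INR (fact n)) * ((/ Cmod z) ^ n * Cmod z ^ n)); [|rewrite Ez; ring].
        replace ((4 * exp 1 / k) ^ n) with ((4 * exp 1 / k) ^ n) by reflexivity. rewrite ?Rpow_mult_distr. ring.
  - intros eta' theta' r' Hps. destruct (Sub _ _ _ Hps) as [e [He HSub]].
    exists M, K. split; auto. split; auto. intros n z Hz.
    apply (arg_sector_Zc p theta) in Hz; auto. destruct Hz as [w [-> [Hw1 Hw2]]]. simpl in Hw2.
    rewrite partial_sum_csum. apply BF. apply (HSub w w); auto.
    replace (w - w)%C with (RtoC 0) by ring. rewrite Cmod_0. auto.
Qed.
End Backward.

(** * Uniqueness and the Laplace representation *)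

Lemma in_sq_Re_Im (z s : C) (r : R) : in_sq z r s -> Re s <= Re z + r /\ Rabs (Im s) <= Rabs (Im z) + r.
Proof.
  intros [H1 H2]. apply Rabs_le_between in H1. split; [lra|].
  assert (T := Rabs_triang (Im z) (Im s - Im z)). replace (Im z + (Im s - Im z)) with (Im s) in T by ring. lra.
Qed.

Lemma segment_point (a b : C) (t : R) : (a + RtoC t * (b - a))%C = (Re a + t * (Re b - Re a), Im a + t * (Im b - Im a)).
Proof. destruct a, b. unfold Re, Im, Cplus, Cmult, Cminus, Copp, RtoC. simpl. f_equal; ring. Qed.

(** The segment from [(x, 0)] to [z] has no point to the right of [z] or further from the axis, so
    [log_dom_open] at [z] gives a uniform radius along it. *)
Lemma identity_log_dom (p alpha : R) (rho : Rbar) (f : C -> C) (x dl : R) (z : C) : 0 < p -> 0 < dl ->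
  log_dom p alpha rho z -> x <= Re z -> (forall w, log_dom p alpha rho w -> CE f w) ->
  (forall w, Cmod (w - (x, 0)) < dl -> f w = RtoC 0) -> f z = RtoC 0.
Proof.
  intros Hp Hdl Hz Hx Hf H0.
  destruct (log_dom_open p alpha rho z Hp Hz) as [R0 [HR HO]].
  destruct (identity_segment f (x, 0) z R0 dl HR Hdl) as [d [Hd H]]; auto.
  - intros t s Ht Hs. rewrite segment_point in Hs. apply in_sq_Re_Im in Hs. simpl in Hs. destruct Hs as [Hs1 Hs2].
    apply Hf, HO.
    + assert (T : t * (Re z - x) <= 1 * (Re z - x)) by (apply Rmult_le_compat_r; lra). unfold Re in *. simpl in *. lra.
    + replace (0 + t * (Im z - 0)) with (t * Im z) in Hs2 by ring.
      assert (T : Rabs (t * Im z) <= Rabs (Im z)).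
      { rewrite Rabs_mult, Rabs_pos_eq by lra. assert (T := Rabs_pos (Im z)). nra. }
      unfold Im in *. simpl in *. rewrite ?Rminus_0_r, ?Rplus_0_l in *. lra.
  - apply H. replace (z - z)%C with (RtoC 0) by ring. rewrite Cmod_0. auto.
Qed.

Section Uniqueness.
Context (s m theta : R) (c : nat -> C) (Hs : 1 < s < 3) (Hm : m = / (s - 1)) (Hc : formal_gevrey s c).
Let p := s - 1.
Let g := power_series_sum (formal_borel m c).

(** Far to the left both continuations equal [g] on a disc in the logarithmic coordinate; the
    identity theorem along the real line does the rest. Agreement on the ray is all that a Laplace
    integral at [Im w = 0] sees. *)
Lemma continuation_unique (eps1 eps2 : R) (h1 h2 : C -> C) :
  growing_continuation m theta g eps1 h1 -> growing_continuation m theta g eps2 h2 ->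
  forall x, h1 (Zc p theta (x, 0)) = h2 (Zc p theta (x, 0)).
Proof.
  intros G1 G2 x. assert (Hp := order_pos s Hs). fold p in Hp.
  assert (E1 := proj1 G1). assert (E2 := proj1 G2).
  destruct (proj1 (proj2 G1)) as [_ [d1 [Hd1 A1]]]. destruct (proj1 (proj2 G2)) as [_ [d2 [Hd2 A2]]].
  set (e := Rmin eps1 eps2). assert (He : 0 < e) by (apply Rmin_glb_lt; lra).
  assert (L1 : e <= eps1) by apply Rmin_l. assert (L2 : e <= eps2) by apply Rmin_r.
  set (dm := Rmin d1 d2). assert (Hdm : 0 < dm) by (apply Rmin_glb_lt; lra).
  assert (L3 : dm <= d1) by apply Rmin_l. assert (L4 : dm <= d2) by apply Rmin_r.
  set (x0 := Rmin x (ln dm / p - 1)).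
  assert (M1 : x0 <= x) by apply Rmin_l. assert (M2 : x0 <= ln dm / p - 1) by apply Rmin_r.
  assert (Z : (fun w => h1 (Zc p theta w) - h2 (Zc p theta w))%C (x, 0) = RtoC 0).
  { apply (identity_log_dom p e p_infty (fun w => h1 (Zc p theta w) - h2 (Zc p theta w))%C x0 (Rmin 1 (e / (4 * p))) (x, 0)); auto.
    - apply Rmin_glb_lt; [lra|]. apply Rdiv_lt_0_compat; lra.
    - split; [|exact I]. change (Rabs (p * 0) < e / 2). rewrite Rmult_0_r, Rabs_R0. lra.
    - intros w [Hw _]. apply CE_minus.
      + apply (continuation_CE s m theta c Hs eps1 h1 G1). fold p. lra.
      + apply (continuation_CE s m theta c Hs eps2 h2 G2). fold p. lra.
    - intros w Hw. assert (T1 := Rmin_l 1 (e / (4 * p))). assert (T2 := Rmin_r 1 (e / (4 * p))).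
      assert (N1 := Im_near _ _ _ Hw). assert (N2 := Re_near _ _ _ Hw). simpl in N1, N2.
      assert (Q : Rabs (p * Im w) < e / 2).
      { rewrite Rabs_mult, (Rabs_pos_eq p) by lra.
        assert (Rabs (Im w) < e / (4 * p)) by (apply Rabs_lt_between; lra).
        apply Rmult_lt_compat_l with (r := p) in H; auto. replace (p * (e / (4 * p))) with (e / 4) in H by (field; lra). lra. }
      assert (QM : Cmod (Zc p theta w) < dm).
      { rewrite Cmod_Zc. rewrite <- (exp_ln dm) by auto. apply exp_increasing.
        assert (T : p * Re w < p * (ln dm / p)) by (apply Rmult_lt_compat_l; lra).
        replace (p * (ln dm / p)) with (ln dm) in T by (field; lra). exact T. }
      rewrite A1, A2; try lra.
      + unfold Cminus. apply Cplus_opp_r.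
      + apply (sector_Zc p); auto. exists w. simpl. repeat split; auto; lra.
      + apply (sector_Zc p); auto. exists w. simpl. repeat split; auto; lra. }
  apply Ceq_minus. exact Z.
Qed.

(* A realization is the Laplace transform of its own Borel transform, and all continuations of g agree on the ray arg u = theta. *)
Lemma realization_is_Laplace (alpha : R) (rho : Rbar) (f : C -> C) (eps : R) (h : C -> C) :
  wide_realization s theta c alpha rho f -> growing_continuation m theta g eps h ->
  exists X, forall zeta, Re zeta < X -> Rabs (Im zeta) < PI / 3 ->
    is_line (LI (fun w => h (Zc p theta w)) 0 zeta) (f (Zc p theta zeta)).
Proof.
  intros Hw Hg. destruct (realization_to_continuation s m theta c Hs Hm Hc alpha rho f Hw) as [e1 [h1 [G1 [X HX]]]].
  exists X. intros zeta H1 H2. eapply is_line_ext; [|apply HX; auto].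
  intros x. unfold LI. f_equal. apply (continuation_unique e1 eps h1 h G1 Hg).
Qed.

(** Far to the left both functions are the Laplace integral of the same continuation, namely the one
    constructed from [f1]. From there the identity theorem reaches every common point of the two
    sectors. *)
Lemma realization_unique (alpha1 : R) (rho1 : Rbar) (f1 : C -> C) (alpha2 : R) (rho2 : Rbar) (f2 : C -> C) :
  wide_realization s theta c alpha1 rho1 f1 -> wide_realization s theta c alpha2 rho2 f2 ->
  forall z, sector theta alpha1 rho1 z -> sector theta alpha2 rho2 z -> f1 z = f2 z.
Proof.
  intros W1 W2 z S1 S2. assert (Hp := order_pos s Hs). fold p in Hp. assert (HPI := PI_RGT_0).
  destruct (realization_to_continuation s m theta c Hs Hm Hc alpha1 rho1 f1 W1) as [e1 [h1 [G1 _]]].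
  destruct (realization_is_Laplace _ _ _ _ _ W1 G1) as [X1 HX1].
  destruct (realization_is_Laplace _ _ _ _ _ W2 G1) as [X2 HX2].
  destruct (realization_log s theta c Hs alpha1 rho1 f1 W1) as [C1 _].
  destruct (realization_log s theta c Hs alpha2 rho2 f2 W2) as [C2 _]. fold p in C1, C2.
  apply (sector_Zc p) in S1; auto. apply (sector_Zc p) in S2; auto.
  destruct S1 as [w [Ew [S1 R1]]]. destruct S2 as [w' [Ew' [S2 R2]]].
  assert (A1 := proj2 (proj1 W1)). assert (A2 := proj2 (proj1 W2)).
  (* The openings are at most [2 * PI], so both logarithms of [z] lie in the strip where [Zc] is
     injective. *)
  assert (w' = w).
  { rewrite <- (Lg_Zc p theta w'), <- (Lg_Zc p theta w) by (auto; lra). congruence. }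
  subst w'. rewrite Ew.
  set (x := Rmin (Re w) (Rmin X1 X2 - 2)).
  assert (M1 : x <= Re w) by apply Rmin_l. assert (M2 : x <= Rmin X1 X2 - 2) by apply Rmin_r.
  assert (M3 := Rmin_l X1 X2). assert (M4 := Rmin_r X1 X2).
  set (al := Rmin alpha1 alpha2). assert (L1 : al <= alpha1) by apply Rmin_l. assert (L2 : al <= alpha2) by apply Rmin_r.
  assert (Hal : Rabs (p * Im w) < al / 2) by (unfold al, Rmin; destruct Rle_dec; lra).
  assert (Z : (fun w => f1 (Zc p theta w) - f2 (Zc p theta w))%C w = RtoC 0).
  { destruct (Rbar_lt_between _ _ R1) as [y1 [Y1 Y1']]. destruct (Rbar_lt_between _ _ R2) as [y2 [Y2 Y2']].
    assert (K1 := Rmin_l y1 y2). assert (K2 := Rmin_r y1 y2).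
    apply (identity_log_dom p al (Finite (Rmin y1 y2)) (fun w => f1 (Zc p theta w) - f2 (Zc p theta w))%C x 1 w); auto; try lra.
    - split; auto. simpl. apply Rmin_glb_lt; auto.
    - intros v [Hv1 Hv2]. simpl in Hv2. apply CE_minus.
      + apply C1. split; [lra|]. apply Rbar_lt_trans with (Finite y1); auto. simpl; lra.
      + apply C2. split; [lra|]. apply Rbar_lt_trans with (Finite y2); auto. simpl; lra.
    - intros v Hv. assert (N1 := Im_near _ _ _ Hv). assert (N2 := Re_near _ _ _ Hv). simpl in N1, N2.
      assert (P3 := PI_gt_3).
      assert (Q : Rabs (Im v) < PI / 3) by (apply Rabs_lt_between; lra).
      rewrite (is_line_unique _ _ _ (HX1 v ltac:(lra) Q) (HX2 v ltac:(lra) Q)).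
      unfold Cminus. apply Cplus_opp_r. }
  apply Ceq_minus. exact Z.
Qed.
End Uniqueness.

(** * The Laplace integral along a ray on its full domain *)

Lemma polar_mult (r1 a1 r2 a2 : R) : (polar r1 a1 * polar r2 a2)%C = polar (r1 * r2) (a1 + a2).
Proof.
  unfold polar, Cmult. simpl. rewrite cos_plus, sin_plus. f_equal; ring.
Qed.

Lemma polar_pow_Cexp (x phi a : R) : polar_pow x phi a = Cexp (a * ln x, a * phi).
Proof. reflexivity. Qed.

Lemma Ccont_polar (r : R -> R) (phi x : R) : continuous r x -> Ccont (fun t => polar (r t) phi) x.
Proof.
  intros Hr. eapply (continuous_ext (fun t => (RtoC (r t) * polar 1 phi)%C)).
  - intros t. unfold polar, RtoC, Cmult. simpl. f_equal; ring.
  - apply Ccont_mult; [apply Ccont_RtoC; auto|apply Ccont_const].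
Qed.

Section Transform.
Context (s m theta : R) (c : nat -> C) (Hs : 1 < s < 3) (Hm : m = / (s - 1)) (Hc : formal_gevrey s c).
Let p := s - 1.
Let g := power_series_sum (formal_borel m c).
Context (eps : R) (h : C -> C) (Hgc : growing_continuation m theta g eps h).
Let H (w : C) : C := h (Zc p theta w).

(* Substitute |u| = exp (p y) along the ray arg u = eta. *)
Lemma Lap_is_laplace (eta t phi : R) (F : C) : Rabs (eta - theta) < eps / 2 -> 0 < t ->
  is_line (LI H ((eta - theta) / p) (ln t / p, (phi - theta) / p)) F ->
  is_laplace m h eta t phi F.
Proof.
  intros He Ht HF. assert (Hp := order_pos s Hs). fold p in Hp.
  assert (Hmp : m * p = 1) by (rewrite Hm; unfold p; field; lra).
  set (zeta := (ln t / p, (phi - theta) / p) : C) in *.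
  (* This is [z^m] for the determination [arg z = phi]. The ray integral equals [p * k] times the
     line integral, and the prefactor [m / z^m] cancels it because [m * p = 1]. *)
  set (k := Cexp (m * ln t, m * phi)).
  assert (Nk : k <> RtoC 0) by apply Cexp_neq_0.
  exists (RtoC p * k * F)%C. split.
  - apply (is_CInt_gen_exp_subst _ p); auto.
    + intros x Hx. apply Ccont_mult; [apply Ccont_mult; [apply Ccont_mult|]|].
      * apply (Ccont_CE h (fun x => polar x eta)); [|apply Ccont_polar, continuous_id].
        destruct Hgc as [_ [[Hh _] _]]. apply Hh. exists x, eta. simpl. auto.
      * apply (Ccont_CE Cexp (fun x => - polar_pow (x / t) (eta - phi) m)%C); [apply CE_Cexp|].
        apply (Ccont_CE (fun w => - w)%C (fun x => polar_pow (x / t) (eta - phi) m)); [ce|].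
        apply (Ccont_polar (fun x => Rpower (x / t) m)).
        apply (ex_derive_continuous (V := R_NormedModule)). unfold Rpower. auto_derive.
        apply (Rdiv_lt_0_compat x t); auto.
      * apply (Ccont_polar (fun x => Rpower x (m - 1))).
        apply (ex_derive_continuous (V := R_NormedModule)). unfold Rpower. auto_derive. auto.
      * apply Ccont_const.
    + eapply is_line_ext; [|apply (is_line_scal (RtoC p * k)%C), HF].
      intros y. unfold LI, H.
      assert (E1 : Zc p theta (y, (eta - theta) / p) = polar (exp (p * y)) eta).
      { rewrite Zc_polar. simpl. f_equal. field. lra. }
      rewrite E1. set (A := ((y, ((eta - theta) / p)%R) - zeta)%C).
      assert (E4 : kap A = (Cexp A * Cexp (- Cexp A))%C) by (unfold kap, Cminus; apply Cexp_plus).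
      rewrite E4.
      assert (E2 : polar_pow (exp (p * y) / t) (eta - phi) m = Cexp A).
      { rewrite polar_pow_Cexp. f_equal. rewrite ln_div, ln_exp by (auto; apply exp_pos).
        unfold A, zeta, Cminus, Cplus, Copp. simpl. rewrite Hm. fold p. f_equal; field; lra. }
      rewrite E2.
      assert (E3 : (RtoC (p * exp (p * y)) * (polar_pow (exp (p * y)) eta (m - 1) * polar 1 eta))%C =
        (RtoC p * (k * Cexp A))%C).
      { unfold k. rewrite <- Cexp_plus. rewrite RtoC_mult. rewrite <- Cmult_assoc. f_equal.
        unfold polar_pow. rewrite polar_mult. unfold Cexp, Rpower. rewrite ln_exp.
        replace (RtoC (exp (p * y))) with (polar (exp (p * y)) 0).
        2:{ unfold polar, RtoC. rewrite cos_0, sin_0. f_equal; ring. }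
        rewrite polar_mult, Rmult_1_r, <- exp_plus. unfold A, zeta, Cminus, Cplus, Copp. simpl. rewrite Hm. fold p. f_equal.
        - f_equal. field. lra.
        - field. lra. }
      replace (RtoC p * k * (h (polar (exp (p * y)) eta) * (Cexp A * Cexp (- Cexp A))))%C with
        (h (polar (exp (p * y)) eta) * Cexp (- Cexp A) * (RtoC p * (k * Cexp A)))%C by ring.
      rewrite <- E3. ring.
  - rewrite polar_pow_Cexp. fold k. assert (Em : (RtoC m * RtoC p)%C = RtoC 1) by (rewrite <- RtoC_mult, Hmp; reflexivity).
    transitivity (RtoC m * RtoC p * F)%C; [rewrite Em; ring|]. field. auto.
Qed.

(** Division by [p] turns the angular condition into [|eta - Im zeta| < PI / 2], and [|z|^m] into
    [exp (Re zeta)]. The inequality only improves to the left, which allows continuation along a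
    horizontal segment. *)
Lemma laplace_domain_decay (eta t phi b : R) : 0 < b -> laplace_domain m eta b t phi -> forall x, x <= ln t / p ->
  Rabs ((eta - theta) / p - (phi - theta) / p) < PI / 2 /\ 0 < decay ((eta - theta) / p) (x, (phi - theta) / p) b.
Proof.
  intros Hb [Ht [H1 H2]] x Hx. assert (Hp := order_pos s Hs). fold p in Hp. assert (HPI := PI_RGT_0).
  assert (E : (eta - theta) / p - (phi - theta) / p = m * (eta - phi)) by (rewrite Hm; fold p; field; lra).
  assert (Hm0 : 0 < m) by (rewrite Hm; apply Rinv_0_lt_compat; fold p; lra).
  unfold decay. simpl. rewrite E. split.
  - rewrite Rabs_mult, (Rabs_pos_eq m), Rabs_minus_sym by lra. exact H1.
  - assert (E2 : Rpower t m = exp (ln t / p)) by (unfold Rpower; f_equal; rewrite Hm; fold p; field; lra).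
    rewrite E2 in H2. assert (T := exp_le _ _ Hx). assert (P := exp_pos x).
    assert (T2 : b * exp x < cos (m * (eta - phi))) by nra.
    assert (T3 : exp (- x) * exp x = 1) by (rewrite <- exp_plus, Rplus_opp_l; apply exp_0).
    assert (P' := exp_pos (- x)). apply Rmult_lt_compat_l with (r := exp (- x)) in T2; auto.
    replace (exp (- x) * (b * exp x)) with (b * (exp (- x) * exp x)) in T2 by ring. rewrite T3 in T2. lra.
Qed.

(** The growth on a closed strip has a single type [b], so one [x1] works for all directions
    [|a| <= d]. This uniformity permits arbitrarily many small turns without moving further left. *)
Lemma Lap_rotate_within (d e : R) : 0 <= d -> p * d < eps / 2 -> 0 < e <= PI / 2 -> exists x1,
  forall a zeta, Rabs a <= d -> Rabs (a - Im zeta) <= PI / 2 - e -> Re zeta <= x1 ->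
    CE (Lap H a) zeta /\
    forall a', Rabs a' <= d -> Rabs (a' - Im zeta) <= PI / 2 - e -> Lap H a zeta = Lap H a' zeta.
Proof.
  intros Hd Hpd He. assert (Hp := order_pos s Hs). fold p in Hp. assert (HPI := PI_RGT_0).
  destruct (continuation_growth_strip s m theta c Hs Hm Hc eps h Hgc d Hd Hpd) as [X [b [B [Hb [HB HS]]]]].
  fold p in HS. change (forall w, Rabs (Im w) <= d -> X <= Rabs (Re w) -> Cmod (H w) <= B * exp (b * exp (Re w))) in HS.
  set (x1 := ln (sin e / (2 * b))).
  assert (Sin : 0 < sin e) by (apply sin_gt_0; lra).
  assert (Opn : forall a, Rabs a <= d -> Rabs (p * a) < eps / 2).
  { intros a Ha. rewrite Rabs_mult, (Rabs_pos_eq p) by lra. nra. }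
  assert (Line : forall a, Rabs a <= d -> exists B', 0 <= B' /\ forall x, Cmod (H (x, a)) <= B' * exp (b * exp x)).
  { intros a Ha. apply (continuation_growth_line s m theta c Hs Hm Hc eps h Hgc a b); [apply Opn; auto|lra|].
    exists (Rmax X 0), B. split; auto. intros x Hx. apply (HS (x, a)); auto. simpl.
    assert (T1 := Rmax_l X 0). assert (T2 := Rmax_r X 0). rewrite Rabs_pos_eq; lra. }
  assert (Dec : forall a zeta, Rabs (a - Im zeta) <= PI / 2 - e -> Re zeta <= x1 -> 0 < decay a zeta b).
  { intros a zeta Ha Hr. assert (D := decay_lower a b e x1 zeta He Hb eq_refl Ha Hr).
    assert (T := exp_pos (Re zeta)). nra. }
  assert (IsL : forall a zeta, Rabs a <= d -> Rabs (a - Im zeta) <= PI / 2 - e -> Re zeta <= x1 ->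
    is_line (LI H a zeta) (Lap H a zeta)).
  { intros a zeta Ha Hi Hr. destruct (Line a Ha) as [B' [HB' HL]].
    apply (Lap_is_line H a b B' (fun x => continuation_cont s m theta c Hs eps h Hgc a x (Opn a Ha)) HL). auto. }
  assert (Rot : forall a a' zeta, Rabs a <= d -> Rabs a' <= d -> a <= a' -> Rabs (a - Im zeta) <= PI / 2 - e ->
    Rabs (a' - Im zeta) <= PI / 2 - e -> Re zeta <= x1 -> Lap H a zeta = Lap H a' zeta).
  { intros a a' zeta Ha Ha' Haa Hi Hi' Hr.
    assert (In : forall w, a <= Im w <= a' -> Rabs (Im w) <= d).
    { intros w Hw. apply Rabs_le_between in Ha, Ha'. apply Rabs_le. lra. }
    apply (Lap_rotate H a a' b B X zeta); auto; try lra.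
    intros w Hw. apply (continuation_CE s m theta c Hs eps h Hgc). apply Opn; auto. }
  exists x1. intros a zeta Ha Hi Hr. split.
  - destruct (Line a Ha) as [B' [HB' HL]].
    apply (Lap_CE H a b B' (fun x => continuation_cont s m theta c Hs eps h Hgc a x (Opn a Ha)) HL). auto.
  - intros a' Ha' Hi'. destruct (Rle_dec a a'); [apply Rot; auto|symmetry; apply Rot; auto; lra].
Qed.

(* The point (x, ph) and the direction et are moved in small steps from (x, 0) and 0, keeping |et - ph| < pi / 2. *)
Lemma Lap_eq_realization (alpha : R) (rho : Rbar) (f : C -> C) (et ph y : R) :
  wide_realization s theta c alpha rho f -> Rabs (p * et) < eps / 2 -> Rabs (et - ph) < PI / 2 ->
  log_dom p alpha rho (y, ph) ->
  exists x d, x <= y /\ 0 < d /\ forall zeta, Cmod (zeta - (x, ph)) < d -> Lap H et zeta = f (Zc p theta zeta).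
Proof.
  intros Hw Het Hep Hy. assert (Hp := order_pos s Hs). fold p in Hp. assert (HPI := PI_RGT_0). assert (HPI3 := PI_gt_3).
  destruct (realization_is_Laplace s m theta c Hs Hm Hc alpha rho f eps h Hw Hgc) as [X HX]. fold p in HX.
  destruct (realization_log s theta c Hs alpha rho f Hw) as [CF _]. fold p in CF.
  destruct (log_dom_open p alpha rho _ Hp Hy) as [R0 [HR0 HO]].
  change (Re (y, ph)) with y in HO. change (Im (y, ph)) with ph in HO.
  (* A quarter of the angular margin: one [e] for the displacement of the point, one for the step of
     the direction, and still at least the margin [e] that [Lap_rotate_within] asks for. *)
  set (e := (PI / 2 - Rabs (et - ph)) / 4).
  assert (Hab := Rabs_pos (et - ph)). assert (He : 0 < e <= PI / 2) by (unfold e; lra).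
  assert (Eab : Rabs (et - ph) = PI / 2 - 4 * e) by (unfold e; field).
  destruct (Lap_rotate_within (Rabs et) e (Rabs_pos et)) as [x1 HL].
  { rewrite Rabs_mult, (Rabs_pos_eq p) in Het by lra. auto. }
  { auto. }
  (* So many steps that each changes direction and argument by at most [e]. *)
  destruct (INR_unbounded ((Rabs et + Rabs ph) / e)) as [N HN].
  assert (T1 := Rabs_pos et). assert (T2 := Rabs_pos ph).
  assert (PN : 0 < INR N). { eapply Rle_lt_trans; [|exact HN]. apply Rdiv_le_0_compat; lra. }
  assert (HN' : Rabs et + Rabs ph < INR N * e).
  { apply Rmult_lt_compat_r with (r := e) in HN; [|lra].
    replace ((Rabs et + Rabs ph) / e * e) with (Rabs et + Rabs ph) in HN by (field; lra). exact HN. }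
  set (q := / INR N). assert (Hq : 0 < q) by (apply Rinv_0_lt_compat; auto).
  assert (HqN : INR N * q = 1) by (unfold q; field; lra).
  assert (Hq1 : q * Rabs et <= e /\ q * Rabs ph <= e).
  { assert (q * (Rabs et + Rabs ph) < q * (INR N * e)) by (apply Rmult_lt_compat_l; auto).
    replace (q * (INR N * e)) with e in H0 by (rewrite <- Rmult_assoc, (Rmult_comm q), HqN; ring).
    assert (0 <= q * Rabs et) by nra. assert (0 <= q * Rabs ph) by nra. lra. }
  set (x := Rmin y (Rmin (X - 2) (x1 - 2))).
  assert (L1 : x <= y) by apply Rmin_l.
  assert (L2 : x <= X - 2) by (eapply Rle_trans; [apply Rmin_r|apply Rmin_l]).
  assert (L3 : x <= x1 - 2) by (eapply Rle_trans; [apply Rmin_r|apply Rmin_r]).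
  assert (Step : forall v u, 0 <= v <= 1 -> Rabs (v * u) <= Rabs u).
  { intros v u Hv. rewrite Rabs_mult, Rabs_pos_eq by lra. assert (T := Rabs_pos u). nra. }
  assert (Ind : forall j, (j <= N)%nat -> exists d, 0 < d /\ forall zeta, Cmod (zeta - (x, INR j * q * ph)) < d ->
    Lap H (INR j * q * et) zeta = f (Zc p theta zeta)).
  { induction j as [|j IH]; intros Hj.
    - exists 1. split; [lra|]. simpl INR. rewrite !Rmult_0_l. intros zeta Hz.
      assert (N1 := Im_near _ _ _ Hz). assert (N2 := Re_near _ _ _ Hz). simpl in N1, N2.
      apply Lap_correct, HX; [lra|apply Rabs_lt_between; lra].
    - destruct IH as [d [Hd IH]]; [lia|].
      assert (Hv : 0 <= INR j * q /\ INR (S j) * q <= 1 /\ INR (S j) * q = INR j * q + q).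
      { assert (P := pos_INR j). split; [nra|]. split; [|rewrite S_INR; ring].
        rewrite <- HqN. apply Rmult_le_compat_r; [lra|]. apply le_INR; auto. }
      set (v := INR j * q) in *. set (v' := INR (S j) * q) in *. destruct Hv as [V1 [V2 V3]].
      (* Direction [u * et] against a point near [w * ph]: the common part [u * (et - ph)] never
         exceeds the final angle, and the mismatch [u - w] is at most one step. *)
      assert (G : forall u w zeta, 0 <= u <= 1 -> v <= w <= v' -> u = v \/ u = v' -> Rabs (Im zeta - w * ph) <= e ->
        Rabs (u * et - Im zeta) <= PI / 2 - e).
      { intros u w zeta Hu Hww Huv Hz.
        replace (u * et - Im zeta) with (u * (et - ph) + ((u - w) * ph + - (Im zeta - w * ph))) by ring.
        assert (Y1 := Rabs_triang (u * (et - ph)) ((u - w) * ph + - (Im zeta - w * ph))).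
        assert (Y2 := Rabs_triang ((u - w) * ph) (- (Im zeta - w * ph))). rewrite Rabs_Ropp in Y2.
        assert (Y3 := Step u (et - ph) Hu).
        assert (Y4 : Rabs ((u - w) * ph) <= q * Rabs ph).
        { rewrite Rabs_mult. apply Rmult_le_compat_r; auto. apply Rabs_le. destruct Huv; subst u; lra. }
        lra. }
      set (r := Rmin e (Rmin R0 1)). assert (Hr : 0 < r) by (repeat apply Rmin_glb_lt; lra).
      assert (R1 : r <= e) by apply Rmin_l.
      assert (R2 : r <= R0) by (eapply Rle_trans; [apply Rmin_r|apply Rmin_l]).
      assert (R3 : r <= 1) by (eapply Rle_trans; [apply Rmin_r|apply Rmin_r]).
      destruct (identity_segment (fun z => Lap H (v' * et) z - f (Zc p theta z))%C (x, v * ph) (x, v' * ph) r (Rmin d r)) as [d' [Hd' HI]]; auto.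
      + apply Rmin_glb_lt; auto.
      + intros t z Ht Hz. rewrite segment_point in Hz. simpl in Hz.
        replace (x + t * (x - x)) with x in Hz by ring.
        replace (v * ph + t * (v' * ph - v * ph)) with ((v + t * q) * ph) in Hz by (rewrite V3; ring).
        assert (Htq : 0 <= t * q <= q) by nra.
        assert (Hz' := in_sq_Re_Im _ _ _ Hz). destruct Hz as [_ Hz2].
        change (Im (x, (v + t * q) * ph)) with ((v + t * q) * ph) in *. change (Re (x, (v + t * q) * ph)) with x in *.
        assert (Y := Step (v + t * q) ph ltac:(lra)).
        apply CE_minus.
        * apply HL; [apply Step; lra|apply (G v' (v + t * q)); auto; lra|lra].
        * apply CF, HO; lra.
      + intros z Hz. assert (D1 := Rmin_l d r). assert (D2 := Rmin_r d r).
        rewrite <- (IH z) by lra.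
        assert (N1 := Im_near _ _ _ Hz). assert (N2 := Re_near _ _ _ Hz). simpl in N1, N2.
        assert (Q : Rabs (Im z - v * ph) <= e) by (apply Rabs_le; lra).
        destruct (HL (v' * et) z) as [_ HL2]; [apply Step; lra|apply (G v' v); auto; lra|lra|].
        rewrite (HL2 (v * et)); [apply Cplus_opp_r|apply Step; lra|apply (G v v); auto; lra].
      + exists d'. split; auto. intros z Hz. apply Ceq_minus. apply HI; auto. }
  destruct (Ind N (le_n N)) as [d [Hd HI]]. rewrite HqN, !Rmult_1_l in HI.
  exists x, d. auto.
Qed.

(** The type [b] is known on the single ray [arg u = eta], so no rotation is possible at the given
    point. Rotation happens far to the left, at the same argument; from there the identity moves to
    the right with the direction fixed, inside the half plane of convergence for [b]. *)
Lemma realization_is_laplace (alpha : R) (rho : Rbar) (f : C -> C) (eta b t phi : R) :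
  wide_realization s theta c alpha rho f -> Rabs (eta - theta) < eps / 2 -> 0 < b -> ray_growth m eta b h ->
  laplace_domain m eta b t phi -> Rbar_lt t rho -> Rabs (phi - theta) < alpha / 2 ->
  is_laplace m h eta t phi (f (polar t phi)).
Proof.
  intros Hw He Hb Hrg Hld Hrho Hphi. assert (Hp := order_pos s Hs). fold p in Hp. assert (Ht := proj1 Hld).
  assert (Hmp : m * p = 1) by (rewrite Hm; unfold p; field; lra).
  apply Lap_is_laplace; auto.
  assert (Hdec := laplace_domain_decay eta t phi b Hb Hld).
  assert (Epx : p * (ln t / p) = ln t) by (field; lra).
  assert (Epe : p * ((eta - theta) / p) = eta - theta) by (field; lra).
  assert (Epp : p * ((phi - theta) / p) = phi - theta) by (field; lra).
  rewrite (polar_Zc p theta) by auto.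
  set (et := (eta - theta) / p) in *. set (ph := (phi - theta) / p) in *. set (y := ln t / p) in *.
  assert (Hy : log_dom p alpha rho (y, ph)).
  { split.
    - change (Rabs (p * ph) < alpha / 2). rewrite Epp. auto.
    - change (Rbar_lt (exp (p * y)) rho). rewrite Epx, exp_ln; auto. }
  assert (Het : Rabs (p * et) < eps / 2) by (rewrite Epe; auto).
  destruct (Lap_eq_realization alpha rho f et ph y Hw Het (proj1 (Hdec y ltac:(lra))) Hy) as [x [d [Hxy [Hd HI]]]].
  destruct (realization_log s theta c Hs alpha rho f Hw) as [CF _]. fold p in CF.
  destruct (continuation_growth_line s m theta c Hs Hm Hc eps h Hgc et b Het ltac:(lra)) as [B [HB HL]].
  (* Beyond [ln r / p + 1] the point [exp (p * v)] of the ray lies strictly past [r], where the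
     growth bound holds. *)
  { destruct Hrg as [r [B0 [Hr [HB0 HG]]]]. exists (ln r / p + 1), B0. split; [lra|]. intros v Hv.
    fold p. rewrite Zc_polar. change (Re (v, et)) with v. change (Im (v, et)) with et. rewrite Epe.
    replace (eta - theta + theta) with eta by ring.
    assert (Hbig : r < exp (p * v)).
    { rewrite <- (exp_ln r) at 1 by auto. apply exp_increasing.
      assert (T : p * (ln r / p + 1) <= p * v) by (apply Rmult_le_compat_l; lra).
      replace (p * (ln r / p + 1)) with (ln r + p) in T by (field; lra). lra. }
    specialize (HG _ Hbig). rewrite Rpower_exp_m in HG by auto. exact HG. }
  fold p in HL. change (forall x, Cmod (H (x, et)) <= B * exp (b * exp x)) in HL.
  assert (Hcont := fun x => continuation_cont s m theta c Hs eps h Hgc et x Het).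
  assert (E : Lap H et (y, ph) = f (Zc p theta (y, ph))).
  { destruct (decay_near et b (y, ph) (proj2 (Hdec y ltac:(lra)))) as [r1 [q [Hr1 [Hq HD]]]].
    destruct (log_dom_open p alpha rho _ Hp Hy) as [R0 [HR0 HO]].
    change (Re (y, ph)) with y in HO. change (Im (y, ph)) with ph in HO.
    set (r := Rmin r1 R0). assert (R1 : r <= r1) by apply Rmin_l. assert (R2 : r <= R0) by apply Rmin_r.
    assert (Hr : 0 < r) by (apply Rmin_glb_lt; auto).
    destruct (identity_segment (fun z => Lap H et z - f (Zc p theta z))%C (x, ph) (y, ph) r d) as [d' [Hd' HI']]; auto.
    - intros u z Hu Hz. rewrite segment_point in Hz. simpl in Hz.
      replace (ph + u * (ph - ph)) with ph in Hz by ring.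
      assert (Hz' := in_sq_Re_Im _ _ _ Hz). destruct Hz as [Hz1 Hz2].
      change (Im (x + u * (y - x), ph)) with ph in *. change (Re (x + u * (y - x), ph)) with (x + u * (y - x)) in *.
      assert (Hx' : x + u * (y - x) <= y) by nra.
      apply CE_minus; [|apply CF, HO; lra].
      apply (Lap_CE H et b B Hcont HL).
      (* decay is larger further to the left *)
      set (z' := (Re z + (y - (x + u * (y - x))), Im z) : C).
      assert (D1 : q <= decay et z' b).
      { apply HD. split.
        - change (Rabs (Re z + (y - (x + u * (y - x))) - y) <= r1).
          replace (Re z + (y - (x + u * (y - x))) - y) with (Re z - (x + u * (y - x))) by ring. lra.
        - change (Rabs (Im z - ph) <= r1). lra. }
      unfold decay in *. change (Re z') with (Re z + (y - (x + u * (y - x)))) in D1. change (Im z') with (Im z) in D1.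
      assert (E1 : exp (- (Re z + (y - (x + u * (y - x))))) <= exp (- Re z)) by (apply exp_le; lra).
      assert (E2 := exp_pos (- (Re z + (y - (x + u * (y - x)))))).
      assert (E3 : 0 < cos (et - Im z)) by nra.
      assert (E4 := Rmult_le_compat_r _ _ _ (Rlt_le _ _ E3) E1). lra.
    - intros w Hww. rewrite HI by auto. apply Cplus_opp_r.
    - apply Ceq_minus. apply HI'. replace ((y, ph) - (y, ph))%C with (RtoC 0) by (symmetry; apply Cplus_opp_r). rewrite Cmod_0. auto. }
  rewrite <- E. apply (Lap_is_line H et b B Hcont HL). apply Hdec. lra.
Qed.
End Transform.

Theorem mainTheorem2 (s m theta : R) (c : nat -> C)
    (Hs : 1 < s < 3) (Hm : m = / (s - 1)) (Hc : formal_gevrey s c) :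
  let g : C -> C := power_series_sum (formal_borel m c) in
  (exists R0 : R, 0 < R0 /\
     (forall u : C, Cmod u < R0 ->
        is_pseries (K := C_AbsRing) (V := C_NormedModule) (formal_borel m c) u (g u)) /\
     holomorphic_on (fun u : C => Cmod u < R0) g) /\
  ((exists (alpha : R) (rho : Rbar) (f : C -> C),
      wide_realization s theta c alpha rho f) <->
   (exists (eps : R) (h : C -> C), growing_continuation m theta g eps h)) /\
  (forall (alpha : R) (rho : Rbar) (f : C -> C) (eps : R) (h : C -> C),
     wide_realization s theta c alpha rho f ->
     growing_continuation m theta g eps h ->
     forall eta b t phi : R,
       Rabs (eta - theta) < eps / 2 ->
       0 < b -> ray_growth m eta b h ->
       laplace_domain m eta b t phi ->
       Rbar_lt t rho -> Rabs (phi - theta) < alpha / 2 ->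
       is_laplace m h eta t phi (f (polar t phi))) /\
  (forall (alpha1 : R) (rho1 : Rbar) (f1 : C -> C)
          (alpha2 : R) (rho2 : Rbar) (f2 : C -> C),
     wide_realization s theta c alpha1 rho1 f1 ->
     wide_realization s theta c alpha2 rho2 f2 ->
     forall z : C, sector theta alpha1 rho1 z -> sector theta alpha2 rho2 z ->
       f1 z = f2 z).
Proof.
  intros g. split; [|split; [split|split]].
  - destruct (formal_borel_bound s m c (proj1 Hs) Hm Hc) as [M [K [HM [HK Hb]]]].
    assert (Small : forall u, Cmod u < / K -> K * Cmod u < 1).
    { intros u Hu. apply Rmult_lt_compat_l with (r := K) in Hu; auto. rewrite Rinv_r in Hu by lra. exact Hu. }
    exists (/ K). split; [apply Rinv_0_lt_compat; auto|]. split.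
    + intros u Hu. apply is_pseries_is_sum.
      exact (proj1 (power_series_sum_correct (formal_borel m c) M K (Rlt_le _ _ HM) HK Hb u (Small u Hu))).
    + intros u Hu. exact (CE_power_series_sum (formal_borel m c) M K (Rlt_le _ _ HM) HK Hb u (Small u Hu)).
  - intros [alpha [rho [f Hw]]].
    destruct (realization_to_continuation s m theta c Hs Hm Hc alpha rho f Hw) as [eps [h [Hg _]]].
    exists eps, h. exact Hg.
  - intros [eps [h Hg]]. exact (continuation_to_realization s m theta c Hs Hm Hc eps h Hg).
  - intros alpha rho f eps h Hw Hg eta b t phi.
    exact (realization_is_laplace s m theta c Hs Hm Hc eps h Hg alpha rho f eta b t phi Hw).
  - intros alpha1 rho1 f1 alpha2 rho2 f2.
    exact (realization_unique s m theta c Hs Hm Hc alpha1 rho1 f1 alpha2 rho2 f2).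
Qed.
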